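(* Let $X$ be a compact metric space, and let $A$ be a pure $C^*$-algebra. Assume additionally that (1) $A$ is simple; or (2) every quotient of $A$ is stably finite. Then the $C^*$-algebra $C(X,A)$ of continuous functions $X\to A$ is pure.
   Context: Cuntz semigroup: for a $C^*$-algebra $B$ and $a,b\in B_+$, $a\precsim b$ means there is a sequence $(v_n)$ in $B$ with $v_n b v_n^*\to a$; $a\sim b$ means $a\precsim b$ and $b\precsim a$. With $\mathcal{K}$ the compact operators on a separable infinite-dimensional Hilbert space, $\mathrm{Cu}(B)=(B\otimes\mathcal{K})_+/\!\sim$, with classes $[a]$, order $[a]\le[b]$ iff $a\precsim b$, and addition $[a]+[b]=[a\oplus b]$. For $a\in B_+$ and $\varepsilon>0$, $(a-\varepsilon)_+$ is the functional calculus of $a$ with $\lambda\mapsto\max\{\lambda-\varepsilon,0\}$. For $x,y\in\mathrm{Cu}(B)$, $x\ll y$ means $x=[a]$, $y=[b]$ and $a\precsim(b-\varepsilon)_+$ for some $\varepsilon>0$. Pureness: $B$ is pure if $\mathrm{Cu}(B)$ is both (a) almost unperforated: whenever $x,y\in\mathrm{Cu}(B)$ satisfy $(k+1)x\le ky$ for some $k\in\mathbb{N}$, then $x\le y$; and (b) almost divisible: for every $x'\ll x$ in $\mathrm{Cu}(B)$ and every $N\in\mathbb{N}$ there is $y\in\mathrm{Cu}(B)$ with $Ny\le x$ and $x'\le(N+1)y$. Quotients are quotients by closed two-sided ideals. Stably finite is meant in the usual sense (for every $n$, the matrix algebra $M_n$ over the unitization contains no infinite projection). *)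

(* Defs.v *)
From HB Require Import structures.
From mathcomp Require Import all_boot all_order all_algebra.
From mathcomp Require Import all_classical all_reals all_analysis.
From mathcomp Require Import complex ring.

Set Implicit Arguments.
Unset Strict Implicit.
Unset Printing Implicit Defensive.
Import Order.TTheory GRing.Theory Num.Theory.
Import numFieldNormedType.Exports.
Local Open Scope classical_set_scope.
Local Open Scope complex_scope.
Local Open Scope ring_scope.

Reserved Notation "x ** y" (at level 40, left associativity).

HB.mixin Record isCStarAlgebra (R : realType) A & CompleteNormedModule R[i] A := {
  cmul : A -> A -> A;
  star : A -> A;
  cmulA : associative cmul;
  cmulDl : left_distributive cmul +%R;
  cmulDr : right_distributive cmul +%R;
  cscaleAl : forall (z : R[i]) (a b : A), cmul (z *: a) b = z *: cmul a b;
  cscaleAr : forall (z : R[i]) (a b : A), cmul a (z *: b) = z *: cmul a b;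
  starK : involutive star;
  starD : {morph star : a b / a + b};
  starZ : forall (z : R[i]) (a : A), star (z *: a) = Num.conj z *: star a;
  starM : forall a b, star (cmul a b) = cmul (star b) (star a);
  ler_norm_cmul : forall a b : A, `|cmul a b| <= `|a| * `|b|;
  cstar_identity : forall a : A, `|cmul (star a) a| = `|a| ^+ 2
}.

#[short(type="cstarAlgType")]
HB.structure Definition CStarAlgebra (R : realType) :=
  {A of CompleteNormedModule R[i] A & isCStarAlgebra R A}.

Notation "x ** y" := (cmul x y) : ring_scope.

Section CStarTheory.
Context {R : realType} {A : cstarAlgType R}.
Implicit Types (a b : A) (z : R[i]).

Lemma cmul0r a : 0 ** a = 0.
Proof. by have := cscaleAl 0 0 a; rewrite !scale0r. Qed.

Lemma cmulr0 a : a ** 0 = 0.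
Proof. by have := cscaleAr 0 a 0; rewrite !scale0r. Qed.

Lemma cmulBl a b c : (a - b) ** c = a ** c - b ** c.
Proof. by rewrite -(scaleN1r b) cmulDl cscaleAl scaleN1r. Qed.

Lemma cmulBr a b c : a ** (b - c) = a ** b - a ** c.
Proof. by rewrite -(scaleN1r c) cmulDr cscaleAr scaleN1r. Qed.

Lemma cmulBB a b c d : a ** b - c ** d = (a - c) ** d + a ** (b - d).
Proof. by rewrite cmulBl cmulBr [RHS]addrC subrKA. Qed.

Lemma star0 : star (0 : A) = 0.
Proof. by have := starZ 0 (0 : A); rewrite conjC0 !scale0r. Qed.

Lemma starB a b : star (a - b) = star a - star b.
Proof. by rewrite -(scaleN1r b) starD starZ rmorphN1 scaleN1r. Qed.

Lemma norm_star a : `|star a| = `|a|.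
Proof.
suff le_star b : `|b| <= `|star b|.
  by apply/eqP; rewrite eq_le le_star andbT -{2}(starK a) le_star.
have [->|b0] := eqVneq b 0; first by rewrite star0.
have nb : 0 < `|b| by rewrite normr_gt0.
rewrite -(ler_pM2r nb) -expr2 -cstar_identity.
exact: ler_norm_cmul.
Qed.

Lemma cmul_continuous : continuous (fun ab : A * A => ab.1 ** ab.2).
Proof.
move=> [a b]; apply/cvgrPdist_lt => e e0 /=.
pose M : R[i] := `|a| + `|b| + 1.
have M0 : 0 < M by rewrite /M ltr_wpDl// addr_ge0.
pose d := e / (M + M).
have MM0 : 0 < M + M by rewrite addr_gt0.
have d0 : 0 < d by rewrite divr_gt0.
have cv1 : (fun c : A * A => c.1) @ (a, b) --> a by exact: cvg_fst.
have cv2 : (fun c : A * A => c.2) @ (a, b) --> b by exact: cvg_snd.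
near=> c.
have ac : `|a - c.1| < d by near: c; move/cvgrPdist_lt: cv1; exact.
have bc : `|b - c.2| < d by near: c; move/cvgrPdist_lt: cv2; exact.
have bc1 : `|b - c.2| < 1 by near: c; move/cvgrPdist_lt: cv2; exact.
have -> : a ** b - c.1 ** c.2 = (a - c.1) ** c.2 + a ** (b - c.2).
  exact: cmulBB.
have gyM : `|c.2| <= M.
  rewrite -(subKr b c.2) (le_trans (ler_normB _ _))// /M -addrA.
  by rewrite ler_wpDl// lerD2l ltW.
have -> : e = d * M + M * d.
  by rewrite [M * d]mulrC -mulrDr divfK// gt_eqF.
rewrite (le_lt_trans (ler_normD _ _))// ltr_leD//.
  rewrite (le_lt_trans (ler_norm_cmul _ _))//.
  by rewrite (le_lt_trans (ler_wpM2l _ gyM))// ltr_pM2r.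
rewrite (le_trans (ler_norm_cmul _ _))// ler_pM// ?(ltW bc)//.
by rewrite /M -addrA ler_wpDr// addr_ge0.
Unshelve. all: by end_near. Qed.

End CStarTheory.

Definition cts_alg (R : realType) (X : metricType R) (cX : compact [set: X])
  (A : cstarAlgType R) := continuousType X A.

Section CtsAlgZmodule.
Context {R : realType} {X : metricType R} {cX : compact [set: X]}
  {A : cstarAlgType R}.
Local Notation CXA := (cts_alg cX A).
Implicit Types f g h : CXA.

HB.instance Definition _ := Choice.copy CXA (continuousType X A).

Definition cts_mk (u : X -> A) (cu : continuous u) : CXA := mkcts cu.
Definition cts_ev f : X -> A := (f : continuousType X A).

Lemma cts_evP f g : cts_ev f =1 cts_ev g -> f = g.
Proof. by move=> fg; apply/(@continuousEP X A). Qed.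

Lemma cts_ev_continuous f : continuous (cts_ev f).
Proof. exact: (@cts_fun X A f). Qed.

Lemma cts0 : continuous (fun _ : X => 0 : A).
Proof. by move=> x; exact: cvg_cst. Qed.
Lemma ctsN f : continuous (fun x : X => - cts_ev f x).
Proof. by move=> x; apply: cvgN; exact: cts_ev_continuous. Qed.
Lemma ctsD f g : continuous (fun x : X => cts_ev f x + cts_ev g x).
Proof. by move=> x; apply: cvgD; exact: cts_ev_continuous. Qed.
Lemma ctsZ (z : R[i]) f : continuous (fun x : X => z *: cts_ev f x).
Proof. by move=> x; apply: cvgZr; exact: cts_ev_continuous. Qed.

Let addA : associative (fun f g => cts_mk (@ctsD f g)).
Proof. by move=> f g h; apply: cts_evP => x; exact: addrA. Qed.
Let addC : commutative (fun f g => cts_mk (@ctsD f g)).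
Proof. by move=> f g; apply: cts_evP => x; exact: addrC. Qed.
Let add0 : left_id (cts_mk cts0) (fun f g => cts_mk (@ctsD f g)).
Proof. by move=> f; apply: cts_evP => x; exact: add0r. Qed.
Let addN : left_inverse (cts_mk cts0) (fun f => cts_mk (@ctsN f))
  (fun f g => cts_mk (@ctsD f g)).
Proof. by move=> f; apply: cts_evP => x; exact: addNr. Qed.

HB.instance Definition _ := GRing.isZmodule.Build CXA addA addC add0 addN.

Let scaleA (z w : R[i]) f :
  cts_mk (@ctsZ z (cts_mk (@ctsZ w f))) = cts_mk (@ctsZ (z * w) f).
Proof. by apply: cts_evP => x; exact: scalerA. Qed.
Let scale1 : left_id 1 (fun (z : R[i]) f => cts_mk (@ctsZ z f)).
Proof. by move=> f; apply: cts_evP => x; exact: scale1r. Qed.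
Let scaleDr : right_distributive (fun (z : R[i]) f => cts_mk (@ctsZ z f)) +%R.
Proof. by move=> z f g; apply: cts_evP => x; exact: scalerDr. Qed.
Let scaleDl f : {morph (fun z : R[i] => cts_mk (@ctsZ z f)) : z w / z + w}.
Proof. by move=> z w; apply: cts_evP => x; exact: scalerDl. Qed.

HB.instance Definition _ := GRing.Zmodule_isLmodule.Build R[i] CXA
  scaleA scale1 scaleDr scaleDl.

(** The norm of a normed module over [R[i]] is [R[i]]-valued, hence the
    detour through [Re] to take the supremum in [R]. *)
Definition cts_norm f : R[i] :=
  (sup [set complex.Re `|cts_ev f x| | x in [set: X]])%:C.

Let Re_norm (V : normedModType R[i]) (v : V) : (complex.Re `|v|)%:C = `|v|.
Proof. by rewrite RRe_real// normr_real. Qed.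

Let Re_norm_cts f : continuous (fun x : X => complex.Re `|cts_ev f x|).
Proof.
move=> x; apply/cvgrPdist_lt => e e0.
have eC : 0 < e%:C by rewrite ltcR.
move/cvgrPdist_lt: (@cts_ev_continuous f x) => /(_ _ eC).
apply: filterS => y xy; rewrite -ltcR; apply: le_lt_trans xy.
apply: (le_trans _ (ler_dist_dist _ _)).
by rewrite -[X in _ <= `|X - _|]Re_norm -[X in _ <= `|_ - X|]Re_norm
  -rmorphB/= normc_def/= expr0n addr0 sqrtr_sqr.
Qed.

Let norm_has_ubound f :
  has_ubound [set complex.Re `|cts_ev f x| | x in [set: X]].
Proof.
have : compact ((fun x : X => complex.Re `|cts_ev f x|) @` [set: X]).
  apply: continuous_compact cX; apply: continuous_subspaceT.
  exact: Re_norm_cts.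
move=> /compact_bounded[M [_ /(_ (M + 1))]]; rewrite ltrDl ltr01 => /(_ isT) Mb.
by exists (M + 1) => r fr; rewrite (le_trans (ler_norm _))// Mb.
Qed.

Lemma cts_norm_ub f x : `|cts_ev f x| <= cts_norm f.
Proof.
by rewrite -Re_norm lecR; apply: (ub_le_sup (norm_has_ubound f)); exists x.
Qed.

Lemma cts_norm_le f (r : R[i]) :
  0 <= r -> (forall x, `|cts_ev f x| <= r) -> cts_norm f <= r.
Proof.
move=> r0 fr; have rE : (complex.Re r)%:C = r by rewrite RRe_real// ger0_real.
rewrite -rE lecR.
have [->|/set0P S0] := eqVneq [set complex.Re `|cts_ev f x| | x in [set: X]] set0.
  by rewrite sup0 -lecR rE.
apply: ge_sup => // _ [x _ <-].
by rewrite -lecR rE Re_norm.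
Qed.

Lemma cts_norm_ge0 f : 0 <= cts_norm f.
Proof.
rewrite -[0]/(0%:C) lecR.
have [->|/set0P[r Sr]] := eqVneq [set complex.Re `|cts_ev f x| | x in [set: X]] set0.
  by rewrite sup0.
apply: (@le_trans _ _ r); last exact: (ub_le_sup (norm_has_ubound f)).
by case: Sr => x _ <-; rewrite -lecR Re_norm; exact: normr_ge0.
Qed.

Let cts_normD f g : cts_norm (f + g) <= cts_norm f + cts_norm g.
Proof.
apply: cts_norm_le => [|x]; first by rewrite addr_ge0 ?cts_norm_ge0.
by rewrite (le_trans (ler_normD _ _))// lerD// cts_norm_ub.
Qed.

Let cts_normZ (z : R[i]) f : cts_norm (z *: f) = `|z| * cts_norm f.
Proof.
have le w g : cts_norm (w *: g) <= `|w| * cts_norm g.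
  apply: cts_norm_le => [|x]; first by rewrite mulr_ge0 ?cts_norm_ge0.
  by rewrite normrZ ler_wpM2l// cts_norm_ub.
apply/eqP; rewrite eq_le le/=; have [->|z0] := eqVneq z 0.
  by rewrite normr0 mul0r cts_norm_ge0.
rewrite -ler_pdivlMl ?normr_gt0// -normfV.
by rewrite (le_trans _ (le _ _))// scalerA mulVf// scale1r.
Qed.

Let cts_norm_eq0 f : cts_norm f = 0 -> f = 0.
Proof.
move=> f0; apply: cts_evP => x; apply/eqP.
by rewrite -normr_le0 -f0 cts_norm_ub.
Qed.

HB.instance Definition _ := Lmodule_isNormed.Build R[i] CXA
  cts_normD cts_normZ cts_norm_eq0.

Lemma cts_normE f : `|f| = cts_norm f. Proof. by []. Qed.

End CtsAlgZmodule.

Section CtsAlgComplete.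
Context {R : realType} {X : metricType R} {cX : compact [set: X]}
  {A : cstarAlgType R}.
Local Notation CXA := (cts_alg cX A).
Implicit Types f g h : CXA.

Section cauchy.
Variables (F : set_system CXA) (FF : ProperFilter F) (cF : cauchy F).

Let cF_ball (e : R[i]) : 0 < e -> \forall f & h \near F, `|f - h| < e.
Proof.
move=> e0; have /cauchy_ballP/(_ e e0) := cF.
by apply: filterS => -[f h] /=; rewrite -ball_normE.
Qed.

Let limx (x : X) : cvg ((cts_ev (cX := cX) (A := A))^~ x @ F).
Proof.
apply: cauchy_cvg; apply/cauchy_ballP => e e0.
have H := cF_ball e0; rewrite near_map2; apply: filterS H => -[f h] /= fh.
rewrite -ball_normE /=; apply: le_lt_trans fh.
exact: (cts_norm_ub (f - h) x).
Qed.

Let g (x : X) : A := lim ((cts_ev (cX := cX) (A := A))^~ x @ F).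

Let g_unif (e : R[i]) : 0 < e ->
  \forall f \near F, forall x, `|g x - cts_ev f x| <= e.
Proof.
move=> e0; have e20 : 0 < e / 2 by rewrite divr_gt0.
have := cF_ball e20.
move=> /nearP_dep; apply: filterS => f fh x.
have gx : \forall h \near F, `|g x - cts_ev h x| < e / 2.
  by have /cvgrPdist_lt := @limx x; apply.
near F => h.
rewrite [e]splitr.
have -> : g x - cts_ev f x = (g x - cts_ev h x) - (cts_ev f x - cts_ev h x).
  by rewrite opprB subrKA.
rewrite (le_trans (ler_normB _ _))// lerD//; apply: ltW.
  by near: h.
apply: le_lt_trans (cts_norm_ub (f - h) x) _.
by near: h.
Unshelve. all: by end_near. Qed.

Let g_cts : continuous g.
Proof.
move=> x; apply/cvgrPdist_le => e e0.
have e30 : 0 < e / 3 by rewrite divr_gt0.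
near F => f.
have gf : forall x, `|g x - cts_ev f x| <= e / 3 by near: f; exact: g_unif.
have /cvgrPdist_lt/(_ _ e30) := @cts_ev_continuous _ _ _ _ f x.
apply: filterS => y /ltW fxy.
have -> : g x - g y =
    (g x - cts_ev f x) + (cts_ev f x - cts_ev f y) - (g y - cts_ev f y).
  by rewrite opprB subrKA subrKA.
have -> : e = e / 3 + e / 3 + e / 3 by field.
by rewrite (le_trans (ler_normB _ _))// lerD// (le_trans (ler_normD _ _))// lerD.
Unshelve. all: by end_near. Qed.

Lemma cts_alg_cvg : cvg F.
Proof.
apply/cvg_ex; exists (cts_mk (cX := cX) g_cts).
apply/cvgrPdist_le => e e0; have := g_unif e0.
by apply: filterS => f fg; apply: cts_norm_le => //; exact: ltW.
Qed.

End cauchy.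

HB.instance Definition _ := Uniform_isComplete.Build CXA cts_alg_cvg.

Lemma cts_star_continuous f : continuous (fun x : X => star (cts_ev f x)).
Proof.
move=> x; apply/cvgrPdist_lt => e e0.
have /cvgrPdist_lt/(_ e e0) := @cts_ev_continuous _ _ _ _ f x.
by apply: filterS => y; rewrite -starB norm_star.
Qed.

Lemma cts_cmul_continuous f h :
  continuous (fun x : X => cts_ev f x ** cts_ev h x).
Proof.
move=> x; apply: (@cvg_comp _ _ _ (fun y => (cts_ev f y, cts_ev h y))
  (fun ab : A * A => ab.1 ** ab.2) _ (nbhs (cts_ev f x, cts_ev h x))).
  by apply: cvg_pair; exact: cts_ev_continuous.
exact: (@cmul_continuous R A (cts_ev f x, cts_ev h x)).
Qed.

Let mul f h : CXA := cts_mk (@cts_cmul_continuous f h).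
Let st f : CXA := cts_mk (@cts_star_continuous f).

Let mulA : associative mul.
Proof. by move=> f g h; apply: cts_evP => x; exact: cmulA. Qed.
Let mulDl : left_distributive mul +%R.
Proof. by move=> f g h; apply: cts_evP => x; exact: cmulDl. Qed.
Let mulDr : right_distributive mul +%R.
Proof. by move=> f g h; apply: cts_evP => x; exact: cmulDr. Qed.
Let scaleAl (z : R[i]) f g : mul (z *: f) g = z *: mul f g.
Proof. by apply: cts_evP => x; exact: cscaleAl. Qed.
Let scaleAr (z : R[i]) f g : mul f (z *: g) = z *: mul f g.
Proof. by apply: cts_evP => x; exact: cscaleAr. Qed.
Let stK : involutive st.
Proof. by move=> f; apply: cts_evP => x; exact: starK. Qed.
Let stD : {morph st : f g / f + g}.
Proof. by move=> f g; apply: cts_evP => x; exact: starD. Qed.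
Let stZ (z : R[i]) f : st (z *: f) = Num.conj z *: st f.
Proof. by apply: cts_evP => x; exact: starZ. Qed.
Let stM f g : st (mul f g) = mul (st g) (st f).
Proof. by apply: cts_evP => x; exact: starM. Qed.

Let norm_mul f g : `|mul f g| <= `|f| * `|g|.
Proof.
apply: cts_norm_le => [|x]; first by rewrite mulr_ge0.
by rewrite (le_trans (ler_norm_cmul _ _))// ler_pM// cts_norm_ub.
Qed.

Let norm_st_mul f : `|mul (st f) f| = `|f| ^+ 2.
Proof.
apply/eqP; rewrite eq_le; apply/andP; split.
  apply: cts_norm_le => [|x]; first by rewrite exprn_ge0.
  by rewrite cstar_identity lerXn2r ?nnegrE// cts_norm_ub.
rewrite -[leRHS]sqrtCK lerXn2r ?nnegrE ?sqrtC_ge0//.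
apply: cts_norm_le => [|x]; first by rewrite sqrtC_ge0.
rewrite -(@ler_pXn2r _ 2)// ?nnegrE ?sqrtC_ge0// sqrtCK -cstar_identity.
exact: (cts_norm_ub (mul (st f) f) x).
Qed.

HB.instance Definition _ := isCStarAlgebra.Build R CXA mulA mulDl mulDr
  scaleAl scaleAr stK stD stZ stM norm_mul norm_st_mul.

End CtsAlgComplete.

Record star_hom (R : realType) (A B : cstarAlgType R) (f : A -> B) : Prop := {
  star_hom_linear : linear f;
  star_homM : {morph f : a b / a ** b};
  star_hom_star : {morph f : a / star a}
}.

Record closed_ideal (R : realType) (A : cstarAlgType R) (I : set A) : Prop := {
  ideal_closed : closed I;
  ideal0 : I 0;
  ideal_linear : forall (z : R[i]) a b, I a -> I b -> I (z *: a + b);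
  idealMl : forall a b, I b -> I (a ** b);
  idealMr : forall a b, I a -> I (a ** b)
}.

Definition simple_cstar (R : realType) (A : cstarAlgType R) : Prop :=
  forall I : set A, closed_ideal I -> I = [set 0] \/ I = [set: A].

(** [quotient_map I pi] presents [Q] as the quotient C*-algebra A/I: the kernel
    and the range determine [Q] up to isomorphism, and the norm of [Q] is then
    the quotient norm since injective *-homomorphisms are isometric. *)
Record quotient_map (R : realType) (A : cstarAlgType R) (I : set A)
    (Q : cstarAlgType R) (pi : A -> Q) : Prop := {
  quotient_hom : star_hom pi;
  quotient_surj : forall q, exists a, pi a = q;
  quotient_ker : forall a, pi a = 0 <-> I a
}.

(** The unitization adjoins a new unit even when A is already unital; then
    M_n of it is M_n(A) + M_n(C), so stable finiteness does not depend on this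
    convention. *)
Definition unitization (R : realType) (A : cstarAlgType R) : Type :=
  (A * R[i])%type.

Section Unitization.
Context {R : realType} {A : cstarAlgType R}.
Implicit Types u v w : unitization A.

HB.instance Definition _ := GRing.Zmodule.copy (unitization A) (A * R[i])%type.

Definition umul u v : unitization A :=
  (u.1 ** v.1 + v.2 *: u.1 + u.2 *: v.1, u.2 * v.2).
Definition ustar u : unitization A := (star u.1, Num.conj u.2).

Let umulA : associative umul.
Proof.
move=> [a x] [b y] [c z]; rewrite /umul /=; congr pair; last exact: mulrA.
rewrite !cmulDl !cmulDr !scalerDr !cscaleAl !cscaleAr !scalerA cmulA.
rewrite !addrA (mulrC y z) (mulrC z x).
rewrite -!addrA; congr (_ + _).
rewrite addrCA; congr (_ + _).
by rewrite [RHS]addrCA; congr (_ + _); rewrite addrCA.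
Qed.
Let umul1l : left_id ((0, 1) : unitization A) umul.
Proof.
by move=> [a x]; rewrite /umul/= cmul0r scaler0 scale1r !add0r mul1r.
Qed.
Let umul1r : right_id ((0, 1) : unitization A) umul.
Proof.
by move=> [a x]; rewrite /umul/= cmulr0 scaler0 scale1r addr0 add0r mulr1.
Qed.
Let umulDl : left_distributive umul +%R.
Proof.
move=> [a x] [b y] [c z]; rewrite /umul /=; congr pair; last exact: mulrDl.
rewrite cmulDl scalerDr scalerDl.
by rewrite /= [RHS]addrACA; congr (_ + _); rewrite addrACA.
Qed.
Let umulDr : right_distributive umul +%R.
Proof.
move=> [a x] [b y] [c z]; rewrite /umul /=; congr pair; last exact: mulrDr.
rewrite cmulDr scalerDr scalerDl.
by rewrite /= [RHS]addrACA; congr (_ + _); rewrite addrACA.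
Qed.

HB.instance Definition _ := GRing.Zmodule_isPzRing.Build (unitization A)
  umulA umul1l umul1r umulDl umulDr.

End Unitization.

Section StablyFinite.
Context {R : realType} {A : cstarAlgType R} {n : nat}.
Implicit Types p q v : 'M[unitization A]_n.

Definition mxstar p : 'M[unitization A]_n := (map_mx ustar p)^T.

Definition projection p : Prop := mxstar p = p /\ p *m p = p.

Definition infinite_projection p : Prop := projection p /\
  exists q v, [/\ projection q, p *m q = q, q <> p,
                  mxstar v *m v = p & v *m mxstar v = q].

End StablyFinite.

Definition stably_finite (R : realType) (A : cstarAlgType R) : Prop :=
  forall n (p : 'M[unitization A]_n), ~ infinite_projection p.

HB.mixin Record isHilbert (R : realType) H & CompleteNormedModule R[i] H := {
  inner : {dot H for (@Num.conj R[i])};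
  inner_norm : forall x : H, inner x x = `|x| ^+ 2
}.

#[short(type="hilbertType")]
HB.structure Definition Hilbert (R : realType) :=
  {H of CompleteNormedModule R[i] H & isHilbert R H}.

Section CompactOperators.
Context {R : realType} {H : hilbertType R}.
Implicit Types k l : H -> H.

Definition compact_op k : Prop :=
  linear k /\ precompact (k @` [set x | `|x| <= 1]).

Definition adjoint k l : Prop := forall x y, inner (k x) y = inner x (l y).

Definition lin_indep n (k : 'I_n -> H -> H) : Prop :=
  forall c : 'I_n -> R[i], \sum_i c i *: k i = 0 -> forall i, c i = 0.

(** [D], with [t b k] in the role of the elementary tensor of [b] and [k], is
    a completion of the algebraic tensor product of [B] with the compact
    operators on [H] in a C*-norm. As the compact operators are nuclear there is
    only one such norm, so that [D] is the C*-tensor product. *)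
Record tensor_compact (B D : cstarAlgType R) (t : B -> (H -> H) -> D) : Prop := {
  tens_linearl : forall k, compact_op k -> linear (t^~ k);
  tens_linearr : forall b (z : R[i]) k l, compact_op k -> compact_op l ->
    t b (z *: k + l) = z *: t b k + t b l;
  tensM : forall b c k l, compact_op k -> compact_op l ->
    t (b ** c) (k \o l) = t b k ** t c l;
  tens_star : forall b k l, compact_op k -> compact_op l -> adjoint k l ->
    t (star b) l = star (t b k);
  tens_inj : forall n (b : 'I_n -> B) (k : 'I_n -> H -> H),
    (forall i, compact_op (k i)) -> lin_indep k ->
    \sum_i t (b i) (k i) = 0 -> forall i, b i = 0;
  tens_dense : dense [set d | exists n (b : 'I_n -> B) (k : 'I_n -> H -> H),
    (forall i, compact_op (k i)) /\ d = \sum_i t (b i) (k i)]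
}.

End CompactOperators.

(** The data used to form Cu(B): a separable infinite-dimensional Hilbert space
    [hilb], the C*-algebra [stab] = B (x) K(hilb), and a unitary [fold] from
    hilb + hilb to hilb. Conjugation with [fold] identifies M_2(K) with K, and
    [dsum a b] is the image of diag(a, b) under the resulting isomorphism from
    M_2(B (x) K) to B (x) K. *)
Record stabilization (R : realType) (B : cstarAlgType R) := Stabilization {
  hilb : hilbertType R;
  hilb_separable : exists2 S : set hilb, countable S & dense S;
  hilb_infinite_dim : ~ exists n (e : 'I_n -> hilb),
    forall x, exists c : 'I_n -> R[i], x = \sum_i c i *: e i;
  stab :> cstarAlgType R;
  tens : B -> (hilb -> hilb) -> stab;
  tensP : tensor_compact tens;
  fold : hilb * hilb -> hilb;
  unfold : hilb -> hilb * hilb;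
  foldK : cancel fold unfold;
  unfoldK : cancel unfold fold;
  fold_linear : linear fold;
  fold_inner : forall p q,
    inner (fold p) (fold q) = inner p.1 q.1 + inner p.2 q.2;
  dsum : stab -> stab -> stab;
  dsum_linear : forall (z : R[i]) a b c d,
    dsum (z *: a + c) (z *: b + d) = z *: dsum a b + dsum c d;
  dsumM : forall a b c d, dsum (a ** c) (b ** d) = dsum a b ** dsum c d;
  dsum_star : forall a b, dsum (star a) (star b) = star (dsum a b);
  dsum_tens : forall b c k l, compact_op k -> compact_op l ->
    dsum (tens b k) (tens c l) =
      tens b (fun x => fold (k (unfold x).1, 0)) +
      tens c (fun x => fold (0, l (unfold x).2))
}.

Section Cuntz.
Context {R : realType} {D : cstarAlgType R}.
Implicit Types a b : D.

Definition cpos : set D := [set a | exists c, a = star c ** c].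

Definition cuntz_le a b : Prop :=
  exists v : nat -> D, (fun n => v n ** b ** star (v n)) @ \oo --> a.

Definition cuntz_class a : set D :=
  [set b | [/\ cpos b, cuntz_le a b & cuntz_le b a]].

(** The value at [a] of the polynomial ['X * q]; there is no unit in [D]. *)
Definition xpoly_eval (q : {poly R}) a : D :=
  \sum_(i < size q) (q`_i)%:C *: iter i (cmul a) a.

(** Functional calculus for a positive [a] and a continuous [f] with f(0) = 0:
    f(a) is the limit of p_n(a), for any polynomials p_n without constant term
    that converge to f uniformly on [0, |a|], which contains the spectrum. *)
Definition fcalc (f : R -> R) a : D :=
  get [set y | exists q : nat -> {poly R},
    (forall e : R, 0 < e -> \forall n \near \oo, forall s : R,
       0 <= s <= complex.Re `|a| -> `|s * (q n).[s] - f s| <= e) /\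
    (fun n => xpoly_eval (q n) a) @ \oo --> y].

Definition cutdown (e : R) a : D := fcalc (fun s => Num.max (s - e) 0) a.

End Cuntz.

Definition Cu (R : realType) (D : cstarAlgType R) : Type :=
  {x : set D | exists2 a, cpos a & x = cuntz_class a}.

Section CuntzSemigroup.
Context {R : realType} {B : cstarAlgType R} {S : stabilization B}.
Implicit Types x y : Cu S.

Definition cu_class (a : S) (pa : cpos a) : Cu S :=
  exist _ (cuntz_class a) (ex_intro2 _ _ a pa erefl).

(** [represents a x] reads x = [a]. *)
Definition represents (a : S) x : Prop := cpos a /\ sval x = cuntz_class a.

Definition cu_le x y : Prop :=
  exists a b, [/\ represents a x, represents b y & cuntz_le a b].

Definition way_below x y : Prop := exists a b (e : R),
  [/\ represents a x, represents b y, 0 < e & cuntz_le a (cutdown e b)].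

Lemma cpos0 : cpos (0 : S).
Proof. by exists 0; rewrite cmulr0. Qed.

Lemma cpos_dsum (a b : S) : cpos a -> cpos b -> cpos (dsum a b).
Proof.
by move=> [c ->] [d ->]; exists (dsum c d); rewrite dsumM dsum_star.
Qed.

Definition cu_rep x : {a : S | represents a x} :=
  let: exist2 a pa xa := cid2 (svalP x) in exist _ a (conj pa xa).

Definition cu0 : Cu S := cu_class cpos0.

Definition cu_add x y : Cu S :=
  cu_class (cpos_dsum (svalP (cu_rep x)).1 (svalP (cu_rep y)).1).

Definition cu_mul (n : nat) x : Cu S := iterop n cu_add x cu0.

End CuntzSemigroup.

Definition almost_unperforated (R : realType) (B : cstarAlgType R)
    (S : stabilization B) : Prop :=
  forall (x y : Cu S) (k : nat),
    cu_le (cu_mul k.+1 x) (cu_mul k y) -> cu_le x y.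

Definition almost_divisible (R : realType) (B : cstarAlgType R)
    (S : stabilization B) : Prop :=
  forall x' x : Cu S, way_below x' x -> forall N : nat,
    exists y : Cu S, cu_le (cu_mul N y) x /\ cu_le x' (cu_mul N.+1 y).

(** A stabilization exists and is unique up to an isomorphism compatible with
    the elementary tensors; direct sums taken with different unitaries are
    Cuntz equivalent. So the choice of [S] is immaterial. *)
Definition pure_cstar (R : realType) (B : cstarAlgType R) : Prop :=
  exists S : stabilization B, almost_unperforated S /\ almost_divisible S.

(* Main.v *)
(** Pureness of [C(X, A)] follows from a pointwise comparison: if
    [2 [F(p)] <= [G(p)]] at every point [p], then [F] is below [G].
    The elements [F] and [G] are moved to the cube of barycentric coordinates of
    a fine cover of [X], and on a cube one proceeds by induction on the dimension,
    since [C([0,1]^{n+1}) = C([0,1], C([0,1]^n))]. On an interval the witnesses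
    at consecutive points of a subdivision must be made orthogonal to each other,
    which uses a cancellation property: if [x' << x] and [2 x <= x' + z], then
    [x' <= K z] for some [K].

    If every quotient of [A] is stably finite, cancellation holds: otherwise,
    modulo the ideal generated by [z], there would be a nonunitary isometry in a
    matrix algebra over the unitization of a quotient of [A]. If [A] is simple and
    cancellation fails, every nonzero class of Cu([A]) is the largest one. Then
    each witness at a point can be pushed into an arbitrarily small hereditary
    subalgebra, so that finitely many of them become almost orthogonal and can be
    glued with a partition of unity. *)

(* The obstacle is that no bound on the dimension of [X] is available, so constants must not grow
   with the number of coordinates. Over an interval the gluing needs the factor 4; before the next
   coordinate is added, this factor is removed again. [x] is cut into pieces so small that the
   factor no longer matters, and these are placed below [y] one after another. What is left of [y]
   after a placement is a complement, and nothing in the order says how large a complement is;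
   cancellation, in the form of the ratio estimate [CAN], bounds it from below at every point. Since
   cancellation and divisibility pass from an algebra to its functions on [0,1], the induction
   closes with the same constant in every dimension. For the same reason the pointwise divisor in
   [ADpt] is built from many layers of a partition of unity, which makes the overlap of the cover
   negligible. In the stably finite case the isometry is at first only approximate and lies over the
   whole stabilization. It is moved into a matrix corner and corrected there by an inverse square
   root, which works modulo an ideal. *)
From HB Require Import structures.
Require Import Defs.
From mathcomp Require Import all_boot all_order all_algebra.
From mathcomp Require Import all_classical all_reals all_analysis.
From mathcomp Require Import complex ring lra zify.

Set Implicit Arguments.
Unset Strict Implicit.
Unset Printing Implicit Defensive.
Import Order.TTheory GRing.Theory Num.Theory.
Import numFieldNormedType.Exports.
Local Open Scope classical_set_scope.
Local Open Scope complex_scope.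
Local Open Scope ring_scope.

(** * Identities in abelian groups *)

(** Reflection for [zmod]: a goal in an abelian group is reified over a list of its atoms, and both
    sides are compared through their integer coefficients by computation. *)
Inductive zexp := ZA (n : nat) | Z0 | ZD (e f : zexp) | ZN (e : zexp).

Fixpoint zeval (V : zmodType) (s : seq V) e : V :=
  match e with ZA n => s`_n | Z0 => 0 | ZD e f => zeval s e + zeval s f | ZN e => - zeval s e end.

Fixpoint zcoef e (i : nat) : int :=
  match e with ZA n => (n == i)%:R | Z0 => 0 | ZD e f => zcoef e i + zcoef f i | ZN e => - zcoef e i end.

Lemma zevalE (V : zmodType) (s : seq V) e : zeval s e = \sum_(i < size s) s`_i *~ zcoef e i.
Proof.
elim: e => [n||e ihe f ihf|e ih] /=.
- have [ns|sn] := ltnP n (size s); last first.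
    rewrite nth_default// big1// => i _; case: eqP (ltn_ord i) => [<-|]; first by rewrite ltnNge sn.
    by rewrite mulr0z.
  rewrite (bigD1 (Ordinal ns))//= eqxx big1 ?addr0// => i ni.
  have -> : (n == i) = false by apply: contraNF ni => /eqP ni; apply/eqP; apply: ord_inj.
  by rewrite mulr0z.
- by rewrite big1// => i _; rewrite mulr0z.
- by rewrite ihe ihf -big_split/=; apply: eq_bigr => i _; rewrite mulrzDr.
- by rewrite ih -sumrN; apply: eq_bigr => i _; rewrite mulrNz.
Qed.

Lemma zmod_eq (V : zmodType) (s : seq V) e f :
  all (fun i => zcoef e i == zcoef f i) (iota 0 (size s)) -> zeval s e = zeval s f.
Proof.
move=> /allP h; rewrite !zevalE; apply: eq_bigr => i _; congr (_ *~ _).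
by apply/eqP/h; rewrite mem_iota ltn_ord.
Qed.

Ltac zfind x s :=
  lazymatch s with
  | cons ?y ?s' => let r := match goal with _ => let _ := match goal with _ => unify x y end in constr:(O)
      | _ => let n := zfind x s' in constr:(S n) end in r
  end.
Ltac zmem x s :=
  lazymatch s with
  | nil => constr:(false)
  | cons ?y ?s' => match goal with _ => let _ := match goal with _ => unify x y end in constr:(true) | _ => zmem x s' end
  end.
Ltac zatoms t s :=
  lazymatch t with
  | @GRing.add _ ?a ?b => let s1 := zatoms a s in zatoms b s1
  | @GRing.opp _ ?a => zatoms a s
  | @GRing.zero _ => s
  | _ => let m := zmem t s in lazymatch m with true => s | false => constr:(cons t s) end
  end.
Ltac zreify t s :=
  lazymatch t with
  | @GRing.add _ ?a ?b => let e := zreify a s in let f := zreify b s in constr:(ZD e f)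
  | @GRing.opp _ ?a => let e := zreify a s in constr:(ZN e)
  | @GRing.zero _ => constr:(Z0)
  | _ => let n := zfind t s in constr:(ZA n)
  end.
Ltac zmod :=
  lazymatch goal with |- @eq ?T ?a ?b =>
    let s0 := constr:(@nil T) in let s1 := zatoms a s0 in let s2 := zatoms b s1 in
    let e := zreify a s2 in let f := zreify b s2 in
    refine (@zmod_eq _ s2 e f _); vm_compute; reflexivity
  end.

(** Lets [zmod] use one equation: [c = d] enters through the difference of the two sides. *)
Lemma zmod_use (V : zmodType) (a b c d : V) : c = d -> a - b = c - d -> a = b.
Proof. by move=> ->; rewrite subrr => /subr0_eq. Qed.

(** * Norms and the unitization *)

Section RealNorm.
Context {R : realType} {V : normedModType R[i]}.
Implicit Types (u v w : V) (r : R).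

(** The norm of a complex normed module lives in [R[i]]; estimates are made in [R], where [lra] and
    [nra] apply, and [nrmE] translates back. *)
Definition nrm v : R := complex.Re `|v|.

Lemma nrmE v : (nrm v)%:C = `|v|.
Proof. by rewrite /nrm RRe_real// normr_real. Qed.

Lemma nrm_ge0 v : 0 <= nrm v.
Proof. by rewrite -lecR nrmE; exact: normr_ge0. Qed.

Lemma nrm0 : nrm 0 = 0.
Proof. by rewrite /nrm normr0. Qed.

Lemma nrm_eq0 v : (nrm v == 0) = (v == 0).
Proof.
rewrite -[RHS]normr_eq0; apply/eqP/eqP => [h|h]; first by rewrite -nrmE h.
by rewrite /nrm h.
Qed.

Lemma nrm_le0 v : nrm v <= 0 -> v = 0.
Proof.
by move=> h; apply/eqP; rewrite -nrm_eq0 eq_le h nrm_ge0.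
Qed.

Lemma nrmD v w : nrm (v + w) <= nrm v + nrm w.
Proof. by rewrite -lecR nrmE rmorphD/= !nrmE ler_normD. Qed.

Lemma nrmN v : nrm (- v) = nrm v.
Proof. by rewrite /nrm normrN. Qed.

Lemma nrmB v w : nrm (v - w) <= nrm v + nrm w.
Proof. by rewrite -[nrm w]nrmN nrmD. Qed.

Lemma nrm_distC v w : nrm (v - w) = nrm (w - v).
Proof. by rewrite -nrmN opprB. Qed.

Lemma nrm_dist3 u v w : nrm (u - w) <= nrm (u - v) + nrm (v - w).
Proof. by rewrite -(subrKA v u) nrmD. Qed.

Lemma nrm_le_dist v w : nrm v <= nrm w + nrm (v - w).
Proof. by rewrite -{1}(subrK w v) addrC nrmD. Qed.

Lemma nrmZ (z : R[i]) v : nrm (z *: v) = complex.Re `|z| * nrm v.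
Proof.
by apply: (@complexI R); rewrite nrmE normrZ rmorphM/= nrmE.
Qed.

Lemma Re_normC r : complex.Re `|r%:C| = `|r|.
Proof. by rewrite normc_def/= expr0n/= addr0 sqrtr_sqr. Qed.

Lemma nrmZr r v : nrm (r%:C *: v) = `|r| * nrm v.
Proof. by rewrite nrmZ Re_normC. Qed.

Lemma nrm_sum I (s : seq I) (P : pred I) (F : I -> V) :
  nrm (\sum_(i <- s | P i) F i) <= \sum_(i <- s | P i) nrm (F i).
Proof.
elim/big_rec2: _ => [|i x y _ h]; first by rewrite nrm0.
by rewrite (le_trans (nrmD _ _))// lerD2l.
Qed.

Lemma nrm_le v r : (nrm v <= r) = (`|v| <= r%:C).
Proof. by rewrite -nrmE lecR. Qed.

Lemma nrm_lt v r : (nrm v < r) = (`|v| < r%:C).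
Proof. by rewrite -nrmE ltcR. Qed.

Lemma nrm_cvgP {T : Type} (F : set_system T) {FF : Filter F} (u : T -> V) l :
  (u @ F --> l) <-> (forall e : R, 0 < e -> \forall x \near F, nrm (l - u x) < e).
Proof.
split=> [/cvgrPdist_lt h e e0|h].
  have eC : 0 < e%:C :> R[i] by rewrite ltcR.
  by have := h _ eC; apply: filterS => x; rewrite nrm_lt.
apply/cvgrPdist_lt => e e0.
have eE : (complex.Re e)%:C = e by rewrite RRe_real// gtr0_real.
have := h (complex.Re e); rewrite -ltcR eE => /(_ e0).
by apply: filterS => x; rewrite nrm_lt eE.
Qed.

Lemma nrm_cvg_seqP (u : nat -> V) l : (u @ \oo --> l) <->
  (forall e : R, 0 < e -> exists n0, forall n, (n0 <= n)%N -> nrm (l - u n) < e).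
Proof.
rewrite nrm_cvgP; split=> h e e0.
  by have [n0 _ hn] := h _ e0; exists n0 => n; exact: hn.
by have [n0 hn] := h _ e0; exists n0.
Qed.

End RealNorm.

Lemma nrm_cauchy_cvg {R : realType} {V : completeNormedModType R[i]}
    (u : nat -> V) :
  (forall e : R, 0 < e -> exists n0, forall m n, (n0 <= m)%N -> (n0 <= n)%N ->
     nrm (u m - u n) < e) -> exists l : V, u @ \oo --> l.
Proof.
move=> h; apply/cvg_ex; apply: cauchy_cvg; apply/cauchy_ballP => e e0.
have eE : (complex.Re e)%:C = e by rewrite RRe_real// gtr0_real.
have := h (complex.Re e); rewrite -ltcR eE => /(_ e0)[n0 hn].
rewrite near_map2.
exists ([set n | (n0 <= n)%N], [set n | (n0 <= n)%N]) => /=.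
  by split; exists n0.
move=> [m n] /= [? ?]; rewrite -ball_normE/=.
by rewrite -eE -nrm_lt hn.
Qed.

Section CStarNorm.
Context {R : realType} {A : cstarAlgType R}.
Implicit Types (a b c x y : A).

Lemma nrmM a b : nrm (a ** b) <= nrm a * nrm b.
Proof. by rewrite -lecR rmorphM/= !nrmE ler_norm_cmul. Qed.

Lemma nrm_star a : nrm (star a) = nrm a.
Proof. by rewrite /nrm norm_star. Qed.

Lemma nrm_cstar a : nrm (star a ** a) = nrm a ^+ 2.
Proof.
by apply: (@complexI R); rewrite nrmE cstar_identity rmorphXn/= nrmE.
Qed.

Lemma nrm_cstar2 a : nrm (a ** star a) = nrm a ^+ 2.
Proof. by have := nrm_cstar (star a); rewrite starK nrm_star. Qed.

Lemma starZr (r : R) a : star (r%:C *: a) = r%:C *: star a.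
Proof. by rewrite starZ conj_Creal// complex_real. Qed.

Lemma cmulNr a b : (- a) ** b = - (a ** b).
Proof. by rewrite -sub0r cmulBl cmul0r sub0r. Qed.

Lemma cmulrN a b : a ** (- b) = - (a ** b).
Proof. by rewrite -sub0r cmulBr cmulr0 sub0r. Qed.

Lemma cmul_suml I (s : seq I) (P : pred I) (F : I -> A) b :
  (\sum_(i <- s | P i) F i) ** b = \sum_(i <- s | P i) (F i ** b).
Proof. by elim/big_rec2: _ => [|i x y _ <-]; rewrite ?cmul0r// cmulDl. Qed.

Lemma cmul_sumr I (s : seq I) (P : pred I) (F : I -> A) b :
  b ** (\sum_(i <- s | P i) F i) = \sum_(i <- s | P i) (b ** F i).
Proof. by elim/big_rec2: _ => [|i x y _ <-]; rewrite ?cmulr0// cmulDr. Qed.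

Lemma star_sum I (s : seq I) (P : pred I) (F : I -> A) :
  star (\sum_(i <- s | P i) F i) = \sum_(i <- s | P i) star (F i).
Proof. by elim/big_rec2: _ => [|i x y _ <-]; rewrite ?star0// starD. Qed.

Lemma cvg_star (u : nat -> A) l : u @ \oo --> l -> (fun n => star (u n)) @ \oo --> star l.
Proof.
move=> /nrm_cvg_seqP h; apply/nrm_cvg_seqP => e /h[n0 hn].
by exists n0 => n /hn; rewrite -starB nrm_star.
Qed.

Lemma cvg_cmul (u v : nat -> A) l m : u @ \oo --> l -> v @ \oo --> m ->
  (fun n => u n ** v n) @ \oo --> l ** m.
Proof.
move=> ul vm.
apply: (@cvg_comp _ _ _ (fun n => (u n, v n)) (fun ab : A * A => ab.1 ** ab.2)
  _ (nbhs (l, m))); first exact: cvg_pair.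
exact: (@cmul_continuous R A (l, m)).
Qed.

Lemma cvg_uniq (u : nat -> A) (l m : A) : u @ \oo --> l -> u @ \oo --> m -> l = m.
Proof. by apply: (@cvg_unique _ _ (u @ \oo)); exact: norm_hausdorff. Qed.

End CStarNorm.

(** The unitization acts on [A] by left multiplication; this action replaces a
    norm on the unitization. *)
Section UnitizationAlgebra.
Context {R : realType} {A : cstarAlgType R}.
Local Notation A1 := (unitization A).
Implicit Types (u v w : A1) (z : R[i]).

HB.instance Definition _ := GRing.Lmodule.copy A1 (A * (R[i])^o)%type.

Lemma umulE u v : u * v = umul u v. Proof. by []. Qed.

Lemma uone_neq0 : (1 : A1) != 0.
Proof. by apply/eqP => -[] /eqP; rewrite oner_eq0. Qed.

HB.instance Definition _ := GRing.PzSemiRing_isNonZero.Build A1 uone_neq0.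

Lemma uscaleAl z u v : z *: (u * v) = z *: u * v.
Proof.
rewrite !umulE /umul; congr pair => /=; last exact: mulrA.
by rewrite !scalerDr cscaleAl !scalerA [z * _]mulrC.
Qed.

Lemma uscaleAr z u v : z *: (u * v) = u * (z *: v).
Proof.
rewrite !umulE /umul; congr pair => /=; last exact: mulrCA.
by rewrite !scalerDr cscaleAr !scalerA [z * u.2]mulrC.
Qed.

HB.instance Definition _ := GRing.Lmodule_isLalgebra.Build R[i] A1 uscaleAl.
HB.instance Definition _ := GRing.Lalgebra_isAlgebra.Build R[i] A1 uscaleAr.

Definition uinj (a : A) : A1 := (a, 0).

Definition uact u (x : A) : A := u.1 ** x + u.2 *: x.

Lemma uactM u v x : uact (u * v) x = uact u (uact v x).
Proof.
rewrite /uact umulE /umul /= !cmulDl !cmulDr !cscaleAl cscaleAr scalerDr scalerA.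
by rewrite cmulA -!addrA; congr (_ + _); rewrite addrCA [X in _ = X]addrC -!addrA; congr (_ + _);
  rewrite addrC.
Qed.

Lemma uactD u v x : uact (u + v) x = uact u x + uact v x.
Proof. by rewrite /uact cmulDl scalerDl addrACA. Qed.

Lemma uactZ z u x : uact (z *: u) x = z *: uact u x.
Proof. by rewrite /uact cscaleAl scalerDr scalerA. Qed.

Lemma uact1 x : uact 1 x = x.
Proof. by rewrite /uact cmul0r add0r scale1r. Qed.

Lemma uact_inj a x : uact (uinj a) x = a ** x.
Proof. by rewrite /uact/= scale0r addr0. Qed.

Lemma uact_sum I (s : seq I) (P : pred I) (F : I -> A1) x :
  uact (\sum_(i <- s | P i) F i) x = \sum_(i <- s | P i) uact (F i) x.
Proof.
elim/big_rec2: _ => [|i y v _ <-]; last by rewrite uactD.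
by rewrite /uact cmul0r scale0r addr0.
Qed.

Lemma ustarM u v : ustar (u * v) = ustar v * ustar u.
Proof.
rewrite !umulE /umul /ustar /=; congr pair; last by rewrite rmorphM mulrC.
by rewrite !starD starM !starZ /= addrAC.
Qed.

Lemma ustarK u : ustar (ustar u) = u.
Proof. by case: u => a z; rewrite /ustar/= starK conjCK. Qed.

Lemma ustarD u v : ustar (u + v) = ustar u + ustar v.
Proof. by rewrite /ustar/= starD rmorphD. Qed.

Lemma ustarZ z u : ustar (z *: u) = Num.conj z *: ustar u.
Proof. by rewrite /ustar/= starZ rmorphM. Qed.

Lemma ustar_inj a : ustar (uinj a) = uinj (star a).
Proof. by rewrite /ustar/= rmorph0. Qed.

Lemma star_uact u x : star (uact u x) ** uact u x = star x ** uact (ustar u * u) x.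
Proof.
rewrite uactM {1}/uact starD starM starZ /uact /=.
by move: (u.1 ** x + _) => w; rewrite cmulDl cmulDr cscaleAl cscaleAr cmulA.
Qed.

Lemma uact_isom u x : ustar u * u = 1 -> nrm (uact u x) = nrm x.
Proof.
move=> u1; apply/eqP; rewrite -(@eqrXn2 _ 2)// ?nrm_ge0//.
by rewrite -!nrm_cstar star_uact u1 uact1.
Qed.

Lemma uinjD a b : uinj (a + b) = uinj a + uinj b.
Proof. by congr pair; rewrite /= addr0. Qed.

Lemma uinjM a b : uinj (a ** b) = uinj a * uinj b.
Proof. by rewrite umulE /umul/= !scale0r !addr0 mulr0. Qed.

Lemma uinjZ z a : uinj (z *: a) = z *: uinj a.
Proof. by congr pair; rewrite /= scaler0. Qed.

Lemma uinj_inj : injective uinj.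
Proof. by move=> a b []. Qed.

End UnitizationAlgebra.

(** * Polynomials in self-adjoint elements *)

From mathcomp Require cyclic separable cyclotomic.

Lemma prim_root_unit_circle (R : realType) n : (n > 0)%N ->
  exists2 z : R[i], n.-primitive_root z & `|z| = 1.
Proof.
pose p : {poly R[i]} := 'X^n - 1; have [r Dp] := closed_field_poly_normal p.
move=> n_gt0; rewrite (monicP _) ?monicXnsubC // scale1r in Dp.
have rn1 : all n.-unity_root r by apply/allP=> z; rewrite -root_prod_XsubC -Dp.
have sz_r : (n < (size r).+1)%N.
  by rewrite -(size_prod_XsubC r id) -Dp size_XnsubC.
have [|z rz zn] := hasP (cyclic.has_prim_root n_gt0 rn1 _ sz_r).
  by rewrite -separable.separable_prod_XsubC -Dp cyclotomic.separable_Xn_sub_1 // pnatr_eq0 -lt0n.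
exists z => //; apply/eqP; rewrite -(@pexpr_eq1 _ _ n)//.
by rewrite -normrX (prim_expr_order zn) normr1.
Qed.

Lemma prim_root_sum (F : fieldType) n (z : F) m : n.-primitive_root z ->
  \sum_(k < n) (z ^+ k) ^+ m = if (n %| m)%N then n%:R else 0.
Proof.
move=> zn; under eq_bigr do rewrite exprAC.
have := subrX1 (z ^+ m) n; rewrite exprAC (prim_expr_order zn) expr1n subrr.
case: ifPn => [nm|nm]; last first.
  move=> /esym/eqP; rewrite mulf_eq0 subr_eq0 -(prim_order_dvd zn) (negbTE nm).
  by move=> /eqP.
move=> _; have -> : z ^+ m = 1 by apply/eqP; rewrite -(prim_order_dvd zn).
by under eq_bigr do rewrite expr1n; rewrite sumr_const card_ord.
Qed.

(** Discrete Fourier inversion: the coefficient of index [j] is the average over [k] of [P.[z ^+ k]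
    * z ^+ (k * (n - j))], the other coefficients cancelling by [prim_root_sum]. *)
Lemma coef_bound_roots (R : realType) (P : {poly R[i]}) n (z : R[i]) (M : R) :
  n.-primitive_root z -> `|z| = 1 -> (size P <= n)%N ->
  (forall k : 'I_n, `|P.[z ^+ k]| <= M%:C) -> forall j, `|P`_j| <= M%:C.
Proof.
move=> zn z1 sP PM j; have n0 := prim_order_gt0 zn.
have M0 : 0 <= M%:C by rewrite (le_trans _ (PM (Ordinal n0))).
have [jn|jn] := leqP n j; first by rewrite nth_default ?normr0// (leq_trans sP).
have E : n%:R * P`_j = \sum_(k < n) P.[z ^+ k] * z ^+ (k * (n - j)).
  under eq_bigr => k _.
    rewrite (horner_coef_wide _ sP) mulr_suml.
    under eq_bigr => i _ do rewrite -mulrA exprM -exprD.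
    over.
  rewrite exchange_big/= (bigD1 (Ordinal jn))//= -mulr_sumr prim_root_sum//.
  rewrite subnKC ?(ltnW jn)// dvdnn big1 ?addr0 1?mulrC// => i ij.
  rewrite -mulr_sumr prim_root_sum// ifF ?mulr0//.
  apply/negP; have lin := ltn_ord i; have [ltij|ltji|eij] := ltngtP i j.
  - by case/dvdnP => -[|[|c]]; lia.
  - by case/dvdnP => -[|[|c]]; nia.
  - by case/eqP: ij; apply: val_inj.
rewrite -(@ler_pM2l _ n%:R) ?ltr0n// -{1}(normr_nat _ n) -normrM E.
rewrite (le_trans (ler_norm_sum _ _ _))//.
have -> : n%:R * M%:C = \sum_(k < n) M%:C by rewrite sumr_const card_ord mulr_natl.
apply: ler_sum => k _; rewrite normrM normrX z1 expr1n mulr1; exact: PM.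
Qed.

Section PolyEval.
Context {R : realType} {A : cstarAlgType R}.
Local Notation A1 := (unitization A).
Implicit Types (u v y : A1) (q : {poly R}) (h x : A).

Definition pev q y : A1 := horner_alg y (map_poly (real_complex R) q).

Lemma pevD p q y : pev (p + q) y = pev p y + pev q y.
Proof. by rewrite /pev !rmorphD. Qed.

Lemma pevN q y : pev (- q) y = - pev q y.
Proof. by rewrite /pev !rmorphN. Qed.

Lemma pevM p q y : pev (p * q) y = pev p y * pev q y.
Proof. by rewrite /pev !rmorphM. Qed.

Lemma pevX_ q n y : pev (q ^+ n) y = pev q y ^+ n.
Proof. by rewrite /pev !rmorphXn. Qed.

Lemma pevX y : pev 'X y = y.
Proof. by rewrite /pev map_polyX horner_algX. Qed.

Lemma pevC (c : R) y : pev c%:P y = c%:C *: 1.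
Proof. by rewrite /pev map_polyC horner_algC. Qed.

Lemma pev0 y : pev 0 y = 0.
Proof. by rewrite /pev !rmorph0. Qed.

Lemma pevZ (c : R) q y : pev (c *: q) y = c%:C *: pev q y.
Proof. by rewrite -mul_polyC pevM pevC -scalerAl mul1r. Qed.

Lemma pev_comp p q y : pev (p \Po q) y = pev p (pev q y).
Proof.
elim/poly_ind: p => [|p c ih]; first by rewrite comp_poly0 !pev0.
by rewrite comp_polyD comp_polyM comp_polyX comp_polyC !pevD !pevM ih !pevC pevX.
Qed.

Lemma pev_comm q y v : y * v = v * y -> pev q y * v = v * pev q y.
Proof.
move=> yv; elim/poly_ind: q => [|p c ih]; first by rewrite pev0 mul0r mulr0.
rewrite pevD pevM pevX pevC mulrDl mulrDr -mulrA yv mulrA ih mulrA.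
by rewrite -scalerAl -scalerAr mul1r mulr1.
Qed.

Lemma horner_alg_sum (P : {poly R[i]}) n y : (size P <= n)%N ->
  horner_alg y P = \sum_(i < n) P`_i *: y ^+ i.
Proof.
move=> sP; rewrite -{1}(coefK P) poly_def !rmorph_sum/=.
rewrite (big_ord_widen n (fun i => horner_alg y (P`_i *: 'X^i)))// big_mkcond/=.
apply: eq_bigr => i _; case: ifPn => [_|]; last first.
  by rewrite -leqNgt => /(nth_default 0) ->; rewrite scale0r.
by rewrite -mul_polyC rmorphM rmorphXn/= horner_algX horner_algC -scalerAl mul1r.
Qed.

Lemma uact_pow_isom u n x : ustar u * u = 1 -> nrm (uact (u ^+ n) x) = nrm x.
Proof.
move=> u1; elim: n => [|n ih]; first by rewrite expr0 uact1.
by rewrite exprS uactM uact_isom.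
Qed.

(** [u ^+ n] times the value of [q] is a polynomial [P] in [u], and on the unit circle [P(w)] is
    [w ^+ n] times [q(Re w)]. Powers of [u] act isometrically, so the sum of the absolute values of
    the coefficients of [P] is a bound, and each of these is at most [M]. The factor depending on
    [size q] is disposed of in [unitary_poly_bound2]. *)
Lemma unitary_poly_bound (u : A1) q (M : R) x :
  ustar u * u = 1 -> u * ustar u = 1 ->
  (forall s : R, -1 <= s <= 1 -> `|q.[s]| <= M) ->
  nrm (uact (pev q ((2^-1)%:C *: (u + ustar u))) x) <=
    (2 * size q).+1%:R * M * nrm x.
Proof.
move=> uu1 u1 qM; set y := _ *: _; set n := size q.
pose Z : {poly R[i]} := (2^-1)%:C *: ('X^2 + 1).
pose P : {poly R[i]} := \sum_(i < n) (q`_i)%:C *: ('X^(n - i) * Z ^+ i).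
have Zu : horner_alg u Z = u * y.
  rewrite /Z /y -mul_polyC rmorphM/= horner_algC rmorphD/= rmorphXn/= horner_algX rmorph1.
  by rewrite -scalerAl mul1r -scalerAr mulrDr u1.
have uy : GRing.comm u y by rewrite /GRing.comm/y -scalerAr -scalerAl mulrDr mulrDl u1 uu1.
have Pu : u ^+ n * pev q y = horner_alg u P.
  rewrite /pev (@horner_alg_sum _ n); last by rewrite size_map_poly.
  rewrite mulr_sumr rmorph_sum/=; apply: eq_bigr => i _.
  rewrite coef_map/= -mul_polyC !rmorphM/= horner_algC !rmorphXn/= horner_algX Zu.
  rewrite -scalerAr -scalerAl mul1r; congr (_ *: _).
  by rewrite exprMn_comm// mulrA -exprD subnK// ltnW.
have sZ : (size Z <= 3)%N.
  rewrite (leq_trans (size_scale_leq _ _))// (leq_trans (size_polyD _ _))//.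
  by rewrite size_polyXn size_poly1.
have sP : (size P <= (2 * n).+1)%N.
  apply: (leq_trans (size_sum _ _ _)); apply/bigmax_leqP => i _.
  apply: (leq_trans (size_scale_leq _ _)); apply: (leq_trans (size_polyMleq _ _)).
  have sZi : (size (Z ^+ i) <= (2 * i).+1)%N.
    by apply: (leq_trans (size_poly_exp_leq _ _)); rewrite ltnS leq_mul2r; apply/orP; right; lia.
  by have := ltn_ord i; rewrite size_polyXn; lia.
have [z zn z1] := @prim_root_unit_circle R (2 * n).+1 (ltn0Sn _).
have PM k : `|P.[z ^+ k]| <= M%:C.
  have : `|z ^+ k| = 1 by rewrite normrX z1 expr1n.
  move: (z ^+ k) => w w1.
  pose s : R := complex.Re w.
  have ww : w * conjc w = 1 by rewrite -sqr_normc w1 expr1n.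
  have sE : Z.[w] = w * s%:C.
    rewrite /s ReJ_add mulrA mulrDr ww mulrC /Z hornerZ hornerD hornerXn hornerC.
    by rewrite fmorphV/= rmorphD/= rmorph1.
  have -> : P.[w] = w ^+ n * (q.[s])%:C.
    rewrite horner_sum (horner_coef q) rmorph_sum/= mulr_sumr; apply: eq_bigr => i _.
    rewrite hornerZ hornerM hornerXn horner_exp sE exprMn [w ^+ _ * (_ * _)]mulrA -exprD.
    by rewrite subnK ?(ltnW (ltn_ord i))// rmorphM/= rmorphXn/= mulrCA.
  rewrite normrM normrX w1 expr1n mul1r normc_def/= expr0n addr0 sqrtr_sqr lecR qM//.
  by have := normc_ge_Re w; rewrite w1 lecR ler_norml.
rewrite -(uact_pow_isom n _ uu1) -uactM Pu (horner_alg_sum _ sP) uact_sum.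
rewrite (le_trans (nrm_sum _ _ _))// -mulrA mulr_natl.
rewrite -[X in _ *+ X]card_ord -sumr_const; apply: ler_sum => i _.
rewrite uactZ nrmZ uact_pow_isom// ler_wpM2r ?nrm_ge0//.
have := coef_bound_roots zn z1 sP (fun k => PM k) i; rewrite -lecR RRe_real//; exact: normr_real.
Qed.

End PolyEval.

Lemma bernoulli_ineq (R : realFieldType) (d : R) n : 0 <= d -> 1 + n%:R * d <= (1 + d) ^+ n.
Proof.
move=> d0; elim: n => [|n ih]; first by rewrite mul0r addr0 expr0.
rewrite exprS; apply: (@le_trans _ _ ((1 + d) * (1 + n%:R * d))); last first.
  by rewrite ler_wpM2l// addr_ge0.
have : 0 <= n%:R * d ^+ 2 :> R by rewrite mulr_ge0// exprn_ge0.
by rewrite -natr1; nra.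
Qed.

(** A factor linear in the exponent cannot make up for exponential growth: if [M < r], the square of
    Bernoulli's inequality for [r / M] outgrows it. *)
Lemma expr_pow2_bound (R : realType) (r M c d : R) : 0 <= r -> 0 <= M -> 0 <= c -> 0 <= d ->
  (forall k, r ^+ (2 ^ k) <= (c * (2 ^ k)%:R + d) * M ^+ (2 ^ k)) -> r <= M.
Proof.
move=> r0 M0 c0 d0 h; rewrite leNgt; apply/negP => Mr.
have [M00|Mn0] := eqVneq M 0.
  by have := h 0%N; rewrite M00 expn0 !expr1 mulr0; rewrite M00 in Mr; lra.
have Mp : 0 < M by rewrite lt_def Mn0.
pose e := r / M - 1.
have ep : 0 < e by rewrite subr_gt0 ltr_pdivlMr// mul1r.
have rE : r / M = 1 + e by rewrite /e; ring.
have h2 k : (2 ^ k)%:R * e ^+ 2 <= 2 * c + d.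
  have := h k.+1; rewrite -ler_pdivrMr ?exprn_gt0// -expr_div_n rE expnSr exprM => h1.
  have b1 : ((2 ^ k)%:R * e) ^+ 2 <= ((1 + e) ^+ (2 ^ k)) ^+ 2.
    rewrite lerXn2r// ?nnegrE ?mulr_ge0 ?exprn_ge0//; [exact: ltW|by rewrite addr_ge0// ltW|].
    by apply: le_trans (bernoulli_ineq _ (ltW ep)); rewrite lerDr.
  have := le_trans b1 h1; rewrite natrM => b2.
  have m1 : 1 <= (2 ^ k)%:R :> R by rewrite ler1n expn_gt0.
  have : (2 ^ k)%:R * ((2 ^ k)%:R * e ^+ 2) <= (2 ^ k)%:R * (2 * c + d).
    apply: (@le_trans _ _ (((2 ^ k)%:R * e) ^+ 2)); first by rewrite exprMn expr2 mulrA.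
    by apply: (le_trans b2); nra.
  by rewrite ler_pM2l// (lt_le_trans ltr01).
have e2 : 0 < e ^+ 2 by rewrite exprn_gt0.
have [k kn] : exists k, (2 * c + d) / e ^+ 2 < (2 ^ k)%:R.
  exists (Num.bound ((2 * c + d) / e ^+ 2)).
  apply: lt_le_trans; first by apply: archi_boundP; apply: divr_ge0 (ltW e2); lra.
  by rewrite ler_nat ltnW// ltn_expl.
by have := h2 k; rewrite -ler_pdivlMr// leNgt kn.
Qed.

Section Bound.
Context {R : realType} {A : cstarAlgType R}.
Local Notation A1 := (unitization A).
Implicit Types (u v y : A1) (q : {poly R}) (h x z : A).

Lemma nrm_cvg_le (V : normedModType R[i]) (w : nat -> V) (l x : V) c n0 : w @ \oo --> l ->
  (forall n, (n0 <= n)%N -> nrm (w n - x) <= c) -> nrm (l - x) <= c.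
Proof.
move=> /nrm_cvg_seqP wl h; apply/ler_addgt0Pr => e /wl[n1 hn].
have nm := leq_maxl n0 n1; have nm1 := leq_maxr n0 n1.
rewrite (le_trans (nrm_dist3 l (w (maxn n0 n1)) x))// addrC lerD ?h// ltW// hn//.
Qed.

Lemma ustar_unit : ustar (1 : A1) = 1.
Proof. by rewrite /ustar /= star0 conjC1. Qed.

Lemma ustar_pev q y : ustar y = y -> ustar (pev q y) = pev q y.
Proof.
move=> yy; elim/poly_ind: q => [|p c ih].
  by rewrite pev0 -[0 in LHS](scale0r (0 : A1)) ustarZ conjC0 scale0r.
rewrite pevD pevM pevX pevC ustarD ustarM ih yy ustarZ conj_Creal ?complex_real// ustar_unit.
by rewrite -pev_comm.
Qed.

Lemma uact_sa_sq v z : ustar v = v -> nrm (uact v z) ^+ 2 <= nrm z * nrm (uact (v * v) z).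
Proof.
by move=> vv; rewrite -nrm_cstar star_uact vv (le_trans (nrmM _ _))// nrm_star.
Qed.

(** The previous bound is applied to the powers [q ^+ (2 ^ k)], whose size grows linearly in the
    exponent, while [uact_sa_sq] squares the lower bound at each step; [expr_pow2_bound] then
    removes the factor. *)
Lemma unitary_poly_bound2 (u : A1) q (M : R) x :
  ustar u * u = 1 -> u * ustar u = 1 ->
  (forall s : R, -1 <= s <= 1 -> `|q.[s]| <= M) ->
  nrm (uact (pev q ((2^-1)%:C *: (u + ustar u))) x) <= M * nrm x.
Proof.
move=> uu1 u1 qM; set y := _ *: _.
have yy : ustar y = y.
  by rewrite /y ustarZ conj_Creal ?complex_real// ustarD ustarK addrC.
have M0 : 0 <= M by apply: le_trans (qM 0 _); rewrite ?normr_ge0//; lra.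
have [x0|x0] := eqVneq (nrm x) 0.
  have -> : x = 0 by apply: nrm_le0; rewrite x0.
  by rewrite /uact cmulr0 scaler0 addr0 nrm0 mulr0.
have nx : 0 < nrm x by rewrite lt_def x0 nrm_ge0.
rewrite -ler_pdivrMr//; set r := _ / _.
have r0 : 0 <= r by rewrite divr_ge0 ?nrm_ge0.
have low k : r ^+ (2 ^ k) * nrm x <= nrm (uact (pev q y ^+ (2 ^ k)) x).
  elim: k => [|k ih]; first by rewrite expn0 !expr1 divfK.
  rewrite -(ler_pM2l nx); apply: le_trans; last first.
    rewrite expnSr exprM expr2; apply: uact_sa_sq.
    by rewrite -pevX_; apply: ustar_pev.
  have -> : nrm x * (r ^+ (2 ^ k.+1) * nrm x) = (r ^+ (2 ^ k) * nrm x) ^+ 2.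
    by rewrite expnSr exprM; ring.
  by rewrite lerXn2r// ?nnegrE ?nrm_ge0// mulr_ge0 ?nrm_ge0// exprn_ge0.
have c0 : 0 <= 2 * (size q)%:R :> R by rewrite mulr_ge0.
apply: (expr_pow2_bound r0 M0 c0 (ler0n R 3)).
move=> k; rewrite -(ler_pM2r nx); apply: (le_trans (low k)).
rewrite -pevX_; apply: le_trans.
  apply: (@unitary_poly_bound _ _ _ _ (M ^+ (2 ^ k))) => // s s1.
  by rewrite horner_exp normrX lerXn2r ?nnegrE ?normr_ge0 ?qM.
rewrite ler_wpM2r ?nrm_ge0// ler_wpM2r ?exprn_ge0//.
rewrite -!natrM -(natrD _ _ 3) ler_nat.
by have := size_poly_exp_leq q (2 ^ k); nia.
Qed.

(** The equation says that [1 - s] is a square root of [1 - a]. The iteration that takes half of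
    [a + u ** u] stays in the ball of radius [nrm a], where it is a contraction; commutation with
    [x] is inherited from the iterates. *)
Lemma sqrt_fix (a : A) : star a = a -> nrm a < 1 -> exists s : A,
  [/\ star s = s, s = (2^-1)%:C *: (a + s ** s) &
      forall x, a ** x = x ** a -> s ** x = x ** s].
Proof.
move=> aa a1; pose u := fix u n : A := if n is n'.+1 then (2^-1)%:C *: (a + u n' ** u n') else 0.
have a0 := nrm_ge0 a; set r := nrm a in a0 a1 *.
have h0 : `|2^-1 : R| = 2^-1 by rewrite ger0_norm// invr_ge0.
have un n : nrm (u n) <= r.
  elim: n => [|n ih]/=; first by rewrite nrm0.
  rewrite nrmZr h0; have := nrmD a (u n ** u n); have := nrmM (u n) (u n).
  by have := nrm_ge0 (u n); rewrite -/r; nra.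
have st n : nrm (u n.+1 - u n) <= r ^+ n.+1.
  elim: n => [|n ih].
    rewrite /= subr0 cmulr0 addr0 nrmZr h0 expr1 -/r; nra.
  have -> : u n.+2 - u n.+1 = (2^-1)%:C *: ((u n.+1 - u n) ** u n + u n.+1 ** (u n.+1 - u n)).
    by rewrite -cmulBB [LHS]/= -scalerBr; congr (_ *: _); zmod.
  rewrite nrmZr h0 exprS; have := nrmD ((u n.+1 - u n) ** u n) (u n.+1 ** (u n.+1 - u n)).
  have := nrmM (u n.+1 - u n) (u n); have := nrmM (u n.+1) (u n.+1 - u n).
  have := un n; have := un n.+1; have := nrm_ge0 (u n.+1 - u n); have := nrm_ge0 (u n).
  have := nrm_ge0 (u n.+1).
  move: (nrm (u n.+1)) (nrm (u n)) (nrm (u n.+1 - u n)) ih => p q w ih ? ? ? ? ? ? ? ?.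
  suff : r * w <= r * r ^+ n.+1 by nra.
  exact: ler_wpM2l.
have dist n m : nrm (u (n + m)%N - u n) * (1 - r) <= r ^+ n.+1 - r ^+ (n + m).+1.
  elim: m => [|m ih]; first by rewrite addn0 !subrr nrm0 mul0r.
  rewrite addnS; have := nrm_dist3 (u (n + m).+1) (u (n + m)%N) (u n); have := st (n + m)%N.
  by rewrite (exprS _ (n + m).+1); nra.
have [l ul] : exists l : A, u @ \oo --> l.
  apply: nrm_cauchy_cvg => e e0.
  have r1 : 0 < 1 - r by rewrite subr_gt0.
  have : (fun n => r ^+ n) @ \oo --> (0 : R) by apply: cvg_expr; rewrite ger0_norm.
  move=> /cvgrPdist_lt/(_ (e * (1 - r) / 2)) [|N _ hN].
    by rewrite divr_gt0// mulr_gt0.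
  exists N => m n Nm Nn.
  wlog mn : m n Nm Nn / (n <= m)%N => [W|].
    by case: (leqP n m) => nm; [exact: W|rewrite nrm_distC; apply: W => //; exact: ltnW].
  rewrite -(ltr_pM2r r1) -(subnKC mn); apply: le_lt_trans (dist _ _) _.
  have := hN n.+1 (leqW Nn); rewrite /= sub0r normrN ger0_norm ?exprn_ge0//.
  by have := exprn_ge0 (n + (m - n)).+1 a0; have := mulr_gt0 e0 r1; lra.
exists l; split.
- apply: (cvg_uniq (cvg_star ul)); have -> // : (fun n => star (u n)) = u.
  apply/funext; elim=> [|n ih]/=; first exact: star0.
  by rewrite starZr starD aa starM ih.
- apply: (@cvg_uniq _ _ (fun n => u n.+1)); first by rewrite (cvg_shiftS u).
  by apply: cvgZr; apply: cvgD; [exact: cvg_cst|exact: cvg_cmul].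
- move=> x ax; apply: (@cvg_uniq _ _ (fun n => u n ** x)).
    by apply: cvg_cmul ul _; exact: cvg_cst.
  have -> : (fun n => u n ** x) = (fun n => x ** u n).
    apply/funext; elim=> [|n ih]/=; first by rewrite cmul0r cmulr0.
    rewrite cscaleAl cscaleAr cmulDl cmulDr ax; congr (_ *: (_ + _)).
    by rewrite -cmulA ih cmulA ih cmulA.
  by apply: cvg_cmul ul; exact: cvg_cst.
Qed.

Lemma pev_bound_sqrt q h s (M : R) x : star h = h -> star s = s ->
  s = (2^-1)%:C *: (h ** h + s ** s) -> s ** h = h ** s ->
  (forall s : R, -1 <= s <= 1 -> `|q.[s]| <= M) ->
  nrm (uact (pev q (uinj h)) x) <= M * nrm x.
Proof.
move=> hh ss sE sh qM.
pose k : A1 := 1 - uinj s.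
have kk : ustar k = k by rewrite /k -scaleN1r ustarD ustarZ ustar_unit ustar_inj ss rmorphN1.
have kh : k * uinj h = uinj h * k.
  by rewrite /k mulrBl mulrBr mul1r mulr1 -!uinjM sh.
have k2 : uinj h * uinj h + k * k = 1.
  rewrite /k mulrBl !mulrBr !mul1r mulr1 -!uinjM.
  have : uinj s + uinj s = uinj (h ** h) + uinj (s ** s).
    rewrite -!uinjD; congr uinj.
    rewrite {1 2}sE -scalerDl -rmorphD/=.
    have -> : 2^-1 + 2^-1 = 1 :> R by lra.
    by rewrite scale1r.
  by move=> E; apply: (zmod_use (esym E)); zmod.
pose u : A1 := uinj h + 'i *: k.
have uE : ustar u = uinj h - 'i *: k.
  by rewrite /u ustarD ustarZ kk ustar_inj hh conjCi scaleNr.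
have ii (v : A1) : 'i%R *: ('i%R *: v) = - v :> A1.
  by rewrite scalerA -expr2 sqrCi scaleN1r.
have uu : ustar u * u = 1.
  rewrite uE /u mulrBl !mulrDr -!scalerAl -!scalerAr ii kh opprD opprK.
  by rewrite -[RHS]k2 addrA addrK.
have uu' : u * ustar u = 1.
  rewrite uE /u mulrDl !mulrBr -!scalerAl -!scalerAr ii kh opprK.
  by rewrite -[RHS]k2 addrA subrK.
have hE : (2^-1)%:C *: (u + ustar u) = uinj h.
  rewrite uE /u addrACA subrr addr0 -uinjD -uinjZ; congr uinj.
  rewrite scalerDr -scalerDl -rmorphD/=.
  have -> : 2^-1 + 2^-1 = 1 :> R by lra.
  by rewrite scale1r.
by rewrite -hE; apply: unitary_poly_bound2.
Qed.

Lemma sqrt_fix_sq h : star h = h -> nrm h < 1 -> exists s : A,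
  [/\ star s = s, s = (2^-1)%:C *: (h ** h + s ** s) & s ** h = h ** s].
Proof.
move=> hh h1; have hh2 : star (h ** h) = h ** h by rewrite starM hh.
have nh2 : nrm (h ** h) < 1.
  by have := nrmM h h; have := nrm_ge0 h; nra.
have [s [ss sE sC]] := sqrt_fix hh2 nh2; exists s; split=> //.
by apply: sC; rewrite cmulA.
Qed.

Lemma pev_bound1 q h (M : R) x : star h = h -> nrm h < 1 ->
  (forall s : R, -1 <= s <= 1 -> `|q.[s]| <= M) ->
  nrm (uact (pev q (uinj h)) x) <= M * nrm x.
Proof.
by move=> hh h1 qM; have [s [ss sE sh]] := sqrt_fix_sq hh h1; apply: (pev_bound_sqrt x hh ss sE sh).
Qed.

End Bound.

(** * Weierstrass approximation *)

Lemma lebesgue_number (R : realType) (X : pseudoMetricType R) (K : set X) (Q : X -> X -> Prop) :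
  compact K -> (forall x, K x -> exists2 d : R, 0 < d & forall y z, ball x d y -> ball x d z -> Q y z) ->
  exists2 d : R, 0 < d & forall y z, K y -> ball y d z -> Q y z.
Proof.
move=> /compact_near_coveringP cK h.
have := cK R (0^'+)%R (fun d y => forall z, ball y d z -> Q y z) _.
case.
  move=> x Kx; have [d d0 hd] := h x Kx.
  exists (ball x (d / 2), [set e | e < d / 2]) => /=.
    split; first by apply: nbhsx_ballx; rewrite divr_gt0.
    by apply: nbhs_right_lt; rewrite divr_gt0.
  move=> [y e]/= [xy ed] z yz; apply: hd.
    by apply: le_ball xy; lra.
  rewrite [d]splitr; apply: ball_triangle xy _; apply: le_ball yz; exact: ltW.
move=> d /= d0 hd; exists (d / 2); first by rewrite divr_gt0.
move=> y z Ky yz; apply: (hd (d / 2)) => //=; last by rewrite divr_gt0.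
by rewrite sub0r normrN ger0_norm ?divr_ge0 ?ltW//; lra.
Qed.

Section Bernstein.
Context {R : realType}.
Implicit Types (x : R) (n : nat) (phi : nat -> R).

Definition bw n x k : R := 'C(n, k)%:R * (x ^+ k * (1 - x) ^+ (n - k)).

Lemma bw_sum n x : \sum_(k < n.+1) bw n x k = 1.
Proof.
have := exprDn (1 - x) x n; rewrite subrK expr1n => ->.
by apply: eq_bigr => k _; rewrite /bw -[RHS]mulr_natl (mulrC (x ^+ k)).
Qed.

(** The absorption identity for binomial coefficients, weighted by an arbitrary [phi] so that it
    yields both the mean and the variance. *)
Lemma bw_shift n x phi :
  \sum_(k < n.+2) k%:R * phi k * bw n.+1 x k = n.+1%:R * x * \sum_(k < n.+1) phi k.+1 * bw n x k.
Proof.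
rewrite big_ord_recl mul0r mul0r add0r mulr_sumr; apply: eq_bigr => k _.
rewrite /bw /= /bump leq0n add1n subSS exprS.
have := mul_bin_diag n.+1 k => /= /(congr1 (fun m : nat => m%:R : R)).
rewrite !natrM => E.
transitivity (k.+1%:R * 'C(n.+1, k.+1)%:R * (phi k.+1 * (x * x ^+ k * (1 - x) ^+ (n - k)))).
  by ring.
by rewrite -E; ring.
Qed.

Lemma bw_mean n x : \sum_(k < n.+1) k%:R * bw n x k = n%:R * x.
Proof.
case: n => [|n]; first by rewrite big_ord1 !mul0r.
under eq_bigr do rewrite -[_%:R]mulr1.
rewrite (bw_shift n x (fun=> 1)); under eq_bigr do rewrite mul1r.
by rewrite bw_sum mulr1.
Qed.

Lemma bw_var n x : \sum_(k < n.+1) (k%:R - n%:R * x) ^+ 2 * bw n x k = n%:R * (x * (1 - x)).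
Proof.
case: n => [|n]; first by rewrite big_ord1 !mul0r subrr expr0n mul0r.
have m0 := bw_sum n.+1 x; have m1 := bw_mean n.+1 x.
have m2 := bw_shift n x (fun k => k%:R - 1).
have E : \sum_(k < n.+1) (k.+1%:R - 1) * bw n x k = n%:R * x.
  by rewrite -bw_mean; apply: eq_bigr => k _; rewrite -natr1 addrK.
rewrite E in m2.
transitivity (\sum_(k < n.+2) (k%:R * (k%:R - 1) * bw n.+1 x k +
   ((1 - 2 * (n.+1%:R * x)) * (k%:R * bw n.+1 x k) + (n.+1%:R * x) ^+ 2 * bw n.+1 x k))).
  by apply: eq_bigr => k _; ring.
by rewrite !big_split/= -!mulr_sumr m0 m1 m2 -natr1; ring.
Qed.

Definition bern (g : R -> R) n : {poly R} :=
  \sum_(k < n.+1) (g (k%:R / n%:R) * 'C(n, k)%:R) *: ('X^k * (1 - 'X) ^+ (n - k)).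

Lemma bernE g n x : (bern g n).[x] = \sum_(k < n.+1) g (k%:R / n%:R) * bw n x k.
Proof.
rewrite horner_sum; apply: eq_bigr => k _.
by rewrite hornerZ hornerM hornerXn horner_exp hornerD hornerN hornerX hornerC /bw mulrA.
Qed.

Lemma bw_ge0 n x k : 0 <= x <= 1 -> 0 <= bw n x k.
Proof. by move=> x01; rewrite mulr_ge0// mulr_ge0// exprn_ge0//; lra. Qed.

(** Chebyshev's argument: indices with [k / n] within [d] of [x] contribute at most [e], and the
    others are dominated by [2 * M] times the variance over [d ^+ 2]. *)
Lemma bern_approx (g : R -> R) (e d M x : R) n : 0 < d -> 0 <= e -> (n > 0)%N -> 0 <= x <= 1 ->
  (forall s t : R, 0 <= s <= 1 -> `|s - t| < d -> `|g s - g t| <= e) ->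
  (forall s : R, 0 <= s <= 1 -> `|g s| <= M) ->
  `|(bern g n).[x] - g x| <= e + 2 * M / (d ^+ 2 * n%:R).
Proof.
move=> d0 e0 n0 x01 uc gM; have n0' : 0 < n%:R :> R by rewrite ltr0n.
have -> : (bern g n).[x] - g x = \sum_(k < n.+1) (g (k%:R / n%:R) - g x) * bw n x k.
  under [RHS]eq_bigr do rewrite mulrBl.
  by rewrite big_split/= sumrN -mulr_sumr bw_sum mulr1 bernE.
have M0 : 0 <= M by apply: le_trans (gM 0 _); rewrite ?normr_ge0//; lra.
apply: (@le_trans _ _ (\sum_(k < n.+1) (e * bw n x k +
    2 * M / (d ^+ 2 * n%:R ^+ 2) * ((k%:R - n%:R * x) ^+ 2 * bw n x k)))); last first.
  rewrite big_split/= -!mulr_sumr bw_sum bw_var mulr1 lerD2l.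
  have -> : 2 * M / (d ^+ 2 * n%:R ^+ 2) * (n%:R * (x * (1 - x))) =
    2 * M / (d ^+ 2 * n%:R) * (x * (1 - x)) by field; rewrite !gt_eqF.
  rewrite -[leRHS]mulr1 ler_wpM2l//; last by nra.
  by rewrite divr_ge0 ?mulr_ge0// ?exprn_ge0 ?ltW.
apply: (le_trans (ler_norm_sum _ _ _)); apply: ler_sum => k _.
rewrite normrM (ger0_norm (bw_ge0 _ _ x01)) [X in _ <= _ + X]mulrA -mulrDl ler_wpM2r ?bw_ge0//.
have c0 : 0 <= 2 * M / (d ^+ 2 * n%:R ^+ 2) * (k%:R - n%:R * x) ^+ 2.
  by rewrite mulr_ge0 ?sqr_ge0// divr_ge0 ?mulr_ge0// ?exprn_ge0 ?ltW.
have k01 : 0 <= (k%:R / n%:R : R) <= 1.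
  by apply/andP; split; rewrite ?divr_ge0// ler_pdivrMr// mul1r ler_nat -ltnS.
have [lt|ge] := ltP `|k%:R / n%:R - x| d.
  by rewrite (le_trans (uc _ _ k01 lt))// lerDl.
apply: (@le_trans _ _ (2 * M)).
  by rewrite (le_trans (ler_normB _ _))// mulr2n mulrDl !mul1r lerD ?gM.
have -> : 2 * M / (d ^+ 2 * n%:R ^+ 2) * (k%:R - n%:R * x) ^+ 2 =
  2 * M * ((k%:R - n%:R * x) ^+ 2 / (d ^+ 2 * n%:R ^+ 2)) by rewrite -mulrA (mulrC _^-1).
rewrite ler_wpDl// -[leLHS]mulr1 ler_wpM2l ?mulr_ge0//.
rewrite ler_pdivlMr ?mulr_gt0 ?exprn_gt0// mul1r -exprMn.
rewrite -[leRHS]real_normK ?num_real// lerXn2r ?nnegrE ?normr_ge0 ?mulr_ge0 ?(ltW d0) ?(ltW n0')//.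
have -> : k%:R - n%:R * x = (k%:R / n%:R - x) * n%:R by field; rewrite gt_eqF.
by rewrite normrM (ger0_norm (ltW n0')) ler_wpM2r// ltW.
Qed.

Lemma weierstrass (f : R -> R) (N e : R) : continuous f -> 0 < N -> 0 < e ->
  exists q : {poly R}, forall s : R, `|s| <= N -> `|q.[s] - f s| <= e.
Proof.
(* Bernstein polynomials live on [0,1], hence the affine change of variable from [-N,N]. *)
move=> cf N0 e0; pose g x := f (2 * N * x - N).
have cg : continuous g.
  move=> x; apply: (@continuous_comp _ _ _ (fun x => 2 * N * x - N) f); last exact: cf.
  by apply: cvgB; [apply: cvgM; [exact: cvg_cst|exact: cvg_id]|exact: cvg_cst].
have [d d0 hd] : exists2 d : R, 0 < d & forall s t : R, `[0, 1]%classic s -> ball s d t -> `|g s - g t| <= e / 2.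
  apply: lebesgue_number; first exact: segment_compact.
  move=> x _; have /cvgrPdist_lt/(_ (e / 4)) := cg x.
  rewrite divr_gt0// => /(_ isT)/nbhs_ballP[d d0 hd]; exists d => // y z /hd h1 /hd h2.
  rewrite distrC in h1; rewrite (_ : g y - g z = (g y - g x) + (g x - g z)); last by ring.
  by rewrite (le_trans (ler_normD _ _))//; move: h1 h2; lra.
have [M gM] : exists M, forall s : R, 0 <= s <= 1 -> `|g s| <= M.
  have : compact (g @` `[0, 1]%classic).
    apply: continuous_compact; last exact: segment_compact.
    exact: continuous_subspaceT.
  move=> /compact_bounded[M [_ /(_ (M + 1))]]; rewrite ltrDl ltr01 => /(_ isT) Mb.
  by exists (M + 1) => s s01; apply: Mb; exists s => //=; rewrite in_itv.
have [n n0 hn] : exists2 n, (0 < n)%N & 2 * M / (d ^+ 2 * n%:R) <= e / 2.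
  pose c := 2 * M / d ^+ 2 / (e / 2).
  exists (Num.bound `|c|).+1 => //.
  have h1 := archi_boundP (normr_ge0 c); have h2 := ler_norm c.
  rewrite invfM mulrA ler_pdivrMr ?ltr0n// -natr1.
  have -> : 2 * M / d ^+ 2 = c * (e / 2) by rewrite /c divfK// gt_eqF// divr_gt0.
  have : c * (e / 2) <= (Num.bound `|c|)%:R * (e / 2).
    by rewrite ler_pM2r ?divr_gt0//; lra.
  by move=> /le_trans; apply; rewrite mulrC ler_wpM2l ?divr_ge0 ?(ltW e0)// ler_nat leqnSn.
exists (bern g n \Po ((2 * N)^-1 *: 'X + 2^-1%:P)) => s sN.
have N2 : 2 * N != 0 by rewrite mulf_neq0// gt_eqF.
rewrite horner_comp hornerD hornerZ hornerX hornerC; set x := (2 * N)^-1 * s + 2^-1.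
have -> : f s = g x by rewrite /g /x mulrDr mulrA divff// mul1r; congr f; field.
have x01 : 0 <= x <= 1.
  have -> : x = (s + N) / (2 * N) by rewrite /x; field; rewrite gt_eqF.
  move: sN; rewrite ler_norml => /andP[? ?]; have N20 : 0 < 2 * N by rewrite mulr_gt0.
  apply/andP; split; first by rewrite divr_ge0 ?(ltW N20)//; lra.
  by rewrite ler_pdivrMr//; lra.
have uc (s0 t0 : R) : 0 <= s0 <= 1 -> `|s0 - t0| < d -> `|g s0 - g t0| <= e / 2.
  by move=> s01 st; apply: hd => //=; rewrite in_itv.
have e20 : 0 <= e / 2 by rewrite divr_ge0// ltW.
by have := bern_approx d0 e20 n0 x01 uc gM; lra.
Qed.

Lemma weierstrass0 (f : R -> R) (N e : R) : continuous f -> f 0 = 0 -> 0 <= N -> 0 < e ->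
  exists2 q : {poly R}, q.[0] = 0 & forall s : R, `|s| <= N -> `|q.[s] - f s| <= e.
Proof.
move=> cf f0 N0 e0.
have [q hq] := @weierstrass f (N + 1) (e / 2) cf (ltr_wpDl N0 ltr01) (divr_gt0 e0 (ltr0n R 2)).
exists (q - q.[0]%:P); first by rewrite hornerD hornerN hornerC subrr.
move=> s sN; rewrite hornerD hornerN hornerC.
have h1 := hq s (le_trans sN (ler_wpDr ler01 (lexx N))).
have h2 : `|q.[0] - f 0| <= e / 2 by apply: hq; rewrite normr0 addr_ge0.
rewrite f0 subr0 in h2; rewrite addrAC (le_trans (ler_normB _ _))//; lra.
Qed.

Lemma poly_lip (q : {poly R}) (N : R) : 0 <= N -> exists L : R, 0 <= L /\
  forall x y : R, `|x| <= N -> `|y| <= N -> `|q.[x] - q.[y]| <= L * `|x - y|.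
Proof.
move=> N0.
suff [B [L [B0 [L0 [_ h]]]]] : exists B L : R, 0 <= B /\ 0 <= L /\
  (forall x : R, `|x| <= N -> `|q.[x]| <= B) /\
  forall x y : R, `|x| <= N -> `|y| <= N -> `|q.[x] - q.[y]| <= L * `|x - y| by exists L.
elim/poly_ind: q => [|p c [B [L [B0 [L0 [hB hL]]]]]].
  by exists 0, 0; split=> //; split=> //; split=> x *; rewrite !horner0 ?subr0 normr0 ?mul0r.
exists (B * N + `|c|), (L * N + B); split; first by rewrite addr_ge0 ?mulr_ge0.
split; first by rewrite addr_ge0 ?mulr_ge0.
split.
  move=> x xN; rewrite hornerMXaddC (le_trans (ler_normD _ _))// lerD2r normrM.
  by rewrite ler_pM ?hB.
move=> x y xN yN; rewrite !hornerMXaddC.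
have -> : p.[x] * x + c - (p.[y] * y + c) = (p.[x] - p.[y]) * x + p.[y] * (x - y) by ring.
rewrite (le_trans (ler_normD _ _))// !normrM mulrDl lerD//.
  by rewrite mulrAC ler_pM// hL.
by rewrite ler_wpM2r ?hB.
Qed.

End Bernstein.

(** * Continuous functional calculus *)

Section FunCalc.
Context {R : realType} {A : cstarAlgType R}.
Local Notation A1 := (unitization A).
Implicit Types (q : {poly R}) (h x z : A) (f g : R -> R).

(** For [q] without constant term the value of [q] in the unitization lies in [A] ([pev_hp]); [hp]
    is its component there. *)
Definition hp q h : A := (pev q (uinj h)).1.

Lemma pev_snd q h : (pev q (uinj h)).2 = (q.[0])%:C.
Proof.
elim/poly_ind: q => [|p c ih]; first by rewrite pev0 horner0.
rewrite pevD pevM pevX pevC hornerMXaddC mulr0 add0r.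
by rewrite /= mulr0 add0r; exact: mulr1.
Qed.

Lemma pev_hp q h : q.[0] = 0 -> pev q (uinj h) = uinj (hp q h).
Proof.
move=> q0; have := pev_snd q h; rewrite /hp /uinj q0.
by case: (pev q _) => a b /= ->.
Qed.

Lemma hpD p q h : hp (p + q) h = hp p h + hp q h.
Proof. by rewrite /hp pevD. Qed.

Lemma hpN q h : hp (- q) h = - hp q h.
Proof. by rewrite /hp pevN. Qed.

Lemma hpZ (c : R) q h : hp (c *: q) h = c%:C *: hp q h.
Proof. by rewrite /hp pevZ. Qed.

Lemma hpX h : hp 'X h = h.
Proof. by rewrite /hp pevX. Qed.

Lemma star_hp q h : star h = h -> star (hp q h) = hp q h.
Proof.
move=> hh; have := @ustar_pev R A q (uinj h); rewrite ustar_inj hh => /(_ erefl).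
by rewrite /hp; case: (pev q _) => a b /= [].
Qed.

Lemma hp0 h : hp 0 h = 0.
Proof. by rewrite /hp pev0. Qed.

Local Opaque pev hp.

Lemma hpM p q h : p.[0] = 0 -> q.[0] = 0 -> hp (p * q) h = hp p h ** hp q h.
Proof.
move=> p0 q0; have pq0 : (p * q).[0] = 0 by rewrite hornerM p0 mul0r.
have E : uinj (hp (p * q) h) = uinj (hp p h) * uinj (hp q h).
  apply: etrans (esym (pev_hp h pq0)) _; apply: etrans (pevM _ _ _) _.
  by congr (_ * _); [exact: pev_hp|exact: pev_hp].
exact: uinj_inj (etrans E (esym (uinjM _ _))).
Qed.

(** Rescaling by [nrm h + e] brings the norm below 1, where [pev_bound1] applies; the Lipschitz
    constant [L] of [q] controls the error [L * e], which is sent to 0. *)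
Lemma pev_bound q h (M : R) z : star h = h ->
  (forall s : R, `|s| <= nrm h -> `|q.[s]| <= M) ->
  nrm (uact (pev q (uinj h)) z) <= M * nrm z.
Proof.
move=> hh qM; have [L [L0 hL]] := poly_lip q (ler_wpDr ler01 (nrm_ge0 h)).
suff H (e : R) : 0 < e -> e <= 1 -> nrm (uact (pev q (uinj h)) z) <= (M + L * e) * nrm z.
  apply/ler_addgt0Pr => e e0.
  pose d := Num.min 1 (e / (L * nrm z + 1)).
  have c0 : 0 < L * nrm z + 1 by rewrite ltr_wpDl// mulr_ge0 ?nrm_ge0.
  have d0 : 0 < d by rewrite lt_min ltr01 divr_gt0.
  have d1 : d <= 1 by rewrite ge_min lexx.
  have := H d d0 d1; rewrite mulrDl => /le_trans; apply; rewrite lerD2l.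
  have : d <= e / (L * nrm z + 1) by rewrite ge_min lexx orbT.
  by rewrite ler_pdivlMr// => de; rewrite mulrAC (le_trans _ de)// mulrC ler_wpM2l ?ltW//; lra.
move=> e0 e1; pose t := nrm h + e.
have n0 := nrm_ge0 h; have t0 : 0 < t by rewrite /t; lra.
pose h' := (t^-1)%:C *: h.
have hh' : star h' = h' by rewrite starZr hh.
have h1 : nrm h' < 1.
  by rewrite nrmZr gtr0_norm ?invr_gt0// mulrC ltr_pdivrMr// mul1r /t ltrDl.
have := @pev_bound1 R A (q \Po (t *: 'X)) h' (M + L * e) z hh' h1.
rewrite pev_comp pevZ pevX -uinjZ /h' scalerA -rmorphM/= divff ?gt_eqF// scale1r; apply.
move=> s s1; rewrite horner_comp hornerZ hornerX.
have s1' : `|s| <= 1 by rewrite ler_norml.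
have b1 : `|nrm h * s| <= nrm h by rewrite normrM ger0_norm// ler_piMr.
have b2 : `|t * s| <= nrm h + 1.
  rewrite normrM gtr0_norm// (@le_trans _ _ t)//; first by rewrite ler_piMr ?(ltW t0).
  by rewrite /t lerD2l.
have -> : q.[t * s] = q.[nrm h * s] + (q.[t * s] - q.[nrm h * s]) by ring.
rewrite (le_trans (ler_normD _ _))// lerD ?qM//.
rewrite (le_trans (hL _ _ b2 _))// ?(le_trans b1) ?lerDl// ler_wpM2l//.
by rewrite -mulrBl /t addrAC subrr add0r normrM gtr0_norm// ler_piMr// ltW.
Qed.

Lemma nrm_mult_le a (M : R) : 0 <= M -> (forall z, nrm (a ** z) <= M * nrm z) -> nrm a <= M.
Proof.
move=> M0 h; have [->//|a0] := eqVneq (nrm a) 0.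
by have := h (star a); rewrite nrm_cstar2 nrm_star expr2 ler_pM2r// lt_def a0 nrm_ge0.
Qed.

Lemma hp_bound q h (M : R) : star h = h -> q.[0] = 0 ->
  (forall s : R, `|s| <= nrm h -> `|q.[s]| <= M) -> nrm (hp q h) <= M.
Proof.
move=> hh q0 qM; apply: nrm_mult_le => [|z].
  by apply: le_trans (qM 0 _); rewrite ?normr_ge0 ?normr0 ?nrm_ge0.
by rewrite -uact_inj -pev_hp// pev_bound.
Qed.

(** Functional calculus on the interval from [- nrm h] to [nrm h] in place of the spectrum. The
    value is characterized by all polynomials near [f] at once, which determines it ([is_fc_uniq])
    and lets each rule be checked on polynomials. *)
Definition is_fc f h (y : A) := forall q (e : R), q.[0] = 0 ->
  (forall s : R, `|s| <= nrm h -> `|q.[s] - f s| <= e) -> nrm (hp q h - y) <= e.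

Definition fc f h : A := get (is_fc f h).

Lemma fcP f h : star h = h -> continuous f -> f 0 = 0 -> is_fc f h (fc f h).
Proof.
move=> hh cf f0; suff : exists y, is_fc f h y by move=> ?; exact: getPex.
have /choice[p hpn] (n : nat) : exists q, q.[0] = 0 /\
    forall s : R, `|s| <= nrm h -> `|q.[s] - f s| <= n.+1%:R^-1.
  have [|q q0 hq] := weierstrass0 cf f0 (nrm_ge0 h) (_ : 0 < n.+1%:R^-1); last by exists q.
  by rewrite invr_gt0.
have dist q n (e : R) : q.[0] = 0 -> (forall s : R, `|s| <= nrm h -> `|q.[s] - f s| <= e) ->
    nrm (hp q h - hp (p n) h) <= e + n.+1%:R^-1.
  move=> q0 hq; have [p0 hn] := hpn n.
  rewrite -hpN -hpD; apply: hp_bound => //; first by rewrite hornerD hornerN q0 p0 subrr.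
  move=> s sh; rewrite hornerD hornerN.
  have -> : q.[s] - (p n).[s] = (q.[s] - f s) - ((p n).[s] - f s) by ring.
  by rewrite (le_trans (ler_normB _ _))// lerD ?hq ?hn.
have inv0 (e : R) : 0 < e -> exists n0, forall n, (n0 <= n)%N -> n.+1%:R^-1 < e.
  move=> e0; have /cvgrPdist_lt/(_ e e0)[N _ hN] := @cvg_harmonic R.
  by exists N => n /hN/=; rewrite sub0r normrN ger0_norm ?invr_ge0.
have [y py] : exists y : A, (fun n => hp (p n) h) @ \oo --> y.
  apply: nrm_cauchy_cvg => e e0; have [N hN] := inv0 (e / 2) (divr_gt0 e0 (ltr0n R 2)).
  exists N => m n Nm Nn; have [p0 hm] := hpn m.
  by rewrite (le_lt_trans (dist _ n _ p0 hm))// [e]splitr ltrD ?hN.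
exists y => q e q0 hq; rewrite nrm_distC; apply/ler_addgt0Pr => d d0.
have [N hN] := inv0 d d0; apply: (nrm_cvg_le (n0 := N) py) => n Nn.
by rewrite nrm_distC (le_trans (dist _ _ _ q0 hq))// lerD2l ltW// hN.
Qed.

Lemma is_fc_uniq f h (y y' : A) : continuous f -> f 0 = 0 -> is_fc f h y -> is_fc f h y' -> y = y'.
Proof.
move=> cf f0 hy hy'; apply/eqP; rewrite -subr_eq0 -nrm_eq0 eq_le nrm_ge0 andbT.
apply/ler_addgt0Pr => e e0; have e2 : 0 < e / 2 by rewrite divr_gt0.
have [q q0 hq] := weierstrass0 cf f0 (nrm_ge0 h) e2.
rewrite add0r (le_trans (nrm_dist3 y (hp q h) y'))// nrm_distC [e]splitr.
by rewrite lerD ?(hy q _ q0 hq) ?(hy' q _ q0 hq).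
Qed.

Lemma fc_approx f h (N e : R) : star h = h -> continuous f -> f 0 = 0 -> 0 < e -> nrm h <= N ->
  exists q, [/\ q.[0] = 0, forall s : R, `|s| <= N -> `|q.[s] - f s| <= e & nrm (hp q h - fc f h) <= e].
Proof.
move=> hh cf f0 e0 hN.
have [q q0 hq] := weierstrass0 cf f0 (le_trans (nrm_ge0 h) hN) e0.
by exists q; split=> //; apply: fcP => // s sh; rewrite hq// (le_trans sh).
Qed.

Lemma fc_eqP f h (y : A) : star h = h -> continuous f -> f 0 = 0 ->
  (forall e : R, 0 < e -> nrm (fc f h - y) <= e) -> fc f h = y.
Proof.
move=> hh cf f0 H; apply/eqP; rewrite -subr_eq0 -nrm_eq0 eq_le nrm_ge0 andbT.
by apply/ler_addgt0Pr => e /H; rewrite add0r.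
Qed.

Lemma fc_le f h (M : R) : star h = h -> continuous f -> f 0 = 0 ->
  (forall s : R, `|s| <= nrm h -> `|f s| <= M) -> nrm (fc f h) <= M.
Proof.
move=> hh cf f0 fM; apply/ler_addgt0Pr => e e0; have e2 : 0 < e / 2 by rewrite divr_gt0.
have [q [q0 hq1 hq2]] := fc_approx hh cf f0 e2 (lexx _).
rewrite (le_trans (nrm_le_dist _ (hp q h)))// nrm_distC.
suff : nrm (hp q h) <= M + e / 2 by lra.
apply: hp_bound => // s sh; have -> : q.[s] = f s + (q.[s] - f s) by ring.
by rewrite (le_trans (ler_normD _ _))// lerD ?fM ?hq1.
Qed.

Lemma fc_hp q h : star h = h -> q.[0] = 0 -> fc (fun s => q.[s]) h = hp q h.
Proof.
move=> hh q0; apply/esym/eqP; rewrite -subr_eq0 -nrm_eq0 eq_le nrm_ge0 andbT.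
by apply: fcP => //; [exact: continuous_horner|move=> s _; rewrite subrr normr0].
Qed.

Lemma fc_id h : star h = h -> fc id h = h.
Proof.
move=> hh; rewrite -{2}(hpX h) -fc_hp ?hornerX//; congr fc.
by apply/funext => s; rewrite hornerX.
Qed.

Lemma fc_ext f g h : star h = h -> continuous f -> f 0 = 0 -> continuous g -> g 0 = 0 ->
  (forall s : R, `|s| <= nrm h -> f s = g s) -> fc f h = fc g h.
Proof.
move=> hh cf f0 cg g0 fg; apply: (is_fc_uniq (h := h) cg g0); last exact: fcP.
move=> q e q0 hq; apply: fcP => // s sh; rewrite fg// hq//.
Qed.

Lemma fcD f g h : star h = h -> continuous f -> f 0 = 0 -> continuous g -> g 0 = 0 ->
  fc (fun s => f s + g s) h = fc f h + fc g h.
Proof.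
move=> hh cf f0 cg g0; apply: fc_eqP => //; first by move=> s; apply: cvgD; [exact: cf|exact: cg].
  by rewrite f0 g0 addr0.
move=> e e0; have e4 : 0 < e / 4 by rewrite divr_gt0.
have [p [p0 hp1 hp2]] := fc_approx hh cf f0 e4 (lexx _).
have [q [q0 hq1 hq2]] := fc_approx hh cg g0 e4 (lexx _).
have H : nrm (hp (p + q) h - fc (fun s => f s + g s) h) <= e / 2.
  apply: fcP; rewrite ?hornerD ?p0 ?q0 ?f0 ?g0 ?addr0//; first by move=> s; apply: cvgD; [exact: cf|exact: cg].
  move=> s sh; rewrite hornerD opprD addrACA.
  by have := hp1 s sh; have := hq1 s sh; have := ler_normD (p.[s] - f s) (q.[s] - g s); lra.
rewrite (le_trans (nrm_dist3 _ (hp (p + q) h) _))// nrm_distC.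
rewrite hpD in H *; rewrite opprD [X in _ + nrm X]addrACA.
by have := nrmD (hp p h - fc f h) (hp q h - fc g h); lra.
Qed.

Lemma fcZ (c : R) f h : star h = h -> continuous f -> f 0 = 0 ->
  fc (fun s => c * f s) h = c%:C *: fc f h.
Proof.
move=> hh cf f0; have ccf : continuous (fun s => c * f s).
  by move=> s; apply: cvgM; [exact: cvg_cst|exact: cf].
apply: fc_eqP; rewrite ?f0 ?mulr0// => e e0.
pose d := e / (2 * (`|c| + 1)).
have c1 : 0 < `|c| + 1 by rewrite ltr_wpDl.
have d0 : 0 < d by rewrite divr_gt0// mulr_gt0.
have dE : 2 * (`|c| * d) <= e.
  have : d * (2 * (`|c| + 1)) = e by rewrite /d divfK// gt_eqF// mulr_gt0.
  by have := ltW d0; lra.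
have [p [p0 hp1 hp2]] := fc_approx hh cf f0 d0 (lexx _).
have H : nrm (hp (c *: p) h - fc (fun s => c * f s) h) <= `|c| * d.
  apply: fcP; rewrite ?hornerZ ?p0 ?f0 ?mulr0//.
  by move=> s sh; rewrite hornerZ -mulrBr normrM ler_wpM2l ?hp1.
rewrite (le_trans (nrm_dist3 _ (hp (c *: p) h) _))// nrm_distC.
rewrite hpZ in H *; rewrite -scalerBr nrmZr.
by have := ler_wpM2l (normr_ge0 c) hp2; lra.
Qed.

Lemma fcN f h : star h = h -> continuous f -> f 0 = 0 -> fc (fun s => - f s) h = - fc f h.
Proof.
move=> hh cf f0; rewrite -scaleN1r -(rmorphN1 (real_complex R)) -fcZ//.
by congr fc; apply/funext => s; rewrite mulN1r.
Qed.

Lemma fcB f g h : star h = h -> continuous f -> f 0 = 0 -> continuous g -> g 0 = 0 ->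
  fc (fun s => f s - g s) h = fc f h - fc g h.
Proof.
move=> hh cf f0 cg g0; rewrite fcD ?g0 ?oppr0 ?fcN// => s.
by apply: cvgN; exact: cg.
Qed.

Lemma continuous_bound f (N : R) : continuous f -> 0 <= N ->
  exists2 B : R, 0 <= B & forall s : R, `|s| <= N -> `|f s| <= B.
Proof.
move=> cf N0.
have : compact (f @` `[- N, N]%classic).
  apply: continuous_compact; last exact: segment_compact.
  exact: continuous_subspaceT.
move=> /compact_bounded[M [_ /(_ (`|M| + 1))]].
rewrite (le_lt_trans (ler_norm _)) ?ltrDl ?ltr01// => /(_ isT) Mb.
exists (`|M| + 1); first by rewrite addr_ge0.
by move=> s sN; apply: Mb; exists s => //=; rewrite in_itv/= -ler_norml.
Qed.

Lemma fcM f g h : star h = h -> continuous f -> f 0 = 0 -> continuous g -> g 0 = 0 ->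
  fc (fun s => f s * g s) h = fc f h ** fc g h.
Proof.
move=> hh cf f0 cg g0; have cfg : continuous (fun s => f s * g s) by move=> s; apply: cvgM; [exact: cf|exact: cg].
have [B B0 hB] := continuous_bound cf (nrm_ge0 h).
have [C C0 hC] := continuous_bound cg (nrm_ge0 h).
have nf : nrm (fc f h) <= B by exact: fc_le.
have ng : nrm (fc g h) <= C by exact: fc_le.
apply: fc_eqP; rewrite ?f0 ?mul0r// => e e0.
pose d := Num.min 1 (e / (2 * (B + C + 1))).
have c1 : 0 < 2 * (B + C + 1) by lra.
have d0 : 0 < d by rewrite lt_min ltr01 divr_gt0.
have d1 : d <= 1 by rewrite ge_min lexx.
have dE : d * (2 * (B + C + 1)) <= e by rewrite -ler_pdivlMr// ge_min lexx orbT.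
have [p [p0 hp1 hp2]] := fc_approx hh cf f0 d0 (lexx _).
have [q [q0 hq1 hq2]] := fc_approx hh cg g0 d0 (lexx _).
have H : nrm (hp (p * q) h - fc (fun s => f s * g s) h) <= d * (B + C + 1).
  apply: fcP; rewrite ?hornerM ?p0 ?f0 ?mul0r//.
  move=> s sh; rewrite hornerM.
  have -> : p.[s] * q.[s] - f s * g s = (p.[s] - f s) * (q.[s] - g s) +
     (f s * (q.[s] - g s) + (p.[s] - f s) * g s) by ring.
  rewrite (le_trans (ler_normD _ _))//; have := ler_normD (f s * (q.[s] - g s)) ((p.[s] - f s) * g s).
  rewrite !normrM; have := hp1 s sh; have := hq1 s sh; have := hB s sh; have := hC s sh.
  have := normr_ge0 (p.[s] - f s); have := normr_ge0 (q.[s] - g s).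
  have := normr_ge0 (f s); have := normr_ge0 (g s).
  by move: `|p.[s] - f s| `|q.[s] - g s| `|f s| `|g s| => a b u v; nra.
rewrite (le_trans (nrm_dist3 _ (hp (p * q) h) _))// nrm_distC.
rewrite hpM// in H *.
have -> : hp p h ** hp q h - fc f h ** fc g h = (hp p h - fc f h) ** (hp q h - fc g h) +
     (fc f h ** (hp q h - fc g h) + (hp p h - fc f h) ** fc g h).
  by rewrite !cmulBl !cmulBr; zmod.
have := nrmD ((hp p h - fc f h) ** (hp q h - fc g h)) (fc f h ** (hp q h - fc g h) + (hp p h - fc f h) ** fc g h).
have := nrmD (fc f h ** (hp q h - fc g h)) ((hp p h - fc f h) ** fc g h).
have := nrmM (hp p h - fc f h) (hp q h - fc g h); have := nrmM (fc f h) (hp q h - fc g h).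
have := nrmM (hp p h - fc f h) (fc g h); have := nrm_ge0 (fc f h); have := nrm_ge0 (fc g h).
have := nrm_ge0 (hp p h - fc f h); have := nrm_ge0 (hp q h - fc g h).
move: (nrm (hp p h - fc f h)) (nrm (hp q h - fc g h)) (nrm (fc f h)) (nrm (fc g h)) hp2 hq2 nf ng.
by move=> a b u v *; nra.
Qed.

Lemma star_fc f h : star h = h -> continuous f -> f 0 = 0 -> star (fc f h) = fc f h.
Proof.
move=> hh cf f0; apply/esym; apply: fc_eqP => // e e0.
have e2 : 0 < e / 2 by rewrite divr_gt0.
have [p [p0 hp1 hp2]] := fc_approx hh cf f0 e2 (lexx _).
rewrite (le_trans (nrm_dist3 _ (hp p h) _))// nrm_distC -{2}(star_hp p hh) -starB nrm_star.
lra.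
Qed.

Lemma hp_intertwine q a b x : q.[0] = 0 -> a ** x = x ** b -> hp q a ** x = x ** hp q b.
Proof.
move=> q0 ab; have {}ab : uinj a * uinj x = uinj x * uinj b by rewrite -!uinjM ab.
have E : pev q (uinj a) * uinj x = uinj x * pev q (uinj b).
  elim/poly_ind: q {q0} => [|p c ih]; first by rewrite !pev0 mul0r mulr0.
  rewrite !pevD !pevM !pevX !pevC mulrDl mulrDr -mulrA ab mulrA ih mulrA.
  by rewrite -scalerAl -scalerAr mul1r mulr1.
apply: uinj_inj; apply: etrans (uinjM _ _) _; apply: etrans _ (esym (uinjM _ _)).
by apply: etrans _ (etrans E _); congr (_ * _); rewrite -pev_hp.
Qed.

Lemma fc_intertwine f a b x : star a = a -> star b = b -> continuous f -> f 0 = 0 ->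
  a ** x = x ** b -> fc f a ** x = x ** fc f b.
Proof.
move=> aa bb cf f0 ab; apply/eqP; rewrite -subr_eq0 -nrm_eq0 eq_le nrm_ge0 andbT.
apply/ler_addgt0Pr => e e0; rewrite add0r.
pose d := e / (2 * nrm x + 1); have nx := nrm_ge0 x.
have d0 : 0 < d by rewrite divr_gt0//; lra.
have dE : d * (2 * nrm x + 1) = e by rewrite /d divfK// gt_eqF//; lra.
have na : nrm a <= nrm a + nrm b by rewrite lerDl nrm_ge0.
have nb : nrm b <= nrm a + nrm b by rewrite lerDr nrm_ge0.
have [q q0 hq] := weierstrass0 cf f0 (le_trans (nrm_ge0 a) na) d0.
have h1 : nrm (hp q a - fc f a) <= d by apply: fcP => // s sa; apply: hq; apply: le_trans na.
have h2 : nrm (hp q b - fc f b) <= d by apply: fcP => // s sa; apply: hq; apply: le_trans nb.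
have -> : fc f a ** x - x ** fc f b = x ** (hp q b - fc f b) - (hp q a - fc f a) ** x.
  by rewrite cmulBl cmulBr (hp_intertwine q0 ab); zmod.
have := nrmB (x ** (hp q b - fc f b)) ((hp q a - fc f a) ** x).
have := nrmM x (hp q b - fc f b); have := nrmM (hp q a - fc f a) x.
by move: (nrm (hp q b - fc f b)) (nrm (hp q a - fc f a)) h1 h2 => u v *; nra.
Qed.

Lemma continuous_hornerf f q : continuous f -> continuous (fun s => q.[f s]).
Proof. by move=> cf s; apply: (@continuous_comp _ _ _ f (horner q)) (cf s) _; exact: continuous_horner. Qed.

Lemma hp_fc q f h : star h = h -> continuous f -> f 0 = 0 -> q.[0] = 0 ->
  hp q (fc f h) = fc (fun s => q.[f s]) h.
Proof.
move=> hh cf f0; have [p ->] : exists p, q = p * 'X + q.[0]%:P.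
  elim/poly_ind: q => [|p c _]; first by exists 0; rewrite horner0 mul0r add0r.
  by exists p; rewrite hornerMXaddC mulr0 add0r.
rewrite hornerMXaddC mulr0 add0r => ->; rewrite addr0 {q}.
elim/poly_ind: p => [|p c ih].
  rewrite mul0r hp0; apply/esym; apply: fc_eqP => // [s||e e0].
  - by under eq_fun do rewrite horner0; exact: cvg_cst.
  - by rewrite horner0.
  by rewrite subr0; apply: (le_trans _ (ltW e0)); apply: fc_le => // [s|| s _];
    rewrite ?horner0 ?normr0//; under eq_fun do rewrite horner0; exact: cvg_cst.
have k0 : (p * 'X).[f 0] = 0 by rewrite f0 hornerMX mulr0.
rewrite mulrDl hpD hpM ?hpX ?hornerX ?hornerMX ?mulr0// ih mul_polyC hpZ hpX -fcM//; last exact: continuous_hornerf.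
rewrite -fcZ// -fcD//.
- by congr fc; apply/funext => s; rewrite hornerD !hornerMX hornerZ hornerX.
- by move=> s; apply: cvgM (cf s); exact: continuous_hornerf.
- by rewrite f0 mulr0.
- by move=> s; apply: cvgM (cf s); exact: cvg_cst.
- by rewrite f0 mulr0.
Qed.

Lemma fc_comp g f h : star h = h -> continuous f -> f 0 = 0 -> continuous g -> g 0 = 0 ->
  fc g (fc f h) = fc (fun s => g (f s)) h.
Proof.
move=> hh cf f0 cg g0; have ff := star_fc hh cf f0.
have cgf : continuous (fun s => g (f s)).
  by move=> s; apply: (@continuous_comp _ _ _ f g) (cf s) (cg _).
have [B B0 hB] := continuous_bound cf (nrm_ge0 h).
apply: fc_eqP => // e e0; have e2 : 0 < e / 2 by rewrite divr_gt0.
have nB : nrm (fc f h) <= B by exact: fc_le.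
have [q [q0 hq1 hq2]] := fc_approx ff cg g0 e2 nB.
rewrite (le_trans (nrm_dist3 _ (hp q (fc f h)) _))// nrm_distC.
suff : nrm (hp q (fc f h) - fc (fun s => g (f s)) h) <= e / 2 by lra.
rewrite hp_fc//.
have -> : fc (fun s => q.[f s]) h - fc (fun s => g (f s)) h =
    fc (fun s => q.[f s] + (-1) * g (f s)) h.
  rewrite fcD ?f0//; first last.
  - by rewrite g0 mulr0.
  - by move=> s; apply: cvgM (cgf s); exact: cvg_cst.
  - exact: continuous_hornerf.
  by rewrite fcZ ?f0// rmorphN1 scaleN1r.
apply: fc_le => //; rewrite ?f0 ?q0 ?g0 ?mulr0 ?addr0//.
  by move=> s; apply: cvgD; [exact: continuous_hornerf|apply: cvgM (cgf s); exact: cvg_cst].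
by move=> s sh; rewrite mulN1r; apply: hq1; exact: hB.
Qed.

End FunCalc.

#[local] Transparent pev hp.

Section Continuity.
Context {R : realType}.
Implicit Types f g : R -> R.

Lemma cont_id : continuous (fun s : R => s). Proof. by move=> s; exact: cvg_id. Qed.

Lemma cont_cst (c : R) : continuous (fun _ : R => c). Proof. by move=> s; exact: cvg_cst. Qed.

Lemma cont_D f g : continuous f -> continuous g -> continuous (fun s => f s + g s).
Proof. by move=> cf cg s; apply: cvgD; [exact: cf|exact: cg]. Qed.

Lemma cont_N f : continuous f -> continuous (fun s => - f s).
Proof. by move=> cf s; apply: cvgN; exact: cf. Qed.

Lemma cont_M f g : continuous f -> continuous g -> continuous (fun s => f s * g s).
Proof. by move=> cf cg s; apply: cvgM; [exact: cf|exact: cg]. Qed.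

Lemma cont_comp f g : continuous g -> continuous f -> continuous (fun s => g (f s)).
Proof. by move=> cg cf s; exact: (@continuous_comp _ _ _ f g) (cf s) (cg _). Qed.

Lemma cont_V f : (forall s, f s != 0) -> continuous f -> continuous (fun s => (f s)^-1).
Proof. by move=> f0 cf s; apply: cvgV; [exact: f0|exact: cf]. Qed.

Lemma cont_sqrt f : continuous f -> continuous (fun s => Num.sqrt (f s)).
Proof. by apply: cont_comp; exact: sqrt_continuous. Qed.

Lemma cont_abs f : continuous f -> continuous (fun s => `|f s|).
Proof. by apply: cont_comp => s; exact: norm_continuous. Qed.

Lemma cont_max f g : continuous f -> continuous g -> continuous (fun s => Num.max (f s) (g s)).
Proof.
move=> cf cg; have -> : (fun s => Num.max (f s) (g s)) = (fun s => 2^-1 * (f s + g s + `|f s - g s|)).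
  by apply/funext => s; case: (leP (f s) (g s)) => h; [rewrite ler0_norm ?subr_le0//|rewrite gtr0_norm ?subr_gt0//]; lra.
by apply: cont_M; [exact: cont_cst|apply: cont_D; [exact: cont_D|apply: cont_abs; apply: cont_D cf (cont_N cg)]].
Qed.

Lemma cont_min f g : continuous f -> continuous g -> continuous (fun s => Num.min (f s) (g s)).
Proof.
move=> cf cg; have -> : (fun s => Num.min (f s) (g s)) = (fun s => - Num.max (- f s) (- g s)).
  by apply/funext => s; rewrite -oppr_min opprK.
by apply: cont_N; apply: cont_max; exact: cont_N.
Qed.

Lemma cont_X f n : continuous f -> continuous (fun s => f s ^+ n).
Proof.
move=> cf; elim: n => [|n ih]; first by under eq_fun do rewrite expr0; exact: cont_cst.
by under eq_fun do rewrite exprS; exact: cont_M.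
Qed.

End Continuity.

Ltac cts :=
  first [assumption |
  lazymatch goal with |- forall x, continuous_at x ?f =>
    lazymatch f with
    | (fun s => s) => exact: cont_id
    | (fun s => Order.max _ _) => apply: cont_max; cts
    | (fun s => Order.min _ _) => apply: cont_min; cts
    | (fun s => Num.norm _) => apply: cont_abs; cts
    | (fun s => Num.sqrt _) => apply: cont_sqrt; cts
    | (fun s => GRing.inv _) => first [exact: cont_cst | apply: cont_V; [ |cts]]
    | (fun s => GRing.exp _ _) => apply: cont_X; cts
    | (fun s => Algebra.opp _) => apply: cont_N; cts
    | (fun s => Algebra.add _ _) => apply: cont_D; cts
    | (fun s => GRing.mul _ _) => apply: cont_M; cts
    | GRing.mul ?c => exact: (@cont_M _ (fun=> c) (fun s => s) (@cont_cst _ c) (@cont_id _))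
    | Algebra.add ?c => exact: (@cont_D _ (fun=> c) (fun s => s) (@cont_cst _ c) (@cont_id _))
    | _ => first [exact: cont_cst | exact: cont_id | exact: (cont_N cont_id) | exact: (cont_abs cont_id) | exact: (cont_sqrt cont_id) | idtac]
    end
  end].

(** * Star homomorphisms: contractivity and functional calculus *)

Section Hom.
Context {R : realType} {A B : cstarAlgType R} (phi : A -> B) (hphi : star_hom phi).
Local Notation A1 := (unitization A).
Local Notation B1 := (unitization B).

Lemma homD a b : phi (a + b) = phi a + phi b.
Proof. by have := star_hom_linear hphi 1 a b; rewrite !scale1r. Qed.

Lemma hom0 : phi 0 = 0.
Proof. by apply: (addrI (phi 0)); rewrite -homD !addr0. Qed.

Lemma homZ (c : R[i]) a : phi (c *: a) = c *: phi a.
Proof. by have := star_hom_linear hphi c a 0; rewrite hom0 !addr0. Qed.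

Lemma homN a : phi (- a) = - phi a.
Proof. by rewrite -scaleN1r homZ scaleN1r. Qed.

Lemma homB a b : phi (a - b) = phi a - phi b.
Proof. by rewrite homD homN. Qed.

Lemma hom_sa h : star h = h -> star (phi h) = phi h.
Proof. by move=> hh; rewrite -(star_hom_star hphi) hh. Qed.

Lemma hom_hp q h : q.[0] = 0 -> phi (hp q h) = hp q (phi h).
Proof.
move=> q0; pose u (x : A1) : B1 := (phi x.1, x.2).
have uM x y : u (x * y) = u x * u y.
  by rewrite /u !umulE /umul /= !homD (star_homM hphi) !homZ.
have uD x y : u (x + y) = u x + u y by rewrite /u homD.
have E : u (pev q (uinj h)) = pev q (uinj (phi h)).
  elim/poly_ind: q {q0} => [|p c ih]; first by rewrite !pev0 /u hom0.
  rewrite !pevD !pevM !pevX !pevC uD uM ih; congr (_ + _).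
  by rewrite /u /= !homZ hom0.
by have := congr1 fst E; rewrite -[(pev q (uinj (phi h))).1]/(hp q (phi h)).
Qed.

(** A self-adjoint [l] of norm below 1 has a root [s] as in [sqrt_fix_sq], and [phi s] is one for
    [phi l]; [pev_bound_sqrt] with the polynomial ['X] then bounds [phi l]. *)
Lemma hom_nrm h : nrm (phi h) <= nrm h.
Proof.
suff H k : star k = k -> nrm (phi k) <= nrm k.
  have : nrm (phi h) ^+ 2 <= nrm h ^+ 2.
    rewrite -!nrm_cstar -(star_hom_star hphi) -(star_homM hphi).
    by apply: H; rewrite starM starK.
  by rewrite ler_pXn2r ?nnegrE ?nrm_ge0.
move=> kk; suff H1 l : star l = l -> nrm l < 1 -> nrm (phi l) <= 1.
  apply/ler_addgt0Pr => e e0; have t0 : 0 < nrm k + e by rewrite ltr_wpDl ?nrm_ge0.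
  have := H1 (((nrm k + e)^-1)%:C *: k).
  rewrite starZr kk homZ !nrmZr gtr0_norm ?invr_gt0// mulrC ltr_pdivrMr// mul1r ltrDl.
  by move=> /(_ erefl e0); rewrite mulrC ler_pdivrMr// mul1r.
move=> ll l1; have [s [ss sE sl]] := sqrt_fix_sq ll l1.
have := @pev_bound_sqrt R B 'X (phi l) (phi s) 1 _ (hom_sa ll) (hom_sa ss).
move=> H1; apply: nrm_mult_le => // z.
rewrite -uact_inj -(pevX (uinj (phi l))); apply: H1.
- by rewrite {1}sE homZ homD !(star_homM hphi).
- by rewrite -!(star_homM hphi) sl.
- by move=> t; rewrite hornerX ler_norml.
Qed.

Lemma hom_fc f h : star h = h -> continuous f -> f 0 = 0 -> phi (fc f h) = fc f (phi h).
Proof.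
move=> hh cf f0; apply: (is_fc_uniq (h := phi h) cf f0); last exact: fcP (hom_sa hh) cf f0.
move=> q e q0 hq.
apply/ler_addgt0Pr => d d0; have d2 : 0 < d / 2 by rewrite divr_gt0.
have [p [p0 hp1 hp2]] := fc_approx hh cf f0 d2 (lexx _).
rewrite (le_trans (nrm_dist3 _ (hp p (phi h)) _))//.
have h1 : nrm (hp q (phi h) - hp p (phi h)) <= e + d / 2.
  rewrite -hpN -hpD; apply: hp_bound; first exact: hom_sa.
    by rewrite hornerD hornerN p0 q0 subrr.
  move=> s sh; rewrite hornerD hornerN.
  have -> : q.[s] - p.[s] = (q.[s] - f s) - (p.[s] - f s) by ring.
  rewrite (le_trans (ler_normB _ _))// lerD ?hq// hp1//.
  exact: le_trans sh (hom_nrm _).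
have h2 : nrm (hp p (phi h) - phi (fc f h)) <= d / 2.
  by rewrite -hom_hp// -homB (le_trans (hom_nrm _)).
by apply: (le_trans (lerD h1 h2)); lra.
Qed.

End Hom.

(** * Positive elements *)

Section Positivity.
Context {R : realType} {A : cstarAlgType R}.
Implicit Types (a b c x y z : A) (f g : R -> R).

(** Positivity without a spectrum: [t - x] acts by left multiplication with norm at most [t]. In
    this form sums of positive elements are visibly positive; [cpos_psd] identifies it with being of
    the form [star c ** c]. *)
Definition psd x := star x = x /\ exists2 t : R, 0 <= t & forall z, nrm (t%:C *: z - x ** z) <= t * nrm z.

Lemma pos_id (s : R) : s = Num.max s 0 - Num.max (- s) 0.
Proof. by case: (leP s 0) => h; [rewrite max_l|rewrite max_r]; lra. Qed.

Lemma psd_sq b : star b = b -> psd (b ** b).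
Proof.
move=> bb; split; first by rewrite starM bb.
exists (nrm b ^+ 2) => [|z]; first by rewrite exprn_ge0 ?nrm_ge0.
have E : pev ((nrm b ^+ 2)%:P - 'X ^+ 2) (uinj b) = (nrm b ^+ 2)%:C *: 1 + (-1) *: uinj (b ** b).
  by rewrite pevD pevN pevC pevX_ pevX (expr2 (uinj b)) (uinjM b b) scaleN1r.
have := @pev_bound R A ((nrm b ^+ 2)%:P - 'X ^+ 2) b (nrm b ^+ 2) z bb.
rewrite E uactD !uactZ uact1 uact_inj scaleN1r; apply.
move=> s sb; rewrite hornerD hornerN hornerC hornerXn.
have : s ^+ 2 <= nrm b ^+ 2 by rewrite -real_normK ?num_real// lerXn2r ?nnegrE ?nrm_ge0.
by have := sqr_ge0 s => s0 s1; rewrite ger0_norm; lra.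
Qed.

Lemma psdD x y : psd x -> psd y -> psd (x + y).
Proof.
move=> [xx [t t0 ht]] [yy [r r0 hr]]; split; first by rewrite starD xx yy.
exists (t + r) => [|z]; first by rewrite addr_ge0.
have -> : (t + r)%:C *: z - (x + y) ** z = (t%:C *: z - x ** z) + (r%:C *: z - y ** z).
  by rewrite rmorphD/= scalerDl cmulDl; zmod.
by rewrite (le_trans (nrmD _ _))// mulrDl lerD.
Qed.

(** Here [w m] is the power [m] of [t - x] applied to [v], of norm at most [t ^+ m * nrm v]. But [v]
    lives where [x] is negative, where these powers grow, so that [v ** v] is [w m.+1] times an
    element of norm at most the inverse of [m.+1 * t ^+ m]. Hence [m * nrm v ^+ 2] stays bounded. *)
Lemma psd_neg0 x : psd x -> fc (fun s => Num.max (- s) 0) x = 0.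
Proof.
move=> [xx [t t0 ht]]; have cn : continuous (fun s : R => Num.max (- s) 0) by cts.
have n0 : Num.max (- (0 : R)) 0 = 0 by rewrite oppr0 maxxx.
set v := fc _ x.
pose w m := fc (fun s => (t - s) ^+ m * Num.max (- s) 0) x.
have cw m : continuous (fun s : R => (t - s) ^+ m * Num.max (- s) 0) by cts.
have w0 m : (t - 0) ^+ m * Num.max (- (0 : R)) 0 = 0 by rewrite n0 mulr0.
have wS m : w m.+1 = t%:C *: w m - x ** w m.
  rewrite -[X in X ** w m](fc_id xx) -fcM//; last exact: cont_id.
  rewrite -fcZ// -scaleN1r -(rmorphN1 (real_complex R)) -fcZ//; first last.
  - by rewrite mul0r.
  - by cts.
  rewrite -fcD//; first last.
  - by rewrite mul0r mulr0.
  - by cts.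
  - by rewrite w0 mulr0.
  - by cts.
  by congr fc; apply/funext => s; rewrite exprS; ring.
have wn m : nrm (w m) <= t ^+ m * nrm v.
  elim: m => [|m ih]; first by rewrite mul1r /w; under eq_fun do rewrite mul1r.
  by rewrite wS (le_trans (ht _))// exprS -mulrA ler_wpM2l.
have key m : m%:R * (nrm v ^+ 2) <= t * nrm v.
  case: m => [|m]; first by rewrite mul0r mulr_ge0 ?nrm_ge0.
  have [tp|] := ltP 0 t; last first.
    move=> tn; have t00 : t = 0 by apply/eqP; rewrite eq_le tn t0.
    have := wn 1%N; rewrite t00 expr1 mul0r => w10.
    have -> : nrm v = 0; last by rewrite expr0n/= mulr0.
    apply/eqP; rewrite -(@sqrf_eq0 R) eq_le exprn_ge0 ?nrm_ge0// andbT.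
    rewrite -nrm_cstar (star_fc xx)// -fcM//.
    apply: le_trans w10; rewrite /w t00 le_eqVlt; apply/orP; left; apply/eqP; congr nrm.
    congr fc; apply/funext => s; rewrite sub0r expr1.
    by case: (leP (- s) 0) => h; rewrite ?mulr0.
  pose k s : R := Num.max (- s) 0 / (t + Num.max (- s) 0) ^+ m.+1.
  have tn0 s : t + Num.max (- s) 0 != 0 by rewrite gt_eqF// ltr_pwDl// le_max lexx orbT.
  have ck : continuous k.
    by apply: cont_M cn _; apply: cont_V => [s|]; [rewrite expf_neq0|cts].
  have k0 : k 0 = 0 by rewrite /k n0 mul0r.
  have E : v ** v = fc k x ** w m.+1.
    rewrite -!fcM//; congr fc; apply/funext => s; rewrite /k.
    case: (leP (- s) 0) => h; first by rewrite !mulr0.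
    by rewrite mulrA divfK// expf_neq0// gt_eqF//; lra.
  have nk : nrm (fc k x) <= (m.+1%:R * t ^+ m)^-1.
    apply: fc_le => // s _; rewrite /k; set r := Num.max _ _.
    have r0 : 0 <= r by rewrite le_max lexx orbT.
    have d0 : 0 < (t + r) ^+ m.+1 by rewrite exprn_gt0// ltr_pwDl.
    rewrite ger0_norm ?divr_ge0 ?(ltW d0)// ler_pdivrMr// mulrC ler_pdivlMr ?mulr_gt0 ?exprn_gt0//.
    have := bernoulli_ineq m.+1 (divr_ge0 r0 t0) => /(ler_wpM2l (exprn_ge0 m.+1 t0)).
    have tE : t * (1 + r / t) = t + r by field; rewrite gt_eqF.
    have tE2 : t ^+ m.+1 * (1 + m.+1%:R * (r / t)) = t ^+ m.+1 + r * (m.+1%:R * t ^+ m).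
      by rewrite exprS; field; rewrite gt_eqF.
    by rewrite -exprMn tE tE2 => /(le_trans _); apply; rewrite lerDr exprn_ge0.
  rewrite -nrm_cstar (star_fc xx)// E.
  have := nrmM (fc k x) (w m.+1); have := ler_pM (nrm_ge0 _) (nrm_ge0 _) nk (wn m.+1).
  move=> h1 h2; have := le_trans h2 h1; rewrite exprS mulrA => h3.
  rewrite (le_trans (ler_wpM2l _ h3))//.
  by rewrite le_eqVlt; apply/orP; left; apply/eqP; field; rewrite expf_neq0 ?gt_eqF.
apply: nrm_le0; have [//|vp] := leP (nrm v) 0.
have := archi_boundP (divr_ge0 t0 (ltW vp)).
by rewrite ltr_pdivrMr// => h; have := key (Num.bound (t / nrm v)); nra.
Qed.

Lemma psd_pos x : psd x -> fc (fun s => Num.max s 0) x = x.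
Proof.
move=> px; have xx := px.1; rewrite -[RHS](fc_id xx).
have -> : fc id x = fc (fun s => Num.max s 0) x + (-1)%:C *: fc (fun s => Num.max (- s) 0) x.
  rewrite -fcZ ?oppr0 ?maxxx//; last by cts.
  rewrite -fcD ?oppr0 ?maxxx ?mulr0//; [|by cts|by cts].
  by congr fc; apply/funext => s /=; rewrite [LHS]pos_id mulN1r.
by rewrite psd_neg0// scaler0 addr0.
Qed.

Lemma fc_pos f x : psd x -> continuous f -> f 0 = 0 -> fc f x = fc (fun s => f (Num.max s 0)) x.
Proof.
move=> px cf f0; rewrite -{1}(psd_pos px) fc_comp ?maxxx//; first exact: px.1.
by cts.
Qed.

Lemma fc_ext_pos f g x : psd x -> continuous f -> f 0 = 0 -> continuous g -> g 0 = 0 ->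
  (forall s : R, 0 <= s <= nrm x -> f s = g s) -> fc f x = fc g x.
Proof.
move=> px cf f0 cg g0 fg; rewrite (fc_pos px)// [RHS](fc_pos px)//.
have cp : continuous (fun s : R => Num.max s 0) by cts.
apply: fc_ext; rewrite ?maxxx//; [exact: px.1|exact: cont_comp|exact: cont_comp|].
move=> s sx; apply: fg; rewrite le_max lexx orbT/= ge_max nrm_ge0 andbT.
exact: le_trans (ler_norm _) sx.
Qed.

Lemma fc_le_pos f x (M : R) : psd x -> continuous f -> f 0 = 0 ->
  (forall s : R, 0 <= s <= nrm x -> `|f s| <= M) -> nrm (fc f x) <= M.
Proof.
move=> px cf f0 fM; rewrite (fc_pos px)//.
have cp : continuous (fun s : R => Num.max s 0) by cts.
apply: fc_le; rewrite ?maxxx//; [exact: px.1|exact: cont_comp|].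
move=> s sx; apply: fM; rewrite le_max lexx orbT/= ge_max nrm_ge0 andbT.
exact: le_trans (ler_norm _) sx.
Qed.

Definition sqc x := fc Num.sqrt x.

Lemma star_sqc x : star x = x -> star (sqc x) = sqc x.
Proof. by move=> xx; rewrite /sqc star_fc ?sqrtr0//; exact: sqrt_continuous. Qed.

Lemma sqcK x : psd x -> sqc x ** sqc x = x.
Proof.
move=> px; have xx := px.1; have cs := @sqrt_continuous R.
rewrite /sqc -fcM ?sqrtr0// -[RHS](psd_pos px); congr fc; apply/funext => s.
case: (leP s 0) => h; first by rewrite ler0_sqrtr ?mul0r.
by rewrite -expr2 sqr_sqrtr// ltW.
Qed.

Lemma fc_psd f h : star h = h -> continuous f -> f 0 = 0 ->
  (forall s : R, `|s| <= nrm h -> 0 <= f s) -> psd (fc f h).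
Proof.
move=> hh cf f0 fp; have -> : fc f h = fc (fun s => Num.sqrt (f s)) h ** fc (fun s => Num.sqrt (f s)) h.
  rewrite -fcM ?f0 ?sqrtr0//; try exact: cont_sqrt.
  apply: fc_ext; rewrite ?f0 ?sqrtr0 ?mul0r//; first by cts.
  by move=> s /fp h0; rewrite -expr2 sqr_sqrtr.
by apply: psd_sq; rewrite star_fc ?f0 ?sqrtr0//; exact: cont_sqrt.
Qed.

Lemma fc_psd_pos f x : psd x -> continuous f -> f 0 = 0 ->
  (forall s : R, 0 <= s <= nrm x -> 0 <= f s) -> psd (fc f x).
Proof.
move=> px cf f0 fp; rewrite (fc_pos px)//; have cp : continuous (fun s : R => Num.max s 0) by cts.
apply: fc_psd; rewrite ?maxxx//; [exact: px.1|exact: cont_comp|].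
move=> s sx; apply: fp; rewrite le_max lexx orbT/= ge_max nrm_ge0 andbT.
exact: le_trans (ler_norm _) sx.
Qed.

Lemma sq_eq0 (v : A) : star v = v -> v ** v = 0 -> v = 0.
Proof.
move=> vv v0; apply: nrm_le0; rewrite -(@ler_pXn2r _ 2) ?nnegrE ?nrm_ge0// expr0n/=.
by rewrite -nrm_cstar vv v0 nrm0.
Qed.

(** Real and imaginary part: with [a = d + star d] and [b = 'i (star d - d)], the sum is half of
    [a ** a + b ** b]. *)
Lemma star_mulD d : psd (star d ** d + d ** star d).
Proof.
pose a := d + star d; pose b := 'i%R *: (star d - d).
have aa : star a = a by rewrite /a starD starK addrC.
have bb : star b = b by rewrite /b starZ conjCi starB starK scaleNr -scalerN opprB.
have E : star d ** d + d ** star d = (2^-1)%:C *: (a ** a + b ** b).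
  rewrite /b cscaleAl cscaleAr scalerA -expr2 sqrCi scaleN1r /a.
  rewrite !cmulDl !cmulDr !cmulNr !cmulrN.
  set p := d ** d; set q := d ** star d; set r := star d ** d; set s := star d ** star d.
  have -> : p + q + (r + s) - (s - r + (- q - - p)) = (q + r) + (q + r) by zmod.
  rewrite scalerDr -scalerDl -rmorphD/=.
  have -> : 2^-1 + 2^-1 = 1 :> R by lra.
  by rewrite scale1r addrC.
have [aE [t t0 ht]] := psdD (psd_sq aa) (psd_sq bb).
rewrite E; split; first by rewrite starZr aE.
exists (2^-1 * t) => [|z]; first by rewrite mulr_ge0.
rewrite cscaleAl rmorphM/= -scalerA -scalerBr nrmZr ger0_norm ?invr_ge0//.
by rewrite -mulrA ler_wpM2l.
Qed.

(** Let [v] be the negative part of [x = star c ** c] and [d = c ** v]. Then [star d ** d] is minus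
    the cube of [v], so [d ** star d] is positive by [star_mulD]; its negative part vanishes, and
    moving it past [d] forces a power of [v] to be 0. *)
Lemma cpos_psd x : cpos x <-> psd x.
Proof.
split=> [[c xE]|px]; last by exists (sqc x); rewrite star_sqc ?sqcK//; exact: px.1.
have xx : star x = x by rewrite xE starM starK.
pose n (s : R) := Num.max (- s) 0.
have cn : continuous n by rewrite /n; cts.
have n0 : n 0 = 0 by rewrite /n oppr0 maxxx.
pose v := fc n x; have vv : star v = v by exact: star_fc.
have vx : v ** x = - (v ** v).
  rewrite -[X in v ** X](fc_id xx) -!fcM//; last exact: cont_id.
  rewrite -scaleN1r -(rmorphN1 (real_complex R)) -fcZ ?n0 ?mulr0//; last by cts.
  congr fc; apply/funext => s; rewrite /n; case: (leP (- s) 0) => h; rewrite ?mul0r ?mulr0//; ring.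
pose d := c ** v.
have dd : star d ** d = - (v ** v ** v).
  by rewrite /d starM vv cmulA -(cmulA v) -xE vx cmulNr.
have v3 : v ** v ** v = fc (fun s => n s * n s * n s) x by rewrite -!fcM ?n0 ?mulr0//; cts.
have c3 : continuous (fun s => n s * n s * n s) by cts.
have sv3 : star (v ** v ** v) = v ** v ** v by rewrite v3 star_fc ?n0 ?mulr0.
have pv3 : psd (v ** v ** v).
  rewrite v3; apply: fc_psd; rewrite ?n0 ?mulr0// => s _.
  by rewrite !mulr_ge0 ?le_max ?lexx ?orbT.
have pd : psd (d ** star d).
  have -> : d ** star d = (star d ** d + d ** star d) + v ** v ** v by rewrite dd; zmod.
  exact: psdD (star_mulD _) pv3.
have I : fc n (star d ** d) ** star d = star d ** fc n (d ** star d).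
  by apply: fc_intertwine; rewrite ?starM ?starK ?cmulA.
rewrite (psd_neg0 pd) cmulr0 in I.
have ndd : fc n (star d ** d) = v ** v ** v.
  rewrite dd v3 -scaleN1r -(rmorphN1 (real_complex R)) -fcZ ?n0 ?mulr0//.
  rewrite fc_comp ?n0 ?mulr0//; [|by cts].
  congr fc; apply/funext => s; rewrite /n; have : 0 <= Num.max (- s) 0 by rewrite le_max lexx orbT.
  by move: (Num.max (- s) 0) => r r0; rewrite max_l; [ring|rewrite mulN1r opprK !mulr_ge0].
have v40 : v ** v ** (v ** v) ** star c = 0.
  by rewrite -[RHS]I ndd /d starM vv !cmulA.
have v60 : v ** v ** v ** (v ** v ** v) = 0.
  have : v ** v ** (v ** v) ** star c ** c ** v = 0 by rewrite v40 !cmul0r.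
  rewrite -!cmulA (cmulA (star c) c v) -xE (cmulA v x v) vx !cmulNr !cmulrN.
  by move=> /eqP; rewrite oppr_eq0 -!cmulA => /eqP.
have v30 := sq_eq0 sv3 v60.
have v20 : v ** v = 0.
  by apply: sq_eq0; rewrite ?starM ?vv// cmulA v30 cmul0r.
have v0 := sq_eq0 vv v20.
have -> : x = fc (fun s => Num.max s 0) x.
  rewrite -[LHS](fc_id xx).
  have -> : fc id x = fc (fun s => Num.max s 0) x + (-1)%:C *: v.
    rewrite -fcZ// -fcD ?n0 ?maxxx ?mulr0//; [|by cts|by cts].
    by congr fc; apply/funext => s /=; rewrite [LHS]pos_id mulN1r.
  by rewrite v0 scaler0 addr0.
by apply: fc_psd; rewrite ?maxxx//; [cts|move=> s _; rewrite le_max lexx orbT].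
Qed.

End Positivity.

(** * Cuntz comparison *)

Section Order.
Context {R : realType} {D : cstarAlgType R}.
Implicit Types (a b c d h v w x y z : D) (f g : R -> R) (e t r : R).

Lemma cpos_sa a : cpos a -> star a = a.
Proof. by case=> c ->; rewrite starM starK. Qed.

Lemma cposD a b : cpos a -> cpos b -> cpos (a + b).
Proof. by move=> /cpos_psd pa /cpos_psd pb; apply/cpos_psd; exact: psdD. Qed.

Lemma cpos_0 : cpos (0 : D).
Proof. by exists 0; rewrite cmulr0. Qed.

Lemma cpos_sum I (s : seq I) (P : pred I) (F : I -> D) :
  (forall i, P i -> cpos (F i)) -> cpos (\sum_(i <- s | P i) F i).
Proof. by move=> h; elim/big_ind: _ => //; [exact: cpos_0|exact: cposD]. Qed.

Lemma cposZ (r : R) a : 0 <= r -> cpos a -> cpos (r%:C *: a).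
Proof.
move=> r0 [c ->]; exists ((Num.sqrt r)%:C *: c).
by rewrite starZr cscaleAl cscaleAr scalerA -rmorphM/= -expr2 sqr_sqrtr.
Qed.

Lemma cpos_conj a c : cpos a -> cpos (star c ** a ** c).
Proof. by move=> [d ->]; exists (d ** c); rewrite starM !cmulA. Qed.

Lemma cpos_conj' a c : cpos a -> cpos (c ** a ** star c).
Proof. by move=> pa; have := cpos_conj (star c) pa; rewrite starK. Qed.

Lemma cpos_sac a c : star c = c -> cpos a -> cpos (c ** a ** c).
Proof. by move=> cc pa; have := cpos_conj c pa; rewrite cc. Qed.

Lemma cpos_ss c : cpos (star c ** c). Proof. by exists c. Qed.

Lemma cpos_ss' c : cpos (c ** star c).
Proof. by exists (star c); rewrite starK. Qed.

Lemma cpos_sq c : star c = c -> cpos (c ** c).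
Proof. by move=> cc; exists c; rewrite cc. Qed.

Lemma cpos_fc f a : cpos a -> continuous f -> f 0 = 0 ->
  (forall s : R, 0 <= s <= nrm a -> 0 <= f s) -> cpos (fc f a).
Proof. by move=> /cpos_psd pa cf f0 fp; apply/cpos_psd; exact: fc_psd_pos. Qed.

Definition cle a b := cpos (b - a).

Lemma cle_refl a : cle a a. Proof. by rewrite /cle subrr; exact: cpos_0. Qed.

Lemma cle_trans b a c : cle a b -> cle b c -> cle a c.
Proof. by rewrite /cle => h1 h2; have := cposD h2 h1; rewrite addrA subrK. Qed.

Lemma cleD a b c d : cle a b -> cle c d -> cle (a + c) (b + d).
Proof. by rewrite /cle => h1 h2; have := cposD h1 h2; rewrite opprD addrACA. Qed.

Lemma cle_conj a b c : cle a b -> cle (star c ** a ** c) (star c ** b ** c).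
Proof. by rewrite /cle -cmulBl -cmulBr; exact: cpos_conj. Qed.

Lemma cle_fc f g a : cpos a -> continuous f -> f 0 = 0 -> continuous g -> g 0 = 0 ->
  (forall s : R, 0 <= s <= nrm a -> f s <= g s) -> cle (fc f a) (fc g a).
Proof.
move=> pa cf f0 cg g0 fg; have aa := cpos_sa pa; rewrite /cle.
have -> : fc g a - fc f a = fc (fun s => g s + (-1) * f s) a.
  rewrite fcD ?f0 ?mulr0//; last by cts.
  by rewrite fcZ// rmorphN1 scaleN1r.
apply: cpos_fc => //; first by cts.
  by rewrite f0 g0 mulr0 addr0.
by move=> s /fg; lra.
Qed.

Lemma cpos_antisym x : cpos x -> cpos (- x) -> x = 0.
Proof.
move=> /cpos_psd px /cpos_psd pnx; have xx := px.1.
have := psd_neg0 pnx; rewrite -(psd_pos px) -scaleN1r -(rmorphN1 (real_complex R)) -fcZ ?maxxx//; last by cts.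
rewrite fc_comp ?maxxx ?mulr0 ?oppr0 ?maxxx//; [|by cts|by cts].
move=> <-; apply: fc_ext; rewrite ?maxxx ?mulr0 ?oppr0 ?maxxx//; [by cts|by cts|].
by move=> s _; rewrite mulN1r opprK; apply/esym/max_idPl; rewrite le_max lexx orbT.
Qed.

(** [t - h] is the square of [Num.sqrt t - f(h)], where [f] vanishes at 0, so its root can act on
    [y] without a unit in [D]. *)
Lemma cpos_nrm h t y : star h = h -> nrm h <= t ->
  cpos (t%:C *: (star y ** y) - star y ** h ** y).
Proof.
move=> hh ht; have t0 : 0 <= t := le_trans (nrm_ge0 h) ht.
pose f (s : R) := Num.sqrt t - Num.sqrt (Num.max (t - s) 0).
have cf : continuous f by rewrite /f; cts.
have f0 : f 0 = 0 by rewrite /f subr0 max_l// subrr.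
pose g := fc f h; have gg : star g = g by exact: star_fc.
exists ((Num.sqrt t)%:C *: y - g ** y).
rewrite starB starZr starM gg cmulBl !cmulBr !cscaleAl !cscaleAr scalerA -rmorphM/= -expr2 sqr_sqrtr//.
have E : h = (Num.sqrt t)%:C *: g + (Num.sqrt t)%:C *: g - g ** g.
  rewrite -{1}(fc_id hh) -!fcZ// -!fcM// -fcD//; first last.
  - by rewrite f0 mulr0.
  - by cts.
  - by rewrite f0 mulr0.
  - by cts.
  rewrite -[X in _ - X]scale1r -scaleNr -(rmorphN1 (real_complex R)) -fcZ//; first last.
  - by rewrite f0 mulr0.
  - by cts.
  rewrite -fcD//; first last.
  - by rewrite f0 !mulr0.
  - by cts.
  - by rewrite f0 mulr0 addr0.
  - by cts.
  apply: fc_ext => //; rewrite ?f0 ?mulr0 ?addr0//; [exact: cont_id|by cts|].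
  move=> s sh; have st : `|s| <= t := le_trans sh ht.
  rewrite /f max_l; last by move: st; rewrite ler_norml; lra.
  have st0 : 0 <= t - s by move: st; rewrite ler_norml; lra.
  have := sqr_sqrtr st0; have := sqr_sqrtr t0.
  by move: (Num.sqrt (t - s)) (Num.sqrt t) => p q /= qE pE; rewrite -[LHS](subKr t) -pE -qE; ring.
rewrite {1}E cmulBr cmulDr cmulBl cmulDl !cscaleAr !cscaleAl -!cmulA; zmod.
Qed.

(** With [y] the part of [a] above [t = nrm b], the cube of [y] equals [y (a - t) y]; it is
    positive, and at most [y (b - t) y], which is negative. Hence [y = 0]. *)
Lemma cle_nrm a b : cpos a -> cle a b -> nrm a <= nrm b.
Proof.
move=> pa ab; have aa := cpos_sa pa; set t := nrm b.
have bb : star b = b by have := cpos_sa ab; rewrite starB aa => /addIr.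
have t0 : 0 <= t by exact: nrm_ge0.
pose p s := Num.max (s - t) 0.
have cp : continuous p by rewrite /p; cts.
have p0 : p 0 = 0 by rewrite /p sub0r max_r// oppr_le0.
pose y := fc p a; have yy : star y = y by exact: star_fc.
have h1 : cle (y ** a ** y) (t%:C *: (y ** y)).
  have h := cle_conj y ab; rewrite yy in h; apply: cle_trans h _.
  by have := @cpos_nrm b t y bb (lexx _); rewrite yy.
have h2 : y ** a ** y - t%:C *: (y ** y) = y ** y ** y.
  rewrite -[X in y ** X](fc_id aa) -!fcM ?p0 ?mulr0 ?mul0r//; try by cts.
  rewrite -fcZ ?p0 ?mulr0//; last by cts.
  rewrite -fcB ?p0 ?mul0r ?mulr0//; try by cts.
  by congr fc; apply/funext => s; rewrite /p; case: leP => h; ring.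
have h3 : y ** y ** y = 0.
  apply: cpos_antisym; last by rewrite -h2 opprB.
  rewrite -!fcM ?p0 ?mulr0//; last by cts.
  apply: cpos_fc; rewrite ?p0 ?mulr0//; first by cts.
  by move=> s _; rewrite !mulr_ge0// le_max lexx orbT.
have y0 : y = 0 by do 2! (apply: sq_eq0 => //; rewrite ?starM ?yy ?cmulA ?h3 ?cmul0r//).
have -> : a = fc (fun s => Num.min s t) a + y.
  rewrite -fcD//; first last.
  - by rewrite min_l.
  - by cts.
  rewrite -[LHS](fc_id aa); congr fc; apply/funext => s /=; rewrite /p.
  by case: (leP s t) => st; [rewrite max_r|rewrite max_l]; lra.
rewrite y0 addr0; apply: fc_le_pos; [exact/cpos_psd|by cts|by rewrite min_l|].
by move=> s /andP[s0 _]; rewrite ger0_norm ?le_min ?s0// ge_min lexx orbT.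
Qed.

Definition cut t a := fc (fun s => Num.max (s - t) 0) a.

Lemma cont_cut t : continuous (fun s : R => Num.max (s - t) 0). Proof. by cts. Qed.

Lemma cut_00 t : 0 <= t -> Num.max (0 - t) 0 = 0.
Proof. by move=> t0; rewrite sub0r max_r// oppr_le0. Qed.

Lemma cpos_cut t a : 0 <= t -> cpos a -> cpos (cut t a).
Proof.
move=> t0 pa; apply: cpos_fc => //; [exact: cont_cut|exact: cut_00|].
by move=> s _; rewrite le_max lexx orbT.
Qed.

Lemma cut0 a : cpos a -> cut 0 a = a.
Proof. by move=> /cpos_psd pa; rewrite /cut; under eq_fun do rewrite subr0; exact: psd_pos. Qed.

Lemma cut_cut t r a : 0 <= t -> 0 <= r -> star a = a -> cut t (cut r a) = cut (r + t) a.
Proof.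
move=> t0 r0 aa; rewrite /cut fc_comp ?cut_00//; try exact: cont_cut.
congr fc; apply/funext => s; case: (leP (s - r) 0) => h.
  by rewrite sub0r !max_r//; lra.
by congr Num.max; ring.
Qed.

Lemma cut_dist t a : 0 <= t -> cpos a -> nrm (a - cut t a) <= t.
Proof.
move=> t0 pa; have aa := cpos_sa pa; rewrite -{1}(fc_id aa) /cut.
rewrite -scaleN1r -(rmorphN1 (real_complex R)) -fcZ ?cut_00//; last exact: cont_cut.
have cc := @cont_cut t.
rewrite -fcD ?cut_00 ?mulr0//; [|exact: cont_id|by cts].
apply: fc_le_pos; [exact/cpos_psd|by apply: cont_D; [exact: cont_id|cts]|by rewrite cut_00// mulr0 addr0|].
by move=> s /andP[s0 _]; case: (leP (s - t) 0) => h; rewrite ger0_norm; lra.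
Qed.

Lemma cut_le t r a : 0 <= t -> t <= r -> cpos a -> cle (cut r a) (cut t a).
Proof.
move=> t0 tr pa; apply: cle_fc; rewrite ?cut_00//; try exact: cont_cut; first exact: le_trans tr.
by move=> s _; rewrite ge_max !le_max lexx orbT lerD2l lerN2 tr.
Qed.

Lemma fcalcE f a : cpos a -> continuous f -> f 0 = 0 -> fcalc f a = fc f a.
Proof.
move=> pa cf f0; have aa := cpos_sa pa.
have xE q : xpoly_eval q a = hp ('X * q) a.
  have hX n : hp ('X ^+ n.+1) a = iter n (cmul a) a.
    elim: n => [|n ih]; first by rewrite hpX.
    by rewrite exprS hpM ?hornerX ?hornerXn ?expr0n// hpX ih iterS.
  rewrite -{2}(coefK q) poly_def mulr_sumr /xpoly_eval.
  elim/big_rec2: _ => [|i x p _ ->]; first by rewrite hp0.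
  by rewrite hpD -scalerAr hpZ -exprS hX.
rewrite /fcalc; set S := [set y | _].
have Suniq y : S y -> y = fc f a.
  move=> [q [hq qy]]; apply: (cvg_uniq qy); apply/nrm_cvg_seqP => e e0.
  have e2 : 0 < e / 2 by rewrite divr_gt0.
  have [N _ hN] := hq _ e2; exists N => n Nn.
  rewrite xE -fc_hp ?hornerM ?hornerX ?mul0r// nrm_distC.
  have cq : continuous (fun s => ('X * q n).[s]) by exact: continuous_horner.
  rewrite -scaleN1r -(rmorphN1 (real_complex R)) -fcZ// -fcD ?f0 ?mulr0 ?hornerM ?hornerX ?mul0r//; last by cts.
  apply: (@le_lt_trans _ _ (e / 2)); last by lra.
  apply: fc_le_pos; rewrite ?f0 ?mulr0 ?addr0 ?hornerM ?hornerX ?mul0r//; [exact/cpos_psd|by cts|].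
  by move=> s sa; rewrite hornerM hornerX mulN1r; apply: (hN n Nn).
have S0 : exists y, S y.
  have /choice[p hp_] (n : nat) : exists q : {poly R}, q.[0] = 0 /\
      forall s : R, `|s| <= nrm a -> `|q.[s] - f s| <= n.+1%:R^-1.
    have [|q q0 hq] := weierstrass0 cf f0 (nrm_ge0 a) (_ : 0 < n.+1%:R^-1); last by exists q.
    by rewrite invr_gt0.
  have /choice[q hq] n : exists q : {poly R}, p n = 'X * q.
    have /factor_theorem[q ->] : root (p n) 0 by rewrite /root (hp_ n).1.
    by exists q; rewrite subr0 mulrC.
  have inv0 e : 0 < e -> exists n0, forall n, (n0 <= n)%N -> n.+1%:R^-1 < e.
    move=> e0; have /cvgrPdist_lt/(_ e e0)[N _ hN] := @cvg_harmonic R.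
    by exists N => n /hN/=; rewrite sub0r normrN ger0_norm ?invr_ge0.
  exists (fc f a), q; split.
    move=> e /inv0[N hN]; exists N => // n /= /hN/ltW h s /andP[s0 sa].
    have := (hp_ n).2 s; rewrite hq hornerM hornerX ger0_norm// => /(_ sa) h2.
    exact: le_trans h2 h.
  apply/nrm_cvg_seqP => e /inv0[N hN]; exists N => n /hN h.
  by rewrite xE -hq nrm_distC; apply: le_lt_trans h; apply: fcP => //; [exact: (hp_ n).1|exact: (hp_ n).2].
by apply: Suniq; exact: getPex.
Qed.

Lemma cutdownE e a : 0 <= e -> cpos a -> cutdown e a = cut e a.
Proof. by move=> e0 pa; rewrite /cutdown fcalcE ?cut_00//; exact: cont_cut. Qed.

End Order.

Notation "a =<= b" := (cle a b) (at level 70).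
Notation "a ≾ b" := (cuntz_le a b) (at level 70).

Section CuntzBasics.
Context {R : realType} {D : cstarAlgType R}.
Implicit Types (a b c d h v w x y z : D) (f g : R -> R) (e t r : R).

Lemma cuntzP a b : a ≾ b <-> forall e, 0 < e -> exists v, nrm (a - v ** b ** star v) < e.
Proof.
split=> [[v /nrm_cvg_seqP h] e /h[N hN]|h]; first by exists (v N); exact: hN.
have inv0 n : 0 < n.+1%:R^-1 :> R by rewrite invr_gt0.
have /choice[v hv] n := h _ (inv0 n).
exists v; apply/nrm_cvg_seqP => e e0.
have /cvgrPdist_lt/(_ e e0)[N _ hN] := @cvg_harmonic R.
exists N => n /hN/=; rewrite sub0r normrN ger0_norm ?invr_ge0//.
exact: lt_trans (hv n).
Qed.

Lemma cuntz_lim a b : (forall e, 0 < e -> exists2 a', nrm (a - a') < e & a' ≾ b) -> a ≾ b.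
Proof.
move=> h; apply/cuntzP => e e0; have e2 : 0 < e / 2 by rewrite divr_gt0.
have [a' ha' /cuntzP/(_ _ e2)[v hv]] := h _ e2; exists v.
by rewrite (le_lt_trans (nrm_dist3 _ a' _))// [e]splitr ltrD.
Qed.

Lemma cuntz_conj b x : x ** b ** star x ≾ b.
Proof. by exists (fun=> x); exact: cvg_cst. Qed.

Lemma cuntz_trans b a c : a ≾ b -> b ≾ c -> a ≾ c.
Proof.
move=> /cuntzP ab /cuntzP bc; apply/cuntzP => e e0.
have e2 : 0 < e / 2 by rewrite divr_gt0.
have [v hv] := ab _ e2; have nv := nrm_ge0 v.
pose d := e / 2 / (nrm v ^+ 2 + 1).
have v1 : 0 < nrm v ^+ 2 + 1 by rewrite ltr_wpDl// exprn_ge0.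
have d0 : 0 < d by rewrite divr_gt0.
have [w hw] := bc _ d0; exists (v ** w).
rewrite (le_lt_trans (nrm_dist3 _ (v ** b ** star v) _))// [e]splitr ltrD//.
rewrite starM -!cmulA (cmulA w) (cmulA (w ** c)) -cmulBr -cmulBl.
rewrite (le_lt_trans (nrmM _ _))//.
have := nrmM (b - w ** c ** star w) (star v); rewrite nrm_star => h.
have dE : d * (nrm v ^+ 2 + 1) = e / 2 by rewrite /d divfK// gt_eqF.
by have := nrm_ge0 (b - w ** c ** star w); nra.
Qed.

(** The functions [s -> s / (s + e)] on [s >= 0] form an approximate unit as [e] decreases to 0. *)
Definition au : R -> R -> R := locked (fun e s => Num.max s 0 / (Num.max s 0 + e)).

Lemma auE e s : au e s = Num.max s 0 / (Num.max s 0 + e).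
Proof. by rewrite /au; unlock. Qed.

Lemma au_den e s : 0 < e -> 0 < Num.max s 0 + e.
Proof. by move=> e0; rewrite ltr_wpDl// le_max lexx orbT. Qed.

Lemma cont_au e : 0 < e -> continuous (au e).
Proof.
move=> e0; have -> : au e = (fun s => Num.max s 0 / (Num.max s 0 + e)) by apply/funext => s; rewrite auE.
by cts => s; rewrite gt_eqF// au_den.
Qed.

Lemma au0 e : au e 0 = 0. Proof. by rewrite auE maxxx mul0r. Qed.

Lemma au_itv e s : 0 < e -> 0 <= au e s <= 1.
Proof.
move=> e0; have d0 := au_den s e0; have m0 : 0 <= Num.max s 0 by rewrite le_max lexx orbT.
by rewrite auE divr_ge0 ?(ltW d0)//= ler_pdivrMr// mul1r lerDl ltW.
Qed.

Lemma au_approx e s : 0 < e -> 0 <= s -> 0 <= s * (1 - au e s ^+ 2) <= 2 * e.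
Proof.
move=> e0 s0; have /andP[a0 a1] := au_itv s e0.
apply/andP; split; first by rewrite mulr_ge0// subr_ge0 expr_le1.
have : s * (1 - au e s) <= e.
  rewrite auE max_l//; have d0 : 0 < s + e by lra.
  have -> : s * (1 - s / (s + e)) = e * (s / (s + e)) by field; rewrite gt_eqF.
  by rewrite ler_piMr ?(ltW e0)// ler_pdivrMr//; lra.
have : 0 <= 1 - au e s by lra.
by move: (au e s) a0 a1 => u a0 a1 h; nra.
Qed.

Lemma au_mul e a : 0 < e -> cpos a ->
  nrm (a - fc (au e) a ** a ** fc (au e) a) <= 2 * e.
Proof.
move=> e0 pa; have aa := cpos_sa pa; have ca := cont_au e0; have a0 := au0 e.
have -> : a - fc (au e) a ** a ** fc (au e) a = fc (fun s => s + (-1) * (au e s * s * au e s)) a.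
  rewrite fcD ?a0 ?mul0r ?mulr0//; try by cts.
  rewrite fcZ ?a0 ?mul0r//; last by cts.
  rewrite !fcM ?a0 ?mul0r//; try by cts.
  by rewrite (fc_id aa) rmorphN1 scaleN1r.
apply: fc_le_pos; rewrite ?a0 ?mul0r ?mulr0 ?addr0//; [exact/cpos_psd|by cts|].
move=> s /andP[s0 _]; have := au_approx e0 s0; move: (au e s) => u.
have -> : s + -1 * (u * s * u) = s * (1 - u ^+ 2) by ring.
by move=> /andP[h1 h2]; rewrite ger0_norm.
Qed.

Lemma cuntz_refl a : cpos a -> a ≾ a.
Proof.
move=> pa; apply/cuntzP => e e0; have e3 : 0 < e / 3 by rewrite divr_gt0.
exists (fc (au (e / 3)) a); rewrite star_fc ?au0//; [|exact: cpos_sa|exact: cont_au].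
by rewrite (le_lt_trans (au_mul _ _))//; lra.
Qed.

Lemma cuntz_scale a b r : 0 <= r -> a ≾ b -> r%:C *: a ≾ b.
Proof.
move=> r0 /cuntzP ab; apply/cuntzP => e e0.
have r1 : 0 < r + 1 by lra.
have [v hv] := ab (e / (r + 1)) (divr_gt0 e0 r1); exists ((Num.sqrt r)%:C *: v).
rewrite starZr !cscaleAl cscaleAr scalerA -rmorphM/= -expr2 sqr_sqrtr// -scalerBr nrmZr ger0_norm//.
by rewrite ltr_pdivlMr// in hv; have := nrm_ge0 (a - v ** b ** star v); nra.
Qed.

Lemma cuntz_scale_r a b r : 0 < r -> a ≾ b -> a ≾ r%:C *: b.
Proof.
move=> r0 /cuntzP ab; apply/cuntzP => e /ab[v hv]; exists ((Num.sqrt r^-1)%:C *: v).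
have E := sqr_sqrtr (ltW (_ : 0 < r^-1)); rewrite invr_gt0 in E.
have -> : (Num.sqrt r^-1)%:C *: v ** (r%:C *: b) ** star ((Num.sqrt r^-1)%:C *: v) =
    (Num.sqrt r^-1 ^+ 2 * r)%:C *: (v ** b ** star v).
  rewrite starZr !(cscaleAl, cscaleAr) !scalerA; congr (_ *: _).
  by rewrite expr2 !rmorphM/=; ring.
by rewrite E// mulVf ?gt_eqF// scale1r.
Qed.

(** The conjugator is [sqc a] times [k(b)], where [k(s) s k(s)] is 1 minus the square of [1 - g(s)].
    The error is then [star w ** w] with [w = (1 - g(b)) sqc a]; it has the norm of [w ** star w],
    which lies below [(1 - g(b)) b (1 - g(b))], and this is small. *)
Lemma cle_cuntz a b : cpos a -> a =<= b -> a ≾ b.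
Proof.
move=> pa ab; have aa := cpos_sa pa.
have pb : cpos b by have := cposD ab pa; rewrite subrK.
have bb := cpos_sa pb.
apply/cuntzP => e e0; pose t := e / 3; have t0 : 0 < t by rewrite divr_gt0.
pose k s := Num.sqrt (Num.max s 0) / (Num.max s 0 + t).
have ck : continuous k by rewrite /k; cts => s; rewrite gt_eqF// au_den.
have k0 : k 0 = 0 by rewrite /k maxxx sqrtr0 mul0r.
have cau := cont_au t0.
have kE s : 0 <= s -> k s * s * k s = au t s ^+ 2.
  move=> s0; rewrite /k auE !max_l//.
  have st : s + t != 0 by rewrite gt_eqF// ltr_wpDl.
  by have := sqr_sqrtr s0; move: (Num.sqrt s) => p pE; rewrite -pE in st *; field.
pose g s := 1 - Num.sqrt (1 - au t s ^+ 2).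
have cg : continuous g by rewrite /g; cts.
have g0 : g 0 = 0 by rewrite /g au0 expr0n subr0 sqrtr1 subrr.
have gE s : g s = 1 - Num.sqrt (1 - au t s ^+ 2) by [].
clearbody k g.
have ra : star (sqc a) = sqc a by exact: star_sqc.
have aK : sqc a ** sqc a = a by apply: sqcK; exact/cpos_psd.
have gg : star (fc g b) = fc g b by exact: star_fc.
pose w := sqc a - fc g b ** sqc a.
exists (sqc a ** fc k b).
have E : a - sqc a ** fc k b ** b ** star (sqc a ** fc k b) = star w ** w.
  rewrite starM (star_fc bb ck k0) ra.
  have -> : sqc a ** fc k b ** b ** (fc k b ** sqc a) = sqc a ** (fc k b ** b ** fc k b) ** sqc a.
    by rewrite !cmulA.
  have -> : fc k b ** b ** fc k b = fc g b + fc g b - fc g b ** fc g b.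
    rewrite -[X in _ ** X ** _](fc_id bb) -!fcM ?k0 ?g0 ?mul0r//; try by cts.
    rewrite -fcD// -fcB ?g0 ?addr0 ?mul0r ?mulr0//; try by cts.
    apply: fc_ext_pos; rewrite ?k0 ?g0 ?addr0 ?mul0r ?mulr0 ?subr0//; try by cts.
      exact/cpos_psd.
    move=> s /andP[s0 _]; rewrite kE// gE.
    have h : 0 <= 1 - au t s ^+ 2 by have /andP[? ?] := au_itv s t0; rewrite subr_ge0 expr_le1.
    by have := sqr_sqrtr h; move: (Num.sqrt _) => p pE; rewrite -[LHS](subKr 1) -pE; ring.
  by rewrite /w starB starM ra gg !(cmulBl, cmulBr, cmulDl, cmulDr) !cmulA aK; zmod.
rewrite E nrm_cstar -nrm_cstar2.
have h1 : w ** star w = star (sqc a - sqc a ** fc g b) ** (sqc a - sqc a ** fc g b).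
  by rewrite /w !starB !starM !ra !gg.
pose u z := z - z ** fc g b.
have uE z : star (u z) ** u z = star z ** z - fc g b ** (star z ** z) -
    ((star z ** z) ** fc g b - fc g b ** (star z ** z) ** fc g b).
  by rewrite /u starB starM gg !(cmulBl, cmulBr) !cmulA; zmod.
have h2 : w ** star w =<= star (u (sqc b)) ** u (sqc b).
  rewrite h1 -/(u (sqc a)) !uE ra (star_sqc bb) aK sqcK; last exact/cpos_psd.
  move: ab; rewrite /cle => -[c cE].
  have bE : b = a + star c ** c by rewrite -cE addrC subrK.
  by exists (u c); rewrite uE; move: (fc g b) => G; rewrite bE !(cmulDl, cmulDr); zmod.
rewrite (le_lt_trans (cle_nrm (cpos_ss' _) h2))//.
rewrite uE (star_sqc bb) sqcK; last exact/cpos_psd.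
have -> : b - fc g b ** b - (b ** fc g b - fc g b ** b ** fc g b) =
    fc (fun s => (1 - g s) * s * (1 - g s)) b.
  have E3 : fc g b ** b ** fc g b = fc (fun s => g s * s * g s) b.
    by rewrite !fcM ?g0 ?mul0r ?(fc_id bb)//; cts.
  have E1 : fc g b ** b = fc (fun s => g s * s) b by rewrite fcM ?(fc_id bb)//; cts.
  have E2 : b ** fc g b = fc (fun s => s * g s) b by rewrite fcM ?(fc_id bb)//; cts.
  rewrite E3 E1 E2 -[X in X - _ - _](fc_id bb).
  rewrite -!fcB ?g0 ?mul0r ?mulr0 ?subr0//; try by cts.
  by congr fc; apply/funext => s /=; ring.
apply: (@le_lt_trans _ _ (2 * t)); last by rewrite /t; lra.
apply: fc_le_pos; rewrite ?mulr0 ?mul0r//; [exact/cpos_psd|by cts|].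
move=> s /andP[s0 _]; have /andP[h3 h4] := au_approx t0 s0.
have h : 0 <= 1 - au t s ^+ 2 by have /andP[? ?] := au_itv s t0; rewrite subr_ge0 expr_le1.
have -> : (1 - g s) * s * (1 - g s) = s * (1 - au t s ^+ 2).
  by rewrite gE opprB addrC subrK mulrAC -expr2 sqr_sqrtr// mulrC.
by rewrite ger0_norm.
Qed.

Lemma cuntz_cut_le t r a : 0 <= t -> t <= r -> cpos a -> cut r a ≾ cut t a.
Proof. by move=> t0 tr pa; apply: cle_cuntz (cut_le t0 tr pa); apply: cpos_cut => //; exact: le_trans tr. Qed.

Lemma cuntz_cut t a : 0 <= t -> cpos a -> cut t a ≾ a.
Proof. by move=> t0 pa; rewrite -{2}(cut0 pa); exact: cuntz_cut_le. Qed.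

Lemma cuntz_of_cuts a b : cpos a -> (forall e, 0 < e -> cut e a ≾ b) -> a ≾ b.
Proof.
move=> pa h; apply: cuntz_lim => e e0; have e2 : 0 < e / 2 by rewrite divr_gt0.
exists (cut (e / 2) a); last exact: h.
by rewrite (le_lt_trans (cut_dist (ltW e2) pa))//; lra.
Qed.

Lemma cuntz_fc_ge g a : cpos a -> continuous g -> g 0 = 0 ->
  (forall e, 0 < e -> exists2 C : R, 0 < C & forall s : R, 0 <= s <= nrm a -> Num.max (s - e) 0 <= C * g s) ->
  a ≾ fc g a.
Proof.
move=> pa cg g0 h; apply: cuntz_of_cuts => // e e0; have [C C0 hC] := h e e0.
have pc := cpos_cut (ltW e0) pa.
apply: (@cuntz_trans (C%:C *: fc g a)).
  apply: cle_cuntz => //; rewrite -fcZ//; last exact: cpos_sa.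
  by apply: cle_fc; rewrite ?cut_00 ?g0 ?mulr0 ?(ltW e0)//; [exact: cont_cut|cts].
apply: cuntz_scale (ltW C0) _; apply: cuntz_refl; apply: cpos_fc => // s /hC h1.
by rewrite -(pmulr_rge0 _ C0) (le_trans _ h1)// le_max lexx orbT.
Qed.

(** A polynomial close to [f] is divisible by the variable, so its absolute value is at most
    [C * s]. *)
Lemma fc_cuntz f a : cpos a -> continuous f -> f 0 = 0 ->
  (forall s : R, 0 <= s <= nrm a -> 0 <= f s) -> fc f a ≾ a.
Proof.
move=> pa cf f0 fp; have aa := cpos_sa pa.
apply: cuntz_lim => e e0; have e2 : 0 < e / 2 by rewrite divr_gt0.
have [p p0 hp_] := weierstrass0 cf f0 (nrm_ge0 a) e2.
have /factor_theorem[q pE] : root p 0 by rewrite /root p0.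
rewrite subr0 in pE.
have cq : continuous (fun s => q.[s]) by exact: continuous_horner.
have [C C0 hC] := continuous_bound cq (nrm_ge0 a).
have cg : continuous (fun s => `|p.[s]|) by apply: cont_abs; exact: continuous_horner.
exists (fc (fun s => `|p.[s]|) a).
  apply: (@le_lt_trans _ _ (e / 2)); last by lra.
  rewrite -scaleN1r -(rmorphN1 (real_complex R)) -fcZ ?p0 ?normr0// -fcD ?p0 ?normr0 ?mulr0//; last by cts.
  apply: fc_le_pos; rewrite ?f0 ?p0 ?normr0 ?mulr0 ?addr0//; [exact/cpos_psd|by cts|].
  move=> s /andP[s0 sa]; have := hp_ s; rewrite ger0_norm// => /(_ sa) h.
  rewrite mulN1r distrC; apply: le_trans h; rewrite -{1}(ger0_norm (fp s _)) ?s0//.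
  exact: ler_dist_dist.
apply: (@cuntz_trans (C%:C *: a)); last by apply: cuntz_scale => //; exact: cuntz_refl.
apply: cle_cuntz; first by apply: cpos_fc => //; rewrite p0 normr0.
rewrite -[X in _ *: X](fc_id aa) -fcZ//; last exact: cont_id.
apply: cle_fc; rewrite ?p0 ?normr0 ?mulr0//; first by apply: cont_M; [exact: cont_cst|exact: cont_id].
move=> s /andP[s0 sa]; rewrite pE hornerMX normrM (ger0_norm s0) ler_wpM2r// hC// ger0_norm//.
Qed.

Lemma sq_cuntz a : cpos a -> a ** a ≾ a.
Proof.
move=> pa; have aa := cpos_sa pa; rewrite -(fc_id aa) -fcM//; try exact: cont_id.
rewrite (fc_id aa); apply: fc_cuntz; rewrite ?mulr0//; first by apply: cont_M; exact: cont_id.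
by move=> s /andP[s0 _]; rewrite mulr_ge0.
Qed.

Lemma cuntz_sq a : cpos a -> a ≾ a ** a.
Proof.
move=> pa; have aa := cpos_sa pa; rewrite -{2 3}(fc_id aa) -fcM//; try exact: cont_id.
apply: cuntz_fc_ge; rewrite ?mulr0//; first by apply: cont_M; exact: cont_id.
move=> e e0; exists e^-1; first by rewrite invr_gt0.
move=> s /andP[s0 _] /=; case: (leP (s - e) 0) => h; first by rewrite !mulr_ge0// invr_ge0 ltW.
by rewrite mulrC ler_pdivlMr//; nra.
Qed.

Lemma ss'_cuntz x : x ** star x ≾ star x ** x.
Proof.
apply: cuntz_trans (cuntz_sq (cpos_ss' x)) _.
by have := cuntz_conj (star x ** x) x; rewrite !cmulA.
Qed.

Lemma ss_cuntz x : star x ** x ≾ x ** star x.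
Proof. by have := ss'_cuntz (star x); rewrite starK. Qed.

(** Conjugating [cut t (star x ** x)] by [x] gives [cut t (x ** star x)] times [x ** star x], which
    is at least [t] times the cutdown. *)
Lemma cut_ss' t x : 0 <= t -> cut t (x ** star x) ≾ cut t (star x ** x).
Proof.
rewrite le_eqVlt => /predU1P[<-|t0].
  by rewrite !cut0; [exact: ss'_cuntz|exact: cpos_ss|exact: cpos_ss'].
have pa := cpos_ss' x; have aa := cpos_sa pa; have pb := cpos_ss x.
have ct := @cont_cut R t; have c0 := cut_00 (ltW t0).
apply: (@cuntz_trans (x ** cut t (star x ** x) ** star x)); last exact: cuntz_conj.
have -> : x ** cut t (star x ** x) ** star x = fc (fun s => Num.max (s - t) 0 * s) (x ** star x).
  have -> : x ** cut t (star x ** x) = cut t (x ** star x) ** x.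
    by apply/esym; apply: fc_intertwine => //; [exact: cpos_sa|rewrite cmulA].
  by rewrite -cmulA -[X in cut t _ ** X](fc_id aa) -fcM//; exact: cont_id.
have cM : continuous (fun s => Num.max (s - t) 0 * s) by apply: cont_M; [exact: ct|exact: cont_id].
apply: (@cuntz_trans (t^-1%:C *: fc (fun s => Num.max (s - t) 0 * s) (x ** star x))).
  apply: cle_cuntz; first exact: cpos_cut (ltW t0) pa.
  rewrite -fcZ ?c0 ?mul0r//; apply: cle_fc; rewrite ?c0 ?mul0r ?mulr0//; first by cts.
  move=> s /andP[s0 _]; case: (leP (s - t) 0) => h; first by rewrite mul0r mulr0.
  by rewrite mulrCA ler_peMr ?(ltW h)// mulrC ler_pdivlMr// mul1r; lra.
apply: cuntz_scale; first by rewrite invr_ge0 ltW.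
apply: cuntz_refl; apply: cpos_fc; rewrite ?c0 ?mul0r// => s /andP[s0 _].
by rewrite mulr_ge0// le_max lexx orbT.
Qed.

(** Multiplying the conjugator of [a'] by an approximate unit of [a'] makes it annihilate [b'], and
    conversely; the cross terms then vanish exactly. *)
Lemma cuntz_add a b a' b' : cpos a' -> cpos b' -> a' ** b' = 0 -> a ≾ a' -> b ≾ b' -> a + b ≾ a' + b'.
Proof.
move=> pa pb ab /cuntzP ha /cuntzP hb; apply/cuntzP => e e0.
have e2 : 0 < e / 2 by rewrite divr_gt0.
have fnd c c' : cpos c' -> (forall d : R, 0 < d -> exists v, nrm (c - v ** c' ** star v) < d) ->
    exists2 w, nrm (c - w ** c' ** star w) < e / 2 & exists k t, 0 < t /\ w = k ** fc (au t) c'.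
  move=> pc h; have e4 : 0 < e / 4 by rewrite divr_gt0.
  have [v hv] := h _ e4; have nv := nrm_ge0 v.
  have v1 : 0 < nrm v ^+ 2 + 1 by rewrite ltr_wpDl// exprn_ge0.
  pose t := e / 8 / (nrm v ^+ 2 + 1); have t0 : 0 < t by rewrite !divr_gt0.
  have tE : t * (nrm v ^+ 2 + 1) = e / 8 by rewrite /t divfK// gt_eqF.
  exists (v ** fc (au t) c'); last by exists v, t.
  rewrite (le_lt_trans (nrm_dist3 _ (v ** c' ** star v) _))//.
  rewrite starM (star_fc (cpos_sa pc) (cont_au t0) (au0 t)).
  have -> : v ** c' ** star v - v ** fc (au t) c' ** c' ** (fc (au t) c' ** star v) =
      v ** (c' - fc (au t) c' ** c' ** fc (au t) c') ** star v.
    by rewrite cmulBr cmulBl !cmulA.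
  have := nrmM (v ** (c' - fc (au t) c' ** c' ** fc (au t) c')) (star v).
  have := nrmM v (c' - fc (au t) c' ** c' ** fc (au t) c'); rewrite nrm_star.
  have := au_mul t0 pc; move: (nrm (c' - _)) => m; have := nrm_ge0 v.
  move: (nrm (v ** _)) (nrm (v ** _ ** _)) => p q.
  by nra.
have [v hv [k1 [t1 [t10 vE]]]] := fnd _ _ pa ha; have [w hw [k2 [t2 [t20 wE]]]] := fnd _ _ pb hb.
have z1 : v ** b' = 0.
  rewrite vE -cmulA; have -> : fc (au t1) a' ** b' = 0; last by rewrite cmulr0.
  have -> : fc (au t1) a' ** b' = b' ** fc (au t1) 0.
    by apply: fc_intertwine; rewrite ?star0 ?cmulr0//; [exact: cpos_sa|exact: cont_au|exact: au0].
  have -> : fc (au t1) (0 : D) = 0; last by rewrite cmulr0.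
  apply: nrm_le0; apply: fc_le; rewrite ?star0 ?nrm0//; [exact: cont_au|exact: au0|].
  by move=> s; rewrite normr_le0 => /eqP ->; rewrite au0 normr0.
have ba : b' ** a' = 0.
  by have := congr1 star ab; rewrite starM star0 !cpos_sa.
have z2 : w ** a' = 0.
  rewrite wE -cmulA; have -> : fc (au t2) b' ** a' = 0; last by rewrite cmulr0.
  have -> : fc (au t2) b' ** a' = a' ** fc (au t2) 0.
    by apply: fc_intertwine; rewrite ?star0 ?cmulr0//; [exact: cpos_sa|exact: cont_au|exact: au0].
  have -> : fc (au t2) (0 : D) = 0; last by rewrite cmulr0.
  apply: nrm_le0; apply: fc_le; rewrite ?star0 ?nrm0//; [exact: cont_au|exact: au0|].
  by move=> s; rewrite normr_le0 => /eqP ->; rewrite au0 normr0.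
have z1' : b' ** star v = 0 by have := congr1 star z1; rewrite starM star0 (cpos_sa pb).
have z2' : a' ** star w = 0 by have := congr1 star z2; rewrite starM star0 (cpos_sa pa).
exists (v + w).
have -> : (v + w) ** (a' + b') ** star (v + w) = v ** a' ** star v + w ** b' ** star w.
  rewrite starD !cmulDl !cmulDr z1 z2 !cmulDl !cmul0r -!cmulA z1' z2' !cmulr0.
  by rewrite !(add0r, addr0).
rewrite opprD addrACA (le_lt_trans (nrmD _ _))// [e]splitr ltrD//.
Qed.

(** With [y] the square root of [cut e a], the square of [cut e a] is [y (a - e) y]; the
    perturbation [x] is absorbed by [e], which leaves [y ** b ** y]. *)
Lemma cut_le_pert a b x e : 0 <= e -> cpos a -> cpos b -> star x = x -> nrm x <= e -> a =<= b + x -> cut e a ≾ b.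
Proof.
move=> t0 pa pb xx ab le; have aa := cpos_sa pa; have bb := cpos_sa pb.
have pc := cpos_cut t0 pa; have ct := @cont_cut R e; have c0 := cut_00 t0.
have cc := cpos_sa pc; apply: cuntz_trans (cuntz_sq pc) _.
pose y := sqc (cut e a); have yy : star y = y by exact: star_sqc.
have yE : y = fc (fun s => Num.sqrt (Num.max (s - e) 0)) a.
  by rewrite /y /sqc fc_comp ?sqrtr0//; exact: sqrt_continuous.
have cy : continuous (fun s => Num.sqrt (Num.max (s - e) 0)) by cts.
apply: (@cuntz_trans (y ** b ** y)); last by have := cuntz_conj b y; rewrite yy.
apply: cle_cuntz; first exact: cpos_sq.
have E : cut e a ** cut e a = y ** a ** y - e%:C *: (y ** y).
  rewrite yE -[X in _ ** X ** _](fc_id aa) -!fcM ?c0 ?sqrtr0 ?mul0r//; try by cts.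
  rewrite -fcZ ?c0 ?sqrtr0 ?mul0r//; last by cts.
  rewrite -fcB ?c0 ?sqrtr0 ?mulr0 ?mul0r//; try by cts.
  congr fc; apply/funext => s; case: (leP (s - e) 0) => h; first by rewrite sqrtr0; ring.
  by have := sqr_sqrtr (ltW h); move: (Num.sqrt _) => p pE; rewrite -pE (_ : s = p ^+ 2 + e); [ring|rewrite pE; ring].
rewrite /cle E; have := cposD (@cpos_nrm R D x e y xx ab) (cpos_sac yy le); rewrite yy cmulBr cmulDr cmulBl cmulDl.
by congr cpos; zmod.
Qed.

Lemma cuntz_close a b t : 0 <= t -> cpos a -> cpos b -> nrm (a - b) <= t -> cut t a ≾ b.
Proof.
move=> t0 pa pb ab; apply: (@cut_le_pert _ _ (a - b)) => //; first by rewrite starB !cpos_sa.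
by rewrite /cle (_ : b + (a - b) - a = 0); [exact: cpos_0 | zmod].
Qed.

(** The conjugator that works for [e / 2] is kept, and [d] is taken small against the square of its
    norm. *)
Lemma cuntz_cut_cut a b e : cpos a -> cpos b -> a ≾ b -> 0 < e -> exists2 d : R, 0 < d & cut e a ≾ cut d b.
Proof.
move=> pa pb /cuntzP ab e0; have e2 : 0 < e / 2 by rewrite divr_gt0.
have [v hv] := ab _ e2; have nv := nrm_ge0 v.
have v1 : 0 < nrm v ^+ 2 + 1 by rewrite ltr_wpDl// exprn_ge0.
pose d := e / 2 / (nrm v ^+ 2 + 1); have d0 : 0 < d by rewrite !divr_gt0.
exists d => //; have pd := cpos_cut (ltW d0) pb.
apply: cuntz_trans (cuntz_conj _ v); apply: cuntz_close (ltW e0) pa (cpos_conj' _ pd) _.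
rewrite (le_trans (nrm_dist3 _ (v ** b ** star v) _))// [leRHS]splitr lerD ?(ltW hv)//.
rewrite -cmulBl -cmulBr; have := nrmM (v ** (b - cut d b)) (star v).
have := nrmM v (b - cut d b); rewrite nrm_star; have := cut_dist (ltW d0) pb.
have dE : d * (nrm v ^+ 2 + 1) = e / 2 by rewrite /d divfK// gt_eqF.
move: (nrm (b - _)) (nrm (v ** _)) (nrm (v ** _ ** _)) => p q s.
by nra.
Qed.

End CuntzBasics.

(** * Direct sums in a stabilization *)

Section HilbertBasics.
Context {R : realType} {H : hilbertType R}.
Implicit Types (x y : H) (k l g : H -> H).

Lemma linD k : linear k -> forall x y, k (x + y) = k x + k y.
Proof. by move=> lk x y; have := lk 1 x y; rewrite !scale1r. Qed.

Lemma lin0 k : linear k -> k 0 = 0.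
Proof. by move=> lk; apply: (addrI (k 0)); rewrite -linD// !addr0. Qed.

Lemma linZ k : linear k -> forall (z : R[i]) x, k (z *: x) = z *: k x.
Proof. by move=> lk z x; have := lk z x 0; rewrite (lin0 lk) !addr0. Qed.

Lemma inner_nrm x : inner x x = (nrm x ^+ 2)%:C.
Proof. by rewrite inner_norm rmorphXn/= nrmE. Qed.

Lemma compact_comp_r k g : compact_op k -> linear g -> continuous g -> compact_op (g \o k).
Proof.
move=> [lk ck] lg cg; split; first by move=> z x y /=; rewrite lk lg.
move: ck; rewrite !precompactE => ck.
have cK : compact (g @` closure (k @` [set x | `|x| <= 1])).
  by apply: continuous_compact => //; exact: continuous_subspaceT.
apply: (subclosed_compact _ cK); first exact: closed_closure.
have -> : g @` closure (k @` [set x | `|x| <= 1]) = closure (g @` closure (k @` [set x | `|x| <= 1])).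
  by apply/closure_id; apply: compact_closed cK; exact: norm_hausdorff.
by apply: closureS => _ [x Bx <-]; exists (k x) => //; apply: subset_closure; exists x.
Qed.

Lemma compact_comp_l k g : compact_op k -> linear g -> (forall x, nrm (g x) <= nrm x) -> compact_op (k \o g).
Proof.
move=> [lk ck] lg cg; split; first by move=> z x y /=; rewrite lg lk.
move: ck; rewrite !precompactE => ck.
apply: subclosed_compact ck _; first exact: closed_closure.
apply: closureS => _ [x Bx <-]; exists (g x) => //=.
by move: Bx => /=; rewrite -!nrm_le => Bx; exact: le_trans (cg x) Bx.
Qed.

Lemma lin_contr_continuous g : linear g -> (forall x, nrm (g x) <= nrm x) -> continuous g.
Proof.
move=> lg cg x; apply/nrm_cvgP => e e0.
have /nrm_cvgP/(_ e e0) : (fun y : H => y) @ x --> x by exact: cvg_id.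
apply: filterS => y; apply: le_lt_trans.
by rewrite -(scaleN1r (g y)) -(linZ lg) -linD// scaleN1r cg.
Qed.

Lemma nrm_continuous : continuous (fun x : H => nrm x).
Proof.
move=> x; apply/cvgrPdist_lt => e e0.
have /nrm_cvgP/(_ e e0) : (fun y : H => y) @ x --> x by exact: cvg_id.
apply: filterS => y; apply: le_lt_trans.
rewrite ler_norml; have := nrm_le_dist x y; have := nrm_le_dist y x; rewrite nrm_distC; lra.
Qed.

Lemma compact_bdd k : compact_op k -> exists2 C : R, 0 < C & forall x, nrm (k x) <= C * nrm x.
Proof.
move=> [lk]; rewrite precompactE => ck.
have : compact ((fun x : H => nrm x) @` closure (k @` [set x | `|x| <= 1])).
  by apply: continuous_compact => //; apply: continuous_subspaceT; exact: nrm_continuous.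
move=> /compact_bounded[M [_ /(_ (`|M| + 1))]].
rewrite (le_lt_trans (ler_norm _)) ?ltrDl ?ltr01// => /(_ isT) Mb.
exists (`|M| + 1) => [|x]; first by rewrite ltr_wpDl.
have [x0|x0] := eqVneq x 0; first by rewrite x0 lin0// !nrm0 mulr0.
have nx : 0 < nrm x by rewrite lt_def nrm_ge0 nrm_eq0 x0.
have y1 : nrm ((nrm x)^-1%:C *: x) <= 1.
  by rewrite nrmZr ger0_norm ?invr_ge0 ?nrm_ge0// mulVf ?gt_eqF.
have kE : nrm (k ((nrm x)^-1%:C *: x)) = nrm (k x) / nrm x.
  by rewrite linZ// nrmZr ger0_norm ?invr_ge0 ?nrm_ge0// mulrC.
rewrite -ler_pdivrMr// -kE; apply: le_trans (ler_norm _) _; apply: Mb.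
exists (k ((nrm x)^-1%:C *: x)) => //; apply: subset_closure.
by exists ((nrm x)^-1%:C *: x) => //=; rewrite -[1]/(1%:C) -nrm_le.
Qed.

Lemma scale_continuous (c : R[i]) : continuous (fun x : H => c *: x).
Proof. by move=> x; apply: cvgZr; exact: cvg_id. Qed.

Lemma compact_comp k l : compact_op k -> compact_op l -> compact_op (k \o l).
Proof.
move=> ck cl; have [C C0 hC] := compact_bdd cl; have lk := ck.1; have ll := cl.1.
have -> : k \o l = ((fun x => C%:C *: x) \o k) \o (fun x => C^-1%:C *: l x).
  apply/funext => x /=; rewrite linZ// scalerA -rmorphM/= divff ?gt_eqF// scale1r//.
apply: compact_comp_l => [||x].
- apply: compact_comp_r ck _ _; last exact: scale_continuous.
  by move=> z x y; rewrite scalerDr !scalerA mulrC.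
- by move=> z x y; rewrite ll scalerDr !scalerA mulrC.
- by rewrite nrmZr ger0_norm ?invr_ge0 ?(ltW C0)// mulrC ler_pdivrMr// mulrC.
Qed.

End HilbertBasics.

Section Stab.
Context {R : realType} {B : cstarAlgType R} {S : stabilization B}.
Local Notation H := (hilb S).
Local Notation D := (stab S).
Local Notation t := (@tens _ _ S).
Implicit Types (a b d s z : D).

Lemma fold_nrm (p : H * H) : nrm (fold p) ^+ 2 = nrm p.1 ^+ 2 + nrm p.2 ^+ 2.
Proof. by apply: (@complexI R); rewrite rmorphD/= -!inner_nrm fold_inner. Qed.

Definition V1 (x : H) : H := @fold _ _ S (x, 0).

Definition V2 (x : H) : H := @fold _ _ S (0, x).

Definition W1 (x : H) : H := (@unfold _ _ S x).1.

Definition W2 (x : H) : H := (@unfold _ _ S x).2.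

Lemma unfold_linear (z : R[i]) (x y : H) : unfold (z *: x + y) = z *: @unfold _ _ S x + unfold y.
Proof.
by apply: (can_inj (@foldK _ _ S)); rewrite fold_linear !unfoldK.
Qed.

Lemma V1_linear : linear V1.
Proof.
move=> z x y; rewrite /V1 -fold_linear; congr fold.
by transitivity ((z *: x + y, z *: 0 + 0) : H * H); [rewrite scaler0 addr0|].
Qed.

Lemma V2_linear : linear V2.
Proof.
move=> z x y; rewrite /V2 -fold_linear; congr fold.
by transitivity ((z *: 0 + 0, z *: x + y) : H * H); [rewrite scaler0 addr0|].
Qed.

Lemma W1_linear : linear W1. Proof. by move=> z x y; rewrite /W1 unfold_linear. Qed.

Lemma W2_linear : linear W2. Proof. by move=> z x y; rewrite /W2 unfold_linear. Qed.

Lemma W1V1 : cancel V1 W1. Proof. by move=> x; rewrite /W1 /V1 foldK. Qed.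

Lemma W2V2 : cancel V2 W2. Proof. by move=> x; rewrite /W2 /V2 foldK. Qed.

Lemma le_of_sq (x y : R) : 0 <= y -> x ^+ 2 <= y ^+ 2 -> x <= y.
Proof. by move=> y0; have [x0|x0] := leP 0 x; [rewrite ler_pXn2r|move=> _; apply: le_trans y0; exact: ltW]. Qed.

Lemma V1_nrm x : nrm (V1 x) <= nrm x.
Proof. by apply: le_of_sq; rewrite ?nrm_ge0// fold_nrm/= nrm0 expr0n addr0. Qed.

Lemma V2_nrm x : nrm (V2 x) <= nrm x.
Proof. by apply: le_of_sq; rewrite ?nrm_ge0// fold_nrm/= nrm0 expr0n add0r. Qed.

Lemma W1_nrm x : nrm (W1 x) <= nrm x.
Proof.
by apply: le_of_sq; rewrite ?nrm_ge0// -{2}(@unfoldK _ _ S x) fold_nrm lerDl exprn_ge0 ?nrm_ge0.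
Qed.

Lemma W2_nrm x : nrm (W2 x) <= nrm x.
Proof.
by apply: le_of_sq; rewrite ?nrm_ge0// -{2}(@unfoldK _ _ S x) fold_nrm lerDr exprn_ge0 ?nrm_ge0.
Qed.

Lemma tens0 k : compact_op k -> t 0 k = 0.
Proof.
move=> ck; have := tens_linearl (tensP S) ck 0 0 0.
by rewrite !scale0r !add0r => _; have := tens_linearl (tensP S) ck (-1) 0 0; rewrite !scaleN1r !addNr.
Qed.

Lemma tens_approx z (e : R) : 0 < e -> exists n (b : 'I_n -> B) (k : 'I_n -> H -> H),
  (forall i, compact_op (k i)) /\ nrm (z - \sum_i t (b i) (k i)) < e.
Proof.
move=> e0; have eC : 0 < e%:C :> R[i] by rewrite ltcR.
have := tens_dense (tensP S) => /(_ (ball z e%:C)^°) h.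
have [||d [/interior_subset zd [n [b [k [ck dE]]]]]] := h.
- by exists z; exact: nbhsx_ballx.
- exact: open_interior.
by exists n, b, k; split=> //; move: zd; rewrite -ball_normE/= dE nrm_lt.
Qed.

Lemma tens_ind (P : D -> Prop) :
  (forall z, (forall e : R, 0 < e -> exists2 z', nrm (z - z') < e & P z') -> P z) ->
  (forall (b : B) k, compact_op k -> P (t b k)) -> P 0 -> (forall x y, P x -> P y -> P (x + y)) ->
  forall z, P z.
Proof.
move=> hlim ht h0 hD z; apply: hlim => e /(tens_approx z)[n [b [k [ck zE]]]].
by exists (\sum_i t (b i) (k i)) => //; elim/big_ind: _ => // i _; exact: ht.
Qed.

Lemma bounded_lim_eq (f g : D -> D) (C : R) :
  (forall x y, nrm (f x - f y) <= C * nrm (x - y)) -> (forall x y, nrm (g x - g y) <= C * nrm (x - y)) ->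
  forall z, (forall e : R, 0 < e -> exists2 z', nrm (z - z') < e & f z' = g z') -> f z = g z.
Proof.
move=> hf hg z h; apply/eqP; rewrite -subr_eq0 -nrm_eq0 eq_le nrm_ge0 andbT.
apply/ler_addgt0Pr => e e0; rewrite add0r.
pose d := e / (2 * `|C| + 1); have c1 : 0 < 2 * `|C| + 1 by rewrite ltr_wpDl// mulr_ge0.
have d0 : 0 < d by rewrite divr_gt0.
have dE : d * (2 * `|C| + 1) = e by rewrite /d divfK// gt_eqF.
have [z' zz' E] := h d d0.
rewrite (le_trans (nrm_dist3 _ (f z') _))// {2}E (nrm_distC (g z')).
have := hf z z'; have := hg z z'; have := ler_norm C; have := nrm_ge0 (z - z'); have := normr_ge0 C.
by nra.
Qed.

Definition dl a : D := dsum a 0.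

Definition dr a : D := dsum 0 a.

Lemma dsum0 : dsum 0 0 = 0 :> D.
Proof.
have := @dsum_linear _ _ S 0 0 0 0 0; rewrite !scale0r !add0r => _.
by have := @dsum_linear _ _ S (-1) 0 0 0 0; rewrite !scaleN1r !addNr.
Qed.

Lemma dsumD a b a' b' : dsum (a + a') (b + b') = dsum a b + dsum a' b' :> D.
Proof. by have := @dsum_linear _ _ S 1 a b a' b'; rewrite !scale1r. Qed.

Lemma dsumE a b : dsum a b = dl a + dr b.
Proof. by rewrite /dl /dr -dsumD addr0 add0r. Qed.

Lemma dl_hom : star_hom dl.
Proof.
split=> [z a b|a b|a]; rewrite /dl.
- by rewrite -dsum_linear scaler0 addr0.
- by rewrite -dsumM cmulr0.
- by rewrite -dsum_star star0.
Qed.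

Lemma dr_hom : star_hom dr.
Proof.
split=> [z a b|a b|a]; rewrite /dr.
- by rewrite -dsum_linear scaler0 addr0.
- by rewrite -dsumM cmulr0.
- by rewrite -dsum_star star0.
Qed.

Lemma dldr a b : dl a ** dr b = 0.
Proof. by rewrite /dl /dr -dsumM cmulr0 cmul0r dsum0. Qed.

Lemma dl_tens (b : B) k : compact_op k -> dl (t b k) = t b (V1 \o k \o W1).
Proof.
move=> ck; rewrite /dl; have := @dsum_tens _ _ S b 0 k k ck ck; rewrite tens0// => -> //.
rewrite [X in _ + X]tens0 ?addr0//.
have h := compact_comp_r ck V2_linear (lin_contr_continuous V2_linear V2_nrm).
exact: (compact_comp_l h W2_linear W2_nrm).
Qed.

Lemma dr_tens (b : B) k : compact_op k -> dr (t b k) = t b (V2 \o k \o W2).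
Proof.
move=> ck; rewrite /dr; have := @dsum_tens _ _ S 0 b k k ck ck; rewrite tens0// => -> //.
rewrite [X in X + _]tens0 ?add0r//.
have h := compact_comp_r ck V1_linear (lin_contr_continuous V1_linear V1_nrm).
exact: (compact_comp_l h W1_linear W1_nrm).
Qed.

End Stab.

Section Corner.
Context {R : realType} {B : cstarAlgType R} {S : stabilization B}.
Local Notation H := (hilb S).
Local Notation D := (stab S).
Local Notation t := (@tens _ _ S).
Variables (al : D -> D) (V W : H -> H).
Hypotheses (hal : star_hom al) (lV : linear V) (lW : linear W) (nV : forall x, nrm (V x) <= nrm x)
  (nW : forall x, nrm (W x) <= nrm x) (VK : cancel V W)
  (alE : forall (b : B) k, compact_op k -> al (t b k) = t b (V \o k \o W)).
Implicit Types (a b d s z : D).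

Let cVk k : compact_op k -> compact_op (V \o k).
Proof. by move=> ck; exact: (compact_comp_r ck lV (lin_contr_continuous lV nV)). Qed.

Let ckW k : compact_op k -> compact_op (k \o W).
Proof. by move=> ck; exact: (compact_comp_l ck lW nW). Qed.

Ltac cpt := solve [repeat first [assumption | match goal with h : forall i, compact_op _ |- _ => exact: h end | apply: cVk | apply: ckW | apply: compact_comp]].

(** [al] is conjugation by [V], which is not in the algebra. For a finite sum [s] of elementary
    tensors, however, [s] multiplied by [V] on the left or by [W] on the right is in it; these
    products [x] and [y] move elements into the corner and back. *)
Lemma corner_split d (e : R) : 0 < e -> exists s s' x y, [/\ nrm (d - s) < e, nrm (d - s') < e,
  forall z, x ** z ** y = al (s ** z ** s') & forall z, y ** al z ** x = s' ** z ** s].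
Proof.
move=> e0; have [n [b [k [ck sE]]]] := tens_approx d e0.
exists (\sum_i t (b i) (k i)), (\sum_i t (b i) (k i)), (\sum_i t (b i) (V \o k i)), (\sum_i t (b i) (k i \o W)).
have nrmC (u v w w' : D) : nrm (u ** w ** v - u ** w' ** v) <= nrm u * nrm v * nrm (w - w').
  rewrite -cmulBl -cmulBr (le_trans (nrmM _ _))// mulrAC.
  by rewrite ler_wpM2r ?nrm_ge0// nrmM.
have tM c c' l l' : compact_op l -> compact_op l' -> t c l ** t c' l' = t (c ** c') (l \o l').
  by move=> cl cl'; rewrite (tensM (tensP S)).
split=> //.
- set x := \sum_i t (b i) (V \o k i); set y := \sum_i t (b i) (k i \o W); set s := \sum_i _.
  apply: tens_ind => [z hz|c l cl||u v hu hv].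
  + pose C := nrm x * nrm y + nrm s * nrm s.
    apply: (@bounded_lim_eq _ _ _ (fun z => x ** z ** y) (fun z => al (s ** z ** s)) C) => // u v.
      by rewrite (le_trans (nrmC _ _ _ _))// ler_wpM2r ?nrm_ge0// lerDl mulr_ge0 ?nrm_ge0.
    rewrite -homB// (le_trans (hom_nrm hal _))// (le_trans (nrmC _ _ _ _))//.
    by rewrite ler_wpM2r ?nrm_ge0// lerDr mulr_ge0 ?nrm_ge0.
  + rewrite /x /y /s !cmul_suml (big_morph al (homD hal) (hom0 hal)).
    apply: eq_bigr => i _; rewrite !cmul_sumr (big_morph al (homD hal) (hom0 hal)).
    apply: eq_bigr => j _.
    rewrite tM; [|cpt|cpt]; rewrite tM; [|cpt|cpt]; rewrite tM; [|cpt|cpt]; rewrite tM; [|cpt|cpt].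
    have cc : compact_op (k i \o l \o k j) by cpt.
    by rewrite (alE _ cc).
  + by rewrite !cmulr0 !cmul0r hom0.
  + by rewrite !cmulDr !cmulDl hu hv homD.
- set x := \sum_i t (b i) (V \o k i); set y := \sum_i t (b i) (k i \o W); set s := \sum_i _.
  apply: tens_ind => [z hz|c l cl||u v hu hv].
  + pose C := nrm y * nrm x + nrm s * nrm s.
    apply: (@bounded_lim_eq _ _ _ (fun z => y ** al z ** x) (fun z => s ** z ** s) C) => // u v; last first.
      by rewrite (le_trans (nrmC _ _ _ _))// ler_wpM2r ?nrm_ge0// lerDr mulr_ge0 ?nrm_ge0.
    rewrite (le_trans (nrmC _ _ _ _))// ler_pM ?mulr_ge0 ?nrm_ge0// ?lerDl ?mulr_ge0 ?nrm_ge0//.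
    by rewrite -homB// hom_nrm.
  + rewrite alE// /x /y /s !cmul_suml.
    apply: eq_bigr => i _; rewrite !cmul_sumr; apply: eq_bigr => j _.
    have WV : (k i \o W) \o (V \o l \o W) \o (V \o k j) = k i \o l \o k j by apply/funext => h /=; rewrite !VK.
    have cVlW : compact_op (V \o l \o W) by apply: ckW; exact: cVk.
    rewrite tM; [|cpt|cpt]; rewrite tM; [|cpt|cpt]; rewrite tM; [|cpt|cpt]; rewrite tM; [|cpt|cpt].
    by rewrite WV.
  + by rewrite hom0// !cmulr0 !cmul0r.
  + by rewrite homD// !cmulDr !cmulDl hu hv.
Qed.

Lemma hom_cuntz (a b : D) : a ≾ b -> al a ≾ al b.
Proof.
move=> /cuntzP ab; apply/cuntzP => e /ab[v hv]; exists (al v).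
rewrite -(star_hom_star hal) -!(star_homM hal) -homB//.
exact: le_lt_trans (hom_nrm hal _) hv.
Qed.

Lemma hom_cpos (a : D) : cpos a -> cpos (al a).
Proof. by move=> [c ->]; exists (al c); rewrite (star_homM hal) (star_hom_star hal). Qed.

Lemma approx3 (d s s' : D) (e : R) : 0 <= e <= 1 -> nrm (d - s) <= e -> nrm (d - s') <= e ->
  nrm (d ** d ** d - s ** d ** s') <= e * (2 * (nrm d + 1) ^+ 2).
Proof.
move=> /andP[e0 e1] hs hs'.
have -> : d ** d ** d - s ** d ** s' = (d - s) ** d ** d + s ** d ** (d - s').
  by rewrite !(cmulBl, cmulBr); zmod.
have ns : nrm s <= nrm d + 1.
  by rewrite (le_trans (nrm_le_dist s d))// nrm_distC lerD2l (le_trans hs).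
have := nrmD ((d - s) ** d ** d) (s ** d ** (d - s')).
have := nrmM ((d - s) ** d) d; have := nrmM (d - s) d; have := nrmM (s ** d) (d - s').
have := nrmM s d; have := nrm_ge0 (s ** d); have := nrm_ge0 d; have := nrm_ge0 s; have := nrm_ge0 (d - s); have := nrm_ge0 (d - s').
move: (nrm (d - s)) (nrm (d - s')) (nrm s) (nrm d) (nrm (s ** d)) (nrm ((d - s) ** d)) (nrm ((d - s) ** d ** d)) (nrm (s ** d ** (d - s'))) hs hs' ns.
move=> p q u v w x y z hs hs' ns q0 p0 u0 v0 w0 h1 h2 h3 h4 h5.
apply: le_trans h5 _; have w1 : w <= (v + 1) ^+ 2 by nra.
have : w * q <= (v + 1) ^+ 2 * e by apply: ler_pM.
have : x * v <= e * (v + 1) ^+ 2 by nra.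
by lra.
Qed.

(** If [p] approximates the positive [c] and [p] is a product [x ** a ** y], then
    [c ** c] is approximated by [p ** star p], which is below [a]. *)
Lemma approx_prod_cuntz (c a : D) : cpos c -> cpos a ->
  (forall e : R, 0 < e -> exists x y, nrm (c - x ** a ** y) < e) -> c ≾ a.
Proof.
move=> pc pa h; have cc := cpos_sa pc; have aa := cpos_sa pa.
apply: (cuntz_trans (cuntz_sq pc)); apply: cuntz_of_cuts; first exact: cpos_sq.
move=> e e0; pose d := Num.min 1 (e / (2 * nrm c + 1)).
have c1 : 0 < 2 * nrm c + 1 by rewrite ltr_wpDl// mulr_ge0 ?nrm_ge0.
have d0 : 0 < d by rewrite lt_min ltr01 divr_gt0.
have d1 : d <= 1 by rewrite ge_min lexx.
have dE : d * (2 * nrm c + 1) <= e by rewrite -ler_pdivlMr// ge_min lexx orbT.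
have [x [y /ltW hp]] := h d d0; set p := x ** a ** y in hp.
apply: (@cuntz_trans _ _ (p ** star p)).
  apply: (cuntz_close (ltW e0)); [exact: cpos_sq|exact: cpos_ss'|].
  have -> : c ** c - p ** star p = (c - p) ** c + p ** (c - star p) by rewrite !(cmulBl, cmulBr); zmod.
  have hp' : nrm (c - star p) <= d by have := hp; rewrite -nrm_star starB cc.
  have np : nrm p <= nrm c + d by rewrite (le_trans (nrm_le_dist p c))// nrm_distC lerD2l.
  have := nrmD ((c - p) ** c) (p ** (c - star p)); have := nrmM (c - p) c; have := nrmM p (c - star p).
  have := nrm_ge0 c; have := nrm_ge0 p; have := nrm_ge0 (c - p); have := nrm_ge0 (c - star p).
  move: (nrm c) (nrm p) (nrm (c - p)) (nrm (c - star p)) dE hp np hp'.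
  by move=> u v w z dE hw hv hz *; nra.
have -> : p ** star p = x ** (a ** (y ** star y) ** a) ** star x.
  by rewrite /p !starM aa !cmulA.
apply: cuntz_trans (cuntz_conj _ _) _.
have h2 : a ** (y ** star y) ** a =<= ((nrm y) ^+ 2)%:C *: (a ** a).
  have := @cpos_nrm R D (y ** star y) (nrm y ^+ 2) a; rewrite aa; apply.
    by rewrite starM starK.
  by rewrite nrm_cstar2.
apply: (cuntz_trans (cle_cuntz _ h2)).
  by have := cpos_conj' a (cpos_ss' y); rewrite aa.
by apply: cuntz_scale; [rewrite exprn_ge0 ?nrm_ge0|exact: sq_cuntz].
Qed.

(** The cube leaves a middle factor when the two outer ones are approximated by the sums of
    [corner_split]. *)
Lemma cuntz_cube (a : D) : cpos a -> cpos (a ** a ** a) /\ a ≾ a ** a ** a.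
Proof.
move=> pa; have aa := cpos_sa pa; have c3 : continuous (fun s : R => s * s * s) by cts.
have E : a ** a ** a = fc (fun s : R => s * s * s) a.
  rewrite !fcM ?mulr0//; try by cts.
  by rewrite !(fc_id aa).
rewrite E; split.
  by apply: cpos_fc; rewrite ?mulr0// => s /andP[s0 _]; rewrite !mulr_ge0.
apply: cuntz_fc_ge; rewrite ?mulr0// => e e0; exists (e ^- 2); first by rewrite invr_gt0 exprn_gt0.
move=> s /andP[s0 _]; case: (leP (s - e) 0) => h; first by rewrite !mulr_ge0// invr_ge0 exprn_ge0// ltW.
rewrite mulrC ler_pdivlMr ?exprn_gt0//; have : 0 <= s * s - e ^+ 2 by nra.
by move=> h2; nra.
Qed.

Lemma corner_cuntz (a : D) : cpos a -> al a ≾ a /\ a ≾ al a.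
Proof.
move=> pa; have aa := cpos_sa pa; have [pa3 a3] := cuntz_cube pa.
have C0 : 0 < 2 * (nrm a + 1) ^+ 2 by rewrite mulr_gt0// exprn_gt0// ltr_wpDl ?nrm_ge0.
have dd (e : R) : 0 < e -> exists2 d : R, 0 <= d <= 1 & 0 < d /\ d * (2 * (nrm a + 1) ^+ 2) < e.
  move=> e0; exists (Num.min 1 (e / 2 / (2 * (nrm a + 1) ^+ 2))); last first.
    split; first by rewrite lt_min ltr01 !divr_gt0.
    apply: (@le_lt_trans _ _ (e / 2)); last by lra.
    by rewrite -ler_pdivlMr// ge_min lexx orbT.
  by rewrite ge_min lexx andbT le_min ler01/= ltW// !divr_gt0.
split.
  apply: cuntz_trans (hom_cuntz a3) _.
  apply: approx_prod_cuntz => //; first exact: hom_cpos.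
  move=> e /dd[d d01 [d0 de]]; have [s [s' [x [y [/ltW hs /ltW hs' hx _]]]]] := corner_split a d0.
  exists x, y; rewrite hx -homB//; apply: le_lt_trans de.
  by apply: (le_trans (hom_nrm hal _)); exact: approx3.
apply: cuntz_trans a3 _; apply: approx_prod_cuntz => //; first exact: hom_cpos.
move=> e /dd[d d01 [d0 de]]; have [s [s' [x [y [/ltW hs /ltW hs' _ hy]]]]] := corner_split a d0.
by exists y, x; rewrite hy; apply: le_lt_trans de; exact: approx3.
Qed.

End Corner.

Section CuMonoid.
Context {R : realType} {B : cstarAlgType R} {S : stabilization B}.
Local Notation D := (stab S).
Implicit Types (a b c : D).

Lemma dl_cuntz a : cpos a -> dl a ≾ a /\ a ≾ dl a.
Proof.
apply: (corner_cuntz dl_hom V1_linear W1_linear V1_nrm W1_nrm W1V1) => b k; exact: dl_tens.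
Qed.

Lemma dr_cuntz a : cpos a -> dr a ≾ a /\ a ≾ dr a.
Proof.
apply: (corner_cuntz dr_hom V2_linear W2_linear V2_nrm W2_nrm W2V2) => b k; exact: dr_tens.
Qed.

Lemma cpos_dl a : cpos a -> cpos (dl a). Proof. exact: (hom_cpos dl_hom). Qed.

Lemma cpos_dr a : cpos a -> cpos (dr a). Proof. exact: (hom_cpos dr_hom). Qed.

Lemma dsum_mono a b a' b' : cpos a' -> cpos b' -> cpos a -> cpos b ->
  a ≾ a' -> b ≾ b' -> dsum a b ≾ dsum a' b'.
Proof.
move=> pa' pb' pa pb ha hb; rewrite !dsumE; apply: cuntz_add; rewrite ?dldr//.
- exact: cpos_dl.
- exact: cpos_dr.
- by apply: (hom_cuntz dl_hom).
- by apply: (hom_cuntz dr_hom).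
Qed.

Lemma add_le_dsum a b : cpos a -> cpos b -> a + b ≾ dsum a b.
Proof.
move=> pa pb; rewrite dsumE; apply: cuntz_add; rewrite ?dldr//.
- exact: cpos_dl.
- exact: cpos_dr.
- exact: (dl_cuntz pa).2.
- exact: (dr_cuntz pb).2.
Qed.

Lemma dsum_le_add a b : cpos a -> cpos b -> a ** b = 0 -> dsum a b ≾ a + b.
Proof.
move=> pa pb ab; rewrite dsumE; apply: cuntz_add => //; [exact: (dl_cuntz pa).1|exact: (dr_cuntz pb).1].
Qed.

End CuMonoid.

(** * The Cuntz semigroup *)

(** The sum of classes depends on the folding unitary of [S], which [Cu (stab S)] does not mention;
    the alias carries [S], so that addition can be a canonical structure. *)
Definition CuM (R : realType) (B : cstarAlgType R) (S : stabilization B) : Type := Cu (stab S).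

Notation "x ⊑ y" := (@cu_le _ _ _ x y) (at level 70).

Section CuMonoid2.
Context {R : realType} {B : cstarAlgType R} {S : stabilization B}.
Local Notation D := (stab S).
Implicit Types (a b c : D) (x y z : CuM S).

(** Total, with value 0 on elements that are not positive. *)
Definition cl a : CuM S := if pselect (cpos a) is left pa then cu_class pa else cu0.

Lemma clE a (pa : cpos a) : cl a = cu_class pa.
Proof. by rewrite /cl; case: pselect => // pa'; congr cu_class; exact: Prop_irrelevance. Qed.

Lemma cuntz_class_eq a b : cpos a -> cpos b -> cuntz_class a = cuntz_class b <-> (a ≾ b /\ b ≾ a).
Proof.
move=> pa pb; split=> [E|[ab ba]].
  have : cuntz_class b b by split=> //; exact: cuntz_refl.
  by rewrite -E => -[].
apply/seteqP; split=> c [pc h1 h2]; split=> //.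
- exact: cuntz_trans ba h1.
- exact: cuntz_trans h2 ab.
- exact: cuntz_trans ab h1.
- exact: cuntz_trans h2 ba.
Qed.

Lemma Cu_ext x y : sval x = sval y -> x = y.
Proof. by move: x y => [x hx] [y hy] /= xy; subst y; congr exist; exact: Prop_irrelevance. Qed.

Lemma representsE a x : represents a x <-> cpos a /\ x = cl a.
Proof.
split=> -[pa xa]; split=> //; last by rewrite xa (clE pa).
by apply: Cu_ext; rewrite (clE pa).
Qed.

Lemma cl_rep a : cpos a -> represents a (cl a).
Proof. by move=> pa; apply/representsE. Qed.

Lemma cl_surj x : exists2 a, cpos a & x = cl a.
Proof. by have [a /representsE[pa xa]] := cu_rep x; exists a. Qed.

Lemma cl_eq a b : cpos a -> cpos b -> cl a = cl b <-> (a ≾ b /\ b ≾ a).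
Proof.
move=> pa pb; rewrite -cuntz_class_eq// (clE pa) (clE pb); split=> [/(congr1 sval)//|h].
exact: Cu_ext.
Qed.

Lemma cl_le a b : cpos a -> cpos b -> cl a ⊑ cl b <-> a ≾ b.
Proof.
move=> pa pb; split=> [[a' [b' [/representsE[pa' E1] /representsE[pb' E2] h]]]|ab].
  have [h1 _] := (cl_eq pa pa').1 E1; have [_ h2] := (cl_eq pb pb').1 E2.
  exact: cuntz_trans h1 (cuntz_trans h h2).
by exists a, b; split=> //; exact: cl_rep.
Qed.

Lemma cule_refl x : x ⊑ x.
Proof. by have [a pa ->] := cl_surj x; apply/cl_le => //; exact: cuntz_refl. Qed.

Lemma cule_trans y x z : x ⊑ y -> y ⊑ z -> x ⊑ z.
Proof.
have [a pa ->] := cl_surj x; have [b pb ->] := cl_surj y; have [c pc ->] := cl_surj z.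
by move=> /cl_le ab /cl_le bc; apply/cl_le => //; apply: cuntz_trans (ab _ _) (bc _ _).
Qed.

Lemma cule_anti x y : x ⊑ y -> y ⊑ x -> x = y.
Proof.
have [a pa ->] := cl_surj x; have [b pb ->] := cl_surj y.
by move=> /(cl_le pa pb) h1 /(cl_le pb pa) h2; apply/cl_eq.
Qed.

Lemma cl_dsum a b : cpos a -> cpos b -> cu_add (cl a) (cl b) = cl (dsum a b).
Proof.
move=> pa pb; rewrite /cu_add.
case: (cu_rep (cl a)) (cu_rep (cl b)) => a' ra [b' rb] /=.
have [pa' Ea] := (representsE _ _).1 ra; have [pb' Eb] := (representsE _ _).1 rb.
have [h1 h2] := (cl_eq pa pa').1 Ea; have [h3 h4] := (cl_eq pb pb').1 Eb.
rewrite -clE; apply/cl_eq; [exact: cpos_dsum|exact: cpos_dsum|].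
by split; apply: dsum_mono.
Qed.

Let addC : commutative (@cu_add _ _ S).
Proof.
move=> x y; have [a pa ->] := cl_surj x; have [b pb ->] := cl_surj y.
have H (u v : D) : cpos u -> cpos v -> dsum u v ≾ dsum v u.
  move=> pu pv; rewrite !dsumE (addrC (dl v)); apply: cuntz_add.
  - exact: cpos_dr.
  - exact: cpos_dl.
  - by have := congr1 star (dldr v u); rewrite starM star0 !cpos_sa//; [exact: cpos_dl|exact: cpos_dr].
  - exact: cuntz_trans (dl_cuntz pu).1 (dr_cuntz pu).2.
  - exact: cuntz_trans (dr_cuntz pv).1 (dl_cuntz pv).2.
by rewrite !cl_dsum//; apply/cl_eq; [exact: cpos_dsum|exact: cpos_dsum|split; apply: H].
Qed.

Let addA : associative (@cu_add _ _ S).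
Proof.
move=> x y z; have [a pa ->] := cl_surj x; have [b pb ->] := cl_surj y; have [c pc ->] := cl_surj z.
have pd (u v : D) : cpos u -> cpos v -> cpos (dsum u v) by move=> pu pv; exact: cpos_dsum.
have dlp (u : D) : cpos u -> cpos (dl u) by exact: cpos_dl.
have drp (u : D) : cpos u -> cpos (dr u) by exact: cpos_dr.
have [dlD drD] := (homD (@dl_hom _ _ S), homD (@dr_hom _ _ S)).
have [dlM drM] := (star_homM (@dl_hom _ _ S), star_homM (@dr_hom _ _ S)).
have L (u : D) (pu : cpos u) : dl (dl u) ≾ u /\ u ≾ dl (dl u).
  by split; [exact: cuntz_trans (dl_cuntz (dlp _ pu)).1 (dl_cuntz pu).1|exact: cuntz_trans (dl_cuntz pu).2 (dl_cuntz (dlp _ pu)).2].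
rewrite !cl_dsum//; try by apply: (pd).
apply/cl_eq; [by apply: (pd) => //; apply: (pd)|by apply: (pd) => //; apply: (pd)|].
rewrite !dsumE !dlD !drD; split.
- rewrite addrA; apply: cuntz_add; [by apply: cposD; apply: (dlp); [exact: dlp|exact: drp]|exact: drp| | | ].
  + by rewrite -dlD dldr.
  + apply: cuntz_add; [by apply: (dlp); exact: dlp|by apply: (dlp); apply: (drp)| | |].
    * by rewrite -dlM dldr (hom0 dl_hom).
    * exact: cuntz_trans (dl_cuntz pa).1 (L _ pa).2.
    * apply: cuntz_trans (dr_cuntz (dlp _ pb)).1 _; apply: cuntz_trans (dl_cuntz pb).1 _.
      by apply: cuntz_trans (dr_cuntz pb).2 _; exact: (dl_cuntz (drp _ pb)).2.
  + by apply: cuntz_trans (dr_cuntz (drp _ pc)).1 _; exact: cuntz_refl (drp _ pc).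
- rewrite -addrA; apply: cuntz_add; [exact: dlp|by apply: cposD; apply: (drp); [exact: dlp|exact: drp]| | | ].
  + by rewrite -drD dldr.
  + exact: (dl_cuntz (dlp _ pa)).1.
  + apply: cuntz_add; [by apply: (drp); apply: (dlp)|by apply: (drp); exact: drp| | |].
    * by rewrite -drM dldr (hom0 dr_hom).
    * apply: cuntz_trans (dl_cuntz (drp _ pb)).1 _; apply: cuntz_trans (dr_cuntz pb).1 _.
      by apply: cuntz_trans (dl_cuntz pb).2 _; exact: (dr_cuntz (dlp _ pb)).2.
    * by apply: cuntz_trans (dr_cuntz pc).1 _; apply: cuntz_trans (dr_cuntz pc).2 _; exact: (dr_cuntz (drp _ pc)).2.
Qed.

Let add0 : left_id (@cu0 _ _ S) (@cu_add _ _ S).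
Proof.
move=> x; have [a pa ->] := cl_surj x; rewrite /cu0 -clE cl_dsum//; last exact: cpos_0.
have p0 : cpos (0 : D) := cpos_0.
apply/cl_eq => //; first exact: cpos_dsum.
exact: dr_cuntz pa.
Qed.

HB.instance Definition _ := gen_eqMixin (CuM S).
HB.instance Definition _ := gen_choiceMixin (CuM S).
HB.instance Definition _ := GRing.isNmodule.Build (CuM S) addA addC add0.

Lemma cl_add a b : cpos a -> cpos b -> cl a + cl b = cl (dsum a b).
Proof. exact: cl_dsum. Qed.

Lemma cu_mulE n x : cu_mul n x = x *+ n. Proof. by []. Qed.

Lemma cl0 : cl 0 = 0. Proof. by rewrite (clE (@cpos0 _ _ S)). Qed.

Lemma cule0x x : (0 : CuM S) ⊑ x.
Proof.
have [a pa ->] := cl_surj x; rewrite -cl0; apply/cl_le => //; first exact: cpos_0.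
by have := cuntz_scale (lexx 0) (cuntz_refl pa); rewrite scale0r.
Qed.

Lemma culeD x y x' y' : x ⊑ x' -> y ⊑ y' -> x + y ⊑ x' + y'.
Proof.
have [a pa ->] := cl_surj x; have [b pb ->] := cl_surj y.
have [c pc ->] := cl_surj x'; have [d pd ->] := cl_surj y'.
move=> /(cl_le pa pc) h1 /(cl_le pb pd) h2; rewrite !cl_add//.
by apply/cl_le; [exact: cpos_dsum|exact: cpos_dsum|exact: dsum_mono].
Qed.

Lemma culeDl x y : x ⊑ x + y.
Proof. by rewrite -{1}(addr0 x); apply: culeD; [exact: cule_refl|exact: cule0x]. Qed.

Lemma culeDr x y : x ⊑ y + x. Proof. by rewrite addrC; exact: culeDl. Qed.

Lemma culeMn n x y : x ⊑ y -> x *+ n ⊑ y *+ n.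
Proof. by move=> xy; elim: n => [|n ih]; [exact: cule_refl|rewrite !mulrS; exact: culeD]. Qed.

Lemma culeMnl m n x : (m <= n)%N -> x *+ m ⊑ x *+ n.
Proof. by move=> mn; rewrite -(subnK mn) mulrnDr; exact: culeDr. Qed.

Lemma cule_sum I (r : seq I) (P : pred I) (F G : I -> CuM S) :
  (forall i, P i -> F i ⊑ G i) -> \sum_(i <- r | P i) F i ⊑ \sum_(i <- r | P i) G i.
Proof. by move=> h; elim/big_ind2: _ => // [|*]; [exact: cule_refl|exact: culeD]. Qed.

Lemma cl_leD a b : cpos a -> cpos b -> cl (a + b) ⊑ cl a + cl b.
Proof.
move=> pa pb; rewrite cl_add//; apply/cl_le; [exact: cposD|exact: cpos_dsum|exact: add_le_dsum].
Qed.

Lemma cl_orth a b : cpos a -> cpos b -> a ** b = 0 -> cl (a + b) = cl a + cl b.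
Proof.
move=> pa pb ab; apply: cule_anti; first exact: cl_leD.
rewrite cl_add//; apply/cl_le; [exact: cpos_dsum|exact: cposD|exact: dsum_le_add].
Qed.

Lemma cl_le_sum I (r : seq I) (P : pred I) (F : I -> D) : (forall i, P i -> cpos (F i)) ->
  cl (\sum_(i <- r | P i) F i) ⊑ \sum_(i <- r | P i) cl (F i).
Proof.
move=> pF; suff [] : cpos (\sum_(i <- r | P i) F i) /\ cl (\sum_(i <- r | P i) F i) ⊑ \sum_(i <- r | P i) cl (F i) by [].
elim/big_rec2: _ => [|i x y Pi [py h]].
  by split; [exact: cpos_0|rewrite cl0; exact: cule_refl].
split; first by apply: cposD => //; exact: pF.
apply: cule_trans (cl_leD (pF i Pi) py) _; apply: culeD h; exact: cule_refl.
Qed.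

Hypothesis AU : almost_unperforated S.

(** Multiplying the hypothesis by [q * p] gives [p * l] copies of [y *+ q] on the right and at least
    [(p * l).+1] copies of [x *+ p] on the left. *)
Lemma AUq x y m l p q : x *+ m ⊑ y *+ l -> (p * l < q * m)%N -> x *+ p ⊑ y *+ q.
Proof.
move=> h lt; apply: (AU (k := (p * l)%N)); rewrite !cu_mulE -!mulrnA.
apply: (@cule_trans (x *+ (m * (q * p)))); first by apply: culeMnl; nia.
rewrite (mulrnA x m); apply: (cule_trans (culeMn (q * p) h)); rewrite -mulrnA; apply: culeMnl; nia.
Qed.

End CuMonoid2.

Section CuAD.
Context {R : realType} {B : cstarAlgType R} {S : stabilization B}.
Local Notation D := (stab S).
Implicit Types (a b c : D) (x y z : CuM S).

Lemma AD_cut : almost_divisible S -> forall a e N, cpos a -> 0 < e ->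
  exists c, [/\ cpos c, cl c *+ N ⊑ cl a & cl (cut e a) ⊑ cl c *+ N.+1].
Proof.
move=> AD a e N pa e0; have pc := cpos_cut (ltW e0) pa.
have [|y [h1 h2]] := AD (cl (cut e a)) (cl a) _ N.
  exists (cut e a), a, e; split; [exact: cl_rep|exact: cl_rep|by []|].
  by rewrite cutdownE ?(ltW e0)//; exact: cuntz_refl.
by have [c pc' yE] := cl_surj y; exists c; rewrite -yE.
Qed.

Lemma AD_of_cut : (forall a e N, cpos a -> 0 < e ->
    exists y : CuM S, y *+ N ⊑ cl a /\ cl (cut e a) ⊑ y *+ N.+1) -> almost_divisible S.
Proof.
move=> h x' x [a [b [e [/representsE[pa ->] /representsE[pb ->] e0 ab]]]] N.
have [y [h1 h2]] := h b e N pb e0; exists y; split=> //; apply: cule_trans h2.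
apply/cl_le => //; first exact: cpos_cut (ltW e0) pb.
by rewrite -cutdownE ?(ltW e0).
Qed.

Lemma cl_cut_le a r t : 0 <= t -> t <= r -> cpos a -> cl (cut r a) ⊑ cl (cut t a).
Proof.
move=> t0 tr pa; apply/cl_le; [exact: cpos_cut (le_trans t0 tr) pa|exact: cpos_cut|exact: cuntz_cut_le].
Qed.

Lemma cl_cut a t : 0 <= t -> cpos a -> cl (cut t a) ⊑ cl a.
Proof. by move=> t0 pa; apply/cl_le => //; [exact: cpos_cut|exact: cuntz_cut]. Qed.

End CuAD.

(** * Adjoints of operators on a Hilbert space *)

Section Hilbert.
Context {R : realType} {H : hilbertType R}.
Implicit Types (x y z u w : H) (k l g : H -> H).
Local Notation ip := (@inner R H).

Lemma innDl x y z : ip (x + y) z = ip x z + ip y z. Proof. exact: linearDl. Qed.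

Lemma innDr x y z : ip z (x + y) = ip z x + ip z y. Proof. exact: linearDr. Qed.

Lemma innZl (c : R[i]) x z : ip (c *: x) z = c * ip x z. Proof. exact: linearZl_LR. Qed.

Lemma innZr (c : R[i]) x z : ip z (c *: x) = Num.conj c * ip z x. Proof. exact: linearZr_LR. Qed.

Lemma innC x y : ip x y = Num.conj (ip y x).
Proof. by have := hermC (@inner R H) x y; rewrite expr0 mul1r. Qed.
Lemma innNl x z : ip (- x) z = - ip x z. Proof. exact: linearNl. Qed.

Lemma innNr x z : ip z (- x) = - ip z x. Proof. exact: linearNr. Qed.

Lemma inn0l z : ip 0 z = 0. Proof. exact: linear0l. Qed.

Lemma inn0r z : ip z 0 = 0. Proof. exact: linear0r. Qed.

Local Notation Rn c := (complex.Re (`|c| : R[i])).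

Lemma Rn_ge0 (c : R[i]) : 0 <= Rn c.
Proof. by have := normr_ge0 c; rewrite lecE => /andP[]. Qed.

Lemma ReC (r : R) : complex.Re (r%:C : R[i]) = r. Proof. by []. Qed.

Lemma Rn_E (c : R[i]) : (Rn c)%:C = `|c|. Proof. by rewrite RRe_real// normr_real. Qed.

Lemma mul_conj_Rn (c : R[i]) : c * Num.conj c = (Rn c ^+ 2)%:C.
Proof. by rewrite -normCK rmorphXn/= Rn_E. Qed.

Lemma inn_ext x y : (forall z, ip z x = ip z y) -> x = y.
Proof.
move=> h; apply/eqP; rewrite -subr_eq0 -nrm_eq0 -(@sqrf_eq0 R); apply/eqP.
by apply: (@complexI R); rewrite -inner_nrm innDr innNr h subrr.
Qed.

Lemma nrm_sqD x y : nrm (x + y) ^+ 2 = nrm x ^+ 2 + nrm y ^+ 2 + 2 * complex.Re (ip x y).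
Proof.
apply: (@complexI R); rewrite -inner_nrm innDl !innDr !inner_nrm (innC y x) !rmorphD/=.
have -> : (2 * complex.Re (ip x y))%:C = ip x y + Num.conj (ip x y).
  by rewrite rmorphM/= ReJ_add (rmorph_nat (real_complex R)) mulrC divfK ?pnatr_eq0.
by ring.
Qed.

Lemma cauchy_schwarz x y : Rn (ip x y) <= nrm x * nrm y.
Proof.
have [->|y0] := eqVneq y 0; first by rewrite inn0r normr0 nrm0 mulr0.
have ny : 0 < nrm y by rewrite lt_def nrm_ge0 nrm_eq0 y0.
apply: le_of_sq; first by rewrite mulr_ge0 ?nrm_ge0.
set c := ip x y; set Y := nrm y.
have E : nrm ((Y ^+ 2)%:C *: x - c *: y) ^+ 2 = Y ^+ 2 * ((nrm x * Y) ^+ 2 - Rn c ^+ 2).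
  apply: (@complexI R); rewrite -inner_nrm innDl !innDr !innNl !innNr !innZl !innZr !inner_nrm -/Y.
  have YE : Num.conj ((Y ^+ 2)%:C : R[i]) = (Y ^+ 2)%:C by rewrite conj_Creal ?complex_real.
  rewrite exprMn (innC y x) -/c !YE; move: (mul_conj_Rn c); move: (Rn c ^+ 2) (nrm x ^+ 2) (Y ^+ 2) => K X2 Y2 KE.
  by rewrite (rmorphM (real_complex R)) (rmorphB (real_complex R)) (rmorphM (real_complex R)) /= -KE; ring.
have : 0 <= Y ^+ 2 * ((nrm x * Y) ^+ 2 - Rn c ^+ 2) by rewrite -E exprn_ge0 ?nrm_ge0.
by rewrite pmulr_rge0 ?exprn_gt0// subr_ge0.
Qed.

(** [w] is a multiple of the vector [v] of least norm on the hyperplane [phi = 1]: the parallelogram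
    law makes minimizing sequences Cauchy, and minimality makes [v] orthogonal to the kernel. *)
Lemma riesz (phi : H -> R[i]) (C : R) : (forall x y, phi (x + y) = phi x + phi y) ->
  (forall c x, phi (c *: x) = c * phi x) -> (forall x, Rn (phi x) <= C * nrm x) ->
  exists w, forall x, phi x = ip x w.
Proof.
move=> fD fZ fC; have [[x0 x00]|h0] := pselect (exists x0, phi x0 != 0); last first.
  by exists 0 => x; rewrite inn0r; apply/eqP; apply: contra_notT h0 => ?; exists x.
pose E := [set r | exists2 x, phi x = 1 & r = nrm x].
have fN x : phi (- x) = - phi x by rewrite -scaleN1r fZ mulN1r.
have E0 : E !=set0 by exists (nrm ((phi x0)^-1 *: x0)), ((phi x0)^-1 *: x0) => //; rewrite fZ mulVf.
have Elb : has_lbound E by exists 0 => _ [x _ ->]; exact: nrm_ge0.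
pose m := inf E.
have m0 : 0 <= m by apply: lb_le_inf => // _ [x _ ->]; exact: nrm_ge0.
have mlb x : phi x = 1 -> m <= nrm x by move=> f1; apply: ge_inf => //; exists x.
have /choice[u hu] n : exists x, phi x = 1 /\ nrm x < m + n.+1%:R^-1.
  have : 0 < n.+1%:R^-1 :> R by rewrite invr_gt0.
  by move=> /(@inf_adherent _ E)/(_ (conj E0 Elb))[_ [x f1 ->] lt]; exists x.
have par x y : phi x = 1 -> phi y = 1 -> nrm (x - y) ^+ 2 <= 2 * nrm x ^+ 2 + 2 * nrm y ^+ 2 - 4 * m ^+ 2.
  move=> fx fy; have h1 : phi ((2^-1)%:C *: (x + y)) = 1.
    have E2 : 2^-1 * (1 + 1) = 1 :> R by field.
    by rewrite fZ fD fx fy -(rmorph1 (real_complex R)) -(rmorphD (real_complex R)) -(rmorphM (real_complex R)) E2.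
  have := mlb _ h1; rewrite nrmZr ger0_norm ?invr_ge0// => h2.
  have h3 : m ^+ 2 <= (2^-1 * nrm (x + y)) ^+ 2 by rewrite lerXn2r ?nnegrE// mulr_ge0 ?nrm_ge0.
  have := nrm_sqD x y; have := nrm_sqD x (- y); rewrite nrmN innNr.
  have -> : complex.Re (- ip x y) = - complex.Re (ip x y) by case: (ip x y).
  move: h3; rewrite exprMn; set a := nrm (x + y) ^+ 2; set b := nrm (x - y) ^+ 2.
  have -> : (2^-1) ^+ 2 = 4^-1 :> R by field.
  by lra.
have inv0 (e : R) : 0 < e -> exists n0, forall n, (n0 <= n)%N -> n.+1%:R^-1 < e.
  move=> e0; have /cvgrPdist_lt/(_ e e0)[N _ hN] := @cvg_harmonic R.
  by exists N => n /hN/=; rewrite sub0r normrN ger0_norm ?invr_ge0.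
have [v uv] : exists v : H, u @ \oo --> (v : H).
  apply: nrm_cauchy_cvg => e e0.
  pose d := Num.min 1 (e ^+ 2 / (4 * (2 * m + 1) + 1)).
  have c0 : 0 < 4 * (2 * m + 1) + 1 by lra.
  have d0 : 0 < d by rewrite lt_min ltr01 divr_gt0// exprn_gt0.
  have d1 : d <= 1 by rewrite ge_min lexx.
  have dE : d * (4 * (2 * m + 1) + 1) <= e ^+ 2 by rewrite -ler_pdivlMr// ge_min lexx orbT.
  have [N hN] := inv0 d d0; exists N => p q Np Nq.
  have [fp np] := hu p; have [fq nq] := hu q.
  have np' : nrm (u p) <= m + d by rewrite (le_trans (ltW np))// lerD2l ltW// hN.
  have nq' : nrm (u q) <= m + d by rewrite (le_trans (ltW nq))// lerD2l ltW// hN.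
  have sq r : 0 <= r -> r <= m + d -> r ^+ 2 <= m ^+ 2 + d * (2 * m + 1).
    by move=> r0 rd; have : r ^+ 2 <= (m + d) ^+ 2 by [rewrite lerXn2r ?nnegrE//; lra]; nra.
  have := par _ _ fp fq; have := sq _ (nrm_ge0 _) np'; have := sq _ (nrm_ge0 _) nq' => h1 h2 h3.
  rewrite -(@ltr_pXn2r _ 2) ?nnegrE ?nrm_ge0 ?(ltW e0)//.
  apply: le_lt_trans h3 _; apply: lt_le_trans dE; lra.
have fv : phi v = 1.
  apply/eqP; rewrite -subr_eq0 -normr_le0 -Rn_E -[0]/(0%:C) lecR.
  apply/ler_addgt0Pr => e e0; have C1 : 0 < `|C| + 1 by rewrite ltr_wpDl.
  have /nrm_cvg_seqP/(_ (e / (`|C| + 1)))[|N /(_ N (leqnn N))] := uv; first by rewrite divr_gt0.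
  rewrite ltr_pdivlMr// => h; have [f1 _] := hu N; rewrite -f1 -fN -fD (le_trans (fC _))// add0r.
  by have := ler_norm C; have := nrm_ge0 (v - u N); nra.
have nv : nrm v <= m.
  apply/ler_addgt0Pr => e e0; have e2 : 0 < e / 2 by rewrite divr_gt0.
  have /nrm_cvg_seqP/(_ _ e2)[N hN] := uv; have [M hM] := inv0 _ e2.
  have := hN _ (leq_maxl N M); have := hM _ (leq_maxr N M); have [_ h] := hu (maxn N M).
  by have := nrm_le_dist v (u (maxn N M)); move: (nrm (v - _)) (_^-1) h => p q h *; lra.
have orth z : phi z = 0 -> ip v z = 0.
  move=> fz; set c := ip v z; set Z := nrm z ^+ 2.
  have Z0 : 0 <= Z by rewrite exprn_ge0 ?nrm_ge0.
  (* Moving [v] by [t c z] changes the square of its norm by [t ^+ 2 * Z + 2 * t] times the square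
     of the modulus of [c], which is negative for this [t] unless [c = 0]. *)
  pose t : R := - (Z + 1)^-1.
  have h1 : phi (v + (t%:C * c) *: z) = 1 by rewrite fD fZ fz mulr0 addr0.
  have h2 : m ^+ 2 <= nrm (v + (t%:C * c) *: z) ^+ 2 by rewrite lerXn2r ?nnegrE ?nrm_ge0// mlb.
  have h3 : nrm v ^+ 2 <= m ^+ 2 by rewrite lerXn2r ?nnegrE ?nrm_ge0.
  have cE : Num.conj (t%:C * c) * c = (t * Rn c ^+ 2)%:C.
    have tE : Num.conj (t%:C : R[i]) = t%:C by rewrite conj_Creal ?complex_real.
    have -> : Num.conj (t%:C * c) = t%:C * Num.conj c by rewrite -{2}tE -rmorphM.
    by rewrite -mulrA (mulrC _ c) mul_conj_Rn [RHS](rmorphM (real_complex R)).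
  move: h2; rewrite nrm_sqD innZr -/c cE ReC nrmZ.
  rewrite normrM exprMn -/Z.
  have -> : complex.Re (`|t%:C| * `|c|) = `|t| * Rn c.
    by rewrite -Rn_E Re_normC -Rn_E -rmorphM.
  rewrite exprMn real_normK ?num_real// => h2.
  have h4 : 0 <= (t ^+ 2 * Z + 2 * t) * Rn c ^+ 2 by lra.
  have h5 : t ^+ 2 * Z + 2 * t < 0.
    have Z1 : 0 < Z + 1 by lra.
    have -> : t ^+ 2 * Z + 2 * t = - ((Z + 2) / (Z + 1) ^+ 2) by rewrite /t; field; rewrite gt_eqF.
    by rewrite oppr_lt0 divr_gt0 ?exprn_gt0//; lra.
  have h6 : Rn c ^+ 2 <= 0 by rewrite -(ler_nM2l h5) mulr0.
  apply/eqP; rewrite -normr_le0 -Rn_E -[0]/(0%:C) lecR; have := Rn_ge0 c; nra.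
have v0 : nrm v != 0.
  by apply: contraTneq (oner_neq0 R[i]) => /eqP; rewrite nrm_eq0 => /eqP v0; rewrite -fv v0 -(scale0r 0) fZ mul0r eqxx.
exists ((nrm v ^- 2)%:C *: v) => x.
have h : ip v (x - phi x *: v) = 0 by apply: orth; rewrite fD fN fZ fv mulr1 subrr.
have E1 : ip x v = phi x * (nrm v ^+ 2)%:C.
  have : ip (x - phi x *: v) v = 0 by rewrite innC h conjC0.
  by rewrite innDl innNl innZl inner_nrm => /eqP; rewrite subr_eq0 => /eqP.
rewrite innZr conj_Creal ?complex_real// E1 mulrCA -rmorphM/= mulVf ?expf_neq0// mulr1//.
Qed.

Lemma adjoint_ex k (C : R) : linear k -> (forall x, nrm (k x) <= C * nrm x) ->
  exists l, linear l /\ adjoint k l.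
Proof.
move=> lk kC; have /choice[l hl] y : exists w, forall x, ip (k x) y = ip x w.
  apply: (@riesz (fun x => ip (k x) y) (C * nrm y)) => [x x'|c x|x].
  - by rewrite linD// innDl.
  - by rewrite linZ// innZl.
  - by rewrite (le_trans (cauchy_schwarz _ _))// mulrAC ler_wpM2r ?nrm_ge0.
exists l; split; last by move=> x y; exact: hl.
by move=> c x y; apply: inn_ext => z; rewrite -hl !innDr !innZr -!hl.
Qed.

Lemma adjoint_bdd k l (C : R) : adjoint k l -> (forall x, nrm (k x) <= C * nrm x) -> forall y, nrm (l y) <= C * nrm y.
Proof.
move=> kl kC y; have [->|ly] := eqVneq (nrm (l y)) 0.
  by have := kC y; apply: le_trans; exact: nrm_ge0.
have np : 0 < nrm (l y) by rewrite lt_def ly nrm_ge0.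
rewrite -(ler_pM2l np) mulrCA.
have : (nrm (l y) ^+ 2)%:C = ip (k (l y)) y by rewrite kl inner_nrm.
move=> /(congr1 (fun c => Rn c)); rewrite Re_normC ger0_norm ?exprn_ge0 ?nrm_ge0// => E.
rewrite -expr2 E (le_trans (cauchy_schwarz _ _))// mulrA ler_wpM2r ?nrm_ge0//.
Qed.

(** Schauder's argument: on the unit ball the square of [nrm (l x - l x')] is at most
    [2 * nrm (k (l x) - k (l x'))], and [k \o l] is compact, so an ultrafilter on the closure of the
    image under [l] is Cauchy. *)
Lemma compact_adjoint k l : compact_op k -> linear l -> adjoint k l -> compact_op l.
Proof.
move=> ck ll kl; split=> //; rewrite precompactE.
have [C C0 kC] := compact_bdd ck; have lC := adjoint_bdd kl kC.
have cN : compact_op (k \o l).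
  have -> : k \o l = ((fun x => C%:C *: x) \o k) \o (fun x => C^-1%:C *: l x).
    apply/funext => x /=; rewrite (linZ ck.1) scalerA -rmorphM/= divff ?gt_eqF// scale1r//.
  apply: compact_comp_l => [||x].
  - apply: compact_comp_r ck _ _; last exact: scale_continuous.
    by move=> z x y; rewrite scalerDr !scalerA mulrC.
  - by move=> z x y; rewrite ll scalerDr !scalerA mulrC.
  - by rewrite nrmZr ger0_norm ?invr_ge0 ?(ltW C0)// mulrC ler_pdivrMr// mulrC.
pose K2 := closure (l @` [set x | `|x| <= 1]).
have ck1 : continuous k.
  move=> x; apply/nrm_cvgP => e e0.
  have /nrm_cvgP/(_ (e / C)) : (fun y : H => y) @ x --> x by exact: cvg_id.
  rewrite divr_gt0// => /(_ isT); apply: filterS => y; rewrite ltr_pdivlMr// mulrC; apply: le_lt_trans.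
  by rewrite -(scaleN1r (k y)) -(linZ ck.1) -(linD ck.1) scaleN1r.
have est x x' : `|x| <= 1 -> `|x'| <= 1 -> nrm (l x - l x') ^+ 2 <= 2 * nrm (k (l x) - k (l x')).
  rewrite -[1]/(1%:C) -!nrm_le => x1 x1'.
  have E1 : l x - l x' = l (x - x') by rewrite -(scaleN1r x') (linD ll) (linZ ll) scaleN1r.
  have E2 : k (l x) - k (l x') = k (l (x - x')) by rewrite -E1 -(scaleN1r (l x')) (linD ck.1) (linZ ck.1) scaleN1r.
  rewrite E2 E1; set y := x - x'.
  have : (nrm (l y) ^+ 2)%:C = ip (k (l y)) y by rewrite kl inner_nrm.
  move=> /(congr1 (fun c => Rn c)); rewrite Re_normC ger0_norm ?exprn_ge0 ?nrm_ge0// => ->.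
  rewrite (le_trans (cauchy_schwarz _ _))// mulrC ler_wpM2r ?nrm_ge0//.
  by rewrite (le_trans (nrmB _ _))//; lra.
have cl_near u d : K2 u -> 0 < d -> exists2 x, `|x| <= 1 & nrm (u - l x) < d.
  move=> Ku d0; have dC : 0 < d%:C :> R[i] by rewrite ltcR.
  have [_ [[x x1 <-] ux]] := Ku _ (nbhsx_ballx u _ dC).
  by exists x => //; move: ux; rewrite -ball_normE/= nrm_lt.
have est2 u u' (e : R) : 0 < e -> K2 u -> K2 u' -> nrm (k u - k u') < e ^+ 2 / 16 -> nrm (u - u') < e.
  move=> e0 hu hu' hk; pose d := Num.min (e / 8) (e ^+ 2 / 32 / C).
  have e20 : 0 < e ^+ 2 by rewrite exprn_gt0.
  have d0 : 0 < d by rewrite lt_min !divr_gt0.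
  have d1 : d <= e / 8 by rewrite ge_min lexx.
  have d2 : d * C <= e ^+ 2 / 32 by rewrite -ler_pdivlMr// ge_min lexx orbT.
  have [x x1 ux] := cl_near u d hu d0; have [x' x1' ux'] := cl_near u' d hu' d0.
  have kd v v' : nrm (v - v') < d -> nrm (k v - k v') <= d * C.
    move=> vv; rewrite -(scaleN1r (k v')) -(linZ ck.1) -(linD ck.1) scaleN1r (le_trans (kC _))//.
    by rewrite mulrC ler_wpM2r ?(ltW C0) ?(ltW vv).
  have h1 := kd _ _ ux; have h2 := kd _ _ ux'; rewrite nrm_distC in h1.
  have h3 : nrm (k (l x) - k (l x')) <= e ^+ 2 / 8.
    have := nrm_dist3 (k (l x)) (k u) (k (l x')); have := nrm_dist3 (k u) (k u') (k (l x')).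
    by move: h1 h2 hk d2; move: (nrm (k (l x) - k u)) (nrm (k u' - k (l x'))) (nrm (k u - k u')) (d * C) => *; lra.
  have h4 : nrm (l x - l x') <= e / 2.
    apply: le_of_sq; first by rewrite divr_ge0// ltW.
    rewrite (le_trans (est _ _ x1 x1'))// expr_div_n; have -> : (2 : R) ^+ 2 = 4 by rewrite -natrX.
    by move: h3; move: (nrm (k _ - _)) => q; lra.
  have := nrm_dist3 u (l x) u'; have := nrm_dist3 (l x) (l x') u'; rewrite (nrm_distC (l x') u').
  by move: ux ux' h4 d1; move: (nrm (u - l x)) (nrm (u' - l x')) (nrm (l x - l x')) => *; lra.
have [_] := cN; rewrite precompactE => cK1.
pose K1 := closure [set (k \o l) x | x in [set x : H | `|x| <= 1]].
have K12 u : K2 u -> K1 (k u).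
  move=> Ku B /ck1 hB; have [_ [[x x1 <-] Bx]] := Ku _ hB.
  by exists (k (l x)); split=> //; exists x.
rewrite compact_ultra /= => F UF FK2.
have PF0 : ProperFilter F by exact: ultra_proper.
have kFK1 : (k @ F) K1 by apply: (@filterS _ F _ K2 (k @^-1` K1)).
have PF : ProperFilter (k @ F) by exact: fmap_proper_filter.
have [p [_ clp]] := cK1 (k @ F) PF kFK1.
have FN (r : R) : 0 < r -> F [set u | nrm (p - k u) < r].
  move=> r0; have [//|FC] := in_ultra_setVsetC [set u | nrm (p - k u) < r] UF.
  have rC : 0 < r%:C :> R[i] by rewrite ltcR.
  have [y [hy py]] := clp [set y | ~ nrm (p - y) < r] _ FC (nbhsx_ballx p _ rC).
  by case: hy; move: py; rewrite -ball_normE/= nrm_lt.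
have cF : cauchy F.
  apply/cauchy_ballP => e e0; have eE : (complex.Re e)%:C = e by rewrite RRe_real// gtr0_real.
  have e0' : 0 < complex.Re e by rewrite -ltcR eE.
  have r0 : 0 < complex.Re e ^+ 2 / 32 by rewrite divr_gt0// exprn_gt0.
  have FNK : F ([set u | nrm (p - k u) < complex.Re e ^+ 2 / 32] `&` K2) by apply: filterI => //; exact: FN.
  rewrite near_map2; exists ([set u | nrm (p - k u) < complex.Re e ^+ 2 / 32] `&` K2,
    [set u | nrm (p - k u) < complex.Re e ^+ 2 / 32] `&` K2) => //.
  move=> [u u'] /= [[hu Ku] [hu' Ku']]; rewrite -ball_normE/= -eE -nrm_lt; apply: est2 => //.
  rewrite nrm_distC in hu; have := nrm_dist3 (k u) p (k u').
  by move: hu hu'; move: (nrm (k u - p)) (nrm (p - k u')) => *; lra.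
have /cvg_ex[v Fv] : cvg F by exact: cauchy_cvg.
exists v; split=> //; apply: (@closed_closure _ [set l x | x in [set x | `|x| <= 1]]) => B /Fv FB.
have [w [Kw Bw]] := @filter_ex _ F _ _ (filterI FK2 FB).
by exists w.
Qed.

End Hilbert.

(** * A stabilization of C(X, A) *)

Section PosLim.
Context {R : realType} {D : cstarAlgType R}.
Implicit Types (a b x y z : D).

Lemma cpos_act y z : cpos y -> nrm ((nrm y)%:C *: z - y ** z) <= nrm y * nrm z.
Proof.
move=> py; have yy := cpos_sa py; set t := nrm y; have t0 : 0 <= t by exact: nrm_ge0.
apply: le_of_sq; first by rewrite mulr_ge0 ?nrm_ge0.
rewrite -nrm_cstar; set w := _ - _.
have h : cle (star w ** w) ((t ^+ 2)%:C *: (star z ** z)).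
  have E : (t ^+ 2)%:C *: (star z ** z) - star w ** w = star z ** fc (fun s => 2 * t * s - s * s) y ** z.
    rewrite fcB ?mulr0//; try by cts.
    rewrite fcZ// ?fcM//; try by cts.
    rewrite (fc_id yy) /w starB starZr starM yy !(cmulBl, cmulBr) !(cscaleAl, cscaleAr) scalerA.
    have E2 : (2 * t)%:C = t%:C + t%:C :> R[i] by rewrite mulr_natl mulr2n rmorphD.
    rewrite E2 scalerDl expr2 rmorphM/= !cmulA.
    by zmod.
  rewrite /cle E; apply: cpos_conj; apply: cpos_fc => //; [by cts|by rewrite !mulr0 subr0|move=> s /andP[s0 st]].
  by have := ler_wpM2l s0 st; nra.
rewrite (le_trans (cle_nrm (cpos_ss w) h))// nrmZr ger0_norm ?exprn_ge0// nrm_cstar exprMn//.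
Qed.

(** By [cpos_act] the condition of [psd] holds with [t] the norm, and in this form it passes to
    limits. *)
Lemma cpos_lim x : (forall e : R, 0 < e -> exists2 y, cpos y & nrm (x - y) < e) -> cpos x.
Proof.
move=> h; apply/cpos_psd; split.
  apply/eqP; rewrite -subr_eq0 -nrm_eq0 eq_le nrm_ge0 andbT; apply/ler_addgt0Pr => e e0.
  have [y py xy] := h (e / 2) (divr_gt0 e0 (ltr0n R 2)); rewrite add0r.
  have -> : star x - x = star (x - y) - (x - y) by rewrite starB (cpos_sa py); zmod.
  by rewrite (le_trans (nrmB _ _))// nrm_star; lra.
exists (nrm x) => [|z]; first exact: nrm_ge0.
apply/ler_addgt0Pr => e e0.
pose d := e / (3 * nrm z + 1); have nz := nrm_ge0 z.
have d0 : 0 < d by rewrite divr_gt0//; lra.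
have dE : d * (3 * nrm z + 1) = e by rewrite /d divfK// gt_eqF//; lra.
have [y py xy] := h d d0.
have -> : (nrm x)%:C *: z - x ** z = ((nrm y)%:C *: z - y ** z) + ((nrm x - nrm y)%:C *: z - (x - y) ** z).
  by rewrite rmorphB/= scalerBl cmulBl; zmod.
have := nrmD ((nrm y)%:C *: z - y ** z) ((nrm x - nrm y)%:C *: z - (x - y) ** z).
have := nrmB ((nrm x - nrm y)%:C *: z) ((x - y) ** z); have := cpos_act z py.
have := nrmM (x - y) z; rewrite nrmZr.
have h1 : `|nrm x - nrm y| <= d.
  have := nrm_le_dist x y; have := nrm_le_dist y x; rewrite ler_norml (nrm_distC y x).
  by move: xy; move: (nrm (x - y)) => q *; lra.
have h2 : nrm y <= nrm x + d by move: h1; rewrite ler_norml; lra.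
have := nrm_ge0 (x - y); have := ler_wpM2r nz h1.
move: (nrm (x - y)) xy (`|nrm x - nrm y| * nrm z) (nrm ((x - y) ** z)) (nrm (_ *: z - y ** z)) => q qd p r s.
move: (nrm (_ *: z - (x - y) ** z)) (nrm (_ *: z - y ** z + _)) => u v *.
have : nrm y * nrm z <= (nrm x + d) * nrm z by rewrite ler_wpM2r.
have : q * nrm z <= d * nrm z by rewrite ler_wpM2r// ltW.
by lra.
Qed.

End PosLim.

Section PosBounded.
Context {R : realType} {A D : cstarAlgType R} (psi : A -> D).
Hypotheses (psiB : forall a b, psi (a - b) = psi a - psi b)
  (psiZ : forall (r : R) a, psi (r%:C *: a) = r%:C *: psi a)
  (psiP : forall a, cpos a -> cpos (psi a)).

(** Otherwise some [c = \sum_n 2^-n a_n] with [a_n] positive contractions and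
    [nrm (psi a_n) > 4^n] would dominate every [2^-n a_n]. *)
Lemma pos_bounded : exists2 C : R, 0 <= C & forall a, cpos a -> nrm (psi a) <= C * nrm a.
Proof.
apply: contrapT => nb.
have /choice[a ha] n : exists a, [/\ cpos a, nrm a <= 1 & 4 ^+ n < nrm (psi a)].
  apply: contrapT => h; apply: nb; exists (4 ^+ n); first by rewrite exprn_ge0.
  move=> a pa; have [->|a0] := eqVneq a 0.
    by have := psiZ 0 0; rewrite !scale0r => ->; rewrite !nrm0 mulr0.
  have na : 0 < nrm a by rewrite lt_def nrm_ge0 nrm_eq0 a0.
  rewrite leNgt; apply/negP => hn; apply: h; exists ((nrm a)^-1%:C *: a); split.
  - by apply: cposZ => //; rewrite invr_ge0 nrm_ge0.
  - by rewrite nrmZr ger0_norm ?invr_ge0 ?nrm_ge0// mulVf ?gt_eqF.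
  - by rewrite psiZ nrmZr ger0_norm ?invr_ge0 ?nrm_ge0// mulrC ltr_pdivlMr.
pose s n := \sum_(i < n) (2^-1 ^+ i)%:C *: a i.
have h2 : (0 : R) <= 2^-1 by [].
have sS n m : cpos (s (n + m)%N - s n) /\ nrm (s (n + m)%N - s n) <= 2 * (2^-1 ^+ n - 2^-1 ^+ (n + m)).
  elim: m => [|m [ih1 ih2]]; first by rewrite addn0 !subrr nrm0 mulr0; split=> //; exact: cpos_0.
  have [pa na _] := ha (n + m)%N.
  rewrite addnS /s big_ord_recr/= -/(s (n + m)%N) addrAC; split.
    by apply: cposD => //; apply: cposZ => //; rewrite exprn_ge0.
  rewrite (le_trans (nrmD _ _))// nrmZr ger0_norm ?exprn_ge0// exprS.
  have p0 := exprn_ge0 (n + m) h2; move: ih2; move: (2^-1 ^+ (n + m)) p0 (nrm _) => p p0 q.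
  by have := ler_piMr p0 na; lra.
have small (e : R) : 0 < e -> exists N, 2 * 2^-1 ^+ N < e.
  move=> e0; have : (fun n => 2^-1 ^+ n : R) @ \oo --> (0 : R) by apply: cvg_expr; rewrite ger0_norm//; lra.
  move=> /cvgrPdist_lt/(_ (e / 2)) [|N _ /(_ N (leqnn N))]; first by rewrite divr_gt0.
  by rewrite /= sub0r normrN ger0_norm ?exprn_ge0// => h; exists N; lra.
have [c sc] : exists c : A, s @ \oo --> (c : A).
  apply: nrm_cauchy_cvg => e /small[N hN]; exists N => m n Nm Nn.
  wlog mn : m n Nm Nn / (n <= m)%N => [W|].
    by case: (leqP n m) => nm; [exact: W|rewrite nrm_distC; apply: W => //; exact: ltnW].
  rewrite -(subnKC mn); have [_ h] := sS n (m - n)%N; apply: le_lt_trans h _.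
  apply: le_lt_trans hN; rewrite ler_pM2l//; have p1 := exprn_ge0 (n + (m - n)) h2.
  have : 2^-1 ^+ n <= 2^-1 ^+ N :> R by rewrite ler_wiXn2l//; lra.
  lra.
have cs n : cpos (c - s n).
  apply: cpos_lim => e e0; have /nrm_cvg_seqP/(_ e e0)[N hN] := sc.
  exists (s (n + N)%N - s n); first exact: (sS n N).1.
  by rewrite opprB addrA subrK; apply: hN; rewrite leq_addl.
have sn n : cpos (s n) by have [h _] := sS 0%N n; rewrite add0n /s big_ord0 subr0 in h.
have key n : 2 ^+ n <= nrm (psi c).
  have [pa _ na] := ha n.
  have h : cle (psi ((2^-1 ^+ n)%:C *: a n)) (psi c).
    rewrite /cle -psiB; apply: psiP.
    have -> : c - (2^-1 ^+ n)%:C *: a n = (c - s n.+1) + s n by rewrite /s big_ord_recr/=; zmod.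
    exact: cposD.
  apply: le_trans (cle_nrm _ h); last by apply: psiP; apply: cposZ => //; rewrite exprn_ge0.
  rewrite psiZ nrmZr ger0_norm ?exprn_ge0// exprVn mulrC ler_pdivlMr ?exprn_gt0//.
  by apply: le_trans (ltW na); rewrite -exprMn; have -> : 2 * 2 = 4 :> R by rewrite -natrM.
have := key (Num.bound (nrm (psi c))); have := archi_boundP (nrm_ge0 (psi c)).
move=> h1 h3; have := lt_le_trans h1 (le_trans _ h3); rewrite ltxx => F; suff : false by [].
apply: F; rewrite -natrX ler_nat ltnW// ltn_expl//.
Qed.

End PosBounded.

Section CompactSums.
Context {R : realType} {H : hilbertType R}.
Implicit Types (k l : H -> H).

Lemma precompact_sub (K A : set H) : compact K -> A `<=` K -> precompact A.
Proof.
move=> cK AK; rewrite precompactE; apply: (subclosed_compact _ cK); first exact: closed_closure.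
have /closure_id -> : closed K by apply: compact_closed cK; exact: norm_hausdorff.
exact: closureS.
Qed.

Lemma compact_lin (z : R[i]) k l : compact_op k -> compact_op l -> compact_op (z *: k + l).
Proof.
move=> [lk ck] [ll cl_]; split.
  move=> c x y; change (z *: k (c *: x + y) + l (c *: x + y) = c *: (z *: k x + l x) + (z *: k y + l y)).
  by rewrite lk ll !scalerDr !scalerA (mulrC z c); zmod.
rewrite !precompactE in ck cl_.
have cK := compact_setX ck cl_.
pose f (p : H * H) := z *: p.1 + p.2.
have cf : continuous f.
  by move=> p; apply: cvgD; [apply: cvgZr; exact: cvg_fst|exact: cvg_snd].
apply: (@precompact_sub (f @` (closure [set k x | x in [set x | `|x| <= 1]] `*` closure [set l x | x in [set x | `|x| <= 1]]))).
  by apply: continuous_compact => //; exact: continuous_subspaceT.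
by move=> _ [x Bx <-]; exists (k x, l x) => //; split; apply: subset_closure; exists x.
Qed.

Lemma compact_zero : compact_op (fun _ : H => 0).
Proof.
split; first by move=> z x y; rewrite scaler0 addr0.
apply: (@precompact_sub [set 0]); first exact: compact_set1.
by move=> _ [x _ <-].
Qed.

End CompactSums.

Section TensBounded.
Context {R : realType} {B : cstarAlgType R} {S : stabilization B}.
Local Notation H := (hilb S).
Local Notation D := (stab S).
Local Notation t := (@tens _ _ S).

Lemma tensD (b c : B) k : compact_op k -> t (b + c) k = t b k + t c k.
Proof. by move=> ck; have := tens_linearl (tensP S) ck 1 b c; rewrite !scale1r. Qed.

Lemma tensZ (z : R[i]) (b : B) k : compact_op k -> t (z *: b) k = z *: t b k.
Proof. by move=> ck; have := tens_linearl (tensP S) ck z b 0; rewrite tens0// !addr0. Qed.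

Lemma tensB (b c : B) k : compact_op k -> t (b - c) k = t b k - t c k.
Proof. by move=> ck; rewrite -scaleN1r tensD// tensZ// scaleN1r. Qed.

Lemma compact_adj_ex (k : H -> H) : compact_op k -> exists2 l, compact_op l & adjoint k l.
Proof.
move=> ck; have [C C0 kC] := compact_bdd ck; have [l [ll kl]] := adjoint_ex ck.1 kC.
by exists l => //; exact: compact_adjoint kl.
Qed.

(** The norm is not given as a cross norm. But tensoring with [l \o k], where [l] is the adjoint of
    [k], sends positive elements to positive ones, hence is bounded by [pos_bounded]; the
    C*-identity takes the square root. *)
Lemma tens_bdd k : compact_op k -> exists2 C : R, 0 <= C & forall b : B, nrm (t b k) <= C * nrm b.
Proof.
move=> ck; have [l cl_ kl] := compact_adj_ex ck.
have clk : compact_op (l \o k) by exact: compact_comp.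
have [|||C C0 hC] := @pos_bounded R B D (fun b => t b (l \o k)).
- by move=> a b; exact: tensB.
- by move=> r a; exact: tensZ.
- move=> _ [c ->]; exists (t c k).
  by rewrite (tensM (tensP S))// (tens_star (tensP S) c ck cl_ kl).
exists (Num.sqrt C) => [|b]; first exact: sqrtr_ge0.
apply: le_of_sq; first by rewrite mulr_ge0 ?sqrtr_ge0 ?nrm_ge0.
rewrite -nrm_cstar -(tens_star (tensP S) b ck cl_ kl) -(tensM (tensP S))// exprMn sqr_sqrtr// -nrm_cstar.
by apply: hC; exact: cpos_ss.
Qed.

End TensBounded.

(** * Partitions of unity on a compact metric space *)

Section Pou.
Context {R : realType} {X : metricType R} (cX : compact [set: X]).

Lemma mdist_continuous (p : X) : continuous (fun x : X => mdist p x).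
Proof.
move=> x; apply/cvgrPdist_lt => e e0; apply/nbhs_ballP; exists e => //= y.
rewrite ballEmdist/=; apply: le_lt_trans; rewrite ler_norml.
have := metric_triangle p x y; have := metric_triangle p y x; rewrite (metric_sym y x).
by move=> ? ?; lra.
Qed.

Lemma finite_net (d : R) : 0 < d -> exists n (p : 'I_n -> X), forall x, exists i, mdist (p i) x < d.
Proof.
(* The filter generated by the finite families containing a given one turns near-covering
   compactness into a finite net. *)
move=> d0; pose F := [set P : set (seq X) | exists s0 : seq X, forall s, {subset s0 <= s} -> P s].
have FF : Filter F.
  split.
  - by exists [::].
  - move=> P Q [s0 h0] [s1 h1]; exists (s0 ++ s1) => s ss; split.
      by apply: h0 => x xs; apply: ss; rewrite mem_cat xs.
    by apply: h1 => x xs; apply: ss; rewrite mem_cat xs orbT.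
  - by move=> P Q PQ [s0 h0]; exists s0 => s /h0 /PQ.
have /compact_near_coveringP cX' := cX.
have [x _|s0 hs] := cX' _ F (fun (s : seq X) x => exists2 p, p \in s & mdist p x < d) FF.
  exists (ball x d, [set s : seq X | x \in s]) => /=.
    by split; [exact: nbhsx_ballx|exists [:: x] => s; apply; rewrite mem_seq1].
  by move=> [y s] /= [xy xs]; exists x => //; move: xy; rewrite ballEmdist.
exists (size s0), (fun i : 'I_(size s0) => tnth (in_tuple s0) i) => x.
have [p ps px] := hs s0 (fun _ => id) x I.
have pi : (index p s0 < size s0)%N by rewrite index_mem.
by exists (Ordinal pi); rewrite (tnth_nth p)/= nth_index.
Qed.

Lemma continuous_sum (I : Type) (r : seq I) (f : I -> X -> R) :
  (forall i, continuous (f i)) -> continuous (fun x => \sum_(i <- r) f i x).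
Proof.
move=> cf; elim: r => [|i r ih].
  have -> : (fun x => \sum_(i <- [::]) f i x) = (fun=> 0) by apply/funext => x; rewrite big_nil.
  by move=> x; exact: cvg_cst.
have -> : (fun x => \sum_(j <- i :: r) f j x) = (fun x => f i x + \sum_(j <- r) f j x).
  by apply/funext => x; rewrite big_cons.
by move=> x; apply: cvgD; [exact: cf|exact: ih].
Qed.

Lemma pou (d : R) : 0 < d -> exists n (p : 'I_n -> X) (h : 'I_n -> X -> R),
  [/\ forall i, continuous (h i), forall i x, 0 <= h i x, forall x, \sum_i h i x = 1 &
      forall i x, h i x != 0 -> mdist (p i) x < d].
Proof.
move=> d0; have [n [p hp_]] := finite_net d0.
pose g i x := Num.max (d - mdist (p i) x) 0.
pose G x := \sum_i g i x.
have g0 i x : 0 <= g i x by rewrite le_max lexx orbT.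
have cg i : continuous (g i).
  have cm : continuous (fun r : R => Num.max (d - r) 0) by cts.
  move=> x; exact: (@continuous_comp _ _ _ (fun x => mdist (p i) x) (fun r : R => Num.max (d - r) 0) x (@mdist_continuous _ x) (cm _)).
have cG : continuous G by exact: continuous_sum.
have G0 x : 0 < G x.
  have [i hi] := hp_ x; rewrite /G (bigD1 i)//= ltr_pwDl//; last by apply: sumr_ge0.
  by rewrite lt_max subr_gt0 hi.
exists n, p, (fun i x => g i x / G x); split.
- by move=> i x; apply: cvgM; [exact: cg|apply: cvgV; [rewrite gt_eqF|exact: cG]].
- by move=> i x; rewrite divr_ge0// ltW.
- by move=> x; rewrite -mulr_suml -/(G x) divff// gt_eqF.
- move=> i x; apply: contraNT; rewrite -leNgt => h.
  by rewrite /g max_r ?mul0r// subr_le0.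
Qed.

End Pou.

Section CtsStab.
Context {R : realType} {X : metricType R} (cX : compact [set: X]) {A : cstarAlgType R} (S : stabilization A).
Local Notation H := (hilb S).
Local Notation D := (stab S).
Local Notation t := (@tens _ _ S).
Local Notation CA := (cts_alg cX A).
Local Notation CD := (cts_alg cX D).

Lemma cts_lip (E E' : cstarAlgType R) (phi : E -> E') (C : R) (F : cts_alg cX E) :
  (forall a b, nrm (phi a - phi b) <= C * nrm (a - b)) -> continuous (fun x : X => phi (cts_ev F x)).
Proof.
move=> hphi x; apply/nrm_cvgP => e e0.
have C1 : 0 < `|C| + 1 by rewrite ltr_wpDl.
have /nrm_cvgP/(_ (e / (`|C| + 1))) := @cts_ev_continuous _ _ _ _ F x.
rewrite divr_gt0// => /(_ isT); apply: filterS => y; rewrite ltr_pdivlMr// => h.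
apply: le_lt_trans (hphi _ _) _; have := ler_norm C; have := nrm_ge0 (cts_ev F x - cts_ev F y).
by nra.
Qed.

Lemma nrm_ev (E : cstarAlgType R) (F : cts_alg cX E) x : nrm (cts_ev F x) <= nrm F.
Proof. by rewrite -lecR !nrmE cts_normE cts_norm_ub. Qed.

Lemma nrm_cts_le (E : cstarAlgType R) (F : cts_alg cX E) (r : R) :
  0 <= r -> (forall x, nrm (cts_ev F x) <= r) -> nrm F <= r.
Proof.
move=> r0 h; rewrite -lecR nrmE cts_normE; apply: cts_norm_le; first by rewrite lecR.
by move=> x; rewrite -nrmE lecR.
Qed.

Lemma tensX_cont (b : CA) k : compact_op k -> continuous (fun x : X => t (cts_ev b x) k).
Proof.
move=> ck; have [C C0 hC] := @tens_bdd _ _ S k ck.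
by apply: (@cts_lip A D (fun b => t b k) C) => a c; rewrite -tensB.
Qed.

(** The value 0 is used where [k] is not compact, since [tensX_cont] gives continuity for compact
    [k] only. *)
Definition tensX (b : CA) (k : H -> H) : CD :=
  if pselect (compact_op k) is left ck then cts_mk (tensX_cont (b := b) ck) else 0.

Lemma tensX_ev b k x : compact_op k -> cts_ev (tensX b k) x = t (cts_ev b x) k.
Proof. by move=> ck; rewrite /tensX; case: pselect. Qed.

Lemma ev_sum (E : cstarAlgType R) I (r : seq I) (P : pred I) (F : I -> cts_alg cX E) x :
  cts_ev (\sum_(i <- r | P i) F i) x = \sum_(i <- r | P i) cts_ev (F i) x.
Proof. by elim/big_rec2: _ => // i y z _ <-. Qed.

Lemma dsumX_cont (F G : CD) : continuous (fun x : X => @dsum _ _ S (cts_ev F x) (cts_ev G x)).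
Proof.
have -> : (fun x : X => @dsum _ _ S (cts_ev F x) (cts_ev G x)) =
    (fun x => @dl _ _ S (cts_ev F x) + @dr _ _ S (cts_ev G x)) by apply/funext => x; rewrite dsumE.
move=> x; apply: cvgD.
- apply: (@cts_lip D D (@dl _ _ S) 1) => a b; rewrite mul1r -(homB (@dl_hom _ _ S)).
  exact: (hom_nrm (@dl_hom _ _ S)).
- apply: (@cts_lip D D (@dr _ _ S) 1) => a b; rewrite mul1r -(homB (@dr_hom _ _ S)).
  exact: (hom_nrm (@dr_hom _ _ S)).
Qed.

Definition dsumX (F G : CD) : CD := cts_mk (@dsumX_cont F G).

(** [F] is replaced by its values at the centres of a fine cover, these by finite sums of tensors,
    and the partition of unity is put into the first tensor factor. *)
Lemma tensX_dense : dense [set d | exists n (b : 'I_n -> CA) (k : 'I_n -> H -> H),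
    (forall i, compact_op (k i)) /\ d = \sum_i tensX (b i) (k i)].
Proof.
set T := [set d | _].
have TD d d' : T d -> T d' -> T (d + d').
  move=> [n [b [k [ck ->]]]] [m [c [l [cl_ ->]]]].
  exists (n + m)%N, (fun i : 'I_(n + m) => match fintype.split i with inl i => b i | inr i => c i end),
    (fun i : 'I_(n + m) => match fintype.split i with inl i => k i | inr i => l i end); split.
    by move=> i; case: fintype.split.
  rewrite big_split_ord/=; congr (_ + _); apply: eq_bigr => i _.
    by rewrite -[lshift m i]/(unsplit (inl i)) unsplitK.
  by rewrite -[rshift n i]/(unsplit (inr i)) unsplitK.
have T0 : T 0 by exists 0%N, (fun=> 0), (fun=> (fun=> 0)); split; [case|rewrite big_ord0].
suff key (F : CD) (e : R) : 0 < e -> exists2 d, T d & nrm (F - d) < e.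
  move=> O [F OF] oO; have /nbhs_ballP[e e0 hO] : nbhs F O by exact: open_nbhs_nbhs.
  have eE : (complex.Re e)%:C = e by rewrite RRe_real// gtr0_real.
  have e0' : 0 < complex.Re e by rewrite -ltcR eE.
  have [d Td Fd] := key F _ e0'; exists d; split=> //; apply: hO.
  by rewrite -ball_normE/= -eE -nrm_lt.
move=> e0; have e3 : 0 < e / 3 by rewrite divr_gt0.
have [d d0 hd] : exists2 d : R, 0 < d & forall y z, [set: X] y -> ball y d z -> nrm (cts_ev F y - cts_ev F z) < e / 3.
  apply: lebesgue_number cX _ => x _.
  have e6 : 0 < e / 6 by rewrite divr_gt0.
  have /nrm_cvgP/(_ _ e6)/nbhs_ballP[d d0 hd] := @cts_ev_continuous _ _ _ _ F x.
  exists d => // y z /hd h1 /hd h2; rewrite (le_lt_trans (nrm_dist3 _ (cts_ev F x) _))//.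
  by rewrite nrm_distC; move: h1 h2; move: (nrm _) (nrm _) => *; lra.
have [n [p [h [ch h0 h1 hp_]]]] := pou cX d0.
have /choice[P hP] (i : 'I_n) : exists P : CD, (exists m (b : 'I_m -> A) (k : 'I_m -> H -> H),
    (forall j, compact_op (k j)) /\ forall x, cts_ev P x = (h i x)%:C *: \sum_j t (b j) (k j)) /\
    T P /\ forall x, h i x != 0 -> nrm (cts_ev P x - (h i x)%:C *: cts_ev F x) <= h i x * (2 * e / 3).
  have [m [b [k [ck hb]]]] := tens_approx (cts_ev F (p i)) e3.
  have cb j : continuous (fun x : X => (h i x)%:C *: b j : A).
    move=> x; apply/nrm_cvgP => r r0; have B1 : 0 < nrm (b j) + 1 by rewrite ltr_wpDl ?nrm_ge0.
    have /cvgrPdist_lt/(_ (r / (nrm (b j) + 1))) := ch i x; rewrite divr_gt0// => /(_ isT).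
    apply: filterS => y; rewrite ltr_pdivlMr// => hy; rewrite -scalerBl -rmorphB/= nrmZr.
    by have := normr_ge0 (h i x - h i y); have := nrm_ge0 (b j); nra.
  have Ev x : cts_ev (\sum_j tensX (cts_mk (cX := cX) (cb j)) (k j)) x = (h i x)%:C *: \sum_j t (b j) (k j).
    by rewrite ev_sum scaler_sumr; apply: eq_bigr => j _; rewrite tensX_ev// -tensZ.
  exists (\sum_j tensX (cts_mk (cX := cX) (cb j)) (k j)); split; first by exists m, b, k.
  split; first by exists m, (fun j => cts_mk (cX := cX) (cb j)), k.
  move=> x hx; rewrite Ev -scalerBr nrmZr ger0_norm// ler_wpM2l//.
  have := hd (p i) x I; rewrite ballEmdist/= hp_// => /(_ isT) h2.
  rewrite (le_trans (nrm_dist3 _ (cts_ev F (p i)) _))// nrm_distC.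
  by move: hb h2; move: (nrm _) (nrm _) => *; lra.
exists (\sum_i P i); first by elim/big_ind: _ => // i _; exact: (hP i).2.1.
apply: (@le_lt_trans _ _ (2 * e / 3)); last by lra.
apply: nrm_cts_le => [|x]; first by rewrite divr_ge0// mulr_ge0// ltW.
rewrite nrm_distC.
have -> : cts_ev (\sum_i P i) x - cts_ev F x = \sum_i (cts_ev (P i) x - (h i x)%:C *: cts_ev F x).
  rewrite big_split/= sumrN -scaler_suml -(rmorph_sum (real_complex R)) h1 scale1r -ev_sum//.
apply: (le_trans (nrm_sum _ _ _)).
have -> : 2 * e / 3 = \sum_i h i x * (2 * e / 3) by rewrite -mulr_suml h1 mul1r.
apply: ler_sum => i _.
have [hx|hx] := eqVneq (h i x) 0; last exact: (hP i).2.2.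
have [[m [b [k [_ ->]]]] _] := hP i; rewrite hx !scale0r subrr nrm0 mul0r//.
Qed.

Lemma tensXP : tensor_compact tensX.
Proof.
split.
- move=> k ck z b c; apply: cts_evP => x; rewrite tensX_ev//.
  change (t (z *: cts_ev b x + cts_ev c x) k = z *: cts_ev (tensX b k) x + cts_ev (tensX c k) x).
  by rewrite !tensX_ev// (tens_linearl (tensP S)).
- move=> b z k l ck cl_; apply: cts_evP => x; rewrite tensX_ev//; last exact: compact_lin.
  change (t (cts_ev b x) (z *: k + l) = z *: cts_ev (tensX b k) x + cts_ev (tensX b l) x).
  by rewrite !tensX_ev// (tens_linearr (tensP S)).
- move=> b c k l ck cl_; apply: cts_evP => x; rewrite tensX_ev//; last exact: compact_comp.
  change (t (cts_ev b x ** cts_ev c x) (k \o l) = cts_ev (tensX b k) x ** cts_ev (tensX c l) x).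
  by rewrite !tensX_ev// (tensM (tensP S)).
- move=> b k l ck cl_ kl; apply: cts_evP => x; rewrite tensX_ev//.
  change (t (star (cts_ev b x)) l = star (cts_ev (tensX b k) x)).
  by rewrite !tensX_ev// (tens_star (tensP S) _ ck cl_ kl).
- move=> n b k ck ik h i; apply: cts_evP => x.
  apply: (tens_inj (tensP S) ck ik (b := fun j => cts_ev (b j) x)).
  have := congr1 (fun F : CD => cts_ev F x) h; rewrite ev_sum => E.
  by rewrite -[RHS]E; apply: eq_bigr => j _; rewrite tensX_ev.
- exact: tensX_dense.
Qed.

(** C(X, A) tensored with the compact operators is C(X, D), with the Hilbert space and the folding
    of [S]. The definition is transparent, so that evaluation at a point commutes with [dsum] by
    conversion. *)
Definition ctsStab : stabilization CA.
Proof.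
refine (@Stabilization R CA H (@hilb_separable _ _ S) (@hilb_infinite_dim _ _ S) CD tensX tensXP
  (@fold _ _ S) (@unfold _ _ S) (@foldK _ _ S) (@unfoldK _ _ S) (@fold_linear _ _ S) (@fold_inner _ _ S)
  dsumX _ _ _ _).
- by move=> z a b c d; apply: cts_evP => x; exact: dsum_linear.
- by move=> a b c d; apply: cts_evP => x; exact: dsumM.
- by move=> a b; apply: cts_evP => x; exact: dsum_star.
- move=> b c k l ck cl_; apply: cts_evP => x.
  have h1 : compact_op (fun x => fold (k (unfold x).1, 0) : H).
    apply: (@compact_comp_l _ _ (@V1 _ _ S \o k)) (@W1_linear _ _ S) (@W1_nrm _ _ S).
    exact: (compact_comp_r ck (@V1_linear _ _ S) (lin_contr_continuous (@V1_linear _ _ S) (@V1_nrm _ _ S))).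
  have h2 : compact_op (fun x => fold (0, l (unfold x).2) : H).
    apply: (@compact_comp_l _ _ (@V2 _ _ S \o l)) (@W2_linear _ _ S) (@W2_nrm _ _ S).
    exact: (compact_comp_r cl_ (@V2_linear _ _ S) (lin_contr_continuous (@V2_linear _ _ S) (@V2_nrm _ _ S))).
  change (@dsum _ _ S (cts_ev (tensX b k) x) (cts_ev (tensX c l) x) =
    cts_ev (tensX b (fun x => fold (k (unfold x).1, 0))) x + cts_ev (tensX c (fun x => fold (0, l (unfold x).2))) x).
  by rewrite !tensX_ev// dsum_tens.
Defined.

End CtsStab.

(** * Compact containment and cancellation *)

Section CutLemmas.
Context {R : realType} {D : cstarAlgType R}.
Implicit Types (a b c s : D).

Lemma cut_close a s (t r : R) : 0 <= t -> 0 <= r -> cpos a -> cpos s -> nrm (a - s) <= t ->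
  cut (t + r) a ≾ cut r s.
Proof.
move=> t0 r0 pa ps h; apply: cuntz_close => //; [exact: addr_ge0|exact: cpos_cut|].
by rewrite (le_trans (nrm_dist3 _ s _))// lerD// cut_dist.
Qed.

Lemma scaleRn n a : (n%:R : R)%:C *: a = a *+ n.
Proof. by rewrite -[RHS]scaler_nat; congr (_ *: _); exact: rmorph_nat. Qed.

Lemma cuntz_leC a b (C : R) : 0 <= C -> cpos a -> cpos b -> a =<= C%:C *: b -> a ≾ b.
Proof. by move=> C0 pa pb h; apply: cuntz_trans (cle_cuntz pa h) _; apply: cuntz_scale => //; exact: cuntz_refl. Qed.

Lemma hp_orth (q : {poly R}) (u v : D) : q.[0] = 0 -> u ** v = 0 -> v ** u = 0 -> hp q (u + v) = hp q u + hp q v.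
Proof.
move=> q0 uv vu.
have hX n h : hp ('X ^+ n.+1) h = iter n (cmul h) h.
  elim: n => [|n ih]; first by rewrite hpX.
  by rewrite exprS hpM ?hornerX ?hornerXn ?expr0n// hpX ih iterS.
have [p ->] : exists p, q = 'X * p.
  have : root q 0 by apply/rootP.
  by move=> /factor_theorem[p ->]; exists p; rewrite subr0 mulrC.
have z (x y : D) n : x ** y = 0 -> x ** iter n (cmul y) y = 0.
  by move=> xy; case: n => [|n]//; rewrite iterS cmulA xy cmul0r.
rewrite -(coefK p) poly_def mulr_sumr.
elim/big_rec: _ => [|i x _ ih]; first by rewrite !hp0 addr0.
rewrite !hpD ih -!scalerAr !hpZ -!exprS !hX.
have -> : iter i (cmul (u + v)) (u + v) = iter i (cmul u) u + iter i (cmul v) v.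
  elim: (i : nat) => // n ihn; rewrite !iterS ihn cmulDl !cmulDr.
  by rewrite (z u v)// (z v u)// addr0 add0r.
by rewrite scalerDr; zmod.
Qed.

Lemma fc_orth (f : R -> R) (u v : D) : star u = u -> star v = v -> u ** v = 0 -> continuous f -> f 0 = 0 ->
  fc f (u + v) = fc f u + fc f v.
Proof.
move=> uu vv uv cf f0; have vu : v ** u = 0 by rewrite -uu -vv -starM uv star0.
have ww : star (u + v) = u + v by rewrite starD uu vv.
apply: fc_eqP => // e e0; have e3 : 0 < e / 3 by rewrite divr_gt0.
pose N := Num.max (nrm (u + v)) (Num.max (nrm u) (nrm v)).
have [|q [q0 hq h1]] := fc_approx ww cf f0 e3 (_ : _ <= N); first by rewrite le_max lexx.
have h2 : nrm (hp q u - fc f u) <= e / 3.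
  by apply: fcP => // s su; apply: hq; rewrite (le_trans su)// !le_max lexx orbT.
have h3 : nrm (hp q v - fc f v) <= e / 3.
  by apply: fcP => // s su; apply: hq; rewrite (le_trans su)// !le_max lexx !orbT.
have -> : fc f (u + v) - (fc f u + fc f v) = (hp q u - fc f u) + (hp q v - fc f v) - (hp q (u + v) - fc f (u + v)).
  by rewrite hp_orth//; zmod.
rewrite (le_trans (nrmB _ _))//; have := nrmD (hp q u - fc f u) (hp q v - fc f v).
by move: h1 h2 h3; lra.
Qed.

End CutLemmas.

Section O5.
Context {R : realType} {B : cstarAlgType R} {S : stabilization B}.
Local Notation D := (stab S).
Implicit Types (a b c : D).

(** Almost algebraic order. [h = w ** star w] is a copy, in the hereditary subalgebra of [a], of
    [v ** a ** star v], which is close to [c]. With [k = f(h)] and [b = cut e a], the remainder is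
    [(1 - k) b (1 - k)]: it is orthogonal to the part of [h] where [f] is 1, and together with an
    element below a cutdown of [h] it covers [b]. *)
Lemma O5 a c (e1 e : R) : cpos a -> cpos c -> c ≾ a -> 0 < e1 -> 0 <= e ->
  exists r, [/\ cpos r, cl (cut e1 c) + cl r ⊑ cl a, cl (cut e a) ⊑ cl c + cl r & cl r ⊑ cl (cut e a)].
Proof.
move=> pa pc /cuntzP ca e10 e0; have aa := cpos_sa pa; have cc := cpos_sa pc.
(* [v ** a ** star v] is [n]-close to [c] and [f] is 1 from [2 * n] on, so [e1] has to be at least
   [3 * n]. *)
pose n := e1 / 4; have n0 : 0 < n by rewrite divr_gt0.
have [v /ltW hv] := ca n n0.
pose sa := sqc a; have ssa : star sa = sa by exact: star_sqc.
have saK : sa ** sa = a by apply: sqcK; exact/cpos_psd.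
pose w := sa ** star v; pose h := w ** star w.
have wsw : star w ** w = v ** a ** star v by rewrite /w starM starK ssa cmulA -(cmulA v) saK.
have ph : cpos h := cpos_ss' w; have hh := cpos_sa ph.
pose f (s : R) := Num.max (Num.min ((s - n) / n) 1) 0.
have cf : continuous f by rewrite /f; cts.
have f0 : f 0 = 0 by rewrite /f sub0r mulNr divff ?gt_eqF// max_r// ge_min lerN10.
have f01 s : 0 <= f s <= 1 by rewrite /f le_max lexx orbT ge_max ler01 andbT ge_min lexx orbT.
have fle s : f s <= n^-1 * Num.max (s - n) 0.
  rewrite /f ge_max; apply/andP; split; last by rewrite mulr_ge0 ?invr_ge0 ?(ltW n0)// le_max lexx orbT.
  by rewrite ge_min (mulrC (s - n)) ler_pM2l ?invr_gt0// le_max lexx.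
have f1 s : 2 * n <= s -> f s = 1.
  by move=> h2; rewrite /f min_r ?max_l// ler_pdivlMr// mul1r; lra.
clearbody f.
pose k := fc f h; have sk : star k = k by exact: star_fc.
pose g s := f s + f s - f s * f s.
have cg : continuous g by rewrite /g; cts.
have g0 : g 0 = 0 by rewrite /g f0 mulr0 subr0 addr0.
have gE s : g s = f s + f s - f s * f s by [].
have kE : fc g h = k + k - k ** k.
  by rewrite /g fcB ?f0 ?mul0r ?addr0//; try (by cts); rewrite fcD// fcM.
clearbody g.
pose b := cut e a; have pb : cpos b := cpos_cut e0 pa; have bb := cpos_sa pb.
pose be := sqc b; have sbe : star be = be by exact: star_sqc.
have beK : be ** be = b by apply: sqcK; exact/cpos_psd.
pose x := be - be ** k; pose r := star x ** x.
have x1 : x ** star x = b - be ** fc g h ** be.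
  by rewrite kE /x starB starM sk sbe !(cmulBl, cmulBr, cmulDl, cmulDr) !cmulA beK; zmod.
have pg : cpos (fc g h).
  by apply: cpos_fc => // s _; rewrite gE; have := f01 s; move: (f s) => q /andP[q0 q1]; nra.
have rx : cl r = cl (x ** star x).
  apply/cl_eq; [exact: cpos_ss|exact: cpos_ss'|by split; [exact: ss_cuntz|exact: ss'_cuntz]].
have gc : fc g h ≾ c.
  have t20 : 0 <= 2 / n by rewrite divr_ge0// ltW.
  apply: (@cuntz_trans _ _ (cut n h)).
    apply: (@cuntz_leC _ _ _ _ (2 / n)) => //; first exact: cpos_cut (ltW n0) ph.
    rewrite -fcZ ?cut_00 ?(ltW n0)//; last exact: cont_cut.
    apply: cle_fc; rewrite ?cut_00 ?mulr0 ?(ltW n0)//; first by apply: cont_M; [exact: cont_cst|exact: cont_cut].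
    move=> s _; rewrite gE; have := fle s; have := f01 s; move: (f s) (Num.max _ _) => q u /andP[q0 q1].
    by rewrite -mulrA; move: (n^-1 * u) => m qm; nra.
  apply: cuntz_trans (cut_ss' _ (ltW n0)) _; rewrite wsw.
  by apply: cuntz_close; rewrite ?(ltW n0)//; [exact: cpos_conj'|rewrite nrm_distC].
exists r; split; first exact: cpos_ss.
- pose p := cut (2 * n) h; have n20 : 0 <= 2 * n by rewrite mulr_ge0// ltW.
  have pp : cpos p := cpos_cut n20 ph.
  apply: (@cule_trans _ _ _ (cl p + cl r)).
    apply: culeD (cule_refl _); apply/cl_le => //; first exact: cpos_cut (ltW e10) pc.
    apply: (@cuntz_trans _ _ (cut (n + 2 * n) c)).
      by apply: cuntz_cut_le => //; [rewrite addr_ge0// ltW|rewrite /n; lra].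
    apply: (@cuntz_trans _ _ (cut (2 * n) (star w ** w))).
      by apply: cut_close => //; [exact: ltW|exact: cpos_ss|rewrite wsw].
    by have := @cut_ss' _ _ (2 * n) (star w) n20; rewrite starK.
  have pk : p ** k = p.
    rewrite /p /cut -fcM ?cut_00//; last exact: cont_cut.
    congr fc; apply/funext => s; case: (leP (s - 2 * n) 0) => hs; first by rewrite mul0r.
    by rewrite f1 ?mulr1//; lra.
  rewrite -cl_orth//; last first.
    + have px : p ** star x = 0 by rewrite /x starB starM sk sbe cmulBr cmulA pk subrr.
      by rewrite /r cmulA px cmul0r.
    + exact: cpos_ss.
  apply/cl_le => //; first by apply: cposD => //; exact: cpos_ss.
  have h1 : h =<= (nrm v ^+ 2)%:C *: a.
    have := @cpos_nrm R D (star v ** v) (nrm v ^+ 2) sa; rewrite ssa saK /h /w !starM !starK ssa !cmulA; apply=> //.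
    by rewrite nrm_cstar.
  have h2 : p =<= h by rewrite /p -{2}(cut0 ph); apply: cut_le.
  have h3 : k ** k =<= n^-1%:C *: h.
    have -> : n^-1%:C *: h = fc (fun s => n^-1 * s) h by rewrite fcZ ?fc_id//; exact: cont_id.
    rewrite -fcM//; apply: cle_fc; rewrite ?f0 ?mulr0//; [by cts|by cts|].
    move=> s /andP[s0 _]; have /andP[q0 q1] := f01 s; have q2 := fle s.
    have : Num.max (s - n) 0 <= s by rewrite ge_max s0 andbT; lra.
    have ni : 0 <= n^-1 by rewrite invr_ge0 ltW.
    by move=> q3; have := ler_wpM2l ni q3; nra.
  (* Parallelogram law: since [k] need not commute with [b], [r] need not be below [b], but it is
     below [2 b + 2 k b k]. *)
  have h4 : r =<= (2%:C *: b + (2 * nrm b / n)%:C *: h).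
    have e4 : 2%:C *: b + 2%:C *: (k ** b ** k) - r = star (be + be ** k) ** (be + be ** k).
      rewrite /r /x starB starD !starM sk sbe !(cmulBl, cmulBr, cmulDl, cmulDr) !cmulA !beK.
      have Z2 (z : D) : 2%:C *: z = z + z by rewrite scaleRn mulr2n.
      rewrite !Z2 -!(cmulA k be) beK.
      zmod.
    apply: (@cle_trans _ _ (2%:C *: b + 2%:C *: (k ** b ** k))); first by rewrite /cle e4; exact: cpos_ss.
    apply: cleD (cle_refl _) _.
    have h5 : k ** b ** k =<= (nrm b)%:C *: (k ** k) by have := @cpos_nrm R D b (nrm b) k bb (lexx _); rewrite sk.
    have h6 : (nrm b)%:C *: (k ** k) =<= (nrm b)%:C *: (n^-1%:C *: h).
      by rewrite /cle -scalerBr; apply: cposZ => //; exact: nrm_ge0.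
    have h7 := cle_trans h5 h6.
    have -> : (2 * nrm b / n)%:C *: h = 2%:C *: ((nrm b)%:C *: (n^-1%:C *: h)).
      by rewrite !scalerA -!rmorphM.
    by rewrite /cle -scalerBr; apply: cposZ.
  have ba : b =<= a by have := cut_le (lexx 0) e0 pa; rewrite (cut0 pa).
  pose C := nrm v ^+ 2 + (2 + 2 * nrm b / n * nrm v ^+ 2).
  have nb0 : 0 <= 2 * nrm b / n by rewrite divr_ge0 ?(ltW n0)// mulr_ge0 ?nrm_ge0.
  have v0 : 0 <= nrm v ^+ 2 by rewrite exprn_ge0 ?nrm_ge0.
  apply: (@cuntz_leC _ _ _ _ C) => //.
    by rewrite !addr_ge0// mulr_ge0.
    by apply: cposD => //; exact: cpos_ss.
  rewrite /C !rmorphD/= !scalerDl; apply: cleD; first exact: cle_trans h2 h1.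
  apply: cle_trans h4 _; apply: cleD.
    by rewrite -scalerDl -rmorphD/= /cle -scalerBr; apply: cposZ.
  have -> : (2 * nrm b / n * nrm v ^+ 2)%:C *: a = (2 * nrm b / n)%:C *: ((nrm v ^+ 2)%:C *: a) by rewrite scalerA -rmorphM.
  by rewrite /cle -scalerBr; apply: cposZ.
- rewrite -/b; have -> : b = x ** star x + be ** fc g h ** be by rewrite x1 subrK.
  have pbg : cpos (be ** fc g h ** be) by exact: cpos_sac.
  apply: cule_trans (cl_leD (cpos_ss' x) pbg) _; rewrite -rx addrC.
  apply: culeD (cule_refl _); apply/cl_le => //.
  apply: cuntz_trans gc; have := cuntz_conj (fc g h) be; rewrite sbe; exact.
- rewrite rx; apply/cl_le => //; [exact: cpos_ss'|apply: cle_cuntz; first exact: cpos_ss'].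
  by rewrite x1 /cle opprB addrC subrK; exact: cpos_sac.
Qed.

End O5.

Section WayBelow.
Context {R : realType} {B : cstarAlgType R} {S : stabilization B}.
Local Notation D := (stab S).
Implicit Types (a b c : D) (x y z : CuM S).

Lemma cut_dsum a b (e : R) : 0 <= e -> cpos a -> cpos b -> cut e (dsum a b) = dsum (cut e a) (cut e b).
Proof.
move=> e0 pa pb; rewrite !dsumE /cut fc_orth ?cut_00//; last 4 first.
- by apply: cpos_sa; exact: cpos_dl.
- by apply: cpos_sa; exact: cpos_dr.
- exact: dldr.
- exact: cont_cut.
by rewrite (hom_fc dl_hom) ?(hom_fc dr_hom) ?cut_00//; (exact: cont_cut || exact: cpos_sa).
Qed.

Definition wb x' x := exists a (e : R), [/\ cpos a, 0 < e, x = cl a & x' ⊑ cl (cut e a)].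

Lemma wb_cut a (e : R) : cpos a -> 0 < e -> wb (cl (cut e a)) (cl a).
Proof. by move=> pa e0; exists a, e; split=> //; exact: cule_refl. Qed.

Lemma wb_le x' x : wb x' x -> x' ⊑ x.
Proof. by move=> [a [e [pa e0 -> h]]]; apply: cule_trans h _; apply: cl_cut => //; exact: ltW. Qed.

Lemma wb_rep x' a : cpos a -> wb x' (cl a) -> exists2 e : R, 0 < e & x' ⊑ cl (cut e a).
Proof.
move=> pa [b [e [pb e0 /(cl_eq pa pb)[_ ba] h]]].
have [d d0 hd] := cuntz_cut_cut pb pa ba e0.
exists d => //; apply: cule_trans h _; apply/cl_le => //; apply: cpos_cut => //; exact: ltW.
Qed.

Lemma wb_trans y' y x x' : y' ⊑ y -> wb y x -> x ⊑ x' -> wb y' x'.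
Proof.
move=> h1 [a [e [pa e0 -> h2]]]; have [b pb ->] := cl_surj x' => /(cl_le pa pb) ab.
have [d d0 hd] := cuntz_cut_cut pa pb ab e0.
exists b, d; split=> //; apply: cule_trans h1 (cule_trans h2 _).
by apply/cl_le => //; apply: cpos_cut => //; exact: ltW.
Qed.

Lemma wb_ler y x x' : wb y x -> x ⊑ x' -> wb y x'.
Proof. exact: wb_trans (cule_refl _). Qed.

Lemma wb_interp x' x : wb x' x -> exists2 y, wb x' y & wb y x.
Proof.
move=> [a [e [pa e0 -> h]]]; have e2 : 0 < e / 2 by rewrite divr_gt0.
exists (cl (cut (e / 2) a)); last exact: wb_cut.
have p2 := cpos_cut (ltW e2) pa.
exists (cut (e / 2) a), (e / 2); split=> //.
rewrite cut_cut ?(ltW e2)//; last exact: cpos_sa.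
by have -> : e / 2 + e / 2 = e by lra.
Qed.

Lemma wb_sup x y : (forall x', wb x' x -> x' ⊑ y) -> x ⊑ y.
Proof.
have [a pa ->] := cl_surj x; have [b pb ->] := cl_surj y => h.
apply/cl_le => //; apply: cuntz_of_cuts => // e e0.
by apply/cl_le => //; [exact: cpos_cut (ltW e0) pa|apply: h; exact: wb_cut].
Qed.

Lemma wb0 x : wb 0 x.
Proof.
have [a pa ->] := cl_surj x; exists a, 1; split=> //; exact: cule0x.
Qed.

Lemma wb_join y z x : wb y x -> wb z x -> exists u, [/\ wb u x, y ⊑ u & z ⊑ u].
Proof.
have [a pa ->] := cl_surj x => /(wb_rep pa)[e e0 h1] /(wb_rep pa)[d d0 h2].
have m0 : 0 < Num.min e d by rewrite lt_min e0 d0.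
exists (cl (cut (Num.min e d) a)); split; first exact: wb_cut.
  by apply: cule_trans h1 _; apply: cl_cut_le; rewrite ?(ltW m0)// ge_min lexx.
by apply: cule_trans h2 _; apply: cl_cut_le; rewrite ?(ltW m0)// ge_min lexx orbT.
Qed.

Lemma wbD x' x y' y : wb x' x -> wb y' y -> wb (x' + y') (x + y).
Proof.
have [a pa ->] := cl_surj x; have [b pb ->] := cl_surj y => /(wb_rep pa)[e e0 h1] /(wb_rep pb)[d d0 h2].
have m0 : 0 < Num.min e d by rewrite lt_min e0 d0.
exists (dsum a b), (Num.min e d); split; rewrite ?cl_add//; first exact: cpos_dsum.
rewrite cut_dsum ?(ltW m0)// -cl_add; try exact: cpos_cut (ltW m0) _.
apply: culeD; [apply: cule_trans h1 _|apply: cule_trans h2 _]; apply: cl_cut_le; rewrite ?(ltW m0)// ge_min lexx ?orbT//.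
Qed.

Lemma wb_split x' y z : wb x' (y + z) -> exists y' z', [/\ wb y' y, wb z' z & x' ⊑ y' + z'].
Proof.
have [a pa ->] := cl_surj y; have [b pb ->] := cl_surj z; rewrite cl_add//.
move=> /wb_rep[|e e0 h]; first exact: cpos_dsum.
exists (cl (cut e a)), (cl (cut e b)); split; [exact: wb_cut|exact: wb_cut|].
by rewrite cl_add; try exact: cpos_cut (ltW e0) _; rewrite -cut_dsum// ltW.
Qed.

Lemma wbMn n x' x : wb x' x -> wb (x' *+ n) (x *+ n).
Proof. by move=> h; elim: n => [|n ih]; [exact: wb0|rewrite !mulrS; exact: wbD]. Qed.

Lemma wb_splitMn n x' y : wb x' (y *+ n) -> exists2 y', wb y' y & x' ⊑ y' *+ n.
Proof.
elim: n x' => [|n ih] x'; first by exists 0; [exact: wb0|exact: wb_le].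
rewrite mulrS => /wb_split[u [v [wu /ih[w ww vw] xuv]]].
have [y' [wy uy wy']] := wb_join wu ww; exists y' => //.
apply: cule_trans xuv _; rewrite mulrS; apply: culeD uy _; apply: cule_trans vw _; exact: culeMn.
Qed.

Definition cancellative := forall x' x z, wb x' x -> x *+ 2 ⊑ x' + z -> exists K, x' ⊑ z *+ K.

(** Each further [b] copies of [x] cost [m] copies of [z]: the [a] copies of [x'] on the right are
    enlarged to copies of [x], and the hypothesis is used again. *)
Lemma CAN_iter x' x z (a b m i : nat) : x' ⊑ x -> x *+ (a + b) ⊑ x' *+ a + z *+ m ->
  x *+ (a + i.+1 * b) ⊑ x' *+ a + z *+ (i.+1 * m).
Proof.
move=> xx h; elim: i => [|i ih]; first by rewrite !mul1n.
rewrite mulSn (addnCA) mulrnDr.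
apply: (@cule_trans _ _ _ (x *+ b + (x' *+ a + z *+ (i.+1 * m)))).
  by apply: culeD ih; exact: cule_refl.
rewrite addrA (addrC (x *+ b)) (mulSn i.+1 m); move: (i.+1 * m)%N => c; rewrite mulrnDr addrA.
apply: culeD; last exact: cule_refl.
apply: cule_trans h; rewrite mulrnDr; apply: culeD (cule_refl _); exact: culeMn.
Qed.

Hypotheses (AU : almost_unperforated S) (FC : cancellative).

(** By cancellation the [a] copies of [x'] are below a fixed number of copies of [z]. After many
    iterations this number is negligible against [i.+1 * m], and almost unperforation yields every
    ratio [p / q] below the limiting ratio [b / m]. *)
Lemma CAN x' x z (a b m p q : nat) : wb x' x -> x *+ (a + b) ⊑ x' *+ a + z *+ m -> (p * m < q * b)%N ->
  x *+ p ⊑ z *+ q.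
Proof.
move=> xx h pq; have h2 := fun i => CAN_iter i (wb_le xx) h.
have b0 : (0 < b)%N by case: (b) pq => //; rewrite muln0.
have [|K hK] := FC (wbMn a xx) (_ : _ ⊑ x' *+ a + z *+ (a.+1 * m)).
  by rewrite -mulrnA; apply: cule_trans (h2 a); apply: culeMnl; nia.
have [i ip] : exists i, (p * (a.+1 * m * K) < i)%N by exists (p * (a.+1 * m * K)).+1.
apply: (@AUq _ _ _ AU _ _ (a + i.+1 * b) (a.+1 * m * K + i.+1 * m)); last by nia.
apply: cule_trans (h2 i) _; move: (i.+1 * m)%N => c; rewrite mulrnDr; apply: culeD (cule_refl _).
by rewrite mulrnA.
Qed.

End WayBelow.

Arguments cancellative {R B} S.

(** * Pointwise comparison *)

Section HomCuntz.
Context {R : realType} {E E' : cstarAlgType R} {phi : E -> E'}.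
Hypothesis hphi : star_hom phi.

Lemma star_hom_cpos a : cpos a -> cpos (phi a).
Proof. by move=> [c ->]; exists (phi c); rewrite (star_homM hphi) (star_hom_star hphi). Qed.

Lemma star_hom_cuntz a b : a ≾ b -> phi a ≾ phi b.
Proof.
move=> /cuntzP h; apply/cuntzP => e e0; have [v hv] := h e e0; exists (phi v).
rewrite -(star_hom_star hphi) -!(star_homM hphi) -(homB hphi).
exact: le_lt_trans (hom_nrm hphi _) hv.
Qed.

End HomCuntz.

Section CtsPointwise.
Context {R : realType} {X : metricType R} {cX : compact [set: X]} {E : cstarAlgType R}.
Implicit Types (F G : cts_alg cX E).

Lemma ev_hom (p : X) : star_hom (fun F : cts_alg cX E => cts_ev F p).
Proof. by split. Qed.

Lemma ev_cpos F p : cpos F -> cpos (cts_ev F p).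
Proof. exact: (star_hom_cpos (ev_hom p)). Qed.

Lemma cpos_cts F : (forall p, cpos (cts_ev F p)) -> cpos F.
Proof.
move=> h; apply/cpos_psd; split; first by apply: cts_evP => p; exact: cpos_sa (h p).
exists (nrm F) => [|z]; first exact: nrm_ge0.
apply: nrm_cts_le => [|p]; first by rewrite mulr_ge0 ?nrm_ge0.
change (nrm ((nrm F)%:C *: cts_ev z p - cts_ev F p ** cts_ev z p) <= nrm F * nrm z).
have := cpos_act (cts_ev z p) (h p); have n1 := nrm_ev F p; have n2 := nrm_ev z p.
have -> : (nrm F)%:C *: cts_ev z p - cts_ev F p ** cts_ev z p = (nrm F - nrm (cts_ev F p))%:C *: cts_ev z p +
    ((nrm (cts_ev F p))%:C *: cts_ev z p - cts_ev F p ** cts_ev z p).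
  by rewrite rmorphB/= scalerBl; zmod.
move=> n3; rewrite (le_trans (nrmD _ _))// nrmZr ger0_norm ?subr_ge0//.
have := nrm_ge0 (cts_ev z p); have := nrm_ge0 (cts_ev F p); move: n1 n2 n3.
move: (nrm F) (nrm z) (nrm (cts_ev F p)) (nrm (cts_ev z p)) (nrm _) => *; nra.
Qed.

Lemma ev_fc (f : R -> R) F p : star F = F -> continuous f -> f 0 = 0 -> cts_ev (fc f F) p = fc f (cts_ev F p).
Proof. exact: (hom_fc (ev_hom p)). Qed.

Lemma ev_cut e F p : 0 <= e -> cpos F -> cts_ev (cut e F) p = cut e (cts_ev F p).
Proof. by move=> e0 pF; rewrite /cut ev_fc ?cut_00//; [exact: cpos_sa|exact: cont_cut]. Qed.

Lemma ev_near F (p : X) (e : R) : 0 < e -> \forall q \near p, nrm (cts_ev F p - cts_ev F q) < e.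
Proof. by move=> e0; have /nrm_cvgP/(_ _ e0) := @cts_ev_continuous _ _ _ _ F p. Qed.

Lemma ev_unif F (e : R) : 0 < e ->
  exists2 d : R, 0 < d & forall p q, mdist p q < d -> nrm (cts_ev F p - cts_ev F q) < e.
Proof.
move=> e0; have [x _|d d0 hd] := @lebesgue_number R X setT (fun y z => nrm (cts_ev F y - cts_ev F z) < e) cX.
  have e2 : 0 < e / 2 by rewrite divr_gt0.
  have /nbhs_ballP[d d0 hd] := ev_near F x e2; exists d => // y z /hd h1 /hd h2.
  rewrite (le_lt_trans (nrm_dist3 _ (cts_ev F x) _))// nrm_distC.
  by move: h1 h2; move: (nrm _) (nrm _) => *; lra.
by exists d => // p q pq; apply: hd => //; rewrite ballEmdist.
Qed.

End CtsPointwise.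

Section Ev.
Context {R : realType} {X : metricType R} {cX : compact [set: X]} {A : cstarAlgType R} {S : stabilization A}.
Local Notation D := (stab S).
Local Notation SX := (ctsStab cX S).
Implicit Types (F G : cts_alg cX D) (x y z : CuM SX) (p : X).

Lemma evS_hom p : @star_hom R (stab SX) D (fun F : cts_alg cX D => cts_ev F p).
Proof. exact: ev_hom. Qed.

Definition ev p x : CuM S := cl (cts_ev (sval (cu_rep x) : cts_alg cX D) p).

Lemma ev_cl p (F : stab SX) : cpos F -> ev p (cl F) = cl (cts_ev (F : cts_alg cX D) p).
Proof.
move=> pF; rewrite /ev; case: (cu_rep _) => G /= rG.
have [pG /(@cl_eq _ _ SX _ _ pF pG)[h1 h2]] := (representsE _ _).1 rG.
apply/cl_eq; [exact: ev_cpos|exact: ev_cpos|split].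
  exact: (star_hom_cuntz (evS_hom p) h2).
exact: (star_hom_cuntz (evS_hom p) h1).
Qed.

Lemma evD p x y : ev p (x + y) = ev p x + ev p y.
Proof.
have [a pa ->] := cl_surj x; have [b pb ->] := cl_surj y.
rewrite cl_add// !ev_cl//; last exact: (@cpos_dsum _ _ SX).
by rewrite cl_add//; exact: ev_cpos.
Qed.

Lemma ev0 p : ev p 0 = 0.
Proof. by rewrite -cl0 ev_cl ?cl0//; exact: cpos_0. Qed.

Lemma evMn p x n : ev p (x *+ n) = ev p x *+ n.
Proof. by elim: n => [|n ih]; rewrite ?ev0// !mulrS evD ih. Qed.

Lemma ev_bigsum p I (r : seq I) (P : pred I) (G : I -> CuM SX) :
  ev p (\sum_(i <- r | P i) G i) = \sum_(i <- r | P i) ev p (G i).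
Proof. exact: (big_morph (ev p) (evD p) (ev0 p)). Qed.

Lemma ev_le p x y : x ⊑ y -> ev p x ⊑ ev p y.
Proof.
have [a pa ->] := cl_surj x; have [b pb ->] := cl_surj y => /(cl_le pa pb) ab.
by rewrite !ev_cl//; apply/cl_le; [exact: ev_cpos|exact: ev_cpos|exact: (star_hom_cuntz (evS_hom p) ab)].
Qed.

Lemma ev_wb p x y : wb x y -> wb (ev p x) (ev p y).
Proof.
move=> [a [e [pa e0 -> h]]]; exists (cts_ev a p), e; split=> //; [exact: ev_cpos|exact: ev_cl|].
by have := ev_le p h; rewrite ev_cl ?ev_cut ?(ltW e0)//; exact: cpos_cut (ltW e0) _.
Qed.

Definition ple x y := forall p, ev p x ⊑ ev p y.

Lemma ple_le x y : x ⊑ y -> ple x y. Proof. by move=> h p; exact: ev_le. Qed.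

Lemma ple_trans y x z : ple x y -> ple y z -> ple x z.
Proof. by move=> h1 h2 p; exact: cule_trans (h1 p) (h2 p). Qed.

Lemma pleD x y x' y' : ple x x' -> ple y y' -> ple (x + y) (x' + y').
Proof. by move=> h1 h2 p; rewrite !evD; exact: culeD. Qed.

Lemma pleMn n x y : ple x y -> ple (x *+ n) (y *+ n).
Proof. by move=> h p; rewrite !evMn; exact: culeMn. Qed.

Lemma pleAU x y (m l p q : nat) : almost_unperforated S -> ple (x *+ m) (y *+ l) -> (p * l < q * m)%N -> ple (x *+ p) (y *+ q).
Proof. by move=> AU h pq t; rewrite !evMn; apply: AUq (pq) => //; rewrite -!evMn. Qed.

(** At each point some cutdown of [y] dominates; a smaller cut does so nearby, and compactness of
    [X] makes it uniform. Thus [wb] can be used together with the pointwise order. *)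
Lemma ptwb x y x' : ple x y -> wb x' x -> exists2 y', wb y' y & ple x' y'.
Proof.
have [F pF ->] := cl_surj x; have [G pG ->] := cl_surj y => h /(wb_rep pF)[e e0 hx].
have e2 : 0 < e / 2 by rewrite divr_gt0.
have /compact_near_coveringP cX' := cX.
have near_d : \forall d \near (0 : R)^'+, forall p, [set: X] p ->
    cl (cut e (cts_ev F p)) ⊑ (cl (cut d (cts_ev G p)) : CuM S).
  apply: cX' => p _.
  have pFp := ev_cpos p pF; have pGp := ev_cpos p pG.
  have [|d d0 hd] := @wb_rep _ _ S (cl (cut (e / 2) (cts_ev F p))) (cts_ev G p) pGp.
    apply: wb_ler (wb_cut pFp e2) _; by have := h p; rewrite !ev_cl.
  have d2 : 0 < d / 2 by rewrite divr_gt0.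
  exists ([set q | nrm (cts_ev F p - cts_ev F q) < e / 2] `&` [set q | nrm (cts_ev G p - cts_ev G q) < d / 2],
      [set d' : R | 0 < d' /\ d' < d / 2]) => /=.
    by split; [apply: filterI; exact: ev_near|apply: filterI; [exact: nbhs_right_gt|exact: nbhs_right_lt]].
  move=> [q d'] /= [[hF hG] [d'0 d'd]].
  have pFq := ev_cpos q pF; have pGq := ev_cpos q pG.
  apply: (@cule_trans _ _ _ (cl (cut (e / 2) (cts_ev F p)))).
    apply/cl_le; [exact: cpos_cut (ltW e0) pFq|exact: cpos_cut (ltW e2) pFp|].
    have E : e = e / 2 + e / 2 by lra.
    rewrite [X in cut X (cts_ev F q)]E; apply: cut_close => //; rewrite ?(ltW e2)// nrm_distC ltW//.
  apply: cule_trans hd _.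
  apply/cl_le; [exact: cpos_cut (ltW d0) pGp|exact: cpos_cut (ltW d'0) pGq|].
  apply: (@cuntz_trans _ _ (cut (d / 2) (cts_ev G q))); last by apply: cuntz_cut_le => //; exact: ltW.
  have E : d = d / 2 + d / 2 by lra.
  by rewrite [X in cut X (cts_ev G p)]E; apply: cut_close => //; rewrite ?(ltW d2)// ltW.
have [d [d0 hd]] := @filter_ex _ (0 : R)^'+ _ _ (filterI (nbhs_right_gt (0 : R)) near_d).
exists (cl (cut d (G : stab SX))); first exact: wb_cut.
move=> p; apply: cule_trans (ev_le p hx) _.
rewrite !ev_cl; [|exact: cpos_cut (ltW d0) _|exact: cpos_cut (ltW e0) _].
by rewrite !ev_cut ?(ltW d0) ?(ltW e0)//; exact: hd.
Qed.

End Ev.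

Section ScalarFun.
Context {R : realType} {X : metricType R} {cX : compact [set: X]} {E : cstarAlgType R}.
Implicit Types (h : X -> R) (y : E).

Lemma fmul_cont h (F : cts_alg cX E) : continuous h -> continuous (fun x : X => (h x)%:C *: cts_ev F x : E).
Proof.
move=> ch x; apply/nrm_cvgP => r r0; have B1 : 0 < nrm (cts_ev F x) + 1 by rewrite ltr_wpDl ?nrm_ge0.
pose c := `|h x| + 1; have c0 : 0 < c by rewrite ltr_wpDl.
have /cvgrPdist_lt H := ch x.
have d0 : 0 < Num.min 1 (r / (2 * (nrm (cts_ev F x) + 1))) by rewrite lt_min ltr01 divr_gt0// mulr_gt0.
have d1 : 0 < r / (2 * c) by rewrite divr_gt0// mulr_gt0.
have K : \forall y \near x, `|h x - h y| < Num.min 1 (r / (2 * (nrm (cts_ev F x) + 1))) /\ nrm (cts_ev F x - cts_ev F y) < r / (2 * c).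
  exact: (filterI (H _ d0) (ev_near F x d1)).
move: K; apply: filterS => y [h1 h2].
have -> : (h x)%:C *: cts_ev F x - (h y)%:C *: cts_ev F y = (h x - h y)%:C *: cts_ev F x + (h y)%:C *: (cts_ev F x - cts_ev F y).
  by rewrite rmorphB/= scalerBl scalerBr; zmod.
rewrite (le_lt_trans (nrmD _ _))// !nrmZr.
move: h1; rewrite lt_min => /andP[h1]; rewrite ltr_pdivlMr ?mulr_gt0// => h3.
move: h2; rewrite ltr_pdivlMr ?mulr_gt0// => h4.
have h5 : `|h y| < c.
  have -> : h y = h x - (h x - h y) by ring.
  by rewrite /c (le_lt_trans (ler_normB _ _))// ltrD2l.
have := normr_ge0 (h x - h y); have := nrm_ge0 (cts_ev F x); have := nrm_ge0 (cts_ev F x - cts_ev F y).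
have := normr_ge0 (h y).
move: h3 h4 h5; rewrite -/c; move: (nrm _) (nrm _) `|_| `|_| => *; nra.
Qed.

Definition fmul h (ch : continuous h) (F : cts_alg cX E) : cts_alg cX E := cts_mk (fmul_cont (F := F) ch).

Lemma cst_cont y : continuous (fun _ : X => y). Proof. by move=> x; exact: cvg_cst. Qed.

Definition fcst y : cts_alg cX E := cts_mk (cst_cont (y := y)).

End ScalarFun.

(** * Pointwise almost divisibility *)

Section ADpt.
Context {R : realType} {X : metricType R} {cX : compact [set: X]} {A : cstarAlgType R} {S : stabilization A}.
Local Notation D := (stab S).
Local Notation SX := (ctsStab cX S).
Hypotheses (AU : almost_unperforated S) (AD : almost_divisible S).

(** The sum counts the layers [l < M] that the value [s] exceeds: it is [s] rounded up, as far as
    [M] allows. *)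
Lemma count_below (s : R) M : 0 <= s ->
  Num.min s M%:R <= (\sum_(l < M) ((l%:R < s)%R : nat))%N%:R <= Num.min (s + 1) M%:R.
Proof.
move=> s0; have s1 : 0 <= s + 1 by rewrite addr_ge0.
elim: M => [|M ih]; first by rewrite big_ord0 !min_r//= lexx.
rewrite big_ord_recr/= natrD -natr1; move: ih; move: (\sum_(l < M) _)%N => k; move: (k%:R : R) (M%:R : R) => u m.
case: (boolP (m < s)) => h; rewrite -?leNgt in h; rewrite /= ?mulr1n ?mulr0n ?addr0 !ge_min !le_min => /andP[/orP[h1|h1] /andP[h2 h3]];
  (apply/andP; split; [apply/orP|apply/andP; split; lra]); solve [left; lra|right; lra].
Qed.

Lemma cl_scale (r : R) (a : D) : 0 <= r -> cpos a -> cl (r%:C *: a) = cl a *+ (0 < r)%R :> CuM S.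
Proof.
move=> r0 pa; case: ltP => h.
  apply/cl_eq => //; first exact: cposZ.
  by split; [exact: cuntz_scale (cuntz_refl pa)|exact: cuntz_scale_r (cuntz_refl pa)].
have -> : r = 0 by apply/eqP; rewrite eq_le h r0.
by rewrite scale0r cl0.
Qed.

(** Almost divisors [c i] at the centres of a cover are spread over the layers where [M * h i]
    exceeds [l]. At a point the class of [y] is a sum of between [M] and [M + n] of the classes
    [cl (c i)], so for large [M] the number [n] of pieces that may overlap becomes negligible. *)
Lemma ADpt x x' N : wb x' x -> exists y : CuM SX, ple (y *+ N) x /\ ple x' (y *+ N.+1).
Proof.
have [F pF ->] := cl_surj x => /(wb_rep pF)[e e0 hx].
have e4 : 0 < e / 4 by rewrite divr_gt0.
have [d d0 hd] := ev_unif (F : cts_alg cX D) e4.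
have [n [p [h [ch h0 h1 hp_]]]] := pou cX d0.
(* Chosen such that [N * (M + n) < N'] and [N'.+1 < N.+1 * M], the two strict inequalities that
   almost unperforation needs below. *)
pose M := (N * n).+3; pose N' := (N * (M + n)).+1.
have /choice[c hc] (i : 'I_n) : exists c : D, [/\ cpos c, cl c *+ N' ⊑ (cl (cut (e / 4) (cts_ev F (p i))) : CuM S) &
    cl (cut (e / 4 + e / 4) (cts_ev F (p i))) ⊑ (cl c *+ N'.+1 : CuM S)].
  have pFi := ev_cpos (p i) pF.
  have [c [pc c1 c2]] := AD_cut AD N' (cpos_cut (ltW e4) pFi) e4; exists c; split=> //.
  by rewrite cut_cut ?(ltW e4)// in c2; exact: cpos_sa.
pose g (i : 'I_n) (l : nat) q := Num.max (M%:R * h i q - l%:R) 0.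
have cg i l : continuous (g i l).
  have cm : continuous (fun r : R => Num.max (M%:R * r - l%:R) 0) by cts.
  by move=> q; apply: (@continuous_comp _ _ _ (h i) (fun r : R => Num.max (M%:R * r - l%:R) 0)); [exact: ch|exact: cm].
have g0 i l q : 0 <= g i l q by rewrite le_max lexx orbT.
pose y : CuM SX := \sum_i \sum_(l < M) cl (fmul (cg i l) (fcst (c i)) : stab SX).
pose k q i := (\sum_(l < M) ((l%:R < M%:R * h i q)%R : nat))%N.
have pf i l : cpos (fmul (cg i l) (fcst (c i)) : cts_alg cX D).
  by apply: cpos_cts => q; apply: cposZ => //; case: (hc i).
have ME q : M%:R = \sum_i M%:R * h i q by rewrite -mulr_sumr h1 mulr1.
have yE q : ev q y = \sum_i cl (c i) *+ k q i.
  rewrite ev_bigsum; apply: eq_bigr => i _; rewrite ev_bigsum /k -sumrMnr.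
  apply: eq_bigr => l _; rewrite ev_cl//.
  change (cl ((g i l q)%:C *: c i) = cl (c i) *+ (l%:R < M%:R * h i q)%R :> CuM S).
  by rewrite cl_scale//; [rewrite /g lt_max ltxx orbF subr_gt0|case: (hc i)].
have h_le1 i q : h i q <= 1.
  by rewrite -(h1 q) (bigD1 i)//= lerDl; apply: sumr_ge0.
have kb q i := count_below M (mulr_ge0 (ler0n R M) (h0 i q)).
have kM q : (M <= \sum_i k q i)%N.
  rewrite -(ler_nat R) natr_sum (ME q); apply: ler_sum => i _.
  have /andP[+ _] := kb q i; rewrite min_l//; exact: ler_piMr.
have kMn q : (\sum_i k q i <= M + n)%N.
  rewrite -(ler_nat R) natr_sum natrD (ME q).
  have -> : n%:R = \sum_(i < n) 1 :> R by rewrite sumr_const card_ord.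
  rewrite -big_split/=.
  by apply: ler_sum => i _; have /andP[_] := kb q i; rewrite le_min => /andP[].
have kpos q i : k q i != 0%N -> nrm (cts_ev F (p i) - cts_ev F q) < e / 4.
  move=> ki; apply: hd; apply: hp_; apply: contraNneq ki => hi.
  by rewrite /k big1// => l _; rewrite hi mulr0 ltNge ler0n.
have cq q := ev_cpos q pF.
exists y; split=> q.
- rewrite evMn ev_cl//; have key : ev q y *+ N *+ N' ⊑ cl (cts_ev F q) *+ (N * (M + n)).
    apply: (@cule_trans _ _ _ (cl (cts_ev F q) *+ (N * (\sum_i k q i)))); last first.
      by apply: culeMnl; rewrite leq_mul2l kMn orbT.
    rewrite -mulrnA (mulnC N N') mulrnA (mulnC N) mulrnA yE; apply: culeMn; rewrite -sumrMnl -sumrMnr; apply: cule_sum => i _.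
    have [->|ki] := eqVneq (k q i) 0%N; first by rewrite !mulr0n mul0rn; exact: cule_refl.
    rewrite mulrnAC; apply: culeMn; have [pc c1 _] := hc i; apply: cule_trans c1 _.
    apply/cl_le; [exact: cpos_cut (ltW e4) (ev_cpos (p i) pF)|exact: cq|].
    rewrite -[e / 4]addr0 -[X in _ ≾ X](cut0 (cq q)); apply: cut_close; rewrite ?(ltW e4) ?(ltW (kpos _ _ ki))//.
  have := AUq AU (p := 1) (q := 1) key; rewrite !mul1n => /(_ (ltnSn _)); exact.
- apply: cule_trans (ev_le q hx) _; rewrite evMn ev_cl; last exact: cpos_cut (ltW e0) _.
  rewrite ev_cut ?(ltW e0)//.
  have key : cl (cut e (cts_ev F q)) *+ M ⊑ ev q y *+ N'.+1.
    apply: cule_trans (culeMnl _ (kM q)) _; rewrite yE -sumrMnl -sumrMnr; apply: cule_sum => i _.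
    have [->|ki] := eqVneq (k q i) 0%N; first by rewrite !mulr0n mul0rn; exact: cule_refl.
    rewrite mulrnAC; apply: culeMn; have [pc _] := hc i; apply: cule_trans.
    have pFi := ev_cpos (p i) pF.
    have ee : 0 <= e / 4 + e / 4 by rewrite addr_ge0// ltW.
    apply: (@cule_trans _ _ _ (cl (cut (e / 4 + (e / 4 + e / 4)) (cts_ev F q)))).
      by apply: cl_cut_le => //; [rewrite addr_ge0// ltW|lra].
    apply/cl_le; [by apply: cpos_cut => //; rewrite addr_ge0// ltW|exact: cpos_cut|].
    by apply: cut_close; rewrite ?(ltW e4)// nrm_distC ltW// kpos.
  apply: (AUq AU (p := 1) (q := N.+1) key); rewrite /N' /M; nia.
Qed.

End ADpt.

#[global] Opaque cl cu_add cu_le ev wb.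

(** * From comparison with a factor to strict comparison and divisibility *)

Section StrictComparison.
Context {R : realType} {X : metricType R} {cX : compact [set: X]} {A : cstarAlgType R} {S : stabilization A}.
Local Notation D := (stab S).
Local Notation SX := (ctsStab cX S).
Hypotheses (AU : almost_unperforated S) (AD : almost_divisible S) (FC : cancellative S).
Variable M : nat.
Hypotheses (M0 : (0 < M)%N) (WC : forall x y : CuM SX, ple (x *+ M) y -> x ⊑ y).
Implicit Types (x y z u r s : CuM SX).

Lemma ple_refl x : ple x x. Proof. by apply: ple_le; exact: cule_refl. Qed.

Lemma evMnD p x y n : ev p ((x + y) *+ n) = ev p (x *+ n) + ev p y *+ n.
Proof. by rewrite mulrnDl evD !evMn. Qed.

(** [u] is a pointwise divisor of [x] and [r] its complement from [O5]. The complement is below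
    [cut e a], hence pointwise below [N.+1] copies of the part of [u] to which it is added; so it
    takes at most the share [N.+1 / N.+2] of [x]. *)
Lemma ADpt_O5 x' x N : wb x' x -> (M <= N)%N ->
  exists u r, [/\ x' ⊑ u + r, ple (u *+ N) x & ple (r *+ N.+2) (x *+ N.+1)].
Proof.
have [a pa ->] := cl_surj x => /(wb_rep pa)[e e0 hx] MN.
have e2 : 0 < e / 2 by rewrite divr_gt0.
have [y [y1 y2]] := ADpt AU AD N (wb_cut pa e2).
(* Weak comparison enters because [O5] needs a global inequality. *)
have yx : y ⊑ cl a.
  by apply: WC => p; apply: cule_trans (y1 p); rewrite !evMn; exact: culeMnl.
have w1 : wb (cl (cut e a)) (cl (cut (e / 2) a)).
  have := wb_cut (cpos_cut (ltW e2) pa) e2; rewrite cut_cut ?(ltW e2)//; last exact: cpos_sa.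
  by have -> : e / 2 + e / 2 = e by lra.
have [y' wy hy'] := ptwb y2 w1.
have [y'' wy'' y'y] := wb_splitMn wy.
have [c pc yE] := cl_surj y; rewrite {y}yE in y1 y2 yx wy wy''.
have [e1 e10 he1] := wb_rep pc wy''.
have [r [pr r1 r2 r3]] := O5 pa pc ((cl_le pc pa).1 yx) e10 (ltW e0).
exists (cl c), (cl r); split; [exact: cule_trans hx r2|exact: y1|].
have h : ple (cl r) (cl (cut e1 c) *+ N.+1).
  apply: (ple_trans (ple_le r3)); apply: (ple_trans hy'); apply: ple_le.
  by apply: cule_trans y'y _; exact: culeMn.
apply: (@ple_trans _ _ _ _ _ ((cl (cut e1 c) + cl r) *+ N.+1)); last by apply: pleMn; exact: ple_le.
rewrite (mulrS (cl r)) (mulrnDl N.+1 (cl (cut e1 c))); apply: pleD h _; exact: ple_refl.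
Qed.

Lemma decomp N t x' x : wb x' x -> (M <= N)%N -> exists (U : seq (CuM SX)) r,
  [/\ x' ⊑ \sum_(u <- U) u + r, forall u, u \in U -> ple (u *+ N) x,
      ple ((\sum_(u <- U) u) *+ N + r *+ N.+2) (x *+ N.+2), ple r x & ple (r *+ N.+2 ^ t) (x *+ N.+1 ^ t)].
Proof.
move=> xx MN; elim: t x' xx => [|t ih] x' xx.
  exists [::], x'; have h := ple_le (wb_le xx); split.
  - by rewrite big_nil add0r; exact: cule_refl.
  - by move=> u; rewrite in_nil.
  - by rewrite big_nil mul0rn add0r; exact: pleMn.
  - exact: h.
  - by rewrite !expn0; exact: h.
have [x1 w1 w2] := wb_interp xx; have [U [r [h1 h2 h3 h4 h5]]] := ih x1 w2.
have [s' [r' [ws wr hx']]] := wb_split (wb_ler w1 h1).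
have [u [r2 [g1 g2 g3]]] := ADpt_O5 wr MN.
have r2r : ple r2 r by have := pleAU (p := 1) (q := 1) AU g3; rewrite !mul1n; apply.
exists (u :: U), r2; split.
- rewrite big_cons (addrC u) -addrA; apply: cule_trans hx' _; apply: culeD g1; exact: wb_le.
- by move=> v; rewrite inE => /orP[/eqP->|/h2//]; exact: ple_trans g2 h4.
- apply: ple_trans h3; rewrite big_cons mulrnDl (addrC (u *+ N)) -addrA; apply: pleD; first exact: ple_refl.
  by rewrite (mulrS r N.+1); apply: pleD.
- exact: ple_trans r2r h4.
- rewrite !expnS mulrnA; apply: (@ple_trans _ _ _ _ _ (r *+ N.+1 *+ N.+2 ^ t)); first exact: pleMn.
  by rewrite mulrnAC (mulnC N.+1) mulrnA; exact: pleMn.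
Qed.

(** [P] collects the pieces already placed and [z] is the complement left for the others. As all
    pieces together fill at most the share [q / q.+1], cancellation puts [y1] pointwise below [q.+2]
    copies of [z]. The next piece is smaller than [y0] by the factor [N], so it fits into [z] with
    the factor [M] to spare; weak comparison puts it there globally, and [O5] yields the next
    complement. *)
Lemma place (q N : nat) : (0 < q)%N -> (M * q.+2 < N)%N -> forall (U : seq (CuM SX)) (P z y0 y1 s : CuM SX),
  wb y0 y1 -> ple y1 (P + z) -> ple ((P + \sum_(u <- U) u) *+ q.+1) (y0 *+ q) ->
  (forall u, u \in U -> ple (u *+ N) y0) -> wb s (\sum_(u <- U) u) -> s ⊑ z.
Proof.
move=> q0 MN; elim=> [|u U ih] P z y0 y1 s.
  by move=> _ _ _ _; rewrite big_nil => /wb_le h; exact: cule_trans h (cule0x _).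
rewrite big_cons => w01 h1 h2 h3 ws.
have [u' [s' [wu ws' hs]]] := wb_split ws.
have yz : ple y1 (z *+ q.+2).
  move=> p; rewrite evMn; have wp := ev_wb p w01.
  apply: (@CAN _ _ S AU FC _ _ (ev p z) q 1 q.+1 1 q.+2 wp); last by rewrite mul1n muln1.
  rewrite addn1; apply: (@cule_trans _ _ _ (ev p ((P + z) *+ q.+1))).
    by rewrite evMn; apply: culeMn.
  rewrite (evMnD p P z q.+1).
  apply: culeD; last exact: cule_refl.
  rewrite -evMn; apply: cule_trans (h2 p); apply: ev_le; apply: culeMn; exact: culeDl.
have uz : u ⊑ z.
  apply: WC; have h : ple (u *+ N) (z *+ q.+2).
    apply: ple_trans (h3 u _) (ple_trans (ple_le (wb_le w01)) yz); exact: mem_head.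
  have := pleAU (p := M) (q := 1) AU h; rewrite mul1n; exact.
have [y2 w02 w21] := wb_interp w01.
have [Y wY hY] := ptwb h1 w21.
have [P' [z' [wP wz hY']]] := wb_split wY.
have [a pa zE] := cl_surj z; have [c pc uE] := cl_surj u; rewrite zE; rewrite zE uE in h1 h2 h3 yz uz wz wu ws wY.
have [e1 e10 hu'] := wb_rep pc wu; have [e e0 hz'] := wb_rep pa wz.
have [r [pr r1 r2 r3]] := O5 pa pc ((cl_le pc pa).1 uz) e10 (ltW e0).
apply: cule_trans hs (cule_trans _ r1); apply: culeD => //.
refine (ih (P + cl c) (cl r) y0 y2 s' w02 _ _ _ ws').
- apply: (ple_trans hY); apply: ple_le; apply: cule_trans hY' _; rewrite -addrA.
  by apply: culeD; [exact: wb_le|exact: cule_trans hz' r2].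
- by rewrite -addrA.
- by move=> v vU; apply: h3; rewrite inE vU orbT.
Qed.

Lemma expn_ratio n N : (0 < n)%N -> exists t, (N * n ^ t < n.+1 ^ t)%N.
Proof.
move=> n0; have h t : (n ^ t * (n + t) <= n * n.+1 ^ t)%N.
  elim: t => [|t ih]; first by rewrite !expn0; lia.
  rewrite !expnS; move: (n ^ t)%N (n.+1 ^ t)%N ih => a b ih; nia.
exists (n * N)%N; have := h (n * N)%N; have : (0 < n ^ (n * N))%N by rewrite expn_gt0 n0.
move: (n ^ (n * N))%N (n.+1 ^ (n * N))%N => a b; nia.
Qed.

Theorem pt_comparison (k : nat) x y : ple (x *+ k.+1) (y *+ k) -> x ⊑ y.
Proof.
move=> h; apply: wb_sup => x' xx; have [x1 w1 w2] := wb_interp xx.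
(* [place] asks for [M * q.+2 < N]. The decomposition loses the factor [N.+2 / N]; with
   [q = 2 k + 1] and [4 k < N] the ratio [k / k.+1] still ends up below [q / q.+1]. *)
pose q := k.*2.+1; pose N := (M * q.+2 + k.*2.*2).+1.
have MN : (M <= N)%N by rewrite /N; nia.
have MqN : (M * q.+2 < N)%N by rewrite /N; nia.
have kN : (k.*2.*2 < N)%N by rewrite /N; nia.
have qE : q = k.*2.+1 by [].
have q0 : (0 < q)%N by [].
clearbody N q.
have [Y wY hY] := ptwb h (wbMn k.+1 w2).
have [y0 wy hy0] := wb_splitMn wY.
have hk : ple (x1 *+ k.+1) (y0 *+ k) := ple_trans hY (ple_le hy0).
have h1 : ple x1 y0 by have := pleAU (p := 1) (q := 1) AU hk; rewrite !mul1n; apply.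
have [t ht] := expn_ratio N (ltn0Sn N).
have [x2 w3 w4] := wb_interp w1.
have [U [r [g1 g2 g3 g4 g5]]] := decomp t w4 MN.
(* The remainder counts as one more small piece: [t] is so large that [N] copies of it fit below
   [x1] pointwise. *)
apply: (@place q N q0 MqN (r :: U) 0 y y0 y x' wy).
- by rewrite add0r; exact: ple_refl.
- rewrite add0r big_cons.
  have e1 : ple ((r + \sum_(u <- U) u) *+ N) (x1 *+ N.+2).
    apply: ple_trans g3; rewrite (mulrnDl N r) (addrC (r *+ N)); apply: pleD; first exact: ple_refl.
    by apply: ple_le; apply: culeMnl; lia.
  have e2 : ple ((r + \sum_(u <- U) u) *+ (N * k.+1)) (y0 *+ (k * N.+2)).
    rewrite !mulrnA; apply: (@ple_trans _ _ _ _ _ (x1 *+ N.+2 *+ k.+1)); first exact: pleMn.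
    by have := pleMn N.+2 hk; rewrite (mulrnAC x1).
  apply: (pleAU AU e2); rewrite qE; nia.
- move=> u; rewrite inE => /orP[/eqP->|/g2 h2]; last exact: ple_trans h2 h1.
  apply: ple_trans h1; have := pleAU (p := N) (q := 1) AU g5; rewrite mul1n; apply.
  exact: ht.
- by rewrite big_cons addrC; exact: wb_ler w3 g1.
Qed.

Lemma cts_AU : almost_unperforated SX.
Proof. by move=> x y k; rewrite !cu_mulE => h; apply: (@pt_comparison k); exact: ple_le. Qed.

Lemma cts_AD : almost_divisible SX.
Proof.
apply: AD_of_cut => a e N pa e0.
have wx := wb_cut pa e0; have [x1 w1 w2] := wb_interp wx.
(* With three copies of [c] as divisor, both [3 N < 3 N + 1] and [3 N + 2 < 3 N + 3] are strict,
   which is the slack that [pt_comparison] requires. *)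
have [c [c1 c2]] := ADpt AU AD (3 * N).+1 w2.
exists (c *+ 3); split.
  apply: (@pt_comparison (3 * N)); have := pleMn (3 * N) c1.
  by have -> : c *+ 3 *+ N *+ (3 * N).+1 = c *+ (3 * N).+1 *+ (3 * N) by rewrite -!mulrnA; congr (_ *+ _); lia.
apply: (@pt_comparison (3 * N).+2).
apply: (@ple_trans _ _ _ _ _ (x1 *+ (3 * N).+3)); first by apply: pleMn; apply: ple_le; exact: wb_le.
have := pleMn (3 * N).+3 c2.
by have -> : c *+ 3 *+ N.+1 *+ (3 * N).+2 = c *+ (3 * N).+2 *+ (3 * N).+3 by rewrite -!mulrnA; congr (_ *+ _); lia.
Qed.

End StrictComparison.

(** * Comparison over an interval *)

Section FunctionalAbsorption.
Context {R : realType} {D : cstarAlgType R}.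
Implicit Types (a b f g y z v : D) (d e : R).

(** Equal to 1 from [d / 2] on, so [fc (kap d) g] is a unit for every cutdown of [g] by at least
    [d / 2]. *)
Definition kap d : R -> R := locked (fun s => Num.max (Num.min (s * (2 / d)) 1) 0).

Lemma kapE d s : kap d s = Num.max (Num.min (s * (2 / d)) 1) 0.
Proof. by rewrite /kap -lock. Qed.

Lemma cont_kap d : continuous (kap d).
Proof.
have -> : kap d = (fun s => Num.max (Num.min (s * (2 / d)) 1) 0) by apply/funext => s; rewrite kapE.
by cts.
Qed.

Lemma kap0 d : kap d 0 = 0. Proof. by rewrite kapE mul0r max_r// ge_min lexx. Qed.

Lemma kap01 d s : 0 <= kap d s <= 1.
Proof. by rewrite kapE le_max lexx orbT ge_max ler01 andbT ge_min lexx orbT. Qed.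

Lemma kap1 d s : 0 < d -> d / 2 <= s -> kap d s = 1.
Proof.
move=> d0 ds; rewrite kapE min_r ?max_l//; have -> : s * (2 / d) = s / (d / 2) by rewrite invf_div.
by rewrite ler_pdivlMr ?divr_gt0// mul1r.
Qed.

Lemma fc_absorb (f k : R -> R) g : cpos g -> continuous f -> f 0 = 0 -> continuous k -> k 0 = 0 ->
  (forall s, 0 <= s <= nrm g -> f s * k s = f s) -> fc f g ** fc k g = fc f g.
Proof.
move=> pg cf f0 ck k0 h; rewrite -fcM//; last exact: cpos_sa.
by apply: fc_ext_pos; rewrite ?f0 ?mul0r//; [exact/cpos_psd|by cts].
Qed.

Lemma sqc_cut_fc t g : 0 <= t -> cpos g -> sqc (cut t g) = fc (fun s => Num.sqrt (Num.max (s - t) 0)) g.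
Proof.
move=> t0 pg; rewrite /sqc /cut fc_comp ?cut_00 ?sqrtr0//; first exact: cpos_sa.
- exact: cont_cut.
- by apply: cont_sqrt; exact: cont_id.
Qed.

Lemma sqc_cut_kap d t g : 0 < d -> d / 2 <= t -> cpos g -> sqc (cut t g) ** fc (kap d) g = sqc (cut t g).
Proof.
move=> d0 dt pg; have t0 : 0 <= t by apply: le_trans dt; rewrite divr_ge0// ltW.
rewrite sqc_cut_fc//; apply: fc_absorb; rewrite ?kap0//; last 1 first.
- move=> s _; case: (lerP (s - t) 0) => h; first by rewrite sqrtr0 mul0r.
  by rewrite kap1 ?mulr1//; lra.
- by cts.
- by rewrite sub0r max_r ?sqrtr0//; lra.
- exact: cont_kap.
Qed.

Lemma nrm_sqc a : cpos a -> nrm (sqc a) ^+ 2 = nrm a.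
Proof. by move=> pa; rewrite -nrm_cstar star_sqc ?sqcK//; [exact/cpos_psd|exact: cpos_sa]. Qed.

(** The conjugator [v] given by the comparison is compressed by [P = phi(f)], which is 1 on
    [cut (4 * e) f] and dominated by a multiple of [cut (3 * e) f]; this keeps [star y ** y] below a
    cutdown of [f], as the construction at the neighbouring points requires. *)
Lemma even_piece f g d e (n : R) : cpos f -> cpos g -> 0 < d -> 0 < e -> 0 < n ->
  cut e f ≾ cut d g -> exists y, [/\ nrm (y ** star y - cut (4 * e) f) <= n,
    star y ** y ≾ cut (3 * e) f & y ** fc (kap d) g = y].
Proof.
move=> pf pg d0 e0 n0 fg.
have ff := cpos_sa pf; have pcg : cpos (cut d g) by exact: cpos_cut (ltW d0) pg.
have e40 : 0 <= 4 * e by lra. have e30 : 0 <= 3 * e by lra.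
have [|v hv] := (cuntzP (cut (4 * e) f) (cut d g)).1 _ n n0.
  by apply: cuntz_trans fg; apply: cuntz_cut_le => //; [exact: ltW|lra].
pose phi (s : R) := Num.min (Num.max (s - 3 * e) 0 / e) 1.
have cphi : continuous phi by rewrite /phi; cts.
have phi0 : phi 0 = 0 by rewrite /phi sub0r max_r ?mul0r ?min_l//; lra.
have phi01 s : 0 <= phi s <= 1.
  by rewrite /phi ge_min lexx orbT andbT le_min ler01 andbT divr_ge0 ?(ltW e0)// le_max lexx orbT.
have phile s : phi s <= e^-1 * Num.max (s - 3 * e) 0 by rewrite /phi ge_min mulrC lexx.
have phi1 s : 4 * e <= s -> phi s = 1.
  by move=> h; rewrite /phi min_r// ler_pdivlMr// mul1r le_max; apply/orP; left; lra.
clearbody phi.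
pose P := fc phi f; have sP : star P = P by exact: star_fc.
have nP : nrm P <= 1.
  by apply: fc_le_pos => //; [exact/cpos_psd|move=> s _; rewrite ger0_norm; have /andP[] := phi01 s].
have Pc : P ** cut (4 * e) f = cut (4 * e) f.
  rewrite /P /cut -fcM ?cut_00//; last exact: cont_cut.
  congr fc; apply/funext => s; case: (lerP (s - 4 * e) 0) => h; first by rewrite mulr0.
  by rewrite phi1 ?mul1r//; lra.
have cP : cut (4 * e) f ** P = cut (4 * e) f.
  by rewrite -[RHS](cpos_sa (cpos_cut e40 pf)) -[in RHS]Pc starM sP (cpos_sa (cpos_cut e40 pf)).
have sq : star (sqc (cut d g)) = sqc (cut d g) by apply: star_sqc; exact: cpos_sa.
have qq : sqc (cut d g) ** sqc (cut d g) = cut d g by apply: sqcK; exact/cpos_psd.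
exists (P ** v ** sqc (cut d g)); split.
- have -> : P ** v ** sqc (cut d g) ** star (P ** v ** sqc (cut d g)) - cut (4 * e) f =
     P ** (v ** cut d g ** star v - cut (4 * e) f) ** P.
    by rewrite !starM sP sq cmulBr cmulBl Pc cP !cmulA -(cmulA (P ** v)) qq.
  rewrite (le_trans (nrmM _ _))// (le_trans (ler_wpM2r (nrm_ge0 _) (nrmM _ _)))//.
  rewrite nrm_distC in hv; have := nrm_ge0 (v ** cut d g ** star v - cut (4 * e) f); have := nrm_ge0 P.
  by move=> P0 x0; rewrite (le_trans (ler_piMr _ nP)) ?mulr_ge0// (le_trans (ler_piMl _ nP))// ltW.
- apply: cuntz_trans (ss_cuntz _) _; rewrite !starM sP sq !cmulA -(cmulA (P ** v)) qq.
  have -> : P ** v ** cut d g ** star v ** P = P ** (v ** cut d g ** star v) ** P by rewrite !cmulA.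
  have pv : cpos (v ** cut d g ** star v) by exact: cpos_conj'.
  apply: (@cuntz_leC _ _ _ _ (nrm (v ** cut d g ** star v) / e)) => //.
  + by rewrite divr_ge0 ?nrm_ge0// ltW.
  + exact: cpos_sac.
  + exact: cpos_cut.
  + apply: (@cle_trans _ _ ((nrm (v ** cut d g ** star v))%:C *: (P ** P))).
      by have := @cpos_nrm _ _ (v ** cut d g ** star v) _ P (cpos_sa pv) (lexx _); rewrite sP.
    rewrite rmorphM/= -scalerA /cle -scalerBr; apply: cposZ; first exact: nrm_ge0.
    rewrite /P -fcM// -fcZ ?cut_00//; last exact: cont_cut.
    apply: cle_fc; rewrite ?cut_00 ?phi0 ?mulr0//; [by cts|by apply: cont_M; [exact: cont_cst|exact: cont_cut]|].
    by move=> s _; have := phile s; have := phi01 s; move: (phi s) (_ * _) => x u /andP[]; nra.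
- by rewrite -!cmulA sqc_cut_kap//; lra.
Qed.

Lemma absorb_data E (m : R) : cpos E -> 0 < m -> exists k l, [/\ star k = k, k = l ** E, nrm l <= m^-1,
  forall y, cpos (E - star y ** y) -> nrm (y - y ** k) ^+ 2 <= 2 * m &
  forall be, star be = be -> exists2 c, cpos c /\ c ≾ E & be ** be = c + (be - be ** k) ** (be - k ** be)].
Proof.
move=> pE m0; have EE := cpos_sa pE.
pose q (s : R) := au m s * au m s.
have cau := cont_au m0.
have cq : continuous q by rewrite /q; cts.
have q0 : q 0 = 0 by rewrite /q au0 mul0r.
have q01 s : 0 <= q s <= 1 by rewrite /q; have /andP[] := au_itv s m0; move: (au m s) => *; nra.
have qap s : 0 <= s -> s * (1 - q s) <= 2 * m by move=> s0; have /andP[_] := au_approx m0 s0; rewrite expr2.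
have [k2 [ck2 k20 k2b qE]] : exists k2 : R -> R, [/\ continuous k2, k2 0 = 0, forall s, 0 <= s -> `|k2 s| <= m^-1 & forall s, 0 <= s -> q s = k2 s * s].
  exists (fun s => au m s / (Num.max s 0 + m)); split.
  - by apply: cont_M => //; apply: cont_V => [s|]; [rewrite gt_eqF// au_den|cts].
  - by rewrite au0 mul0r.
  - move=> s s0; have mm := au_den s m0; have /andP[a0 a1] := au_itv s m0.
    rewrite ger0_norm ?divr_ge0 ?(ltW mm)// ler_pdivrMr// mulrC ler_pdivlMr//.
    have : m <= Num.max s 0 + m by rewrite lerDr le_max lexx orbT.
    by move: (au m s) a0 a1 (Num.max s 0 + m) => x *; nra.
  - by move=> s s0; rewrite /q {1}auE max_l//; have := au_den s m0; rewrite max_l// => ?; field; rewrite gt_eqF.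
clearbody q.
pose k := fc q E; have sk : star k = k by exact: star_fc.
have kE : k = fc k2 E ** E.
  rewrite -{2}(fc_id EE) -fcM//; last exact: cont_id.
  apply: fc_ext_pos; rewrite ?k20 ?mul0r//; [exact/cpos_psd|by apply: cont_M => //; exact: cont_id|].
  by move=> s /andP[s0 _]; exact: qE.
have nk2 : nrm (fc k2 E) <= m^-1 by apply: fc_le_pos => //; [exact/cpos_psd|move=> s /andP[s0 _]; exact: k2b].
pose K s := q s + q s - q s * q s.
have cK : continuous K by rewrite /K; cts.
have K0 : K 0 = 0 by rewrite /K q0 mul0r subr0 addr0.
have bz be : be ** be = be ** fc K E ** be + (be - be ** k) ** (be - k ** be).
  rewrite /K fcB ?q0 ?mul0r ?addr0//; try by cts.
  rewrite fcD// fcM// -/k !(cmulBl, cmulBr, cmulDl, cmulDr) !cmulA; zmod.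
have pK : cpos (fc K E).
  by apply: cpos_fc => // s _; rewrite /K; have := q01 s; move: (q s) => u /andP[]; nra.
exists k, (fc k2 E); split => //.
- move=> yi pEi; pose T := yi - yi ** k; rewrite -/T.
  have sT : star T = star yi - k ** star yi by rewrite /T starB starM sk.
  rewrite -nrm_cstar; apply: (@le_trans _ _ (nrm (fc (fun s => s - s * q s - (q s * s - q s * s * q s)) E))).
    apply: cle_nrm; first exact: cpos_ss.
    have [x xE] := pEi; rewrite /cle.
    have -> : fc (fun s => s - s * q s - (q s * s - q s * s * q s)) E = E - E ** k - (k ** E - k ** E ** k).
      have ci := @cont_id R.
      rewrite !fcB ?mul0r ?q0 ?mulr0 ?subr0//; try (by cts).
      by rewrite !fcM ?q0 ?mul0r//; try (by cts); rewrite fc_id.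
    have -> : E - E ** k - (k ** E - k ** E ** k) - star T ** T = star (x - x ** k) ** (x - x ** k).
      have E1 : E = star x ** x + star yi ** yi by rewrite -xE subrK.
      by rewrite sT /T starB starM sk E1 !(cmulBl, cmulBr, cmulDl, cmulDr) !cmulA; zmod.
    exact: cpos_ss.
  apply: fc_le_pos; rewrite ?q0 ?mul0r ?subr0//; [exact/cpos_psd| |].
    by have ci := @cont_id R; cts.
  move=> s /andP[s0 _]; have := qap s s0; have /andP[u0 u1] := q01 s.
  have -> : s - s * q s - (q s * s - q s * s * q s) = s * (1 - q s) * (1 - q s) by ring.
  rewrite ger0_norm ?mulr_ge0 ?subr_ge0// => h; apply: le_trans h.
  by rewrite ler_piMr ?mulr_ge0 ?subr_ge0// lerBlDr lerDl.
- move=> be sbe; exists (be ** fc K E ** be); last exact: bz.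
  split; first exact: cpos_sac.
  apply: (@cuntz_trans _ _ (fc K E)); first by have := cuntz_conj (fc K E) be; rewrite sbe.
  by apply: fc_cuntz => // s _; rewrite /K; have := q01 s; move: (q s) => u /andP[]; nra.
Qed.

(** [r] is the value at [z] of the square root of the cutdown function divided by [max(s, t)]; the
    denominator is [s] wherever the numerator is nonzero, and at least [t] everywhere. *)
Lemma root_data z t : cpos z -> 0 < t -> exists r, [/\ star r = r, r ** z ** r = cut t z & r ** r =<= t^-1%:C *: cut t z].
Proof.
move=> pz t0; have zz := cpos_sa pz.
pose rho (s : R) := Num.sqrt (Num.max (s - t) 0 / Num.max s (t)).
have dm s : 0 < Num.max s (t) by rewrite lt_max t0 orbT.
have crho : continuous rho by rewrite /rho; apply: cont_sqrt; apply: cont_M; [cts|apply: cont_V => [s|]; [rewrite gt_eqF|cts]].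
have rho0 : rho 0 = 0 by rewrite /rho cut_00 ?(ltW t0)// mul0r sqrtr0.
have rho2 s : rho s * rho s = Num.max (s - t) 0 / Num.max s (t).
  by rewrite -expr2 sqr_sqrtr// divr_ge0 ?(ltW (dm s))// le_max lexx orbT.
have rz s : rho s * rho s * s = Num.max (s - t) 0.
  rewrite rho2; case: (lerP (s - t) 0) => h; first by rewrite !mul0r.
  by rewrite max_l ?divfK//; [rewrite gt_eqF//; lra|lra].
have rle s : rho s * rho s <= t^-1 * Num.max (s - t) 0.
  rewrite rho2 mulrC; apply: ler_wpM2r; first by rewrite le_max lexx orbT.
  by rewrite lef_pV2 ?posrE// le_max lexx orbT.
clearbody rho.
pose r := fc rho z; have sr : star r = r by exact: star_fc.
have rzr : r ** z ** r = cut (t) z.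
  have -> : r ** z ** r = fc rho z ** fc (fun s => s) z ** fc rho z by rewrite (fc_id zz).
  rewrite -!fcM ?rho0 ?mul0r//; try (by cts); try exact: cont_id.
  by congr fc; apply/funext => s; rewrite -rz mulrAC.
exists r; split=> //; rewrite /r -fcM// /cut -fcZ ?cut_00 ?(ltW t0)//; last exact: cont_cut.
apply: cle_fc; rewrite ?rho0 ?cut_00 ?mulr0 ?(ltW t0)//; [by cts|by apply: cont_M; [exact: cont_cst|exact: cont_cut]].
Qed.

End FunctionalAbsorption.

Section IntervalStep.
Context {R : realType} {A : cstarAlgType R} {S : stabilization A}.
Local Notation D := (stab S).
Implicit Types (a b f g y z v : D) (d e : R).

Hypotheses (AU : almost_unperforated S) (FC : cancellative S).

(** Both neighbours are pushed out of the way by [1 - k], where [k] is an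
    approximate unit for [E = y1^* y1 + y2^* y2]; the factor 4 leaves enough room
    for that. *)
Lemma odd_piece d e (B n : R) : 0 < d -> 0 < e -> 1 <= B -> 0 < n ->
  exists2 t : R, 0 < t & forall f g y1 y2, cpos f -> cpos g ->
    (cl (cut e f) : CuM S) *+ 4 ⊑ cl (cut d g) -> nrm f + 1 <= B -> nrm g <= B -> nrm y1 <= B -> nrm y2 <= B ->
    star y1 ** y1 ≾ cut (2 * e) f -> star y2 ** y2 ≾ cut (2 * e) f ->
    nrm (y1 ** fc (kap d) g - y1) <= t -> nrm (y2 ** fc (kap d) g - y2) <= t ->
    exists y, [/\ nrm (y ** star y - cut (4 * e) f) <= n, nrm (y ** fc (kap d) g - y) <= n,
      nrm (y ** star y1) <= n & nrm (y ** star y2) <= n].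
Proof.
(* [L] bounds [nrm (v ** r)] below. [c] is the size to which [1 - k] has to reduce the neighbours,
   [m] is the parameter of [k] that achieves this, and [t] makes up for the factor [m^-1] in
   [k = l ** E]. *)
move=> d0 e0 B1 n0; pose L := 2 * B / d + 1.
have L1 : 1 <= L by rewrite /L lerDr divr_ge0 ?(ltW d0)//; lra.
pose c := n / (L * B); have c0 : 0 < c by rewrite divr_gt0// mulr_gt0//; lra.
pose m := c ^+ 2 / 2; have m0 : 0 < m by rewrite divr_gt0// exprn_gt0.
pose t := n * m / (2 * L * B ^+ 2).
have LB0 : 0 < 2 * L * B ^+ 2 by rewrite !mulr_gt0// ?exprn_gt0//; lra.
exists t; first by rewrite divr_gt0// mulr_gt0.
move=> f g y1 y2 pf pg h4 fB gB yB1 yB2 hy1 hy2 ht1 ht2.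
have ff := cpos_sa pf; have gg := cpos_sa pg.
pose E := star y1 ** y1 + star y2 ** y2.
have pE : cpos E by apply: cposD; exact: cpos_ss.
have EE := cpos_sa pE.
have [k [l [sk kE nl kT kc]]] := absorb_data pE m0.
pose b := cut (d / 2) g; have d2 : 0 <= d / 2 by rewrite divr_ge0// ltW.
have pb : cpos b := cpos_cut d2 pg; have bb := cpos_sa pb.
pose be := sqc b; have sbe : star be = be by exact: star_sqc.
have beK : be ** be = b by apply: sqcK; exact/cpos_psd.
have nb : nrm b <= B.
  by apply: le_trans gB; apply: cle_nrm => //; have := cut_le (lexx 0) d2 pg; rewrite (cut0 pg).
have nbe : nrm be <= B.
  apply: le_of_sq; first lra; rewrite nrm_sqc// (le_trans nb)//; rewrite expr2; nra.
pose w := be - k ** be; have swE : star w = be - be ** k by rewrite /w starB starM sk sbe.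
pose z := star w ** w; have pz : cpos z := cpos_ss w; have zz := cpos_sa pz.
have [c1 [pc1 c1E] bz] := kc be sbe; rewrite beK -swE -/w -/z in bz.
have hz : cl (cut e f) ⊑ (cl (cut (d / 2) z) : CuM S).
  have pce := cpos_cut (ltW e0) pf.
  have wX : wb (cl (cut (2 * e) f) : CuM S) (cl (cut e f)).
    have := wb_cut pce e0; rewrite cut_cut ?(ltW e0)//.
    by have -> : e + e = 2 * e by lra.
  have pcz := cpos_cut d2 pz.
  (* Of the four copies of [f] below [g] each neighbour uses at most one copy of [cut (2 * e) f],
     and [z] takes the rest. Cancellation with ratio 2 to 1 leaves the strict slack for one copy of
     [f] below [z]. *)
  have key : (cl (cut e f) : CuM S) *+ (2 + 2) ⊑ cl (cut (2 * e) f) *+ 2 + cl (cut (d / 2) z) *+ 1.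
    apply: cule_trans h4 _.
    have -> : cut d g = cut (d / 2) b by rewrite /b cut_cut//; congr cut; lra.
    apply: (@cule_trans _ _ _ (cl (c1 + cut (d / 2) z))).
      apply/cl_le; [exact: cpos_cut|exact: cposD|].
      apply: cuntz_close => //; first exact: cposD.
      have -> : b - (c1 + cut (d / 2) z) = z - cut (d / 2) z by rewrite {1}bz; zmod.
      exact: cut_dist.
    apply: cule_trans (cl_leD pc1 pcz) _; apply: culeD; last exact: cule_refl.
    apply: (@cule_trans _ _ _ (cl E)).
      by apply/cl_le.
    apply: cule_trans (cl_leD (cpos_ss y1) (cpos_ss y2)) _; rewrite mulr2n.
    have p2 : cpos (cut (2 * e) f) by apply: cpos_cut => //; lra.
    by apply: culeD; apply/cl_le => //; exact: cpos_ss.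
  by have := CAN AU FC (p := 1) (q := 1) wX key isT.
have nm0 : 0 < Num.min n 1 by rewrite lt_min n0 ltr01.
have cz : cut (4 * e) f ≾ cut (d / 2) z.
  apply: (@cuntz_trans _ _ (cut e f)); first by apply: cuntz_cut_le => //; [exact: ltW|lra].
  by apply/(cl_le (S := S)) => //; [exact: cpos_cut (ltW e0) _|exact: cpos_cut].
have [v] := (cuntzP _ _).1 cz _ nm0; rewrite lt_min => /andP[/ltW hv /ltW hv1].
have [r [sr rzr r2]] := root_data pz (divr_gt0 d0 (ltr0n R 2)); rewrite invf_div in r2.
pose y := v ** r ** star w.
have yy : y ** star y = v ** cut (d / 2) z ** star v.
  by rewrite /y !starM starK sr -rzr /z !cmulA.
have nvr : nrm (v ** r) <= L.
  apply: le_of_sq; first lra.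
  rewrite -nrm_star -nrm_cstar starK starM sr.
  have pcz := cpos_cut d2 pz.
  have h1 : v ** r ** (r ** star v) =<= (2 / d)%:C *: (v ** cut (d / 2) z ** star v).
    have -> : v ** r ** (r ** star v) = star (star v) ** (r ** r) ** star v by rewrite starK !cmulA.
    have -> : (2 / d)%:C *: (v ** cut (d / 2) z ** star v) = star (star v) ** ((2 / d)%:C *: cut (d / 2) z) ** star v.
      by rewrite starK cscaleAr cscaleAl.
    exact: cle_conj.
  have ph : cpos (v ** r ** (r ** star v)).
    by have := cpos_ss' (v ** r); rewrite starM sr.
  have := cle_nrm ph h1; rewrite nrmZr ger0_norm ?divr_ge0 ?(ltW d0)// => h2.
  apply: (le_trans h2).
  have h3 : nrm (v ** cut (d / 2) z ** star v) <= B.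
    have -> : v ** cut (d / 2) z ** star v = cut (4 * e) f - (cut (4 * e) f - v ** cut (d / 2) z ** star v) by zmod.
    rewrite (le_trans (nrmB _ _))// (le_trans _ fB)// lerD//.
    have e40 : 0 <= 4 * e by rewrite mulr_ge0// ltW.
    by apply: cle_nrm; [exact: cpos_cut|have := @cut_le _ _ 0 (4 * e) f (lexx 0); rewrite (cut0 pf); apply].
  have d20 : 0 <= 2 / d by rewrite divr_ge0// ltW.
  have := ler_wpM2l d20 h3; rewrite -/L expr2.
  have -> : 2 / d * B = L - 1 by rewrite /L addrK mulrAC.
  by move: (_ * _) => u; nra.
have tr (yi : D) : nrm yi <= B -> cpos (E - star yi ** yi) -> nrm (y ** star yi) <= n.
  move=> nyi pEi; pose T := yi - yi ** k.
  have sT : star T = star yi - k ** star yi by rewrite /T starB starM sk.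
  have nT : nrm T <= c by apply: le_of_sq; [exact: ltW|rewrite (le_trans (kT _ pEi))//; rewrite /m; lra].
  have -> : y ** star yi = (v ** r) ** (be ** star T).
    by rewrite sT /y swE !cmulBr cmulBl !cmulA.
  have h1 := nrmM (v ** r) (be ** star T); have h2 := nrmM be (star T); rewrite nrm_star in h2.
  have -> : n = L * (B * c) by rewrite /c mulrA mulrC divfK// mulf_neq0// gt_eqF// ?(lt_le_trans ltr01).
  apply: (le_trans h1); apply: ler_pM; rewrite ?nrm_ge0//; apply: (le_trans h2); exact: ler_pM (nrm_ge0 _) (nrm_ge0 _) nbe nT.
exists y; split.
- by rewrite yy nrm_distC.
- have -> : y ** fc (kap d) g - y = - ((v ** r) ** (be ** (l ** (E ** fc (kap d) g - E)))).
    have h : l ** (E ** fc (kap d) g - E) = k ** fc (kap d) g - k by rewrite cmulBr cmulA -kE.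
    have bk : be ** fc (kap d) g = be by exact: sqc_cut_kap.
    rewrite h /y swE !(cmulBr, cmulBl) !cmulA -(cmulA (v ** r) be (fc (kap d) g)) bk; zmod.
  rewrite nrmN.
  have hE : nrm (E ** fc (kap d) g - E) <= 2 * B * t.
    have -> : E ** fc (kap d) g - E = star y1 ** (y1 ** fc (kap d) g - y1) + star y2 ** (y2 ** fc (kap d) g - y2).
      by rewrite /E cmulDl !cmulBr !cmulA; zmod.
    have -> : 2 * B * t = B * t + B * t by ring.
    rewrite (le_trans (nrmD _ _))// lerD// (le_trans (nrmM _ _))// nrm_star ler_pM ?nrm_ge0//.
  have -> : n = L * (B * (m^-1 * (2 * B * t))).
    by rewrite /t; field; rewrite !gt_eqF// ?(lt_le_trans ltr01).
  do 3 (apply: (le_trans (nrmM _ _)); apply: ler_pM; rewrite ?nrm_ge0//).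
- by apply: tr => //; rewrite /E (addrC (star y1 ** y1)) addrK; exact: cpos_ss.
- by apply: tr => //; rewrite /E addrK; exact: cpos_ss.
Qed.

End IntervalStep.

Section Lipschitz.
Context {R : realType} {X : metricType R}.

Lemma lip_cont (f : X -> R) : (forall x y, `|f x - f y| <= mdist x y) -> continuous f.
Proof.
move=> h x; apply/cvgrPdist_lt => e e0; apply/nbhs_ballP; exists e => //= y.
by rewrite ballEmdist/=; apply: le_lt_trans.
Qed.

Lemma lip_cont_to (f : R -> X) : (forall r s, mdist (f r) (f s) <= `|r - s|) -> continuous f.
Proof.
move=> h r; apply/cvg_ballP => e e0; apply/nbhs_ballP; exists e => //= s.
by rewrite ballEmdist/= => rs; apply: le_lt_trans (h r s) rs.
Qed.

End Lipschitz.

(** * The unit interval as a compact metric space *)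

Section UnitInterval.
Context {R : realType}.

Record uitv := UItv { uval : R; uvalP : 0 <= uval <= 1 }.

HB.instance Definition _ := [isSub of uitv for uval].
HB.instance Definition _ := [Choice of uitv by <:].

Definition udist (x y : uitv) : R := `|uval x - uval y|.

Lemma udistxx x : udist x x = 0. Proof. by rewrite /udist subrr normr0. Qed.

Lemma udist_pos x y : udist x y = 0 -> x = y.
Proof. by move/normr0_eq0/eqP; rewrite subr_eq0 => /eqP xy; apply: val_inj. Qed.

Lemma udist_sym x y : udist x y = udist y x. Proof. exact: distrC. Qed.

Lemma udist_tri y x z : udist x z <= udist x y + udist y z. Proof. exact: ler_distD. Qed.

HB.instance Definition _ := @isMetric.Build R uitv udist udistxx udist_pos udist_sym udist_tri.

Lemma mdist_uval (x y : uitv) : mdist x y = `|uval x - uval y|. Proof. by []. Qed.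

Lemma uval_continuous : continuous (uval : uitv -> R).
Proof.
by apply: lip_cont => x y; rewrite mdist_uval.
Qed.

Lemma uproj_subproof (r : R) : 0 <= Num.max (Num.min r 1) 0 <= 1.
Proof. by rewrite le_max lexx orbT ge_max ler01 andbT ge_min lexx orbT. Qed.

Definition uproj r : uitv := UItv (uproj_subproof r).

Lemma uprojK (x : uitv) : uproj (uval x) = x.
Proof. by apply: val_inj; case: x => s /= /andP[s0 s1]; rewrite min_l// max_l. Qed.

Lemma uproj_lip r s : mdist (uproj r) (uproj s) <= `|r - s|.
Proof.
rewrite mdist_uval /=; have h (a b : R) : a <= b -> `|Num.max (Num.min a 1) 0 - Num.max (Num.min b 1) 0| <= `|a - b|.
  move=> ab; have f (c : R) : [/\ Num.min c 1 <= c, Num.min c 1 <= 1, Num.min c 1 = c \/ Num.min c 1 = 1,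
      0 <= Num.max (Num.min c 1) 0 & Num.min c 1 <= Num.max (Num.min c 1) 0].
    by split; [rewrite ge_min lexx|rewrite ge_min lexx orbT|case: (leP c 1) => _; [left|right]|rewrite le_max lexx orbT|rewrite le_max lexx].
  have g (c x : R) : Num.min c 1 <= x -> 0 <= x -> Num.max (Num.min c 1) 0 <= x by move=> *; rewrite ge_max; apply/andP.
  have [a1 a2 a3 a4 a5] := f a; have [b1 b2 b3 b4 b5] := f b.
  have := g a (Num.max (Num.min b 1) 0); have := g b (Num.max (Num.min a 1) 0 + (b - a)).
  move: (Num.max (Num.min a 1) 0) (Num.max (Num.min b 1) 0) a4 a5 b4 b5 => x y a4 a5 b4 b5.
  move: (Num.min a 1) (Num.min b 1) a1 a2 a3 a5 b1 b2 b3 b5 => m n a1 a2 a3 a5 b1 b2 b3 b5 g1 g2.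
  have h1 : y <= x + (b - a) by apply: g1; [case: a3; lra|lra].
  have h2 : x <= y by apply: g2; [case: b3; lra|lra].
  by rewrite distrC (distrC a) !ger0_norm ?subr_ge0//; lra.
case: (boolP (r <= s)) => [/h //|]; rewrite -ltNge => /ltW /h; by rewrite distrC (distrC s).
Qed.

Lemma uitv_compact : compact [set: uitv].
Proof.
have -> : [set: uitv] = uproj @` `[0, 1].
  apply/seteqP; split=> // x _; exists (uval x); last exact: uprojK.
  by rewrite /= in_itv /=; exact: uvalP.
apply: continuous_compact; last exact: segment_compact.
apply: continuous_subspaceT; exact: lip_cont_to uproj_lip.
Qed.

(** At each point only two consecutive hats can be nonzero, so only consecutive witnesses have to be
    orthogonal. *)
Lemma hat_partition (d : R) : 0 < d -> exists n (p : nat -> uitv) (h : nat -> uitv -> R),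
  [/\ forall i, continuous (fun s => Num.sqrt (h i s)), forall i, mdist (p i) (p i.+1) < d &
    forall s, exists j, [/\ (j < n)%N, 0 <= h j s, 0 <= h j.+1 s, h j s + h j.+1 s = 1 &
      mdist (p j) s < d /\ mdist (p j.+1) s < d] /\ forall i, i != j -> i != j.+1 -> h i s = 0].
Proof.
move=> d0; pose n := (Num.trunc (d^-1)).+1.
have nd : n%:R^-1 < d.
  rewrite -[d]invrK ltf_pV2 ?posrE ?invr_gt0// ?ltr0n//; exact: truncnS_gt.
have n0 : 0 < n%:R :> R by rewrite ltr0n.
pose h (i : nat) (s : uitv) := Num.max (1 - `|n%:R * uval s - i%:R|) 0.
exists n.+1, (fun i => uproj (i%:R / n%:R)), h; split.
- move=> i.
  have cm : continuous (fun r : R => Num.sqrt (Num.max (1 - `|n%:R * r - i%:R|) 0)) by cts.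
  by move=> s; apply: (@continuous_comp _ _ _ uval (fun r : R => Num.sqrt (Num.max (1 - `|n%:R * r - i%:R|) 0))); [exact: uval_continuous|exact: cm].
- move=> i; apply: le_lt_trans (uproj_lip _ _) _; apply: le_lt_trans nd.
  by rewrite -mulrBl -natr1 opprD addNKr mulN1r normrN gtr0_norm// invr_gt0.
- move=> s; have /andP[s0 s1] := uvalP s; pose t := n%:R * uval s.
  have t0 : 0 <= t by rewrite mulr_ge0// ltW.
  have tn : t <= n%:R by rewrite ler_piMr// ltW.
  pose j := Num.trunc t; have /andP[tj tj1] : j%:R <= t < j.+1%:R by exact: truncn_itv.
  rewrite -natr1 in tj1.
  have hj : h j s = 1 - (t - j%:R) by rewrite /h -/t ger0_norm ?subr_ge0// max_l//; lra.
  have hj1 : h j.+1 s = t - j%:R.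
    by rewrite /h -/t -natr1 ltr0_norm ?subr_lt0// max_l//; lra.
  have dist k : `|k%:R - t| <= 1 -> mdist (uproj (k%:R / n%:R)) s < d.
    move=> h1; rewrite -[s]uprojK; apply: le_lt_trans (uproj_lip _ _) _; apply: le_lt_trans nd.
    have -> : k%:R / n%:R - uval s = (k%:R - t) * n%:R^-1 by rewrite mulrBl /t mulrAC divff ?mul1r// gt_eqF.
    by rewrite normrM (ger0_norm (_ : 0 <= n%:R^-1)) ?invr_ge0 ?(ltW n0)// ler_piMl// invr_ge0 ltW.
  exists j; split.
    split; rewrite ?hj ?hj1; try lra.
      by rewrite -(ltr_nat R) -natr1; lra.
    by split; apply: dist; rewrite -?natr1 ler_norml; lra.
  move=> i ij ij1; rewrite /h -/t max_r// subr_le0.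
  have : (i < j)%N \/ (j.+1 < i)%N by move: ij ij1; clear -R; lia.
  case=> hi; have : i.+1%:R <= j%:R :> R \/ j.+2%:R <= i%:R :> R by rewrite !ler_nat; move: hi; clear -R; lia.
    by case=> h1; [rewrite ger0_norm|rewrite ltr0_norm]; move: h1; rewrite -!natr1; lra.
  by case=> h1; [rewrite ger0_norm|rewrite ltr0_norm]; move: h1; rewrite -!natr1; lra.
Qed.

End UnitInterval.
Arguments uitv R : clear implicits.

Section TwoTerm.
Context {R : realType} {D : cstarAlgType R}.
Implicit Types (f k y z : D).

(** [a] and [b] are square roots of two consecutive hats. The diagonal terms average to nearly [f],
    the cross term is small by near orthogonality, and [k] is nearly a right unit for both
    witnesses. *)
Lemma two_term f k y1 y2 (a b B t n : R) : star k = k -> nrm k <= 1 -> 0 <= a -> 0 <= b -> a ^+ 2 + b ^+ 2 = 1 -> 0 <= B -> 0 <= t -> 0 <= n ->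
  nrm y1 <= B -> nrm y2 <= B -> nrm (y1 ** star y1 - f) <= t -> nrm (y2 ** star y2 - f) <= t ->
  nrm (y1 ** star y2) <= n -> nrm (y1 ** k - y1) <= n -> nrm (y2 ** k - y2) <= n ->
  forall w, w = (a%:C *: y1 + b%:C *: y2) ** k -> nrm (w ** star w - f) <= t + 2 * n + 8 * B * n.
Proof.
move=> sk nk a0 b0 ab B0 t0 n0 yB1 yB2 h1 h2 h12 k1 k2 w wE.
have [a1 b1] : a <= 1 /\ b <= 1 by nra.
pose z := a%:C *: y1 + b%:C *: y2.
have abC : a%:C * a%:C + b%:C * b%:C = 1 :> R[i] by rewrite -!rmorphM -rmorphD -!expr2 ab.
have hz : nrm (z ** star z - f) <= t + 2 * n.
  have -> : z ** star z - f = ((a ^+ 2)%:C *: (y1 ** star y1 - f) + (b ^+ 2)%:C *: (y2 ** star y2 - f)) +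
      ((a * b)%:C *: (y1 ** star y2) + (a * b)%:C *: star (y1 ** star y2)).
    have {1}-> : f = (a ^+ 2)%:C *: f + (b ^+ 2)%:C *: f by rewrite -scalerDl -rmorphD/= ab scale1r.
    rewrite /z starD !starZr starM starK !(cmulDl, cmulDr) !(cscaleAl, cscaleAr) !scalerA !expr2 !rmorphM/= (mulrC b%:C a%:C) !scalerBr.
    zmod.
  rewrite (le_trans (nrmD _ _))// (le_trans (lerD (nrmD _ _) (nrmD _ _)))// !nrmZr nrm_star !ger0_norm ?mulr_ge0 ?exprn_ge0//.
  have ab1 : a * b <= 1 by nra.
  have := nrm_ge0 (y1 ** star y2); have A0 := exprn_ge0 2 a0; have B0' := exprn_ge0 2 b0.
  have := ler_wpM2l A0 h1; have := ler_wpM2l B0' h2.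
  have E : b ^+ 2 = 1 - a ^+ 2 by lra.
  move: (nrm (y1 ** star y2)) h12 => u hu; rewrite E; move: (a ^+ 2) (nrm _) (nrm _) => x p q g1 g2 u0.
  have : a * b * u <= n by nra.
  by nra.
have nz : nrm z <= 2 * B.
  rewrite (le_trans (nrmD _ _))// !nrmZr !ger0_norm//.
  by have := nrm_ge0 y1; have := nrm_ge0 y2; move: (nrm y1) (nrm y2) yB1 yB2 => *; nra.
have nw : nrm w <= 2 * B.
  by rewrite wE (le_trans (nrmM _ _))//; have := nrm_ge0 z; have := nrm_ge0 k; rewrite -/z; move: (nrm z) (nrm k) nz nk => *; nra.
have wz : nrm (w - z) <= 2 * n.
  have -> : w - z = a%:C *: (y1 ** k - y1) + b%:C *: (y2 ** k - y2).
    by rewrite wE /z cmulDl !cscaleAl !scalerBr; zmod.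
  rewrite (le_trans (nrmD _ _))// !nrmZr !ger0_norm//.
  have := nrm_ge0 (y1 ** k - y1); have := nrm_ge0 (y2 ** k - y2).
  by move: (nrm (_ - y1)) (nrm (_ - y2)) k1 k2 => *; nra.
have -> : w ** star w - f = ((w - z) ** star w + z ** star (w - z)) + (z ** star z - f).
  by rewrite starB cmulBl cmulBr; zmod.
rewrite (le_trans (nrmD _ _))// addrC lerD// (le_trans (nrmD _ _))//.
have -> : 8 * B * n = 2 * n * (2 * B) + 2 * B * (2 * n) by ring.
by apply: lerD; rewrite (le_trans (nrmM _ _))// nrm_star ler_pM ?nrm_ge0.
Qed.

End TwoTerm.

Section WeakComparison.
Context {R : realType} {A : cstarAlgType R} {S : stabilization A}.
Local Notation D := (stab S).
Local Notation cI := (@uitv_compact R).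
Local Notation SI := (ctsStab cI S).
Hypotheses (AU : almost_unperforated S) (FC : cancellative S).

(** At even subdivision points the witnesses are chosen freely; at odd points they are chosen nearly
    orthogonal to both neighbours, by [odd_piece]. The norms stay below a common [B], so the
    tolerances can be fixed before the subdivision. *)
Theorem uitv_comparison (x y : CuM SI) : ple (x *+ 4) y -> x ⊑ y.
Proof.
have [F pF ->] := cl_surj x; have [G pG ->] := cl_surj y => h.
apply/cl_le => //; apply: cuntz_of_cuts => // e' e'0.
(* The cut at the centres costs [4 * e], the variation of [F] costs [e], and the terms in [n] cost
   less than [3 * e]. *)
pose e := e' / 8; have e0 : 0 < e by rewrite divr_gt0.
have [Y /(wb_rep pG)[d d0 hd] hY] := ptwb h (wbMn 4 (wb_cut pF e0)).
have {}hd p : (cl (cut e (cts_ev (F : cts_alg cI D) p)) : CuM S) *+ 4 ⊑ cl (cut d (cts_ev (G : cts_alg cI D) p)).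
  have := cule_trans (hY p) (ev_le p hd); rewrite evMn !ev_cl; [|exact: cpos_cut (ltW d0) _|exact: cpos_cut (ltW e0) _].
  by rewrite !ev_cut ?(ltW d0) ?(ltW e0).
have fp p : cpos (cts_ev (F : cts_alg cI D) p) by exact: ev_cpos.
have gp p : cpos (cts_ev (G : cts_alg cI D) p) by exact: ev_cpos.
set f := fun p => cts_ev (F : cts_alg cI D) p; set g := fun p => cts_ev (G : cts_alg cI D) p.
pose B := nrm (F : cts_alg cI D) + nrm (G : cts_alg cI D) + 1.
have fB p : nrm (f p) + 1 <= B.
  by have := nrm_ev (F : cts_alg cI D) p; have := nrm_ge0 (G : cts_alg cI D); rewrite /B -/(f p); lra.
have gB p : nrm (g p) <= B.
  by have := nrm_ev (G : cts_alg cI D) p; have := nrm_ge0 (F : cts_alg cI D); rewrite /B -/(g p); lra.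
have B1 : 1 <= B.
  by have := nrm_ge0 (G : cts_alg cI D); have := nrm_ge0 (F : cts_alg cI D); rewrite /B; lra.
have B0 : 0 < B by lra.
pose n := Num.min (e / (16 * B)) 1; have n0 : 0 < n by rewrite lt_min ltr01 divr_gt0// mulr_gt0.
have nle1 : n <= 1 by rewrite ge_min lexx orbT.
have e16 : 16 * B * n <= e by rewrite mulrC -ler_pdivlMr ?mulr_gt0// ge_min lexx.
clearbody n.
have [t t0 odd_ex] := odd_piece AU FC d0 e0 B1 n0.
pose kF : cts_alg cI D := fc (kap d) (G : cts_alg cI D).
have kE p : cts_ev kF p = fc (kap d) (g p) by apply: ev_fc; [exact: cpos_sa|exact: cont_kap|exact: kap0].
pose m := Num.min t n / B; have m0 : 0 < m by rewrite divr_gt0// lt_min t0.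
have mt : B * m <= t by rewrite /m mulrC divfK ?gt_eqF// ge_min lexx.
have mn : B * m <= n by rewrite /m mulrC divfK ?gt_eqF// ge_min lexx orbT.
have [d1 d10 hF] := ev_unif (F : cts_alg cI D) e0.
have [d2 d20 hk] := ev_unif kF m0.
have dd0 : 0 < Num.min d1 d2 by rewrite lt_min d10.
have [N [p [hat [chat hpp hhat]]]] := hat_partition dd0.
have near1 q r : mdist q r < Num.min d1 d2 -> nrm (f q - f r) < e /\ nrm (fc (kap d) (g q) - fc (kap d) (g r)) < m.
  by rewrite lt_min => /andP[h1 h2]; split; [exact: hF|rewrite -!kE; exact: hk].
pose good i y := [/\ nrm (y ** star y - cut (4 * e) (f (p i))) <= n, nrm (y ** fc (kap d) (g (p i)) - y) <= n & nrm y <= B].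
have boundB i u : nrm (u ** star u - cut (4 * e) (f (p i))) <= n -> nrm u <= B.
  move=> h1; apply: le_of_sq; first exact: ltW.
  rewrite -nrm_star -nrm_cstar starK.
  have -> : u ** star u = cut (4 * e) (f (p i)) + (u ** star u - cut (4 * e) (f (p i))) by zmod.
  rewrite (le_trans (nrmD _ _))//.
  have h2 : nrm (cut (4 * e) (f (p i))) <= nrm (f (p i)).
    have e40 : 0 <= 4 * e by rewrite mulr_ge0// ltW.
    by apply: cle_nrm; [exact: cpos_cut|have := cut_le (lexx 0) e40 (fp (p i)); rewrite cut0].
  by have := fB (p i); move: h1 h2; move: (nrm _) (nrm (cut _ _)) (nrm (f _)) => a b c *; nra.
have /choice[ye hye] i : exists y, [/\ good i y, star y ** y ≾ cut (3 * e) (f (p i)) & y ** fc (kap d) (g (p i)) = y].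
  have [|u [y1 y2 y3]] := even_piece (fp (p i)) (gp (p i)) d0 e0 n0.
    apply/(cl_le (S := S)); [exact: cpos_cut (ltW e0) _|exact: cpos_cut (ltW d0) _|].
    by apply: cule_trans (hd (p i)); have := @culeMnl _ _ S 1 4 (cl (cut e (f (p i)))) isT; rewrite mulr1n.
  exists u; split=> //; split; [exact: y1|by rewrite y3 subrr nrm0 ltW|exact: boundB y1].
have trans i j u : nrm (f (p i) - f (p j)) < e -> nrm (fc (kap d) (g (p i)) - fc (kap d) (g (p j))) < m ->
    nrm u <= B -> star u ** u ≾ cut (3 * e) (f (p i)) -> u ** fc (kap d) (g (p i)) = u ->
    star u ** u ≾ cut (2 * e) (f (p j)) /\ nrm (u ** fc (kap d) (g (p j)) - u) <= t.
  move=> h1 h2 h3 h4 h5; split.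
    apply: cuntz_trans h4 _; have -> : 3 * e = e + 2 * e by ring.
    by apply: cut_close; rewrite ?(ltW e0) ?(ltW h1)//; lra.
  rewrite -{2}h5 -cmulBr; apply: le_trans mt; rewrite (le_trans (nrmM _ _))// ler_pM ?nrm_ge0// nrm_distC ltW//.
(* For [i = 0] the predecessor is 0 itself; this is harmless, as [yo] is used at odd indices
   only. *)
have /choice[yo hyo] i : exists y, [/\ good i y, nrm (y ** star (ye i.-1)) <= n & nrm (y ** star (ye i.+1)) <= n].
  have [[_ _ b1] s1 k1] := hye i.-1; have [[_ _ b2] s2 k2] := hye i.+1.
  have [hf1 hg1] : nrm (f (p i.-1) - f (p i)) < e /\ nrm (fc (kap d) (g (p i.-1)) - fc (kap d) (g (p i))) < m.
    case: i {b1 s1 k1 b2 s2 k2} => [|i] /=; last by apply: near1.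
    by rewrite !subrr nrm0.
  have [hf2 hg2] : nrm (f (p i.+1) - f (p i)) < e /\ nrm (fc (kap d) (g (p i.+1)) - fc (kap d) (g (p i))) < m.
    by rewrite nrm_distC (nrm_distC (fc _ _)); apply: near1.
  have [s1' t1] := trans _ _ _ hf1 hg1 b1 s1 k1; have [s2' t2] := trans _ _ _ hf2 hg2 b2 s2 k2.
  have [u [y1 y2 y3 y4]] := odd_ex _ _ _ _ (fp (p i)) (gp (p i)) (hd (p i)) (fB _) (gB _) b1 b2 s1' s2' t1 t2.
  by exists u; split=> //; split=> //; exact: boundB y1.
pose yy i := if odd i then yo i else ye i.
have gyy i : good i (yy i) by rewrite /yy; case: ifP => _; [case: (hyo i)|case: (hye i)].
have oyy i : nrm (yy i ** star (yy i.+1)) <= n.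
  rewrite /yy /=; case: (boolP (odd i)) => oi /=; first by case: (hyo i).
  by rewrite -nrm_star starM starK; case: (hyo i.+1).
pose Z : cts_alg cI D := \sum_(i < N.+1) fmul (chat i) (fcst (yy i)).
pose W := Z ** kF.
apply: (@cuntz_trans _ _ (W ** star W)).
  have -> : e' = 8 * e by rewrite /e; lra.
  apply: cuntz_close => //; [lra|exact: cpos_ss'|].
  apply: nrm_cts_le => [|s]; first lra.
  have [j [[jN h0 h1 h2 [pj pj1]] hz]] := hhat s.
  have [f1 k1] := near1 _ _ pj; have [f2 k2] := near1 _ _ pj1.
  have Zs : cts_ev Z s = (Num.sqrt (hat j s))%:C *: yy j + (Num.sqrt (hat j.+1 s))%:C *: yy j.+1.
    rewrite ev_sum (bigD1 (Ordinal (ltnW jN : (j < N.+1)%N)))//= (bigD1 (Ordinal (jN : (j.+1 < N.+1)%N)))/=; last first.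
      by rewrite -val_eqE/= gtn_eqF.
    rewrite big1 ?addr0// => i /andP[i1 i2].
    by change ((Num.sqrt (hat i s))%:C *: yy i = 0); rewrite hz ?sqrtr0 ?scale0r.
  have [g1 g2 g3] := gyy j; have [g1' g2' g3'] := gyy j.+1.
  have fin (i : nat) : nrm (f (p i) - f s) < e -> nrm (yy i ** star (yy i) - cut (4 * e) (f (p i))) <= n ->
      nrm (yy i ** star (yy i) - f s) <= 5 * e + n.
    move=> u1 u2; have e40 : 0 <= 4 * e by rewrite mulr_ge0// ltW.
    have := cut_dist e40 (fp (p i)); rewrite nrm_distC => u3.
    have -> : yy i ** star (yy i) - f s = (yy i ** star (yy i) - cut (4 * e) (f (p i))) + (cut (4 * e) (f (p i)) - f (p i)) + (f (p i) - f s) by zmod.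
    rewrite (le_trans (nrmD _ _))// (le_trans (lerD (nrmD _ _) (lexx _)))//.
    by move: u1 u2 u3; rewrite -/(f (p i)); move: (nrm _) (nrm _) (nrm _) => ? ? ? v1 v2 v3; clear -v1 v2 v3 AU FC; lra.
  have kin (i : nat) : nrm (fc (kap d) (g (p i)) - fc (kap d) (g s)) < m -> nrm (yy i) <= B ->
      nrm (yy i ** fc (kap d) (g (p i)) - yy i) <= n -> nrm (yy i ** fc (kap d) (g s) - yy i) <= 2 * n.
    move=> u1 u2 u3.
    have -> : yy i ** fc (kap d) (g s) - yy i = (yy i ** fc (kap d) (g (p i)) - yy i) - yy i ** (fc (kap d) (g (p i)) - fc (kap d) (g s)).
      by rewrite cmulBr; zmod.
    have -> : 2 * n = n + n by ring.
    rewrite (le_trans (nrmB _ _))// lerD// (le_trans (nrmM _ _))// (le_trans _ mn)// ler_pM ?nrm_ge0// ltW//.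
  rewrite nrm_distC.
  change (nrm ((cts_ev Z s ** cts_ev kF s) ** star (cts_ev Z s ** cts_ev kF s) - f s) <= 8 * e).
  rewrite Zs kE.
  have nk : nrm (fc (kap d) (g s)) <= 1.
    apply: fc_le_pos; [exact/cpos_psd|exact: cont_kap|exact: kap0|].
    by move=> r _; rewrite ger0_norm; have /andP[] := kap01 d r.
  have sk : star (fc (kap d) (g s)) = fc (kap d) (g s) by apply: star_fc; [exact: cpos_sa|exact: cont_kap|exact: kap0].
  have := @two_term _ _ (f s) (fc (kap d) (g s)) (yy j) (yy j.+1) (Num.sqrt (hat j s)) (Num.sqrt (hat j.+1 s)) B (5 * e + n) (2 * n) sk nk.
  rewrite !sqrtr_ge0 !sqr_sqrtr// h2 => /(_ isT isT erefl (ltW B0)) T.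
  apply: le_trans (T _ _ g3 g3' (fin _ f1 g1) (fin _ f2 g1') _ (kin _ k1 g3 g2) (kin _ k2 g3' g2') _ erefl) _.
  - by rewrite addr_ge0// ?mulr_ge0// ltW.
  - by rewrite mulr_ge0// ltW.
  - by apply: le_trans (oyy j) _; rewrite mulr_natl mulr2n lerDl ltW.
  - have Bn : n <= B * n by rewrite ler_pMl.
    move: e16 Bn; have -> : 8 * B * (2 * n) = 16 * (B * n) by ring.
    by rewrite -mulrA; move: (B * n) => ? v1 v2; clear -v1 v2 e0 AU FC; lra.
have skF : star kF = kF by apply: star_fc; [exact: cpos_sa|exact: cont_kap|exact: kap0].
have -> : W ** star W = Z ** (kF ** kF) ** star Z by rewrite /W starM skF !cmulA.
apply: cuntz_trans (cuntz_conj _ _) _.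
rewrite /kF -fcM ?kap0//; try exact: cont_kap; last exact: cpos_sa.
apply: fc_cuntz => //; rewrite ?kap0 ?mul0r//; first by apply: cont_M; exact: cont_kap.
by move=> s _; have /andP[] := kap01 d s; move: (kap d s) => *; nra.
Qed.

(** Pointwise, [CAN] gives [m] copies of [x] below [n] copies of [z] whenever [m < n]; for [m = 4]
    the comparison over the interval applies, and 8 is one possible [n]. *)
Theorem uitv_cancellative : cancellative SI.
Proof.
move=> x' x z xx h; exists 8%N.
have key m n : (m * 1 < n * 1)%N -> ple (x *+ m) (z *+ n).
  move=> mn p; rewrite !evMn; apply: (CAN AU FC (a := 1) (b := 1) (m := 1) (ev_wb p xx) _ mn).
  by rewrite !mulr1n -evMn -evD; exact: ev_le.
by apply: cule_trans (wb_le xx) _; apply: uitv_comparison; exact: key.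
Qed.

End WeakComparison.

(** * Comparison over cubes *)

Section Tower.
Context {R : realType} {A : cstarAlgType R} (S : stabilization A).
Local Notation D := (stab S).
Local Notation cI := (@uitv_compact R).
Local Notation I := (uitv R).
Implicit Types (t : nat -> I).

(** The algebra changes with the dimension, so its stabilization is carried along in a dependent
    pair. Points of a cube are infinite sequences of which [evt] reads the first [n] terms, so that
    all cubes share one type of points. *)
Fixpoint cube_alg n : {B : cstarAlgType R & stabilization B} :=
  if n is n'.+1 then existT _ (cts_alg cI (projT1 (cube_alg n')) : cstarAlgType R) (ctsStab cI (projT2 (cube_alg n')))
  else existT _ A S.

Definition cubeS n : stabilization (projT1 (cube_alg n)) := projT2 (cube_alg n).

Definition tl_ t : nat -> I := fun i => t i.+1.

Fixpoint evt n t : stab (cubeS n) -> D :=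
  match n return stab (cubeS n) -> D with
  | 0 => fun a => a
  | n'.+1 => fun F => @evt n' (tl_ t) (cts_ev (F : cts_alg cI (stab (cubeS n'))) (t 0%N))
  end.

Fixpoint evc n t : CuM (cubeS n) -> CuM S :=
  match n return CuM (cubeS n) -> CuM S with
  | 0 => fun a => a
  | n'.+1 => fun x => @evc n' (tl_ t) (ev (S := cubeS n') (t 0%N) x)
  end.

Lemma evt_hom n t : star_hom (@evt n t).
Proof.
elim: n t => [|n ih] t; first by split.
have [h1 h2 h3] := ih (tl_ t); split.
- by move=> z a b; exact: h1.
- by move=> a b; exact: h2.
- by move=> a; exact: h3.
Qed.

Arguments evt_hom {n} t.

Lemma evt_dsum n t a b : @evt n t (dsum a b) = dsum (evt t a) (evt t b).
Proof. by elim: n t a b => [//|n ih] t a b; exact: ih. Qed.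

Lemma evc_cl n t a : cpos a -> @evc n t (cl a) = cl (evt t a).
Proof.
elim: n t a => [//|n ih] t a pa /=; rewrite (ev_cl (S := cubeS n) (t 0%N) pa) ih//; exact: ev_cpos.
Qed.

Lemma evcMn n t x m : @evc n t (x *+ m) = evc t x *+ m.
Proof. by elim: n t x => [//|n ih] t x /=; rewrite evMn ih. Qed.

Lemma evcD n t x y : @evc n t (x + y) = evc t x + evc t y.
Proof. by elim: n t x y => [//|n ih] t x y /=; rewrite evD ih. Qed.

Lemma cpos_evt n (F : stab (cubeS n)) : (forall t, cpos (evt t F)) -> cpos F.
Proof.
elim: n F => [|n ih] F h; first exact: (h (fun=> uproj 0)).
apply: (@cpos_cts R _ cI (stab (cubeS n))) => p; apply: ih => t.
exact: (h (fun i => if i is j.+1 then t j else p)).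
Qed.

Lemma evt_const n a : exists F : stab (cubeS n), forall t, evt t F = a.
Proof.
elim: n => [|n [F hF]]; first by exists a.
by exists (fcst (cX := cI) F) => t; exact: hF.
Qed.

Lemma evt_coord n i : (i < n)%N -> exists M : stab (cubeS n) -> stab (cubeS n),
  (forall a b, nrm (M a - M b) <= nrm (a - b)) /\ forall t F, evt t (M F) = (uval (t i))%:C *: evt t F.
Proof.
elim: n i => [//|n ih] [_|i].
  pose M (F : cts_alg cI (stab (cubeS n))) := fmul (@uval_continuous R) F.
  exists M; split=> [a b|t F]; last exact: (homZ (evt_hom (tl_ t)) (uval (t 0%N))%:C).
  apply: (@nrm_cts_le _ _ cI (stab (cubeS n)) (M a - M b)) => [|p]; first exact: nrm_ge0.
  change (nrm ((uval p)%:C *: cts_ev (a : cts_alg cI (stab (cubeS n))) p - (uval p)%:C *: cts_ev (b : cts_alg cI (stab (cubeS n))) p) <=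
    @nrm _ (cts_alg cI (stab (cubeS n))) (a - b)).
  rewrite -scalerBr nrmZr; have /andP[p0 p1] := uvalP p; rewrite ger0_norm//.
  apply: (le_trans _ (@nrm_ev _ _ cI (stab (cubeS n)) (a - b) p)).
  by rewrite ler_piMl// nrm_ge0.
rewrite ltnS => /ih[M [lM hM]].
have cM (F : cts_alg cI (stab (cubeS n))) : continuous (fun p => M (cts_ev F p)).
  by apply: (cts_lip (C := 1)) => a b; rewrite mul1r.
exists (fun F => cts_mk (cX := cI) (cM F)); split=> [a b|t F]; last exact: hM.
apply: (@nrm_cts_le _ _ cI (stab (cubeS n))) => [|p]; first exact: nrm_ge0.
apply: (le_trans (lM _ _)); exact: (@nrm_ev _ _ cI (stab (cubeS n)) (a - b) p).
Qed.

(** Functions on the cube that come from the function algebra. The functions needed later are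
    polynomial in the coordinates, so closure under sums and under multiplication by a coordinate
    suffices. *)
Definition realizable n (u : (nat -> I) -> D) := exists F : stab (cubeS n), forall t, evt t F = u t.

Lemma realD n u v : realizable n u -> realizable n v -> realizable n (fun t => u t + v t).
Proof. by move=> [F hF] [G hG]; exists (F + G) => t; rewrite (homD (evt_hom t)) hF hG. Qed.

Lemma realN n u : realizable n u -> realizable n (fun t => - u t).
Proof. by move=> [F hF]; exists (- F) => t; rewrite (homN (evt_hom t)) hF. Qed.

Lemma real_coord n i u : (i < n)%N -> realizable n u -> realizable n (fun t => (uval (t i))%:C *: u t).
Proof. by move=> /evt_coord[M [_ hM]] [F hF]; exists (M F) => t; rewrite hM hF. Qed.

Lemma real_sum n (J : Type) (r : seq J) (P : pred J) (u : J -> (nat -> I) -> D) :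
  (forall j, realizable n (u j)) -> realizable n (fun t => \sum_(j <- r | P j) u j t).
Proof.
move=> h; elim: r => [|j r ih].
  by exists 0 => t; rewrite (hom0 (evt_hom t)) big_nil.
have [F hF] := ih; have [G hG] := h j; case: (boolP (P j)) => Pj.
  by exists (G + F) => t; rewrite (homD (evt_hom t)) hF hG big_cons Pj.
by exists F => t; rewrite hF big_cons (negbTE Pj).
Qed.

Lemma evt_continuous (X : metricType R) n (T : X -> nat -> I) (F : stab (cubeS n)) :
  (forall i, continuous (fun x => T x i)) -> continuous (fun x => evt (T x) F).
Proof.
elim: n T F => [|n ih] T F cT; first by move=> x; exact: cvg_cst.
move=> x; apply/nrm_cvgP => e e0; have e2 : 0 < e / 2 by rewrite divr_gt0.
have /nrm_cvgP/(_ _ e2) h1 := ih (fun x => tl_ (T x)) (cts_ev (F : cts_alg cI (stab (cubeS n))) (T x 0%N)) (fun i => cT i.+1) x.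
have h2 : \forall y \near x, nrm (cts_ev (F : cts_alg cI (stab (cubeS n))) (T x 0%N) - cts_ev (F : cts_alg cI (stab (cubeS n))) (T y 0%N)) < e / 2.
  exact: (cT 0%N x _ (ev_near (F : cts_alg cI (stab (cubeS n))) (T x 0%N) e2)).
have h3 : \forall y \near x, nrm (evt (tl_ (T x)) (cts_ev (F : cts_alg cI (stab (cubeS n))) (T x 0%N)) -
      evt (tl_ (T y)) (cts_ev (F : cts_alg cI (stab (cubeS n))) (T x 0%N))) < e / 2 /\
    nrm (cts_ev (F : cts_alg cI (stab (cubeS n))) (T x 0%N) - cts_ev (F : cts_alg cI (stab (cubeS n))) (T y 0%N)) < e / 2.
  exact: filterI h1 h2.
move: h3; apply: filterS => y [g1 g2] /=.
rewrite (le_lt_trans (nrm_dist3 _ (evt (tl_ (T y)) (cts_ev (F : cts_alg cI (stab (cubeS n))) (T x 0%N))) _))//.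
rewrite [ltRHS](splitr e) ltrD// (le_lt_trans _ g2)// -(homB (evt_hom _)).
exact: (hom_nrm (evt_hom _)).
Qed.

Hypotheses (AU : almost_unperforated S) (AD : almost_divisible S) (FC : cancellative S).

Lemma cube_pure n : [/\ almost_unperforated (cubeS n), almost_divisible (cubeS n) & cancellative (cubeS n)].
Proof.
elim: n => [//|n [h1 h2 h3]]; have WC := uitv_comparison h1 h3; split.
- exact: (cts_AU (M := 4) h1 h2 h3 isT WC).
- exact: (cts_AD (M := 4) h1 h2 h3 isT WC).
- exact: uitv_cancellative.
Qed.

Lemma cube_comparison n k (x y : CuM (cubeS n)) :
  (forall t, evc t x *+ k.+1 ⊑ evc t y *+ k) -> x ⊑ y.
Proof.
elim: n k x y => [|n ih] k x y h.
  have := h (fun=> uproj 0); rewrite /= => h'.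
  by have := AUq AU (p := 1) (q := 1) h'; rewrite !mul1n; apply.
have [h1 h2 h3] := cube_pure n; have WC := uitv_comparison h1 h3.
(* The ratio [K / K.+1] is spent twice, once on the new coordinate and once in the induction
   hypothesis; [K = 2 k + 1] satisfies [K.+1 ^ 2 * k < K ^ 2 * k.+1]. *)
pose K := k.*2.+1; have KE : K = k.*2.+1 by []. clearbody K.
apply: (pt_comparison (M := 4) h1 h2 h3 isT WC (k := K)) => p; rewrite !evMn.
apply: (ih K) => t; rewrite !evcMn.
have := h (fun i => if i is j.+1 then t j else p); rewrite /= -/(evc _ _) => h'.
rewrite -!mulrnA; apply: (AUq AU h'); rewrite KE; nia.
Qed.

End Tower.

(** * Comparison over a compact metric space *)

Section Nerve.
Context {R : realType} {X : metricType R} {cX : compact [set: X]} {A : cstarAlgType R} {S : stabilization A}.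
Local Notation D := (stab S).
Local Notation SX := (ctsStab cX S).
Local Notation I := (uitv R).
Hypotheses (AU : almost_unperforated S) (AD : almost_divisible S) (FC : cancellative S).

Lemma pull_cont n (T : X -> nat -> I) (cT : forall i, continuous (fun x => T x i)) (F : stab (cubeS S n)) :
  continuous (fun x => evt (T x) F).
Proof. exact: evt_continuous. Qed.

Lemma pull_hom n (T : X -> nat -> I) (cT : forall i, continuous (fun x => T x i)) :
  @star_hom R (stab (cubeS S n)) (cts_alg cX D) (fun F => cts_mk (cX := cX) (pull_cont cT (F := F))).
Proof.
split=> [z a b|a b|a]; apply: cts_evP => x.
- by have := @star_hom_linear _ _ _ _ (evt_hom S n (T x)) z a b.
- by have := @star_homM _ _ _ _ (evt_hom S n (T x)) a b.
- by have := @star_hom_star _ _ _ _ (evt_hom S n (T x)) a.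
Qed.

Lemma convex_dist (n : nat) (t : 'I_n -> R) (a : 'I_n -> D) (b : D) (e : R) : (forall i, 0 <= t i) -> \sum_i t i = 1 ->
  (forall i, t i != 0 -> nrm (a i - b) <= e) -> nrm (\sum_i (t i)%:C *: a i - b) <= e.
Proof.
move=> t0 t1 h.
have -> : \sum_i (t i)%:C *: a i - b = \sum_i (t i)%:C *: (a i - b).
  under [RHS]eq_bigr do rewrite scalerBr.
  by rewrite sumrB -scaler_suml -(rmorph_sum (real_complex R)) t1 scale1r.
apply: (le_trans (nrm_sum _ _ _)).
have -> : e = \sum_i t i * e by rewrite -mulr_suml t1 mul1r.
apply: ler_sum => i _; rewrite nrmZr ger0_norm//.
by have [->|ti] := eqVneq (t i) 0; rewrite ?mul0r// ler_wpM2l// h.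
Qed.

Lemma ple_unif (f g : stab SX) (m l : nat) (e : R) : cpos f -> cpos g -> ple (cl f *+ m) (cl g *+ l) -> 0 < e ->
  exists2 d : R, 0 < d & forall p, (cl (cut e (cts_ev (f : cts_alg cX D) p)) : CuM S) *+ m ⊑ cl (cut d (cts_ev (g : cts_alg cX D) p)) *+ l.
Proof.
move=> pf pg h e0; have [Y wY hY] := ptwb h (wbMn m (wb_cut pf e0)).
have [y0 /(wb_rep pg)[d d0 hd] Yy] := wb_splitMn wY.
exists d => // p; have := hY p; rewrite evMn ev_cl; last exact: cpos_cut (ltW e0) _.
rewrite (@ev_cut _ _ cX D)// ?(ltW e0)// => h1; apply: cule_trans h1 _.
apply: cule_trans (ev_le p Yy) _; rewrite evMn; apply: culeMn; apply: cule_trans (ev_le p hd) _.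
rewrite ev_cl; last exact: cpos_cut (ltW d0) _.
by rewrite (@ev_cut _ _ cX D)// ?(ltW d0)//; exact: cule_refl.
Qed.

(** The comparison is carried out on the cube of barycentric coordinates of a
    fine cover of [X]; the penalty [psi] vanishes only on the nerve and makes
    the hypothesis hold on the rest of the cube. *)
Lemma nerve_comparison k (x y : CuM SX) : ple (x *+ k.+2) (y *+ k.+1) -> x ⊑ y.
Proof.
have [f pf ->] := cl_surj x; have [g pg ->] := cl_surj y => h.
apply/cl_le => //; apply: cuntz_of_cuts => // e' e'0.
pose e := e' / 4; have e0 : 0 < e by rewrite divr_gt0.
have [d d0 hfg] := ple_unif pf pg h e0.
pose ff := fun p => cts_ev (f : cts_alg cX D) p; pose gg := fun p => cts_ev (g : cts_alg cX D) p.
have pff p : cpos (ff p) by exact: ev_cpos.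
have pgg p : cpos (gg p) by exact: ev_cpos.
have d2 : 0 < d / 2 by rewrite divr_gt0.
have [d1 d10 hf] := ev_unif (f : cts_alg cX D) e0.
have [d3 d30 hg] := ev_unif (g : cts_alg cX D) d2.
pose m := Num.min d1 d3; have m0 : 0 < m by rewrite lt_min d10.
have hfm p q : mdist p q < m -> nrm (ff p - ff q) <= e /\ nrm (gg p - gg q) <= d / 2.
  by rewrite lt_min => /andP[/hf h1 /hg h2]; split; exact: ltW.
(* Radius [m / 2], so that the centres of overlapping pieces are at distance below [m]. *)
have [n [p [hh [ch h0 h1 hp_]]]] := pou cX (divr_gt0 m0 (ltr0n R 2)).
pose close (i j : 'I_n) := mdist (p i) (p j) < m.
pose T (x : X) (i : nat) : I := if insub i is Some i' then uproj (hh (i' : 'I_n) x) else uproj 0.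
have cT i : continuous (fun x => T x i).
  rewrite /T; case: insubP => [i' _ _|_]; last by move=> ?; exact: cvg_cst.
  move=> z; apply: (@continuous_comp _ _ _ (hh i') uproj); first exact: ch.
  exact: (lip_cont_to uproj_lip).
have hle i z : hh i z <= 1 by rewrite -(h1 z) (bigD1 i)//= lerDl sumr_ge0.
have TE z (i : 'I_n) : uval (T z i) = hh i z.
  by rewrite /T valK /= min_l ?max_l.
pose w (t : nat -> I) (i : 'I_n) : R := uval (t i).
have w0 t i : 0 <= w t i by rewrite /w; have /andP[] := uvalP (t i).
have realsum (a : 'I_n -> D) : realizable (S := S) n (fun t => \sum_i (w t i)%:C *: a i).
  by apply: real_sum => i; apply: real_coord; [exact: ltn_ord|exact: evt_const].
have [F hF] := realsum (fun i => ff (p i)); have [G hG] := realsum (fun i => gg (p i)).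
have pF : cpos F by apply: cpos_evt => t; rewrite hF; apply: cpos_sum => i _; exact: cposZ.
have pG : cpos G by apply: cpos_evt => t; rewrite hG; apply: cpos_sum => i _; exact: cposZ.
have e30 : 0 <= 3 * e by lra.
pose F3 := cut (3 * e) F; have pF3 : cpos F3 by exact: cpos_cut.
have F3E t : evt t F3 = cut (3 * e) (evt t F).
  by rewrite /F3 /cut (hom_fc (evt_hom S n t)) ?cut_00//; [exact: cpos_sa|exact: cont_cut].
pose G2 := cut (d / 2) G; have pG2 : cpos G2 by apply: cpos_cut; [exact: ltW|].
have G2E t : evt t G2 = cut (d / 2) (evt t G).
  by rewrite /G2 /cut (hom_fc (evt_hom S n t)) ?cut_00 ?(ltW d2)//; [exact: cpos_sa|exact: cont_cut].
(* Zero exactly when the weights add up to 1 and any two positive weights belong to close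
   centres. *)
pose psi t := \sum_i \sum_(j | ~~ close i j) w t i * w t j + (\sum_i w t i - 1) ^+ 2.
have psi0 t : 0 <= psi t.
  rewrite addr_ge0 ?sqr_ge0//; apply: sumr_ge0 => i _; apply: sumr_ge0 => j _; exact: mulr_ge0.
have [P hP] : exists P : stab (cubeS S n), forall t, evt t P = (psi t)%:C *: evt t F3.
  pose L (u : (nat -> I) -> D) t := \sum_i (w t i)%:C *: u t - u t.
  have rL u : realizable (S := S) n u -> realizable (S := S) n (L u).
    move=> ru; apply: realD; last exact: realN.
    by apply: real_sum => i; apply: real_coord => //; exact: ltn_ord.
  have r3 : realizable (S := S) n (fun t => evt t F3) by exists F3.
  have [P hP] : realizable (S := S) n (fun t => \sum_i \sum_(j | ~~ close i j) (w t i)%:C *: ((w t j)%:C *: evt t F3) + L (L (fun t => evt t F3)) t).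
    apply: realD; last exact/rL/rL.
    apply: real_sum => i; apply: real_sum => j; apply: real_coord; first exact: ltn_ord.
    by apply: real_coord; first exact: ltn_ord.
  exists P => t; rewrite hP /psi rmorphD/= scalerDl; congr (_ + _).
    rewrite (rmorph_sum (real_complex R)) scaler_suml; apply: eq_bigr => i _.
    rewrite (rmorph_sum (real_complex R)) scaler_suml; apply: eq_bigr => j _.
    by rewrite rmorphM/= scalerA.
  have LE u : L u t = (\sum_i w t i - 1)%:C *: u t.
    by rewrite /L -scaler_suml rmorphB/= scalerBl scale1r (rmorph_sum (real_complex R)).
  by rewrite !LE scalerA -rmorphM -expr2.
have pP : cpos P by apply: cpos_evt => t; rewrite hP; apply: cposZ => //; exact: (star_hom_cpos (evt_hom S n t)).
(* Where the penalty is positive, [P] has the class of [F3], and two copies of it suffice because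
   [k + 2 <= 2 (k + 1)]. Where it vanishes, all centres with positive weight are close to one of
   them, and the hypothesis at that centre applies. *)
have main : cl F3 ⊑ cl G2 + (cl P + cl P).
  apply: (cube_comparison AU AD FC (k := k.+1)) => t.
  have pFt : cpos (evt t F3) by exact: (star_hom_cpos (evt_hom S n t)).
  have pGt : cpos (evt t G) by exact: (star_hom_cpos (evt_hom S n t)).
  rewrite !evcD !evc_cl// hP cl_scale//.
  have := psi0 t; rewrite le_eqVlt => /orP[/eqP z|->]; last first.
    rewrite mulr1n -mulr2n mulrnDl -mulrnA; apply: (@cule_trans _ _ _ (cl (evt t F3) *+ (2 * k.+1))).
      by apply: culeMnl; clear; lia.
    exact: culeDr.
  rewrite -z ltxx mulr0n !addr0; move: (esym z); rewrite /psi => /eqP.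
  have q0 : 0 <= \sum_i \sum_(j | ~~ close i j) w t i * w t j.
    by apply: sumr_ge0 => i _; apply: sumr_ge0 => j _; exact: mulr_ge0.
  rewrite paddr_eq0 ?sqr_ge0// sqrf_eq0 subr_eq0 => /andP[/eqP z1 /eqP z2].
  have [i0 i00] : exists i, w t i != 0.
    apply: contrapT => H; have : \sum_i w t i = 0.
      by apply: big1 => i _; apply/eqP/negPn/negP => H'; apply: H; exists i.
    by rewrite z2 => /eqP; rewrite oner_eq0.
  have cl0_ j : w t j != 0 -> close i0 j.
    apply: contraNT => nc; have /eqP := z1.
    have s0 i : 0 <= \sum_(j | ~~ close i j) w t i * w t j by apply: sumr_ge0 => ? _; exact: mulr_ge0.
    rewrite psumr_eq0// => /allP/(_ i0 (mem_index_enum _)) /=; rewrite psumr_eq0 => [|? _]; last exact: mulr_ge0.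
    by move=> /allP/(_ j (mem_index_enum _)); rewrite nc /= mulf_eq0 (negbTE i00).
  have dF : nrm (evt t F - ff (p i0)) <= e.
    by rewrite hF; apply: convex_dist => // j /cl0_; rewrite nrm_distC => /hfm[].
  have dG : nrm (evt t G - gg (p i0)) <= d / 2.
    by rewrite hG; apply: convex_dist => // j /cl0_; rewrite nrm_distC => /hfm[].
  apply: (@cule_trans _ _ _ (cl (cut e (ff (p i0))) *+ k.+2)).
    apply: culeMn; rewrite F3E; have pFt' : cpos (evt t F) by exact: (star_hom_cpos (evt_hom S n t)).
    apply/cl_le; [exact: cpos_cut|exact: cpos_cut (ltW e0) _|].
    apply: (@cuntz_trans _ _ (cut (e + e) (evt t F))); first by apply: cuntz_cut_le => //; [rewrite addr_ge0// ltW|lra].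
    by apply: cut_close => //; exact: ltW.
  apply: cule_trans (hfg _) _; apply: culeMn; rewrite G2E.
  apply/cl_le; [exact: cpos_cut (ltW d0) _|exact: cpos_cut (ltW d2) _|].
  have -> : d = d / 2 + d / 2 by exact: splitr.
  have -> : (d / 2 + d / 2) / 2 = d / 2 by rewrite -splitr.
  by apply: cut_close; rewrite ?(ltW d2)// nrm_distC.
have pPP : cpos (dsum P P) by exact: cpos_dsum.
have pGP : cpos (dsum G2 (dsum P P)) by exact: cpos_dsum.
rewrite (cl_add pP pP) (cl_add pG2 pPP) in main.
have {}main := (cl_le pF3 pGP).1 main.
have hpull := pull_hom n cT.
pose pl (F : stab (cubeS S n)) : cts_alg cX D := cts_mk (cX := cX) (pull_cont cT (F := F)).
have hpl : pl F3 ≾ pl (dsum G2 (dsum P P)) := star_hom_cuntz hpull main.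
have plF z : cts_ev (pl F3 : cts_alg cX D) z = cut (3 * e) (evt (T z) F) by exact: F3E.
(* On the image of [X] the penalty vanishes, and with it the two copies of [P]. *)
have psiT z : psi (T z) = 0.
  rewrite /psi; have -> : \sum_i w (T z) i = 1 by rewrite -(h1 z); apply: eq_bigr => i _; exact: TE.
  rewrite subrr expr0n addr0; apply: big1 => i _; apply: big1 => j nc; rewrite /w !TE.
  apply/eqP; rewrite mulf_eq0; apply: contraNT nc; rewrite negb_or => /andP[hi hj].
  have := hp_ i z hi; have := hp_ j z hj; rewrite (metric_sym (p j)) => u1 u2.
  by rewrite /close (le_lt_trans (metric_triangle _ z _))// [ltRHS](splitr m) ltrD// metric_sym.
have nearT (a : X -> D) (r : R) z : (forall q, mdist q z < m -> nrm (a q - a z) <= r) ->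
    nrm (\sum_i (w (T z) i)%:C *: a (p i) - a z) <= r.
  move=> ha; apply: convex_dist => //.
    by rewrite -(h1 z); apply: eq_bigr => i _; exact: TE.
  move=> i; rewrite /w TE => hi; apply: ha; apply: lt_trans (hp_ i z hi) _.
  by rewrite ltr_pdivrMr// ltr_pMr// ltr1n.
apply: (@cuntz_trans _ _ (pl F3 : stab SX)).
  have -> : e' = e + 3 * e by rewrite /e; lra.
  have p3 : cpos (pl F : cts_alg cX D) by exact: (star_hom_cpos hpull).
  have -> : (pl F3 : stab SX) = cut (3 * e) (pl F : stab SX).
    apply: (@cts_evP _ _ cX) => z; rewrite plF.
    by rewrite (ev_cut (F := pl F) z e30 p3).
  apply: cut_close => //; first exact: ltW.
  apply: (@nrm_cts_le _ _ cX D) => [|z]; first exact: ltW.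
  change (nrm (ff z - evt (T z) F) <= e); rewrite nrm_distC hF.
  by apply: nearT => q /hfm[].
apply: (cuntz_trans hpl).
have p3 : cpos (pl G : cts_alg cX D) by exact: (star_hom_cpos hpull).
have p4 : cpos (cut (d / 2) (pl G : stab SX)) by exact: cpos_cut (ltW d2) _.
have -> : (pl (dsum G2 (dsum P P)) : stab SX) = dl (S := SX) (cut (d / 2) (pl G : stab SX)).
  apply: (@cts_evP _ _ cX) => z.
  change (evt (T z) (dsum G2 (dsum P P)) = dsum (cts_ev (cut (d / 2) (pl G) : cts_alg cX D) z) 0).
  rewrite !evt_dsum hP psiT scale0r dsum0 (ev_cut (F := pl G) z (ltW d2) p3) G2E//.
apply: cuntz_trans (dl_cuntz p4).1 _.
apply: cuntz_close; [exact: ltW|exact: p3|exact: pg|].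
apply: (@nrm_cts_le _ _ cX D) => [|z]; first exact: ltW.
change (nrm (evt (T z) G - gg z) <= d / 2); rewrite hG.
by apply: nearT => q /hfm[].
Qed.

Lemma cts_comparison (x y : CuM SX) : ple (x *+ 2) y -> x ⊑ y.
Proof. by move=> h; apply: (@nerve_comparison 0); rewrite mulr1n. Qed.

Theorem cts_pure : almost_unperforated SX /\ almost_divisible SX.
Proof.
split; first exact: (cts_AU (M := 2) AU AD FC isT cts_comparison).
exact: (cts_AD (M := 2) AU AD FC isT cts_comparison).
Qed.

End Nerve.

(** * Operator bounds for elementary tensors *)

Section OperatorRoot.
Context {R : realType} {H : hilbertType R}.
Implicit Types (k l q : H -> H) (x y : H).
Local Notation ip := (@inner R H).

Lemma half_nrm x : nrm ((2^-1)%:C *: x) = 2^-1 * nrm x.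
Proof. by rewrite nrmZr ger0_norm// invr_ge0. Qed.

Lemma adjoint_lim (s : H -> H) (u : nat -> H -> H) : (forall x, (fun n => u n x) @ \oo --> s x) ->
  (forall n, adjoint (u n) (u n)) -> adjoint s s.
Proof.
move=> us au x y; apply/eqP; rewrite -subr_eq0 -normr_le0; apply/ler_addgt0Pr => e0 e00.
have eE : (complex.Re e0)%:C = e0 by rewrite RRe_real// gtr0_real.
set e := complex.Re e0 in eE; have e_0 : 0 < e by rewrite -ltcR eE.
have c0 : 0 < nrm x + nrm y + 1 by have := nrm_ge0 x; have := nrm_ge0 y; lra.
have d0 : 0 < e / (nrm x + nrm y + 1) by rewrite divr_gt0.
have /nrm_cvg_seqP/(_ _ d0)[N1 h1] := us x; have /nrm_cvg_seqP/(_ _ d0)[N2 h2] := us y.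
have {}h1 := h1 (maxn N1 N2) (leq_maxl _ _); have {}h2 := h2 (maxn N1 N2) (leq_maxr _ _).
set n := maxn N1 N2 in h1 h2.
have -> : ip (s x) y - ip x (s y) = ip (s x - u n x) y - ip x (s y - u n y).
  by rewrite innDl innNl innDr innNr (au n x y); ring.
rewrite add0r; apply: (le_trans (ler_normB _ _)).
rewrite -(Rn_E (ip (s x - u n x) y)) -(Rn_E (ip x (s y - u n y))) -rmorphD -eE lecR.
have := cauchy_schwarz (s x - u n x) y; have := cauchy_schwarz x (s y - u n y).
move: h1 h2; rewrite !ltr_pdivlMr//.
have := nrm_ge0 x; have := nrm_ge0 y; have := nrm_ge0 (s x - u n x); have := nrm_ge0 (s y - u n y).
by move: (nrm (s x - u n x)) (nrm (s y - u n y)) (nrm x) (nrm y) => *; nra.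
Qed.

(** [1 - s] is a square root of [1 - q]. *)
Lemma operator_root q : linear q -> adjoint q q -> (forall x, nrm (q x) <= 4^-1 * nrm x) ->
  exists s, [/\ linear s, adjoint s s, forall x, nrm (s x) <= nrm x & forall x, s x + s x = q x + s (s x)].
Proof.
move=> lq aq bq; pose half x := (2^-1)%:C *: x : H.
pose u := fix u n : H -> H := if n is n'.+1 then fun x => half (q x + u n' (u n' x)) else fun=> 0.
have uS n x : u n.+1 x = half (q x + u n (u n x)) by [].
have ul n : linear (u n).
  elim: n => [|n ih] z x y; first by rewrite /= scaler0 addr0.
  by rewrite !uS /half lq !ih -[in LHS]addrACA -scalerDr !scalerDr !scalerA (mulrC _ z) -!scalerA -!scalerDr.
have ub n x : nrm (u n x) <= 2^-1 * nrm x.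
  elim: n x => [|n ih] x; first by rewrite /= nrm0 mulr_ge0 ?nrm_ge0.
  rewrite uS half_nrm ler_wpM2l// (le_trans (nrmD _ _))//.
  by have := bq x; have := ih (u n x); have := ih x; have := nrm_ge0 x; lra.
have ua n : adjoint (u n) (u n).
  elim: n => [|n ih] x y; first by rewrite /= inn0l inn0r.
  by rewrite !uS /half innZl innZr !innDl !innDr aq !ih conj_Creal// complex_real.
have ud n x : nrm (u n.+1 x - u n x) <= 2^-1 ^+ n * nrm x.
  elim: n x => [|n ih] x; first by rewrite subr0 expr0 mul1r; have := ub 1%N x; have := nrm_ge0 x; lra.
  have -> : u n.+2 x - u n.+1 x = half (u n.+1 (u n.+1 x - u n x) + (u n.+1 (u n x) - u n (u n x))).
    have -> : u n.+1 (u n.+1 x - u n x) = u n.+1 (u n.+1 x) - u n.+1 (u n x).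
      by rewrite -scaleN1r addrC (ul n.+1) scaleN1r addrC.
    rewrite (uS n.+1) [in X in _ - X](uS n) /half -scalerBr; congr (_ *: _); zmod.
  rewrite half_nrm exprS -mulrA ler_wpM2l// (le_trans (nrmD _ _))//.
  have := ub n.+1 (u n.+1 x - u n x); have := ih x; have := ih (u n x); have := ub n x.
  have p0 : 0 <= 2^-1 ^+ n :> R by rewrite exprn_ge0// invr_ge0.
  have := nrm_ge0 x; move: (2^-1 ^+ n) p0 => p p0 x0 h1 h2 h3 h4.
  have := ler_wpM2l p0 h1; lra.
have small (e : R) : 0 < e -> exists N, 2 * 2^-1 ^+ N < e.
  move=> e0; have : (fun n => 2^-1 ^+ n : R) @ \oo --> (0 : R) by apply: cvg_expr; rewrite ger0_norm//; lra.
  move=> /cvgrPdist_lt/(_ (e / 2)) [|N _ /(_ N (leqnn N))]; first by rewrite divr_gt0.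
  by rewrite /= sub0r normrN ger0_norm ?exprn_ge0 ?invr_ge0// => h; exists N; lra.
have udm n m x : nrm (u (n + m)%N x - u n x) <= 2 * (2^-1 ^+ n - 2^-1 ^+ (n + m)) * nrm x.
  elim: m => [|m ih]; first by rewrite addn0 !subrr nrm0 mulr0 mul0r.
  rewrite addnS (le_trans (nrm_dist3 _ (u (n + m)%N x) _))//.
  by have := ud (n + m)%N x; rewrite exprS; have := nrm_ge0 x; move: ih; lra.
have /choice[s hs] x : exists y, (fun n => u n x) @ \oo --> (y : H).
  apply: nrm_cauchy_cvg => e e0; have x1 : 0 < nrm x + 1 by have := nrm_ge0 x; lra.
  have [|N hN] := small (e / (nrm x + 1)); first by rewrite divr_gt0.
  exists N => m n Nm Nn.
  wlog mn : m n Nm Nn / (n <= m)%N => [W|].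
    by case: (leqP n m) => nm; [exact: W|rewrite nrm_distC; apply: W => //; exact: ltnW].
  rewrite -(subnKC mn); apply: le_lt_trans (udm n (m - n)%N x) _.
  have p1 : 0 <= 2^-1 ^+ (n + (m - n)) :> R by rewrite exprn_ge0// invr_ge0.
  have p2 : 2^-1 ^+ n <= 2^-1 ^+ N :> R by rewrite ler_wiXn2l// ?invr_ge0// invf_le1// ler1n.
  move: hN; rewrite ltr_pdivlMr//; have := nrm_ge0 x.
  by move: p1 p2; move: (2^-1 ^+ n) (2^-1 ^+ N) (2^-1 ^+ _) (nrm x) => *; nra.
have sd n x : nrm (s x - u n x) <= 2 * 2^-1 ^+ n * nrm x.
  apply/ler_addgt0Pr => e e0; have /nrm_cvg_seqP/(_ e e0)[N hN] := hs x.
  have {}hN := hN (n + N)%N (leq_addl _ _); rewrite (le_trans (nrm_dist3 _ (u (n + N)%N x) _))//.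
  have := udm n N x; rewrite nrm_distC in hN; have := nrm_ge0 x.
  have p1 : 0 <= 2^-1 ^+ (n + N) :> R by rewrite exprn_ge0// invr_ge0.
  by move: hN p1; rewrite nrm_distC; move: (2^-1 ^+ n) (2^-1 ^+ _) => *; nra.
have lim0 (v : H) (C : R) : 0 <= C -> (forall n, nrm v <= 2 * 2^-1 ^+ n * C) -> v = 0.
  move=> C0 h; apply/eqP; rewrite -nrm_eq0 eq_le nrm_ge0 andbT; apply/ler_addgt0Pr => e e0; rewrite add0r.
  have C1 : 0 < C + 1 by lra.
  have [|N hN] := small (e / (C + 1)); first by rewrite divr_gt0.
  apply: (le_trans (h N)); move: hN; rewrite ltr_pdivlMr//.
  have p1 : 0 <= 2^-1 ^+ N :> R by rewrite exprn_ge0// invr_ge0.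
  by move: (2^-1 ^+ N) p1 => *; nra.
have sb x : nrm (s x) <= nrm x.
  apply/ler_addgt0Pr => e e0; have /nrm_cvg_seqP/(_ e e0)[N hN] := hs x.
  have := ub N x; have {}hN := hN N (leqnn N); have := nrm_le_dist (s x) (u N x); have := nrm_ge0 x.
  by move: hN; rewrite nrm_distC; lra.
have ls : linear s.
  move=> z x y; apply/eqP; rewrite -subr_eq0; apply/eqP.
  apply: (lim0 _ (nrm (z *: x + y) + (nrm (z *: x) + nrm y))) => [|n]; first by rewrite !addr_ge0 ?nrm_ge0.
  have -> : s (z *: x + y) - (z *: s x + s y) = (s (z *: x + y) - u n (z *: x + y)) - (z *: (s x - u n x) + (s y - u n y)).
    by rewrite ul scalerBr; zmod.
  rewrite (le_trans (nrmB _ _))// mulrDr lerD ?sd// (le_trans (nrmD _ _))// mulrDr lerD ?sd//.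
  by rewrite !nrmZ mulrCA ler_wpM2l ?Rn_ge0//; exact: sd.
exists s; split => //.
  by apply: (adjoint_lim (u := u)) => // x; exact: hs.
move=> x; apply/eqP; rewrite -subr_eq0; apply/eqP.
apply: (lim0 _ (4 * nrm x)) => [|n]; first by rewrite mulr_ge0 ?nrm_ge0.
have -> : s x + s x - (q x + s (s x)) = ((s x - u n.+1 x) + (s x - u n.+1 x)) - ((s (s x) - u n (s x)) + u n (s x - u n x)).
  have -> : u n (s x - u n x) = u n (s x) - u n (u n x) by rewrite -scaleN1r addrC ul scaleN1r addrC.
  have -> : q x = u n.+1 x + u n.+1 x - u n (u n x).
    rewrite uS /half -scalerDl -rmorphD/=; have -> : 2^-1 + 2^-1 = 1 :> R by lra.
    by rewrite scale1r addrK.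
  by zmod.
rewrite (le_trans (nrmB _ _))// (le_trans (lerD (nrmD _ _) (nrmD _ _)))//.
have := sd n.+1 x; have := sd n (s x); have := ub n (s x - u n x); have := sd n x; have := sb x.
rewrite exprS; have p1 : 0 <= 2^-1 ^+ n :> R by rewrite exprn_ge0// invr_ge0.
have := nrm_ge0 x; move: (2^-1 ^+ n) p1 => p p1 x0 h1 h2 h3 h4 h5.
have := ler_wpM2l p1 h1; have := mulr_ge0 p1 x0; lra.
Qed.

End OperatorRoot.

Section RankOne.
Context {R : realType} {H : hilbertType R}.
Implicit Types (k l : H -> H) (x y z : H).
Local Notation ip := (@inner R H).

Definition rank1 x y : H -> H := fun z => ip z y *: x.

Lemma rank1_adjoint x y : adjoint (rank1 x y) (rank1 y x).
Proof. by move=> z w; rewrite /rank1 innZl innZr -innC mulrC. Qed.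

Lemma rank1_comp x y x' y' : rank1 x y \o rank1 x' y' = ip x' y *: rank1 x y'.
Proof.
apply/funext => z; change (ip (ip z y' *: x') y *: x = ip x' y *: (ip z y' *: x)).
by rewrite innZl scalerA mulrC.
Qed.

Lemma rank1_linear x y : linear (rank1 x y).
Proof. by move=> c u v; rewrite /rank1 innDl innZl scalerDl scalerA. Qed.

Lemma rank1_compact x y : compact_op (rank1 x y).
Proof.
split; first exact: rank1_linear.
pose f (p : R * R) : H := (p.1 +i* p.2)%C *: x.
have cf : continuous f.
  move=> p; have -> : f = (fun q => q.1%:C *: x + q.2%:C *: ('i *: x)).
    by apply/funext => q; rewrite /f scalerA -scalerDl; congr (_ *: _); rewrite [LHS]complexE mulrC.
  have cz (w : H) : continuous (fun r : R => r%:C *: w).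
    move=> r; apply/nrm_cvgP => e e0; have w1 : 0 < nrm w + 1 by have := nrm_ge0 w; lra.
    have /cvgrPdist_lt/(_ (e / (nrm w + 1))) : (fun r : R => r) @ r --> r by exact: cvg_id.
    rewrite divr_gt0// => /(_ isT); apply: filterS => s; rewrite ltr_pdivlMr// -scalerBl -rmorphB nrmZr.
    by have := nrm_ge0 w; have := normr_ge0 (r - s); nra.
  apply: cvgD.
    by apply: (@continuous_comp _ _ _ fst (fun r : R => r%:C *: x)); [exact: cvg_fst|exact: cz].
  by apply: (@continuous_comp _ _ _ snd (fun r : R => r%:C *: ('i *: x))); [exact: cvg_snd|exact: cz].
pose M := nrm y; have seg := @segment_compact R (- M) M.
apply: (@precompact_sub _ _ (f @` (`[- M, M] `*` `[- M, M]))).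
  by apply: continuous_compact (compact_setX seg seg); exact: continuous_subspaceT.
move=> _ [z /= z1 <-]; exists (complex.Re (ip z y), complex.Im (ip z y)) => /=; last first.
  by rewrite /f /rank1 /=; congr (_ *: _); case: (ip z y).
have nz : nrm z <= 1 by rewrite -lecR nrmE.
have h : complex.Re `|ip z y| <= M.
  by have := cauchy_schwarz z y; have := nrm_ge0 y; rewrite /M; move: nz; have := nrm_ge0 z; nra.
have [h1 h2] : `|complex.Re (ip z y)| <= M /\ `|complex.Im (ip z y)| <= M.
  move: h; case: (ip z y) => a b; rewrite normc_def /= => h.
  split; apply: le_trans h; rewrite -sqrtr_sqr ler_wsqrtr//; have := sqr_ge0 a; have := sqr_ge0 b; lra.
by rewrite !in_itv /= -!ler_norml.
Qed.

Lemma lin_bdd_continuous k (c : R) : linear k -> 0 < c -> (forall x, nrm (k x) <= c * nrm x) -> continuous k.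
Proof.
move=> lk c0 kc; pose g x : H := (c^-1)%:C *: k x.
have cg : continuous g.
  apply: lin_contr_continuous => [z x y|x]; first by rewrite /g lk scalerDr !scalerA mulrC.
  by rewrite /g nrmZr ger0_norm ?invr_ge0 ?(ltW c0)// mulrC ler_pdivrMr// mulrC.
have -> : k = (fun x => c%:C *: g x).
  by apply/funext => x; rewrite /g scalerA -rmorphM divff ?gt_eqF// scale1r.
by move=> x; apply: (@continuous_comp _ _ _ g (fun y => c%:C *: y)); [exact: cg|exact: scale_continuous].
Qed.

End RankOne.

Section TensorNorm.
Context {R : realType} {B : cstarAlgType R} {S : stabilization B}.
Local Notation H := (hilb S).
Local Notation D := (stab S).
Local Notation t := (@tens _ _ S).
Local Notation ip := (@inner R H).
Implicit Types (b : B) (k l q : H -> H).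

Lemma tens_D b k l : compact_op k -> compact_op l -> t b (k + l) = t b k + t b l.
Proof. by move=> ck cl_; have := tens_linearr (tensP S) b 1 ck cl_; rewrite !scale1r. Qed.

Lemma tens_Z b (z : R[i]) k : compact_op k -> t b (z *: k) = z *: t b k.
Proof.
move=> ck; have c0 := @compact_zero R H.
have h0 : t b (fun=> 0) = 0.
  have := tens_D b c0 c0; have -> : (fun=> 0) + (fun=> 0) = (fun=> 0) :> (H -> H) by apply/funext => x; rewrite addr0.
  by move=> h; apply: (addrI (t b (fun=> 0))); rewrite addr0 -h.
have h := tens_linearr (tensP S) b z ck c0; rewrite h0 in h.
rewrite -[RHS]addr0 -h; congr t.
by apply/funext => x; change (z *: k x = z *: k x + 0); rewrite addr0.
Qed.

(** [1 - p] has the root [1 - s], where [p] is [r ^+ 2] times [l \o k]. With [q1 = (1 - s) q] this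
    writes the square of [q] as the square of [q1] plus [r ^+ 2] times that of [k \o q], an identity
    of compact operators that passes to tensors. The value of [r] brings the norm of [p] down to
    1/4, as [operator_root] asks. *)
Lemma tens_bdd_op k l q b (c : R) : linear k -> adjoint k l -> linear l -> 0 < c -> (forall x, nrm (k x) <= c * nrm x) ->
  compact_op q -> nrm (t b (k \o q)) <= 2 * c * nrm (t b q).
Proof.
move=> lk kl ll c0 kc cq; have lc := adjoint_bdd kl kc.
pose r := (2 * c)^-1; have r0 : 0 < r by rewrite invr_gt0; lra.
pose p x := (r ^+ 2)%:C *: l (k x) : H.
have r2 : (r ^+ 2)%:C \is Num.real by rewrite complex_real.
have lp : linear p.
  by move=> z x y; rewrite /p lk ll scalerDr !scalerA mulrC.
have lk' : adjoint l k by move=> x y; rewrite innC -kl -innC.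
have [|x|s [ls ss sb sE]] := @operator_root R H p lp.
- by move=> x y; rewrite /p innZl innZr lk' kl conj_Creal.
- rewrite /p nrmZr ger0_norm ?exprn_ge0 ?(ltW r0)//.
  have h1 := lc (k x); have h2 := kc x; have r20 : 0 <= r ^+ 2 by rewrite exprn_ge0// ltW.
  apply: (le_trans (ler_wpM2l r20 (le_trans h1 (ler_wpM2l (ltW c0) h2)))).
  have -> : r ^+ 2 * (c * (c * nrm x)) = 4^-1 * nrm x by rewrite /r; field; rewrite gt_eqF.
  by [].
have cs : continuous s by apply: lin_contr_continuous.
have ck : continuous k.
  exact: lin_bdd_continuous lk c0 kc.
pose q1 : H -> H := fun x => q x - s (q x).
have csq : compact_op (s \o q) by exact: compact_comp_r.
have cq1 : compact_op q1.
  have := compact_lin (-1) csq cq; congr compact_op; apply/funext => x.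
  by change (-1 *: s (q x) + q x = q x - s (q x)); rewrite scaleN1r addrC.
have ckq : compact_op (k \o q) by exact: compact_comp_r.
have [q' cq' qq'] := compact_adj_ex cq; have [q1' cq1' qq1'] := compact_adj_ex cq1.
have [kq' ckq' kqq'] := compact_adj_ex ckq.
have tt k0 k1 : compact_op k0 -> compact_op k1 -> adjoint k0 k1 -> star (t b k0) ** t b k0 = t (star b ** b) (k1 \o k0).
  by move=> c0' c1 a; rewrite (tensM (tensP S))// -(tens_star (tensP S) b c0' c1 a).
have E : t (star b ** b) (q' \o q) = t (star b ** b) (q1' \o q1) + (r ^+ 2)%:C *: t (star b ** b) (kq' \o (k \o q)).
  rewrite -tens_Z; last exact: compact_comp.
  rewrite -tens_D; [|exact: compact_comp|].
    congr t; apply/funext => x; apply: inn_ext => z.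
    change (ip z (q' (q x)) = ip z (q1' (q1 x) + (r ^+ 2)%:C *: kq' (k (q x)))).
    rewrite innDr innZr -qq' -qq1' -(kqq' z) /= conj_Creal// /q1 innDl innNl !innDr !innNr.
    have h := sE (q x); have h' : ip (q z) (p (q x)) = (r ^+ 2)%:C * ip (k (q z)) (k (q x)) by rewrite /p innZr conj_Creal// kl.
    have h2 : ip (q z) (s (q x)) + ip (q z) (s (q x)) = ip (q z) (p (q x)) + ip (q z) (s (s (q x))) by rewrite -!innDr h.
    rewrite -h'; have -> : ip (s (q z)) (q x) = ip (q z) (s (q x)) by exact: ss.
    have -> : ip (s (q z)) (s (q x)) = ip (q z) (s (s (q x))) by exact: ss.
    move: h2; move: (ip _ (p _)) (ip _ (s (q x))) (ip _ (s (s _))) (ip _ (q x)) => u v w y h2.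
    have -> : u = v + v - w by rewrite h2 addrK.
    ring.
  have := compact_lin ((r ^+ 2)%:C) (compact_comp ckq' ckq) (@compact_zero R H); congr compact_op.
  by apply/funext => x; change ((r ^+ 2)%:C *: kq' (k (q x)) + 0 = (r ^+ 2)%:C *: kq' (k (q x))); rewrite addr0.
rewrite -!tt// in E.
have h : (r ^+ 2)%:C *: (star (t b (k \o q)) ** t b (k \o q)) =<= star (t b q) ** t b q.
  by rewrite /cle E addrK; exact: cpos_ss.
have := cle_nrm (cposZ (exprn_ge0 2 (ltW r0)) (cpos_ss _)) h; rewrite nrmZr !nrm_cstar ger0_norm ?exprn_ge0 ?(ltW r0)//.
rewrite -exprMn => h3; have := le_of_sq (nrm_ge0 _) h3; rewrite /r ler_pdivrMl; last lra.
by rewrite mulrC.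
Qed.

(** Unlike in [tens_bdd] the constant is tied to the operator norm, which approximation by finite
    rank requires. The best constant [m] satisfies [m ^+ 2 <= 2 * c * m]: by the C*-identity the
    square of the norm is that of a tensor with [k] composed with its adjoint, where [tens_bdd_op]
    takes out one factor. *)
Lemma tens_op_bound k b (c : R) : compact_op k -> 0 < c -> (forall x, nrm (k x) <= c * nrm x) ->
  nrm (t b k) <= 2 * c * nrm b.
Proof.
move=> ck c0 kc; have [l cl_ kl] := compact_adj_ex ck.
have [C C0 hC] := @tens_bdd _ _ S k ck.
have step (C' : R) : 0 <= C' -> (forall b, nrm (t b k) <= C' * nrm b) -> forall b, nrm (t b k) ^+ 2 <= 2 * c * C' * nrm b ^+ 2.
  move=> C'0 hC' {}b; rewrite -nrm_star -nrm_cstar starK.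
  have lk' : adjoint l k by move=> x y; rewrite innC -kl -innC.
  rewrite -(tens_star (tensP S) b ck cl_ kl) -(tensM (tensP S))//.
  have h1 := @tens_bdd_op k l l (b ** star b) c ck.1 kl cl_.1 c0 kc cl_; apply: (le_trans h1).
  have -> : t (b ** star b) l = star (t (b ** star b) k).
    by rewrite -(tens_star (tensP S) _ ck cl_ kl) starM starK.
  rewrite nrm_star -!mulrA; apply: ler_wpM2l => //; apply: ler_wpM2l; first exact: ltW.
  apply: (le_trans (hC' _)); apply: ler_wpM2l => //.
  by rewrite (le_trans (nrmM _ _))// nrm_star expr2.
pose V := [set x : R | 0 <= x /\ forall b, nrm (t b k) <= x * nrm b].
have V0 : V !=set0 by exists C.
have lV : has_lbound V by exists 0 => x [].
pose m := inf V.
have m0 : 0 <= m by apply: lb_le_inf => // x [].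
have mV b' : nrm (t b' k) <= m * nrm b'.
  apply/ler_addgt0Pr => e e0; have b1 : 0 < nrm b' + 1 by have := nrm_ge0 b'; lra.
  have [|x [x0 hx] xm] := @inf_adherent _ V (e / (nrm b' + 1)) _ (conj V0 lV); first by rewrite divr_gt0.
  apply: (le_trans (hx b')); have := ler_wpM2r (nrm_ge0 b') (ltW xm).
  have : e / (nrm b' + 1) * nrm b' <= e by rewrite mulrAC ler_pdivrMr// ler_pM2l//; lra.
  by rewrite -/m; lra.
have h : m <= Num.sqrt (2 * c * m).
  apply: ge_inf => //; split; first exact: sqrtr_ge0.
  move=> b'; apply: le_of_sq; first by rewrite mulr_ge0 ?sqrtr_ge0 ?nrm_ge0.
  by rewrite exprMn sqr_sqrtr ?mulr_ge0//; [exact: step|lra].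
have cm : 0 <= 2 * c * m by rewrite !mulr_ge0// ltW.
have h2 : m ^+ 2 <= 2 * c * m by rewrite -(sqr_sqrtr cm) lerXn2r ?nnegrE ?sqrtr_ge0.
have mc : m <= 2 * c.
  have [->|mn0] := eqVneq m 0; first by lra.
  have mp : 0 < m by rewrite lt_def mn0.
  by rewrite -(ler_pM2r mp) -expr2.
apply: (le_trans (mV b)); apply: ler_wpM2r => //; exact: nrm_ge0.
Qed.

End TensorNorm.

(** * Finite-rank corners *)

Section Isometric.
Context {R : realType} {A D : cstarAlgType R} {phi : A -> D}.
Hypotheses (hphi : star_hom phi) (iphi : forall a, phi a = 0 -> a = 0).

Lemma cut_nrm0 (E : cstarAlgType R) (a : E) : cpos a -> cut (nrm a) a = 0.
Proof.
move=> pa; have -> : (0 : E) = fc (fun=> 0) a.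
  have := @fcZ _ _ 0 (fun s : R => s) a (cpos_sa pa) (@cont_id R) erefl; rewrite scale0r => <-.
  by congr fc; apply/funext => s; rewrite mul0r.
apply: fc_ext_pos; rewrite ?cut_00 ?nrm_ge0//; [exact/cpos_psd|exact: cont_cut|exact: cont_cst|].
by move=> s /andP[_ h]; rewrite max_r// subr_le0.
Qed.

Lemma nrm_cut0 (E : cstarAlgType R) (a : E) (r : R) : 0 <= r -> cpos a -> cut r a = 0 -> nrm a <= r.
Proof. by move=> r0 pa h; have := cut_dist r0 pa; rewrite h subr0. Qed.

(** For positive [h] the cutdown of [h] by [nrm (phi h)] lies in the kernel, hence vanishes, so
    [nrm h] is at most [nrm (phi h)]; the C*-identity does the rest. *)
Lemma inj_isometric a : nrm (phi a) = nrm a.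
Proof.
have h h' : cpos h' -> nrm (phi h') = nrm h'.
  move=> ph; apply/eqP; rewrite eq_le (hom_nrm hphi)/=.
  apply: nrm_cut0 => //; first exact: nrm_ge0.
  apply: iphi; rewrite /cut (hom_fc hphi) ?cut_00 ?nrm_ge0//; [|exact: cpos_sa|exact: cont_cut].
  exact: cut_nrm0 (star_hom_cpos hphi ph).
have := h _ (cpos_ss a); rewrite (star_homM hphi) (star_hom_star hphi) !nrm_cstar => /eqP.
by rewrite eqrXn2 ?nrm_ge0// => /eqP.
Qed.

End Isometric.

Lemma nrm_cube (R : realType) (A : cstarAlgType R) (h : A) : star h = h -> nrm (h ** h ** h) = nrm h ^+ 3.
Proof.
move=> hh; have [->|h0] := eqVneq h 0; first by rewrite !cmul0r nrm0 expr0n.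
have nh : 0 < nrm h by rewrite lt_def nrm_ge0 nrm_eq0 h0.
have q2 (k : A) : star k = k -> nrm (k ** k) = nrm k ^+ 2 by move=> kk; rewrite -nrm_cstar kk.
have E4 : nrm ((h ** h) ** (h ** h)) = nrm h ^+ 4.
  have hhs : star (h ** h) = h ** h by rewrite starM hh.
  by rewrite (q2 _ hhs) (q2 _ hh) -exprM.
have h4 : nrm h ^+ 4 <= nrm (h ** h ** h) * nrm h by rewrite -E4 cmulA; exact: nrmM.
have h3 : nrm (h ** h ** h) <= nrm h ^+ 3 by apply: (le_trans (nrmM _ _)); rewrite (q2 _ hh) -exprSr.
by apply/eqP; rewrite eq_le h3 /= -(ler_pM2r nh) -exprSr.
Qed.

Section FiniteRank.
Context {R : realType} {H : hilbertType R}.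
Implicit Types (k l : H -> H) (x y z : H) (e : nat -> H).
Local Notation ip := (@inner R H).

Definition onb n e := forall i j, (i < n)%N -> (j < n)%N -> ip (e i) (e j) = (i == j)%:R.

Definition proj n e x : H := \sum_(i < n) ip x (e i) *: e i.

Lemma ip_suml I (r : seq I) (F : I -> H) y : ip (\sum_(i <- r) F i) y = \sum_(i <- r) ip (F i) y.
Proof. by elim: r => [|i r ih]; rewrite ?big_nil ?inn0l// !big_cons innDl ih. Qed.

Lemma proj_ip n e x j : onb n e -> (j < n)%N -> ip (proj n e x) (e j) = ip x (e j).
Proof.
move=> he jn; rewrite /proj ip_suml (bigD1 (Ordinal jn))//= big1 ?addr0.
  by rewrite innZl he// eqxx mulr1.
by move=> i ij; rewrite innZl he// -val_eqE /= in ij *; rewrite (negbTE ij) mulr0.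
Qed.

Lemma proj_nrm n e x : onb n e -> nrm (x - proj n e x) <= nrm x /\ nrm (proj n e x) <= nrm x.
Proof.
move=> he; have o : ip (x - proj n e x) (proj n e x) = 0.
  set v := x - proj n e x; rewrite innC /proj ip_suml big1 ?conjC0// => i _.
  by rewrite innZl (innC (e i)) /v innDl innNl proj_ip// subrr conjC0 mulr0.
have := nrm_sqD (x - proj n e x) (proj n e x); rewrite subrK o mulr0 addr0 => h.
by split; apply: le_of_sq; rewrite ?nrm_ge0// h ?lerDl ?lerDr exprn_ge0 ?nrm_ge0.
Qed.

Lemma projB n e x y : proj n e (x - y) = proj n e x - proj n e y.
Proof. by rewrite /proj -sumrB; apply: eq_bigr => i _; rewrite innDl innNl scalerBl. Qed.

Lemma projZ n e (c : R[i]) x : proj n e (c *: x) = c *: proj n e x.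
Proof. by rewrite /proj scaler_sumr; apply: eq_bigr => i _; rewrite innZl scalerA. Qed.

Lemma gram_schmidt (ys : seq H) : exists n e, onb n e /\ forall y, y \in ys -> proj n e y = y.
Proof.
elim: ys => [|y ys [n [e [he hy]]]]; first by exists 0%N, (fun=> 0); split=> // i j.
pose v := y - proj n e y; have [v0|v0] := eqVneq v 0.
  exists n, e; split=> // z; rewrite inE => /orP[/eqP->|/hy//].
  by move/eqP: v0; rewrite subr_eq0 => /eqP <-.
have nv : 0 < nrm v by rewrite lt_def nrm_ge0 nrm_eq0 v0.
pose u := (nrm v)^-1%:C *: v.
have uu : ip u u = 1.
  by rewrite inner_nrm /u nrmZr ger0_norm ?invr_ge0 ?(ltW nv)// mulVf ?gt_eqF// expr1n.
have ue i : (i < n)%N -> ip u (e i) = 0.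
  by move=> hi; rewrite /u innZl /v innDl innNl proj_ip// subrr mulr0.
pose e' i := if i == n then u else e i.
have e'E i : (i < n)%N -> e' i = e i by move=> hi; rewrite /e' ltn_eqF.
have e'n : e' n = u by rewrite /e' eqxx.
have pE z : proj n.+1 e' z = proj n e z + ip z u *: u.
  rewrite /proj big_ord_recr /= e'n; congr (_ + _); apply: eq_bigr => i _.
  by rewrite e'E.
exists n.+1, e'; split.
  move=> i j; rewrite !ltnS (leq_eqVlt i) (leq_eqVlt j) => /orP[/eqP->|hi] /orP[/eqP->|hj].
  - by rewrite e'n uu eqxx.
  - by rewrite e'n e'E// ue// gtn_eqF.
  - by rewrite e'n e'E// innC ue// conjC0 ltn_eqF.
  - by rewrite !e'E// he.
move=> z; rewrite inE => /orP[/eqP->|zy]; rewrite pE.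
  have vv : v = (nrm v)%:C *: u by rewrite /u scalerA -rmorphM divff ?gt_eqF// scale1r.
  have -> : ip y u = (nrm v)%:C.
    have -> : y = v + proj n e y by rewrite /v subrK.
    rewrite innDl {1}vv innZl uu mulr1 (_ : ip (proj n e y) u = 0) ?addr0//.
    by rewrite /proj ip_suml big1// => i _; rewrite innZl (innC (e i) u) ue ?conjC0 ?mulr0.
  by rewrite -vv /v addrC subrK.
rewrite (hy z zy) (_ : ip z u = 0) ?scale0r ?addr0// -(hy z zy) /proj ip_suml big1// => i _.
by rewrite innZl (innC (e i) u) ue ?conjC0 ?mulr0.
Qed.

Lemma compact_net k (d : R) : compact_op k -> 0 < d -> exists ys : seq H, forall x, nrm x <= 1 ->
  exists2 y, y \in ys & nrm (k x - y) < d.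
Proof.
move=> [lk ck] d0; rewrite precompactE in ck.
pose F := [set P : set (seq H) | exists s0 : seq H, forall s, {subset s0 <= s} -> P s].
have FF : Filter F.
  split.
  - by exists [::].
  - move=> P Q [s0 h0] [s1 h1]; exists (s0 ++ s1) => s ss; split.
      by apply: h0 => x xs; apply: ss; rewrite mem_cat xs.
    by apply: h1 => x xs; apply: ss; rewrite mem_cat xs orbT.
  - by move=> P Q PQ [s0 h0]; exists s0 => s /h0 /PQ.
have /compact_near_coveringP cX' := ck.
have [x _|s0 hs] := cX' _ F (fun (s : seq H) x => exists2 p, p \in s & nrm (x - p) < d) FF.
  exists ([set y | nrm (x - y) < d], [set s : seq H | x \in s]) => /=.
    split; last by exists [:: x] => s; apply; rewrite mem_seq1.
    apply/nbhs_ballP; exists d%:C => /=; first by rewrite ltcR.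
    by move=> y; rewrite -ball_normE /= -nrm_lt.
  by move=> [y s] /= [xy xs]; exists x => //; rewrite nrm_distC.
exists s0 => x x1; apply: (hs s0 (fun _ => id)); apply: subset_closure; exists x => //=.
by rewrite -nrmE lecR.
Qed.

(** [ys] is a finite net for the image of the unit ball. Any orthonormal family whose span contains
    it works, so one family can serve several operators. *)
Lemma finite_rank_approx k (d : R) : compact_op k -> 0 < d -> exists ys : seq H, forall n e, onb n e ->
  (forall y, y \in ys -> proj n e y = y) -> forall x, nrm (k x - proj n e (k x)) <= d * nrm x.
Proof.
move=> ck d0; have [ys hys] := compact_net ck d0; exists ys => n e he hp x.
have [->|x0] := eqVneq x 0.
  have p0 : proj n e 0 = 0 by have := projZ n e 0 0; rewrite !scale0r.
  by rewrite lin0 ?p0 ?subrr ?nrm0 ?mulr0//; exact: ck.1.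
have nx : 0 < nrm x by rewrite lt_def nrm_ge0 nrm_eq0 x0.
pose u := (nrm x)^-1%:C *: x.
have xu : x = (nrm x)%:C *: u by rewrite /u scalerA -rmorphM divff ?gt_eqF// scale1r.
have nu : nrm u <= 1 by rewrite /u nrmZr ger0_norm ?invr_ge0 ?(ltW nx)// mulVf ?gt_eqF.
have [y /hp yy /ltW ky] := hys u nu.
have E : k x = (nrm x)%:C *: k u by rewrite -(linZ ck.1) -xu.
rewrite E projZ -scalerBr nrmZr ger0_norm ?(ltW nx)// mulrC; apply: ler_wpM2r; first exact: ltW.
apply: le_trans ky; have -> : k u - proj n e (k u) = (k u - y) - proj n e (k u - y) by rewrite projB yy; zmod.
by have [] := proj_nrm (k u - y) he.
Qed.

End FiniteRank.

(** * Matrix corners of the stabilization *)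

Section Corner.
Context {R : realType} {B : cstarAlgType R} {S : stabilization B}.
Local Notation H := (hilb S).
Local Notation D := (stab S).
Local Notation t := (@tens _ _ S).
Local Notation ip := (@inner R H).
Implicit Types (a b c : B) (d : D) (x y u v : H) (e : nat -> H) (n : nat).

Lemma tens_rank1M a b x y x' y' :
  t a (rank1 x y) ** t b (rank1 x' y') = ip x' y *: t (a ** b) (rank1 x y').
Proof.
rewrite -(tensM (tensP S)); [|exact: rank1_compact|exact: rank1_compact].
by rewrite rank1_comp tens_Z//; exact: rank1_compact.
Qed.

Lemma tens_rank1_star b x y : star (t b (rank1 x y)) = t (star b) (rank1 y x).
Proof. by rewrite -(tens_star (tensP S) b (rank1_compact x y) (rank1_compact y x) (rank1_adjoint x y)). Qed.

Lemma tens_diag_hom u : ip u u = 1 -> star_hom (fun b => t b (rank1 u u)).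
Proof.
move=> uu; have ck := rank1_compact u u; split=> [z a b|a b|a].
- exact: (tens_linearl (tensP S)).
- by rewrite tens_rank1M uu scale1r.
- by rewrite tens_rank1_star.
Qed.

Lemma tens_diag_inj u : ip u u = 1 -> forall b, t b (rank1 u u) = 0 -> b = 0.
Proof.
move=> uu b h; apply: (tens_inj (tensP S) (n := 1) (b := fun=> b) (k := fun=> rank1 u u) _ _ _ ord0).
- by move=> _; exact: rank1_compact.
- move=> c hc i; rewrite (ord1 i).
  have := congr1 (fun f : H -> H => ip (f u) u) hc; rewrite big_ord1.
  change (ip (c ord0 *: (ip u u *: u)) u = ip 0 u -> c ord0 = 0).
  by rewrite uu scale1r innZl uu mulr1 inn0l.
- by rewrite big_ord1.
Qed.

Lemma tens_rank1_nrm b u v : ip u u = 1 -> ip v v = 1 -> nrm (t b (rank1 u v)) = nrm b.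
Proof.
move=> uu vv; apply/eqP; rewrite -(@eqrXn2 _ 2)// ?nrm_ge0// -nrm_cstar tens_rank1_star tens_rank1M uu scale1r.
by rewrite (inj_isometric (tens_diag_hom vv) (tens_diag_inj vv)) nrm_cstar.
Qed.

Lemma tens_suml I (r : seq I) (F : I -> B) x y : t (\sum_(i <- r) F i) (rank1 x y) = \sum_(i <- r) t (F i) (rank1 x y).
Proof.
have ck := rank1_compact x y; elim: r => [|i r ih]; first by rewrite !big_nil tens0.
by rewrite !big_cons tensD// ih.
Qed.

(** The copy of the matrix algebra over [B] along the matrix units [rank1 (e i) (e j)]. *)
Definition cor n e (b : 'M[B]_n) : D := \sum_i \sum_j t (b i j) (rank1 (e i) (e j)).

Lemma corD n e (b c : 'M[B]_n) : cor e (b + c) = cor e b + cor e c.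
Proof.
rewrite /cor -big_split /=; apply: eq_bigr => i _; rewrite -big_split /=; apply: eq_bigr => j _.
by rewrite mxE tensD//; exact: rank1_compact.
Qed.

Lemma corZ n e (z : R[i]) (b : 'M[B]_n) : cor e (map_mx ( *:%R z) b) = z *: cor e b.
Proof.
rewrite /cor scaler_sumr; apply: eq_bigr => i _; rewrite scaler_sumr; apply: eq_bigr => j _.
by rewrite mxE tensZ//; exact: rank1_compact.
Qed.

Definition cmx n (b c : 'M[B]_n) : 'M[B]_n := \matrix_(i, j) \sum_k (b i k ** c k j).

Lemma cor_sandwich n e (b : 'M[B]_n) a a' (i j : 'I_n) u v : onb n e ->
  t a (rank1 u (e i)) ** cor e b ** t a' (rank1 (e j) v) = t (a ** b i j ** a') (rank1 u v).
Proof.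
move=> he; have T (p q : 'I_n) : t a (rank1 u (e i)) ** t (b p q) (rank1 (e p) (e q)) ** t a' (rank1 (e j) v) =
    (p == i)%:R *: ((j == q)%:R *: t (a ** b p q ** a') (rank1 u v)).
  by rewrite tens_rank1M cscaleAl tens_rank1M !he.
rewrite /cor cmul_sumr cmul_suml (bigD1 i)//= [X in _ + X]big1 ?addr0; last first.
  by move=> p pi; rewrite cmul_sumr cmul_suml big1// => q _; rewrite T (negbTE pi) scale0r.
rewrite cmul_sumr cmul_suml (bigD1 j)//= [X in _ + X]big1 ?addr0; last first.
  by move=> q qj; rewrite T eq_sym (negbTE qj) scale0r scaler0.
by rewrite T !eqxx !scale1r.
Qed.

Lemma corM n e (b c : 'M[B]_n) : onb n e -> cor e (cmx b c) = cor e b ** cor e c.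
Proof.
move=> he; rewrite [cor e b]/cor cmul_suml; apply: eq_bigr => i _; rewrite cmul_suml.
transitivity (\sum_k \sum_q t (b i k ** c k q) (rank1 (e i) (e q))).
  rewrite exchange_big /=; apply: eq_bigr => q _; rewrite mxE.
  exact: tens_suml.
apply: eq_bigr => k _; rewrite /cor cmul_sumr [RHS](bigD1 k)//= [X in _ = _ + X]big1 ?addr0.
  by rewrite cmul_sumr; apply: eq_bigr => q _; rewrite tens_rank1M he// eqxx scale1r.
move=> p pk; rewrite cmul_sumr big1// => q _; rewrite tens_rank1M he//.
by rewrite (_ : (p == k :> nat) = false) ?scale0r//; exact: negbTE.
Qed.

Lemma cor_star n e (b : 'M[B]_n) : star (cor e b) = cor e (map_mx star b)^T.
Proof.
rewrite /cor star_sum exchange_big /=; apply: eq_bigr => i _; rewrite star_sum.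
by apply: eq_bigr => j _; rewrite tens_rank1_star !mxE.
Qed.

(** Cutting out the entry [a] with [star a] on both sides leaves an element of norm [nrm a ^+ 3],
    while each of the two outer factors has norm [nrm a]. *)
Lemma cor_entry n e (b : 'M[B]_n) i j : onb n e -> nrm (b i j) <= nrm (cor e b).
Proof.
move=> he; have [->|b0] := eqVneq (b i j) 0; first by rewrite nrm0 nrm_ge0.
have nb : 0 < nrm (b i j) by rewrite lt_def nrm_ge0 nrm_eq0 b0.
have ii : ip (e i) (e i) = 1 by rewrite he// eqxx.
have jj : ip (e j) (e j) = 1 by rewrite he// eqxx.
have := cor_sandwich b (star (b i j)) (star (b i j)) i j (e i) (e i) he.
set a := b i j in nb b0 * => E.
have h1 : nrm (star a ** a ** star a) = nrm a ^+ 3.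
  have aa : star (star a ** a) = star a ** a by rewrite starM starK.
  have E2 : nrm (star a ** a ** star a) ^+ 2 = nrm a ^+ 6.
    rewrite -nrm_star -nrm_cstar starK !starM !starK.
    have -> : star a ** a ** star a ** (a ** (star a ** a)) = (star a ** a) ** (star a ** a) ** (star a ** a) by rewrite !cmulA.
    by rewrite nrm_cube// nrm_cstar -exprM.
  by apply/eqP; rewrite -(@eqrXn2 _ 2)// ?nrm_ge0 ?exprn_ge0 ?nrm_ge0// E2 -exprM.
have := nrmM (t (star a) (rank1 (e i) (e i)) ** cor e b) (t (star a) (rank1 (e j) (e i))).
rewrite E !tens_rank1_nrm// h1 nrm_star => h2.
have h3 := nrmM (t (star a) (rank1 (e i) (e i))) (cor e b); rewrite tens_rank1_nrm// nrm_star in h3.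
have := le_trans h2 (ler_wpM2r (nrm_ge0 _) h3); rewrite mulrAC -expr2 exprSr mulrC.
by rewrite (mulrC (nrm a ^+ 2)) ler_pM2r// exprn_gt0.
Qed.

Lemma cor_sub n e (b c : 'M[B]_n) : cor e (b - c) = cor e b - cor e c.
Proof.
rewrite corD; congr (_ + _); rewrite -scaleN1r -corZ; congr cor; apply/matrixP => i j.
by rewrite !mxE scaleN1r.
Qed.

(** Entries are controlled by the norm ([cor_entry]), so approximating matrices converge
    entrywise. *)
Lemma cor_closed n e d : onb n e -> (forall r : R, 0 < r -> exists b : 'M[B]_n, nrm (d - cor e b) < r) ->
  exists b : 'M[B]_n, d = cor e b.
Proof.
move=> he h; have /choice[b hb] (m : nat) : exists b : 'M[B]_n, nrm (d - cor e b) < m.+1%:R^-1.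
  by apply: h; rewrite invr_gt0.
have small (r : R) : 0 < r -> exists N, forall m, (N <= m)%N -> m.+1%:R^-1 < r.
  move=> r0; exists (Num.bound r^-1) => m Nm; rewrite -[r]invrK ltf_pV2 ?posrE ?invr_gt0// ?ltr0n//.
  have := archi_boundP (ltW (_ : 0 < r^-1)); rewrite invr_gt0 => /(_ r0) h'.
  by apply: (lt_le_trans h'); rewrite ler_nat (leq_trans Nm).
have /choice[c hc] (p : 'I_n * 'I_n) : exists c : B, (fun m => b m p.1 p.2) @ \oo --> (c : B).
  apply: nrm_cauchy_cvg => r r0; have [N hN] := small (r / 2) (divr_gt0 r0 (ltr0n R 2)).
  exists N => m1 m2 h1 h2.
  have -> : b m1 p.1 p.2 - b m2 p.1 p.2 = (b m1 - b m2) p.1 p.2 by rewrite !mxE.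
  apply: (le_lt_trans (cor_entry _ _ _ he)); rewrite cor_sub (le_lt_trans (nrm_dist3 _ d _))//.
  have := lt_trans (hb m1) (hN _ h1); have := lt_trans (hb m2) (hN _ h2); rewrite (nrm_distC d (cor e (b m1))).
  by move: (nrm _) (nrm _) => *; lra.
exists (\matrix_(i, j) c (i, j)); apply/eqP; rewrite -subr_eq0 -nrm_eq0 eq_le nrm_ge0 andbT.
apply/ler_addgt0Pr => r r0; rewrite add0r.
pose C := (n * n)%:R + 1 : R; have C0 : 0 < C by rewrite /C ltr_wpDl.
have r2 : 0 < r / (2 * C) by rewrite divr_gt0// mulr_gt0.
have [N1 hN1] := small (r / 2) (divr_gt0 r0 (ltr0n R 2)).
have /choice[N2 hN2] (p : 'I_n * 'I_n) : exists N, forall m, (N <= m)%N -> nrm (b m p.1 p.2 - c p) < r / (2 * C).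
  have /nrm_cvg_seqP/(_ _ r2)[N hN] := hc p; exists N => m Nm; rewrite nrm_distC; exact: hN.
pose m := maxn N1 (\max_p N2 p).
have m1 : (N1 <= m)%N by exact: leq_maxl.
have m2 p : (N2 p <= m)%N by rewrite leq_max; apply/orP; right; exact: (leq_bigmax p).
rewrite (le_trans (nrm_dist3 _ (cor e (b m)) _))// [leRHS](splitr r) lerD//.
  by have := lt_trans (hb m) (hN1 m m1); exact: ltW.
rewrite -cor_sub /cor (le_trans (nrm_sum _ _ _))//.
have -> : r / 2 = C * (r / (2 * C)) by field; rewrite gt_eqF.
apply: (@le_trans _ _ (\sum_(i < n) \sum_(j < n) r / (2 * C))).
  apply: ler_sum => i _; rewrite (le_trans (nrm_sum _ _ _))//; apply: ler_sum => j _.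
  rewrite tens_rank1_nrm ?he ?eqxx// !mxE; exact: ltW (hN2 (i, j) m (m2 _)).
have -> : \sum_(i < n) \sum_(j < n) r / (2 * C) = (n * n)%:R * (r / (2 * C)).
  by rewrite !sumr_const !card_ord -mulrnA (mulr_natl _ (n * n)).
by apply: ler_wpM2r; [exact: ltW | rewrite /C lerDl].
Qed.

Lemma cor_fc n e (b : 'M[B]_n) (f : R -> R) : onb n e -> star (cor e b) = cor e b -> continuous f -> f 0 = 0 ->
  exists c : 'M[B]_n, fc f (cor e b) = cor e c.
Proof.
move=> he sb cf f0; apply: cor_closed => // r r0.
have [q [q0 _ hq]] := fc_approx sb cf f0 (divr_gt0 r0 (ltr0n R 2)) (lexx _).
suff [c hc] : exists c : 'M[B]_n, hp q (cor e b) = cor e c.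
  exists c; rewrite -hc nrm_distC; apply: le_lt_trans hq _; lra.
have [p ->] : exists p, q = 'X * p.
  have : root q 0 by apply/rootP.
  by move=> /factor_theorem[p ->]; exists p; rewrite subr0 mulrC.
rewrite -(coefK p) poly_def mulr_sumr.
elim/big_rec: _ => [|i x _ [c hc]].
  by exists 0; have := cor_sub e b b; rewrite !subrr hp0 => ->.
have [g hg] : exists g : 'M[B]_n, hp ('X ^+ i.+1) (cor e b) = cor e g.
  elim: (i : nat) => [|m [g hg]]; first by exists b; rewrite hpX.
  by exists (cmx b g); rewrite exprS hpM ?hornerX ?hornerXn ?expr0n// hpX hg corM.
exists (map_mx ( *:%R (p`_i)%:C) g + c).
by rewrite hpD hc -scalerAr hpZ -exprS hg corD corZ.
Qed.

(** Each compact operator [k] is compressed by the projection [p] onto the span of [e]. The error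
    [(k - p k) + p (k - k p)] is small in operator norm by [finite_rank_approx], and [tens_op_bound]
    carries this over to the tensors. *)
Lemma corner_dense d (r : R) : 0 < r -> exists ys : seq H, forall n e, onb n e ->
  (forall y, y \in ys -> proj n e y = y) -> exists b : 'M[B]_n, nrm (d - cor e b) < r.
Proof.
move=> r0; have r2 : 0 < r / 2 by rewrite divr_gt0.
have [m [b [k [ck hd]]]] := tens_approx d r2.
(* The adjoints are approximated as well, which controls the part [k - k p] of the error. *)
have /choice[l hl] i : exists l, compact_op l /\ adjoint (k i) l by have [l] := compact_adj_ex (ck i); exists l.
pose M := \sum_i nrm (b i) + 1.
have M0 : 0 < M by rewrite /M ltr_wpDl// sumr_ge0// => i _; exact: nrm_ge0.
pose w := r / (8 * M); have w0 : 0 < w by rewrite divr_gt0// mulr_gt0.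
have /choice[ys1 h1] i := finite_rank_approx (ck i) w0.
have /choice[ys2 h2] i := finite_rank_approx (hl i).1 w0.
exists (flatten [seq ys1 i ++ ys2 i | i <- enum 'I_m]) => n e he hp.
have mem i y : y \in ys1 i ++ ys2 i -> y \in flatten [seq ys1 i ++ ys2 i | i <- enum 'I_m].
  by move=> hy; apply/flattenP; exists (ys1 i ++ ys2 i) => //; apply: map_f; rewrite mem_enum.
have {}h1 i x : nrm (k i x - proj n e (k i x)) <= w * nrm x.
  by apply: (h1 i n e he) => y hy; apply: hp; apply: (mem i); rewrite mem_cat hy.
have {}h2 i x : nrm (l i x - proj n e (l i x)) <= w * nrm x.
  by apply: (h2 i n e he) => y hy; apply: hp; apply: (mem i); rewrite mem_cat hy orbT.
pose pk i : H -> H := fun x => proj n e (k i (proj n e x)).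
have pkE i : pk i = \sum_(p < n) \sum_(q < n) ip (k i (e q)) (e p) *: rank1 (e p) (e q).
  apply/funext => x; rewrite /pk /proj; rewrite fct_sumE; apply: eq_bigr => p _.
  rewrite fct_sumE; have -> : k i (\sum_(q < n) ip x (e q) *: e q) = \sum_(q < n) ip x (e q) *: k i (e q).
    rewrite (big_morph (k i) (linD (ck i).1) (lin0 (ck i).1)); apply: eq_bigr => q _; exact: linZ (ck i).1 _ _.
  rewrite ip_suml scaler_suml; apply: eq_bigr => q _.
  change ((ip (ip x (e q) *: k i (e q)) (e p)) *: e p = ip (k i (e q)) (e p) *: (ip x (e q) *: e p)).
  by rewrite innZl scalerA mulrC.
have cpk i : compact_op (pk i) /\ t (b i) (pk i) = \sum_(p < n) \sum_(q < n) ip (k i (e q)) (e p) *: t (b i) (rank1 (e p) (e q)).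
  have c0 := @compact_zero R H.
  have key (I : Type) (s : seq I) (F : I -> H -> H) (G : I -> D) : (forall j, compact_op (F j) /\ t (b i) (F j) = G j) ->
      compact_op (\sum_(j <- s) F j) /\ t (b i) (\sum_(j <- s) F j) = \sum_(j <- s) G j.
    move=> hF; elim: s => [|j s [ih1 ih2]].
      rewrite !big_nil; split=> //; rewrite -(scale0r (t (b i) 0)) -tens_Z//.
      by congr t; rewrite scale0r.
    have [f1 f2] := hF j; rewrite !big_cons; split; last by rewrite tens_D// f2 ih2.
    by have := compact_lin 1 f1 ih1; rewrite scale1r.
  rewrite pkE; apply: (key) => p; apply: (key) => q; split; last by rewrite tens_Z//; exact: rank1_compact.
  have := compact_lin (ip (k i (e q)) (e p)) (rank1_compact (e p) (e q)) c0.
  by congr compact_op; apply/funext => x; change (ip (k i (e q)) (e p) *: rank1 (e p) (e q) x + 0 = ip (k i (e q)) (e p) *: rank1 (e p) (e q) x); rewrite addr0.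
have near i : nrm (t (b i) (k i) - t (b i) (pk i)) <= 4 * w * nrm (b i).
  have [cp _] := cpk i.
  pose g := fun x => k i x - pk i x.
  have cg : compact_op g.
    have := compact_lin (-1) cp (ck i); congr compact_op; apply/funext => x.
    by change (-1 *: pk i x + k i x = k i x - pk i x); rewrite scaleN1r addrC.
  have -> : t (b i) (k i) - t (b i) (pk i) = t (b i) g.
    apply/eqP; rewrite subr_eq -tens_D//; apply/eqP; congr t; apply/funext => x.
    by change (k i x = k i x - pk i x + pk i x); rewrite subrK.
  have gb x : nrm (g x) <= 2 * w * nrm x.
    have lkp : forall y, nrm (k i (y - proj n e y)) <= w * nrm y.
      pose kq y := k i (y - proj n e y); pose lq y := l i y - proj n e (l i y).
      have a1 : adjoint lq kq.
        move=> u v; rewrite /lq /kq.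
        have psa (a c : H) : ip (proj n e a) c = ip a (proj n e c).
          rewrite [RHS]innC /proj !ip_suml rmorph_sum; apply: eq_bigr => p _.
          by rewrite !innZl rmorphM (innC a) (innC (e p) c) mulrC.
        rewrite innDl innNl psa -innNr -innDr innC -(hl i).2 -innC.
        by rewrite (linD (ck i).1).
      have lqb := h2 i; exact: (adjoint_bdd a1 lqb).
    have -> : g x = (k i x - proj n e (k i x)) + proj n e (k i (x - proj n e x)).
      have -> : k i (x - proj n e x) = k i x - k i (proj n e x).
        by rewrite -scaleN1r (linD (ck i).1) (linZ (ck i).1) scaleN1r.
      by rewrite projB /g /pk; zmod.
    rewrite (le_trans (nrmD _ _))//; have := h1 i x; have [_] := proj_nrm (k i (x - proj n e x)) he.
    by have := lkp x; lra.
  have w20 : 0 < 2 * w by lra.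
  by apply: (le_trans (tens_op_bound (b i) cg w20 gb)); rewrite mulrA -natrM.
exists (\matrix_(p, q) \sum_i ip (k i (e q)) (e p) *: b i).
have -> : cor e (\matrix_(p < n, q < n) \sum_i ip (k i (e q)) (e p) *: b i) = \sum_i t (b i) (pk i).
  rewrite /cor (eq_bigr _ (fun i _ => (cpk i).2)).
  apply: esym; rewrite exchange_big; apply: eq_bigr => p _ /=; rewrite exchange_big; apply: eq_bigr => q _ /=.
  rewrite mxE tens_suml.
  by apply: eq_bigr => i _; rewrite tensZ//; exact: rank1_compact.
rewrite (le_lt_trans (nrm_dist3 _ (\sum_i t (b i) (k i)) _))// [ltRHS](splitr r) ltrD//.
rewrite -sumrB; apply: (@le_lt_trans _ _ (\sum_i 4 * w * nrm (b i))).
  by apply: (le_trans (nrm_sum _ _ _)); apply: ler_sum => i _; exact: near.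
rewrite -mulr_sumr /w; have -> : 4 * (r / (8 * M)) = r / 2 / M by field; rewrite gt_eqF.
by rewrite mulrAC ltr_pdivrMr// ltr_pM2l// /M ltrDl.
Qed.

End Corner.

(** * Ideals *)

Section Ideals.
Context {R : realType} {D : cstarAlgType R}.
Implicit Types (a b c d : D) (I J : set D).

Lemma closed_nrm I : closed I <-> forall d, (forall r : R, 0 < r -> exists2 d', I d' & nrm (d - d') < r) -> I d.
Proof.
split=> [cI d h|h d cd].
  apply: cI => U /nbhs_ballP[s /= s0 hs].
  have sE : s = (complex.Re s)%:C by rewrite RRe_real// gtr0_real.
  have s0' : 0 < complex.Re s by rewrite -ltcR -sE.
  have [d' Id' dd'] := h _ s0'.
  exists d'; split=> //; apply: hs; rewrite -ball_normE /= sE -nrm_lt; exact: dd'.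
apply: h => r r0; have rC : (0 : R[i]) < r%:C by rewrite ltcR.
have [d' [Id']] := cd _ (nbhsx_ballx d _ rC); rewrite -ball_normE /= => dd'.
by exists d' => //; rewrite nrm_lt.
Qed.

Lemma idealD I a b : closed_ideal I -> I a -> I b -> I (a + b).
Proof. by move=> hI Ia Ib; have := ideal_linear hI 1 Ia Ib; rewrite scale1r. Qed.

Lemma idealZ I (z : R[i]) a : closed_ideal I -> I a -> I (z *: a).
Proof. by move=> hI Ia; have := ideal_linear hI z Ia (ideal0 hI); rewrite addr0. Qed.

Lemma idealB I a b : closed_ideal I -> I a -> I b -> I (a - b).
Proof. by move=> hI Ia Ib; have := ideal_linear hI (-1) Ib Ia; rewrite scaleN1r addrC. Qed.

Lemma ideal_sum I T (s : seq T) (P : pred T) (F : T -> D) : closed_ideal I -> (forall i, P i -> I (F i)) ->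
  I (\sum_(i <- s | P i) F i).
Proof. by move=> hI h; elim/big_rec: _ => [|i x Pi Ix]; [exact: ideal0|apply: idealD => //; exact: h]. Qed.

(** The closure of the sums of products of [c] from both sides; that [c] itself belongs to it
    follows from [ideal_sandwich]. *)
Definition gen_ideal c : set D := [set d | forall r : R, 0 < r -> exists s : seq (D * D),
  nrm (d - \sum_(p <- s) p.1 ** c ** p.2) < r].

Lemma gen_ideal_closed c : closed_ideal (gen_ideal c).
Proof.
have mulP (x : D) d d' (r : R) : 0 < r -> nrm (d - d') < r / (nrm x + 1) -> nrm (x ** (d - d')) < r /\ nrm ((d - d') ** x) < r.
  move=> r0; have n0 := nrm_ge0 x; rewrite ltr_pdivlMr; last lra.
  have := nrmM x (d - d'); have := nrmM (d - d') x; have := nrm_ge0 (d - d').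
  by move: (nrm (_ ** _)) (nrm (_ ** _)) (nrm (d - d')) (nrm x) n0 => *; split; nra.
have rx (x : D) (r : R) : 0 < r -> 0 < r / (nrm x + 1) by move=> r0; rewrite divr_gt0// ltr_wpDl// nrm_ge0.
split.
- apply/closed_nrm => d h r r0; have r2 : 0 < r / 2 by rewrite divr_gt0.
  have [d' hd' dd'] := h _ r2; have [s hs] := hd' _ r2; exists s.
  by rewrite (le_lt_trans (nrm_dist3 _ d' _))// [ltRHS]splitr ltrD.
- by move=> r r0; exists [::]; rewrite big_nil subrr nrm0.
- move=> z a b ha hb r r0; have r2 : 0 < r / 2 by rewrite divr_gt0.
  pose m := complex.Re `|z| + 1; have z0 : 0 <= complex.Re `|z| by rewrite -lecR RRe_real ?normr_real ?normr_ge0.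
  have m0 : 0 < m by rewrite /m; lra.
  have [s hs] := ha _ (divr_gt0 r2 m0); have [s' hs'] := hb _ r2.
  exists ([seq (z *: p.1, p.2) | p <- s] ++ s'); rewrite big_cat big_map /=.
  under eq_bigr => p _ do rewrite !cscaleAl.
  rewrite -scaler_sumr; set A := \sum_(p <- s) _; set A' := \sum_(p <- s') _.
  have -> : z *: a + b - (z *: A + A') = z *: (a - A) + (b - A') by rewrite scalerBr; zmod.
  rewrite (le_lt_trans (nrmD _ _))// nrmZ [ltRHS]splitr; move: hs; rewrite ltr_pdivlMr// /m.
  move: hs' (nrm_ge0 (a - A)) z0; move: (nrm (b - A')) (nrm (a - A)) (complex.Re _) => x y w *; nra.
- move=> x d hd r r0; have [s hs] := hd _ (rx x r r0).
  exists [seq (x ** p.1, p.2) | p <- s]; rewrite big_map /=.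
  under eq_bigr => p _ do rewrite -!cmulA cmulA.
  by under eq_bigr => p _ do rewrite -cmulA (cmulA p.1); rewrite -cmul_sumr -cmulBr; have [] := mulP x d _ r r0 hs.
- move=> d x hd r r0; have [s hs] := hd _ (rx x r r0).
  exists [seq (p.1, p.2 ** x) | p <- s]; rewrite big_map /=.
  by under eq_bigr => p _ do rewrite cmulA; rewrite -cmul_suml -cmulBl; have [] := mulP x d _ r r0 hs.
Qed.

End Ideals.

Section GenIdeal.
Context {R : realType} {B : cstarAlgType R} {S : stabilization B}.
Local Notation D := (stab S).
Implicit Types (a c : D).

(** The real part of [x ** c ** y] is at most half of [x ** c ** star x + star y ** c ** y], because
    conjugating [c] by [x - star y] gives a positive element. So each product counts for two copies
    of [c]. *)
Lemma gen_ideal_cut a c (e : R) : cpos a -> cpos c -> gen_ideal c a -> 0 < e -> exists K, cl (cut e a) ⊑ cl c *+ K.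
Proof.
move=> pa pc ga e0; have [s hs] := ga e e0; have sa := cpos_sa pa; have sc := cpos_sa pc.
pose y := \sum_(p <- s) p.1 ** c ** p.2.
pose x := (2^-1)%:C *: (a - y + star (a - y)).
pose q (p : D * D) := p.1 ** c ** star p.1 + star p.2 ** c ** p.2.
pose b := (2^-1)%:C *: \sum_(p <- s) q p.
have h2 : (0 : R) <= 2^-1 by rewrite invr_ge0.
have pq p : cpos (q p) by apply: cposD; [exact: cpos_conj'|exact: cpos_conj].
have pb : cpos b by apply: cposZ => //; apply: cpos_sum.
have xx : star x = x by rewrite /x starZr starD starK addrC.
have nx : nrm x <= e.
  rewrite /x nrmZr ger0_norm//; have := nrmD (a - y) (star (a - y)); rewrite nrm_star.
  by move: hs; rewrite -/y; move: (nrm _) (nrm _) => *; lra.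
have le : a =<= b + x.
  have hv : (2^-1)%:C *: (a + a) = a.
    by rewrite -[a in a + a]scale1r -scalerDl scalerA -{2}[a]scale1r; congr (_ *: _); rewrite -(rmorphD _ 1 1) -rmorphM mulVf.
  rewrite /cle; have -> : b + x - a = (2^-1)%:C *: (\sum_(p <- s) q p + (a - y + star (a - y)) - (a + a)) by rewrite scalerBr hv scalerDr.
  suff : cpos ((2^-1)%:C *: (\sum_(p <- s) (p.1 - star p.2) ** c ** star (p.1 - star p.2))).
    congr cpos; congr (_ *: _); rewrite starB sa /y star_sum.
    transitivity (\sum_(p <- s) (q p - (p.1 ** c ** p.2 + star (p.1 ** c ** p.2)))).
      apply: eq_bigr => p _; rewrite starB starK !starM sc !cmulBr !cmulBl /q cmulA; zmod.
    by rewrite sumrB [X in _ - X]big_split /=; zmod.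
  by apply: cposZ => //; apply: cpos_sum => p _; exact: cpos_conj'.
exists ((size s).*2).
have h := cut_le_pert (ltW e0) pa pb xx nx le.
apply: (cule_trans (y := cl b)); first by apply/cl_le => //; exact: cpos_cut (ltW e0) pa.
apply: (cule_trans (y := cl (\sum_(p <- s) q p))).
  by apply/cl_le => //; [exact: cpos_sum|apply: cuntz_scale => //; apply: cuntz_refl; exact: cpos_sum].
apply: (cule_trans (cl_le_sum _ (fun p _ => pq p))).
have -> : cl c *+ (size s).*2 = \sum_(p <- s) (cl c *+ 2).
  by rewrite big_const_seq count_predT iter_addr_0 -mulrnA mul2n.
apply: cule_sum => p _; apply: (cule_trans (cl_leD (cpos_conj' _ pc) (cpos_conj _ pc))).
rewrite mulr2n; apply: culeD; apply/cl_le => //; [exact: cpos_conj'|exact: cuntz_conj|exact: cpos_conj|].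
by have := cuntz_conj c (star p.2); rewrite starK.
Qed.

End GenIdeal.

(** * Ideals of the stabilization and the dichotomy for simple algebras *)

Section TensorIdeal.
Context {R : realType}.

Lemma absorb (A : cstarAlgType R) (y : A) (r : R) : 0 < r -> exists2 k : A, nrm (y - y ** k) < r & star k = k.
Proof.
move=> r0; pose m := r ^+ 2 / 4; have m0 : 0 < m by rewrite divr_gt0// exprn_gt0.
have [k [l [kk _ _ h]]] := absorb_data (cpos_ss y) m0; exists k => //.
have := h y; rewrite subrr => /(_ cpos_0) hy; apply: le_lt_trans (_ : r * (3 / 4) < r); last lra.
by apply: le_of_sq; [lra | rewrite /m in hy; nra].
Qed.

(** Approximate units on both sides put [b] into the closure of the products. *)
Lemma ideal_sandwich (A : cstarAlgType R) (I : set A) (b : A) : closed_ideal I -> (forall a a', I (a ** b ** a')) -> I b.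
Proof.
move=> hI h; apply/(closed_nrm _).1 => [|r r0]; first exact: ideal_closed hI.
have r2 : 0 < r / 2 by rewrite divr_gt0.
have [k hk _] := absorb b r2; pose w := r / 2 / (nrm k + 1).
have nk := nrm_ge0 k; have w0 : 0 < w by rewrite divr_gt0//; lra.
have [k' hk' kk'] := absorb (star b) w0; exists (k' ** b ** k); first exact: h.
have {}hk' : nrm (b - k' ** b) < w by rewrite -nrm_star starB starM kk'.
rewrite (le_lt_trans (nrm_dist3 _ (b ** k) _))// [ltRHS]splitr ltr_leD// -cmulBl.
apply: (le_trans (nrmM _ _)); move: hk'; rewrite /w ltr_pdivlMr; last lra.
by have := nrm_ge0 (b - k' ** b); move: (nrm (b - _)) => q; nra.
Qed.

Context {B : cstarAlgType R} {S : stabilization B}.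
Local Notation H := (hilb S).
Local Notation D := (stab S).
Local Notation t := (@tens _ _ S).
Local Notation ip := (@inner R H).
Implicit Types (a b c : B) (d : D) (x y u v : H) (e : nat -> H) (n : nat) (J : set D).

Lemma unit_vector : exists u, ip u u = 1.
Proof.
apply: contrapT => h; apply: (@hilb_infinite_dim _ _ S); exists 0%N, (fun=> 0) => x; exists (fun=> 0).
rewrite big_ord0; apply: contrapT => x0; apply: h; exists ((nrm x)^-1%:C *: x).
have nx : nrm x != 0 by rewrite nrm_eq0; apply/eqP.
rewrite innZl innZr inner_nrm conj_Creal ?complex_real// -!rmorphM mulrA -expr2 -exprMn mulVf// expr1n.
by [].
Qed.

(** The ideal of [B] that corresponds to [J]: an element of a corner lies in [J] exactly when its
    entries lie here ([cor_pull], [pull_cor]). *)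
Definition pull J : set B := [set b | forall x y, J (t b (rank1 x y))].

Lemma pull_closed J : closed_ideal J -> closed_ideal (pull J).
Proof.
move=> hJ; have [u uu] := unit_vector; split.
- apply/closed_nrm => b h x y; apply/(closed_nrm _).1 => [|r r0]; first exact: ideal_closed hJ.
  have ck := rank1_compact x y; have [c c0 hc] := compact_bdd ck.
  have c2 : 0 < 2 * c by rewrite mulr_gt0.
  have [b' hb' bb'] := h _ (divr_gt0 r0 c2); exists (t b' (rank1 x y)) => //.
  have -> : t b (rank1 x y) - t b' (rank1 x y) = t (b - b') (rank1 x y).
    by apply/eqP; rewrite subr_eq -tensD// subrK.
  apply: (le_lt_trans (tens_op_bound _ ck c0 hc)).
  by move: bb'; rewrite ltr_pdivlMr// mulrC.
- by move=> x y; rewrite tens0; [exact: ideal0|exact: rank1_compact].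
- move=> z a b ha hb x y; rewrite (tens_linearl (tensP S)); last exact: rank1_compact.
  exact: (ideal_linear hJ).
- move=> a b hb x y; have := Defs.idealMl hJ (t a (rank1 x u)) (hb u y).
  by rewrite tens_rank1M uu scale1r.
- move=> a b ha x y; have := Defs.idealMr hJ (t b (rank1 u y)) (ha x u).
  by rewrite tens_rank1M uu scale1r.
Qed.

Lemma cor_pull J n e (b : 'M[B]_n) : closed_ideal J -> (forall i j, pull J (b i j)) -> J (cor e b).
Proof. by move=> hJ h; apply: ideal_sum => // i _; apply: ideal_sum => // j _; exact: h. Qed.

Lemma pull_cor J n e (b : 'M[B]_n) i j : closed_ideal J -> onb n e -> J (cor e b) -> pull J (b i j).
Proof.
move=> hJ he hb; apply: (ideal_sandwich (pull_closed hJ)) => a a' x y.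
by rewrite -(cor_sandwich _ _ _ _ _ _ _ he); apply: Defs.idealMr => //; apply: Defs.idealMl.
Qed.

Lemma cor_elem n e a (p q : 'I_n) : exists c : 'M[B]_n, t a (rank1 (e p) (e q)) = cor e c.
Proof.
exists (\matrix_(i, j) if (i == p) && (j == q) then a else 0).
have t0 u v : t 0 (rank1 u v) = 0 by rewrite tens0//; exact: rank1_compact.
rewrite /cor (bigD1 p)//= (bigD1 q)//= big1 => [|j jq]; last by rewrite mxE (negbTE jq) andbF t0.
rewrite big1 ?addr0 => [|i ip']; first by rewrite mxE !eqxx.
by rewrite big1// => j _; rewrite mxE (negbTE ip') t0.
Qed.

Lemma cor_compress n e (x y : 'M[B]_n) d : onb n e -> exists c : 'M[B]_n, cor e x ** d ** cor e y = cor e c.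
Proof.
move=> he; pose X := cor e x; pose Y := cor e y.
pose inr z := exists c : 'M[B]_n, z = cor e c.
have inrD (a b : D) : inr a -> inr b -> inr (a + b) by move=> [c ->] [c' ->]; exists (c + c'); rewrite corD.
have inr0 : inr 0 by exists (x - x); rewrite cor_sub subrr.
have inrS I (s : seq I) (F : I -> D) : (forall i, inr (F i)) -> inr (\sum_(i <- s) F i).
  by move=> hF; elim/big_rec: _ => // i z _ hz; exact: inrD.
apply: cor_closed => // r r0; pose C := nrm X * nrm Y + 1.
have C0 : 0 < C by rewrite /C ltr_wpDl// mulr_ge0 ?nrm_ge0.
have [ys hys] := corner_dense d (divr_gt0 r0 C0).
have [m [f [hf pf]]] := gram_schmidt ys; have [b hb] := hys m f hf pf.
suff [c hc] : inr (X ** cor f b ** Y).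
  exists c; rewrite -hc -cmulBl -cmulBr; apply: (le_lt_trans (nrmM _ _)).
  move: hb; rewrite ltr_pdivlMr// /C; have := nrmM X (d - cor f b); have := nrm_ge0 (d - cor f b); have := nrm_ge0 Y.
  by move: (nrm (X ** _)) (nrm (d - _)) (nrm X) (nrm Y) => *; nra.
rewrite /X /Y /cor cmul_sumr; apply: (inrS) => j; rewrite cmul_sumr; apply: (inrS) => q.
rewrite cmul_sumr cmul_suml; apply: (inrS) => k; rewrite cmul_sumr cmul_suml; apply: (inrS) => l.
rewrite !cmul_suml; apply: (inrS) => p; rewrite !cmul_suml; apply: (inrS) => i.
rewrite !tens_rank1M cscaleAl tens_rank1M scalerA.
have [c ->] := cor_elem e (x p i ** b k l ** y j q) p q; rewrite -corZ.
by eexists; reflexivity.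
Qed.

(** If [pull J] is everything, [J] contains the dense corners. If it is 0, an element [d] of [J]
    vanishes between any two elements of a corner, hence between two copies of [star d], and then
    [d = 0] by the C*-identity. *)
Lemma simple_stab : simple_cstar B -> simple_cstar D.
Proof.
move=> sB J hJ; case: (sB _ (pull_closed hJ)) => hI; [left|right]; last first.
  apply/seteqP; split=> // d _; apply/(closed_nrm _).1 => [|r r0]; first exact: ideal_closed hJ.
  have [ys hys] := corner_dense d r0; have [m [f [hf pf]]] := gram_schmidt ys; have [b hb] := hys m f hf pf.
  by exists (cor f b) => //; apply: cor_pull => // i j; rewrite hI.
apply/seteqP; split=> [d Jd|_ ->]; last exact: ideal0.
have vanish n e (x y : 'M[B]_n) : onb n e -> cor e x ** d ** cor e y = 0.
  move=> he; have [c hc] := cor_compress x y d he.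
  have Jc : J (cor e c) by rewrite -hc; apply: Defs.idealMr => //; exact: Defs.idealMl.
  have c0 i j : c i j = 0 by have := pull_cor i j hJ he Jc; rewrite hI.
  rewrite hc /cor big1// => i _; rewrite big1// => j _; rewrite c0 tens0//; exact: rank1_compact.
pose s := star d; pose N := nrm d; have N0 : 0 <= N := nrm_ge0 d.
have sds : s ** d ** s = 0.
  apply: nrm_le0; apply/ler_addgt0Pr => r r0; rewrite add0r.
  pose C := 2 * N ^+ 2 + N + 1; have C0 : 0 < C by rewrite /C; nra.
  pose w := Num.min 1 (r / C); have w0 : 0 < w by rewrite /w lt_min ltr01 divr_gt0.
  have [ys hys] := corner_dense s w0; have [m [f [hf pf]]] := gram_schmidt ys; have [b hb] := hys m f hf pf.
  set z := cor f b in hb.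
  have -> : s ** d ** s = (s - z) ** d ** s + z ** d ** (s - z) by rewrite !cmulBl !cmulBr vanish//; zmod.
  have nz : nrm z <= N + w by have := nrm_le_dist z s; have : nrm s = N by [exact: nrm_star]; rewrite (nrm_distC z); lra.
  have w1 : w <= 1 by rewrite /w ge_min lexx.
  have wr : w * C <= r by rewrite -ler_pdivlMr// /w ge_min lexx orbT.
  apply: (le_trans (nrmD _ _)); have := nrmM ((s - z) ** d) s; have := nrmM (s - z) d; have := nrmM (z ** d) (s - z); have := nrmM z d.
  rewrite (_ : nrm s = N) ?nrm_star// -/N; move: hb nz (nrm_ge0 (s - z)) (nrm_ge0 z); rewrite /C in wr.
  move: (nrm (s - z)) (nrm z) (nrm (z ** d)) (nrm (_ ** d)) (nrm (_ ** s)) (nrm (_ ** (s - z))) => p q o1 o2 o3 o4 p1 q1 p0 q0 l1 l2 l3 l4.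
  have qq : q <= N + 1 by lra.
  have h1 := le_trans l1 (ler_wpM2r N0 qq); have h2 := le_trans l2 (ler_wpM2r p0 h1).
  have h3 := le_trans l4 (ler_wpM2r N0 l3).
  have k0 : 0 <= 2 * N ^+ 2 + N by nra.
  by have := ler_wpM2r k0 (ltW p1); nra.
apply: nrm_le0; have : nrm (star (s ** d) ** (s ** d)) = 0 by rewrite starM starK -/s cmulA sds cmul0r nrm0.
by rewrite nrm_cstar nrm_cstar => /eqP; rewrite !expf_eq0 /= => /eqP ->.
Qed.

(** By simplicity multiples of a nonzero class dominate every cutdown. If cancellation fails for
    [x'], [x], [z], this forces [z = 0], so a nonzero [x0] between [x'] and [x] satisfies
    [x0 *+ 2 <= x0]. Then [x0] is the largest class, and almost unperforation puts it below every
    nonzero class. *)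
Lemma simple_dichotomy : almost_unperforated S -> simple_cstar B ->
  cancellative S \/ (forall a c : D, cpos a -> cpos c -> c <> 0 -> a ≾ c).
Proof.
move=> AU sB; have sD := simple_stab sB.
have full (c a : D) (e : R) : cpos c -> c <> 0 -> cpos a -> 0 < e -> exists K, cl (cut e a) ⊑ cl c *+ K.
  move=> pc c0 pa e0; apply: gen_ideal_cut => //.
  have [h|->//] := sD _ (gen_ideal_closed c).
  exfalso; have /(ideal_sandwich (gen_ideal_closed c)) : forall z w : D, gen_ideal c (z ** c ** w).
    by move=> z w r r0; exists [:: (z, w)]; rewrite big_seq1 subrr nrm0.
  by rewrite h.
have [|nc] := pselect (cancellative S); [by left|right].
move: nc => /existsNP[x' /existsNP[x /existsNP[z /not_implyP[wx /not_implyP[le nK]]]]].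
have [c pc zE] := cl_surj z; have [a pa xE] := cl_surj x; rewrite xE in wx.
have [e e0 xe] := wb_rep pa wx; pose x0 := cl (cut e a).
have pe := cpos_cut (ltW e0) pa.
have c0 : c = 0.
  apply: contrapT => c0; have [K hK] := full c a e pc c0 pa e0.
  by apply: nK; exists K; rewrite zE; exact: cule_trans xe hK.
have two : x0 *+ 2 ⊑ x0.
  apply: (cule_trans (culeMn 2 (cl_cut (ltW e0) pa))); rewrite -xE.
  by apply: (cule_trans le); rewrite zE c0 cl0 addr0.
have all k : x0 *+ k ⊑ x0.
  elim: k => [|k ih]; first by rewrite mulr0n; exact: cule0x.
  rewrite mulrSr; apply: (cule_trans (culeD ih (cule_refl _))); rewrite -mulr2n; exact: two.
have a0 : cut e a <> 0.
  move=> h; apply: nK; exists 0%N; rewrite mulr0n; apply: (cule_trans xe); rewrite h cl0; exact: cule_refl.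
move=> b d pb pd d0; apply: (@cuntz_trans _ _ (cut e a)).
  apply: cuntz_of_cuts => // r r0; have [K hK] := full _ _ _ pe a0 pb r0.
  by apply/cl_le => //; [exact: cpos_cut (ltW r0) _|exact: cule_trans hK (all K)].
have [K hK] := full _ _ _ pd d0 pa e0; apply/cl_le => //.
have := AU x0 (cl d) K; rewrite !cu_mulE; apply; exact: cule_trans (all _) hK.
Qed.

End TensorIdeal.

(** * The purely infinite case *)

Section Hereditary.
Context {R : realType} {D : cstarAlgType R}.
Implicit Types (a c e x y z : D).

(** Membership in the hereditary subalgebra of [c], in factorized form; equality is a separate case
    because [c] need not be of the form [c ** x ** c]. *)
Definition hered c' c := c' = c \/ exists x, c' = c ** x ** c.

Lemma hered_trans c'' c' c : hered c'' c' -> hered c' c -> hered c'' c.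
Proof.
case=> [->//|[x ->]] [->|[y ->]]; right; first by exists x.
by exists (y ** c ** x ** c ** y); rewrite !cmulA.
Qed.

(** Near orthogonality across [z] of the hereditary subalgebras of [c1] and [c2]. The bound is
    relative to the norms of [y1 ** c1] and [c2 ** y2], so it is inherited by smaller hereditary
    subalgebras. *)
Definition sep (eta : R) z c1 c2 := forall y1 y2, nrm (y1 ** c1 ** z ** (c2 ** y2)) <= eta * nrm (y1 ** c1) * nrm (c2 ** y2).

Lemma sep_hered eta z c1 c2 c1' c2' : hered c1' c1 -> hered c2' c2 -> sep eta z c1 c2 -> sep eta z c1' c2'.
Proof.
have left d1 d1' d2 : hered d1' d1 -> sep eta z d1 d2 -> sep eta z d1' d2.
  by case=> [->//|[x ->]] h y1 y2; rewrite !cmulA; have := h (y1 ** d1 ** x) y2; rewrite !cmulA.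
have right d1 d2' d2 : hered d2' d2 -> sep eta z d1 d2 -> sep eta z d1 d2'.
  by case=> [->//|[x ->]] h y1 y2; have := h y1 (x ** (d2 ** y2)); rewrite !cmulA.
by move=> h1 h2 /(left _ _ _ h1); exact: right.
Qed.

(** The cutdown is supported where [e] exceeds 1/2; there [rho] is the inverse of [e], whence the
    bound 2. *)
Lemma cut_factor e : cpos e -> exists chi rho, [/\ cut 2^-1 e = e ** chi ** e, cut 2^-1 e ** (rho ** e) = cut 2^-1 e,
  (e ** rho) ** cut 2^-1 e = cut 2^-1 e & nrm rho <= 2].
Proof.
move=> pe; have ee := cpos_sa pe; have h0 : (0 : R) <= 2^-1 by rewrite invr_ge0.
have [m mE] : exists m : R, m = 2^-1 by exists 2^-1.
rewrite -mE; have hm : m = 1 / 2 by rewrite mE; field.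
pose chi s : R := Num.max (s - m) 0 * (Num.max s (1 / 4))^-1 * (Num.max s (1 / 4))^-1.
pose rho s : R := Num.min (4 * s) (Num.max s m)^-1.
have x4 (s : R) : Num.max s (1 / 4) != 0 by rewrite gt_eqF// lt_max; apply/orP; right; lra.
have xm (s : R) : Num.max s m != 0 by rewrite gt_eqF// lt_max; apply/orP; right; lra.
have cc : continuous chi by rewrite /chi; cts.
have cr : continuous rho by rewrite /rho; cts.
have c0 : chi 0 = 0 by rewrite /chi max_r ?mul0r//; lra.
have r0 : rho 0 = 0.
  by rewrite /rho mulr0 max_r ?min_l ?invr_ge0//; lra.
have t0 : Num.max (0 - m) 0 = 0 by rewrite max_r//; lra.
have ct := @cont_cut R m.
exists (fc chi e), (fc rho e).
have chE (s : R) : s * chi s * s = Num.max (s - m) 0.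
  rewrite /chi; have [h|h] := leP (s - m) 0; first by rewrite !mul0r mulr0 mul0r.
  have s0 : s != 0 by rewrite gt_eqF//; lra.
  have -> : Num.max s (1 / 4) = s by rewrite max_l//; lra.
  by rewrite mulrA mulrCA divff// mulr1 divfK.
have roE (s : R) : Num.max (s - m) 0 * (rho s * s) = Num.max (s - m) 0.
  rewrite /rho; have [h|h] := leP (s - m) 0; first by rewrite !mul0r.
  have sm : m < s by lra.
  have s0 : 0 < s by lra.
  have -> : Num.max s m = s by rewrite max_l// ltW.
  by rewrite min_r ?mulVf ?mulr1 ?gt_eqF// -[s^-1]mul1r ler_pdivrMr//; nra.
have rb (s : R) : 0 <= s -> `|rho s| <= 2.
  move=> s0; have M0 : 0 < Num.max s m by rewrite lt_max; apply/orP; right; lra.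
  have i0 : 0 <= (Num.max s m)^-1 by rewrite invr_ge0 ltW.
  rewrite ger0_norm /rho; last by rewrite le_min i0 mulr_ge0.
  rewrite ge_min; apply/orP; right; rewrite -[X in X <= _]mul1r ler_pdivrMr//.
  by have : m <= Num.max s m; [rewrite le_max lexx orbT | lra].
have eE : fc (fun s => s) e = e by exact: fc_id.
clearbody chi rho; split.
- rewrite -{2 4}eE -!fcM ?c0 ?mulr0 ?mul0r//; try by cts.
  by congr fc; apply/funext => s; rewrite chE.
- rewrite -{3}eE /cut -!fcM ?r0 ?mulr0 ?mul0r//; try by cts.
  by congr fc; apply/funext => s; rewrite roE.
- rewrite -{1}eE /cut -!fcM ?r0 ?mulr0 ?mul0r//; try by cts.
  by congr fc; apply/funext => s; rewrite mulrC (mulrC s) roE.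
- apply: fc_le_pos => //; first exact/cpos_psd.
  by move=> s /andP[s0 _]; exact: rb.
Qed.

End Hereditary.

Lemma fc_compress (R : realType) (D : cstarAlgType R) (h : D) (f : R -> R) : star h = h -> continuous f -> f 0 = 0 ->
  fc (fun s => s * (1 - f s) ^+ 2) h = h - h ** fc f h - fc f h ** h + fc f h ** h ** fc f h.
Proof.
move=> hh cf f0; have -> : (fun s => s * (1 - f s) ^+ 2) = (fun s => (s - s * f s - f s * s) + f s * s * f s) by apply/funext => s; ring.
by rewrite fcD ?fcB ?fcM ?(fc_id hh) ?f0 ?mulr0 ?mul0r ?subr0 ?addr0//; cts.
Qed.

Section Pairs.
Context {R : realType} {B : cstarAlgType R} {S : stabilization B}.
Local Notation D := (stab S).
Hypothesis PI : forall a c : D, cpos a -> cpos c -> c <> 0 -> a ≾ c.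
Implicit Types (a c e x y z : D).

Fixpoint copies K a : D := if K is K'.+1 then dsum a (copies K' a) else 0.

Lemma copies_hom K : star_hom (copies K).
Proof.
elim: K => [|K ih]; first by split=> [w a b|a b|a] /=; rewrite ?scaler0 ?addr0 ?cmul0r ?star0.
split=> [w a b|a b|a] /=.
- by rewrite (star_hom_linear ih) dsum_linear.
- by rewrite (star_homM ih) dsumM.
- by rewrite (star_hom_star ih) dsum_star.
Qed.

Definition copy i a : D := iter i dr (dl a).

Lemma copy_hom i : star_hom (copy i).
Proof.
elim: i => [|i ih]; first exact: dl_hom.
split=> [w a b|a b|a]; rewrite /copy !iterS -/(copy i _).
- by rewrite (star_hom_linear ih) (star_hom_linear dr_hom).
- by rewrite (star_homM ih) (star_homM dr_hom).
- by rewrite (star_hom_star ih) (star_hom_star dr_hom).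
Qed.

Lemma copiesE K a : copies K a = \sum_(i < K) copy i a.
Proof.
elim: K => [|K ih]; rewrite ?big_ord0//= dsumE ih big_ord_recl; congr (_ + _).
by rewrite (big_morph dr (homD dr_hom) (hom0 dr_hom)).
Qed.

Lemma copy_nrm i a : nrm (copy i a) = nrm a.
Proof.
apply: (inj_isometric (copy_hom i)) => b.
have z c : cpos c -> c ≾ 0 -> c = 0.
  move=> pc /cuntzP h; apply: nrm_le0; apply/ler_addgt0Pr => r r0; rewrite add0r.
  by have [v] := h r r0; rewrite cmulr0 cmul0r subr0 => /ltW.
have sq (phi : D -> D) : star_hom phi -> (forall c, cpos c -> c ≾ phi c) -> forall c, phi c = 0 -> c = 0.
  move=> hphi h c c0; have := h _ (cpos_ss c); rewrite (star_homM hphi) c0 cmulr0 => /(z _ (cpos_ss c)) hc.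
  by apply/eqP; rewrite -nrm_eq0 -sqrf_eq0 -nrm_cstar hc nrm0.
elim: i => [|i ih] /=; first by apply: sq dl_hom _ _ => c pc; exact: (dl_cuntz pc).2.
by move=> /(sq _ dr_hom (fun c pc => (dr_cuntz pc).2)).
Qed.

(** Let [g] be [c1] normalized. The square of [c2] dominates [K] orthogonal copies of [g ** g],
    which yield elements [e i] in the hereditary subalgebra of [c2] whose sum has norm at most 5/4.
    So the elements [b i], in which [e i] is seen from [g] through [z], cannot all be large, and for
    some [i] the removal from [g] of the part where [b i] is large leaves [f i] of norm above 1/2.
    Cutdowns of [f i] and [e i] are then nearly orthogonal across [z]. *)
Lemma pair_separation c1 c2 z (eta : R) : cpos c1 -> c1 <> 0 -> cpos c2 -> c2 <> 0 -> 0 < eta ->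
  exists c1' c2', [/\ cpos c1' /\ c1' <> 0, cpos c2' /\ c2' <> 0, hered c1' c1, hered c2' c2 & sep eta z c1' c2'].
Proof.
move=> p1 n1 p2 n2 eta0; have s1 := cpos_sa p1; have s2 := cpos_sa p2.
have nc1 : 0 < nrm c1 by rewrite lt_def nrm_ge0 nrm_eq0 andbT; apply/eqP.
pose g := (nrm c1)^-1%:C *: c1; have pg : cpos g by apply: cposZ => //; rewrite invr_ge0 ltW.
have gg := cpos_sa pg.
have ng : nrm g = 1 by rewrite /g nrmZr ger0_norm ?invr_ge0 ?(ltW nc1)// mulVf ?gt_eqF.
have gE : g = (nrm c1)^-1%:C *: c1 by [].
clearbody g; have sq1 (h : D) : star h = h -> nrm h = 1 -> nrm (h ** h) = 1.
  by move=> hh h1; have := nrm_cstar h; rewrite hh h1 expr1n.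
have ng2 := sq1 _ gg ng; have pgg : cpos (g ** g) by exact: cpos_sq.
have ng4 := sq1 _ (cpos_sa pgg) ng2.
(* The final estimate is [2 * 2 * d0 * (5 / 4) = eta], with the factors 2 coming from [cut_factor]
   and 5/4 bounding the norm of [T]. *)
pose d0 := eta / 5; have d00 : 0 < d0 by rewrite divr_gt0.
pose d := d0 ^+ 2; have dp : 0 < d by rewrite exprn_gt0.
pose Z := nrm z ^+ 2; have Z0 : 0 <= Z by rewrite exprn_ge0 ?nrm_ge0.
have [K hK] : exists K : nat, 5 * Z / d < K%:R.
  by exists (Num.bound (5 * Z / d)); apply: archi_boundP; rewrite divr_ge0 ?(ltW dp)// mulr_ge0.
pose s := copies K (g ** g).
have ps : cpos s by have := star_hom_cpos (copies_hom K) pgg.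
have ns : nrm s <= 1 by rewrite -ng2; exact: hom_nrm (copies_hom K) _.
have n22 : c2 ** c2 <> 0.
  move=> h; apply: n2; apply/eqP; rewrite -nrm_eq0 -sqrf_eq0 -nrm_cstar s2 h nrm0//.
have /cuntzP := PI ps (cpos_sq s2) n22 => /(_ (1 / 4)) [|v hv]; first by lra.
pose T := v ** c2; have TT : T ** star T = v ** (c2 ** c2) ** star v by rewrite /T starM s2 !cmulA.
rewrite -TT in hv; have TE : T = v ** c2 by []; clearbody T.
have nT : nrm T ^+ 2 <= 5 / 4.
  by rewrite -nrm_cstar2; have := nrm_le_dist (T ** star T) s; rewrite nrm_distC; lra.
pose x (i : nat) := copy i g ** T; pose e i := star (x i) ** x i.
have cgs i : star (copy i g) = copy i g by rewrite -(star_hom_star (copy_hom i)) gg.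
have pe i : cpos (e i) by exact: cpos_ss.
have nx i : nrm (x i) <= nrm T by have := nrmM (copy i g) T; rewrite copy_nrm ng mul1r.
have ne i : (i < K)%N -> 3 / 4 <= nrm (e i).
  move=> iK; rewrite nrm_cstar -nrm_cstar2 /x starM cgs !cmulA -(cmulA _ T).
  have le : nrm (copy i g ** copy i (g ** g) ** copy i g) <= nrm (copy i g ** s ** copy i g).
    apply: cle_nrm; first by apply: cpos_sac => //; exact: (star_hom_cpos (copy_hom i) pgg).
    have := @cle_conj _ _ (copy i (g ** g)) s (copy i g); rewrite cgs; apply.
    rewrite /cle /s copiesE (bigD1 (Ordinal iK))//= addrAC subrr add0r.
    by apply: cpos_sum => j _; exact: (star_hom_cpos (copy_hom j) pgg).
  have E : nrm (copy i g ** copy i (g ** g) ** copy i g) = 1.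
    by rewrite -!(star_homM (copy_hom i)) copy_nrm -ng4 !cmulA.
  have := nrm_le_dist (copy i g ** s ** copy i g) (copy i g ** (T ** star T) ** copy i g).
  rewrite -cmulBl -cmulBr; have := nrmM (copy i g ** (s - T ** star T)) (copy i g); have := nrmM (copy i g) (s - T ** star T).
  rewrite !copy_nrm ng mulr1 mul1r.
  move=> l1 l2 l3; move: l3 le (le_trans l2 (le_trans l1 (ltW hv))); rewrite E.
  by move: (nrm _) (nrm _) (nrm _) => *; lra.
have nse : nrm (\sum_(i < K) e i) <= 5 / 4.
  have -> : \sum_(i < K) e i = star T ** s ** T.
    rewrite /s copiesE cmul_sumr cmul_suml; apply: eq_bigr => i _.
    by rewrite /e /x starM cgs (star_homM (copy_hom i)) !cmulA.
  have := nrmM (star T ** s) T; have := nrmM (star T) s; rewrite nrm_star; have := nrm_ge0 T.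
  by move: nT ns (nrm_ge0 s); move: (nrm T) (nrm s) (nrm (_ ** s)) (nrm (_ ** T)) => ? ? ? ? v1 v2 v3 v4 v5 v6; clear -v1 v2 v3 v4 v5 v6 PI; nra.
pose b i := g ** (z ** e i ** star z) ** g.
have pb i : cpos (b i) by apply: cpos_sac => //; exact: cpos_conj'.
pose mu (r : R) := Num.min (r * d^-1) 1; have cmu : continuous mu by rewrite /mu; cts.
have mu0 : mu 0 = 0 by rewrite /mu mul0r min_l.
have di0 : 0 < d^-1 by rewrite invr_gt0.
have mub (r : R) : 0 <= r -> 0 <= mu r <= 1 /\ mu r <= r * d^-1.
  by move=> r0; rewrite /mu le_min mulr_ge0 ?(ltW di0)// ler01 !ge_min !lexx orbT.
have mud (r : R) : 0 <= r -> r * (1 - mu r) ^+ 2 <= d.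
  move=> r0; rewrite /mu; have [h|h] := leP (r * d^-1) 1; last by rewrite subrr expr0n mulr0 ltW.
  have rd : r <= d by rewrite -[d]mul1r -ler_pdivrMr.
  have q0 : 0 <= r * d^-1 by rewrite mulr_ge0// ltW.
  have q1 : (1 - r * d^-1) ^+ 2 <= 1 by move: (r * d^-1) q0 h => *; nra.
  by have := sqr_ge0 (1 - r * d^-1); move: (_ ^+ 2) q1 => *; nra.
clearbody mu.
pose m i := fc mu (b i); have mm i : star (m i) = m i by apply: star_fc => //; exact: cpos_sa.
pose q i := g - g ** m i; have qs i : star (q i) = g - m i ** g by rewrite /q starB starM gg mm.
pose f i := q i ** star (q i); have pf i : cpos (f i) by exact: cpos_ss'.
have fE i : f i = g ** g - g ** (fc (fun r => 2 * mu r - mu r * mu r) (b i)) ** g.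
  have bs := cpos_sa (pb i).
  have -> : fc (fun r => 2 * mu r - mu r * mu r) (b i) = m i + m i - m i ** m i.
    have -> : (fun r => 2 * mu r - mu r * mu r) = (fun r => (mu r + mu r) - mu r * mu r) by apply/funext => r; ring.
    by rewrite fcB ?fcD ?fcM ?mu0 ?mul0r ?addr0//; cts.
  by rewrite /f qs /q !cmulBr !cmulBl !cmulDr !cmulDl !cmulA; zmod.
have c2m : continuous (fun r => 2 * mu r - mu r * mu r) by cts.
have m20 : 2 * mu 0 - mu 0 * mu 0 = 0 by rewrite mu0; ring.
have m2b (r : R) : 0 <= r -> 0 <= 2 * mu r - mu r * mu r <= 2 * d^-1 * r.
  by move=> r0; have [/andP[h1 h2] h3] := mub r r0; clear -h1 h2 h3 PI; apply/andP; split; nra.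
have fle i : f i =<= g ** g.
  rewrite /cle fE subKr; apply: cpos_sac => //; apply: cpos_fc => // r.
  by move=> /andP[r0 _]; have /andP[] := m2b r r0.
have ggle i : g ** g =<= f i + (2 * d^-1)%:C *: (g ** b i ** g).
  rewrite /cle fE; set F := fc _ _; suff : cpos (g ** ((2 * d^-1)%:C *: b i - F) ** g).
    by congr cpos; rewrite cmulBr cmulBl cscaleAr cscaleAl; zmod.
  apply: cpos_sac => //; rewrite -[X in _ *: X](fc_id (cpos_sa (pb i))) -fcZ ?(cpos_sa (pb i))//; last exact: cont_id.
  apply: cle_fc => //; [by cts|by rewrite mulr0|].
  by move=> r /andP[r0 _]; have /andP[] := m2b r r0.
(* Averaging: if all [f i] had norm at most 1/2, summing [ggle] would give
   [K <= K / 2 + (5 / 2) * Z / d], against the choice of [K]. *)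
have [i [iK fi]] : exists i, (i < K)%N /\ 2^-1 < nrm (f i).
  apply: contrapT => H.
  have fi i : (i < K)%N -> nrm (f i) <= 2^-1 by move=> iK; rewrite leNgt; apply/negP => h; apply: H; exists i.
  have cs (r : seq 'I_K) (F G : 'I_K -> D) : (forall i, F i =<= G i) -> \sum_(i <- r) F i =<= \sum_(i <- r) G i.
    by move=> h; elim/big_rec2: _ => [|j u w _]; [exact: cle_refl|exact: cleD].
  have := cs (index_enum 'I_K) _ _ (fun i => ggle i).
  move=> /(cle_nrm (cpos_sum _ (fun _ _ => pgg))); rewrite sumr_const card_ord -scaleRn nrmZr ng2 mulr1 ger0_norm//.
  rewrite big_split /= -scaler_sumr => h; have := le_trans h (nrmD _ _).
  have h1 : nrm (\sum_(i < K) f i) <= K%:R * 2^-1.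
    apply: (le_trans (nrm_sum _ _ _)); apply: (@le_trans _ _ (\sum_(i < K) 2^-1)); first by apply: ler_sum => j _; exact: fi.
    by rewrite sumr_const card_ord mulr_natl.
  have h2 : nrm (\sum_(i < K) g ** b i ** g) <= Z * (5 / 4).
    have -> : \sum_(i < K) g ** b i ** g = (g ** g) ** (z ** (\sum_(i < K) e i) ** star z) ** (g ** g).
      by rewrite !cmul_sumr !cmul_suml !cmul_sumr !cmul_suml; apply: eq_bigr => j _; rewrite /b !cmulA.
    set E := \sum_(i < K) e i in nse *; have := nrmM ((g ** g) ** (z ** E ** star z)) (g ** g); have := nrmM (g ** g) (z ** E ** star z).
    have := nrmM (z ** E) (star z); have := nrmM z E; rewrite nrm_star ng2 /Z; have := nrm_ge0 z.
    by move: nse (nrm_ge0 E); move: (nrm E) (nrm z) (nrm (z ** E)) (nrm (z ** _ ** _)) (nrm (_ ** (z ** _ ** _))) (nrm _) => ? ? ? ? ? ? v1 v2 v3 v4 v5 v6 v7; clear -v1 v2 v3 v4 v5 v6 v7 PI; nra.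
  rewrite nrmZr ger0_norm ?mulr_ge0 ?(ltW di0)// => h3.
  have : K%:R <= K%:R * 2^-1 + 2 * d^-1 * (Z * (5 / 4)).
    by apply: (le_trans h3); rewrite lerD// ler_wpM2l// mulr_ge0// ltW.
  have E : 5 * Z / d = 2 * (2 * d^-1 * (Z * (5 / 4))) by field; rewrite gt_eqF.
  move: hK; rewrite E; generalize (K%:R : R) (2 * d^-1 * (Z * (5 / 4)) : R) => k y k1 k2.
  by clear -k1 k2; lra.
have pe' := pe i; have h0 : (0 : R) <= 2^-1 by rewrite invr_ge0.
have [chi1 [rho1 [F1 F2 F3 F4]]] := cut_factor (pf i).
have [chi2 [rho2 [E1 E2 E3 E4]]] := cut_factor pe'.
exists (cut 2^-1 (f i)), (cut 2^-1 (e i)); split.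
- split; first exact: cpos_cut h0 (pf i).
  by move=> z0; rewrite ltNge (nrm_cut0 h0 (pf i) z0) in fi.
- split; first exact: cpos_cut h0 pe'.
  by move=> z0; have := nrm_cut0 h0 pe' z0; have := ne i iK; lra.
- right; pose w := star (q i) - m i ** star (q i).
  have fw : f i = g ** w by rewrite /f /w /q cmulBl cmulBr cmulA.
  have fw' : f i = star w ** g by rewrite -(cpos_sa (pf i)) fw starM gg.
  exists (((nrm c1)^-1%:C * (nrm c1)^-1%:C) *: (w ** chi1 ** star w)).
  by rewrite F1 {1}fw fw' gE !cscaleAl !cscaleAr !cscaleAl scalerA !cmulA.
- right; pose w := star v ** copy i g ** copy i g ** T.
  have ew : e i = c2 ** w by rewrite /e /x starM cgs TE starM s2 /w TE !cmulA.
  have ew' : e i = star w ** c2 by rewrite -(cpos_sa pe') ew starM s2.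
  by exists (w ** chi2 ** star w); rewrite E1 {1}ew ew' !cmulA.
move=> y1 y2.
have nxq : nrm (star (q i) ** z ** star (x i)) <= d0.
  apply: le_of_sq; first exact: ltW.
  rewrite -nrm_cstar2; have -> : star (q i) ** z ** star (x i) ** star (star (q i) ** z ** star (x i)) = fc (fun r => r * (1 - mu r) ^+ 2) (b i).
    transitivity (star (q i) ** (z ** e i ** star z) ** q i); first by rewrite /e !starM !starK !cmulA.
    have bs := cpos_sa (pb i); rewrite qs /q; transitivity (b i - b i ** m i - m i ** b i + m i ** b i ** m i).
      by rewrite /b !cmulBl !cmulBr !cmulA; zmod.
    by rewrite fc_compress.
  apply: fc_le_pos; [exact/cpos_psd|by cts|by rewrite mul0r|].
  move=> r /andP[r0 _]; rewrite ger0_norm; first exact: mud.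
  by rewrite mulr_ge0 ?sqr_ge0.
have nq : nrm (q i) <= 1.
  apply: le_of_sq => //; rewrite -nrm_cstar2 expr1n -ng2; exact: cle_nrm (pf i) (fle i).
have nT1 : nrm T <= 5 / 4 by have := nrm_ge0 T; move: nT; move: (nrm T) => ? v1 v2; clear -v1 v2 PI; nra.
have -> : y1 ** cut 2^-1 (f i) ** z ** (cut 2^-1 (e i) ** y2) =
    (y1 ** cut 2^-1 (f i)) ** (rho1 ** (q i ** (star (q i) ** z ** star (x i)) ** x i) ** rho2) ** (cut 2^-1 (e i) ** y2).
  by rewrite -{1}F2 -{1}E3 /f /e !cmulA.
set Y1 := y1 ** _; set Y2 := _ ** y2; set W := star (q i) ** z ** star (x i) in nxq *.
have w1 : nrm (q i ** W ** x i) <= d0 * (5 / 4).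
  have := nrmM (q i ** W) (x i); have := nrmM (q i) W; have := nx i; have := nrm_ge0 (x i); have := nrm_ge0 W; have := nrm_ge0 (q i).
  move: nq nxq nT1; move: (nrm (q i)) (nrm W) (nrm T) (nrm (x i)) (nrm (q i ** W)) (nrm _) => q1 W1 T1 x1 qw qwx l1 l2 l3 g1 g2 g3 l4 l5 l6.
  have h1 : qw <= d0 by apply: (le_trans l5); apply: (le_trans _ l2); rewrite -[leRHS]mul1r; exact: ler_wpM2r.
  exact: (le_trans l6 (le_trans (ler_wpM2r g3 h1) (ler_wpM2l (ltW d00) (le_trans l4 l3)))).
have w2 : nrm (rho1 ** (q i ** W ** x i) ** rho2) <= eta.
  have := nrmM (rho1 ** (q i ** W ** x i)) rho2; have := nrmM rho1 (q i ** W ** x i); have := nrm_ge0 (q i ** W ** x i); have := nrm_ge0 rho1; have := nrm_ge0 rho2.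
  have etaE : eta = 2 * (2 * (d0 * (5 / 4))) by rewrite /d0; field.
  move: F4 E4 w1; move: (nrm rho1) (nrm rho2) (nrm (q i ** W ** x i)) (nrm (rho1 ** _)) (nrm _) => r1 r2 p1' p2' p3' l1 l2 l3 g1 g2 g3 l4 l5.
  have h1 : p2' <= 2 * p1' by apply: (le_trans l4); exact: ler_wpM2r.
  have h0' : 0 <= 2 * p1' by rewrite mulr_ge0.
  rewrite etaE; apply: (le_trans l5); apply: (le_trans (ler_wpM2r g1 h1)).
  by rewrite mulrC; apply: ler_pM => //; rewrite ler_wpM2l.
have := nrmM (Y1 ** (rho1 ** (q i ** W ** x i) ** rho2)) Y2; have := nrmM Y1 (rho1 ** (q i ** W ** x i) ** rho2).
have := nrm_ge0 Y1; have := nrm_ge0 Y2; move: w2.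
move=> l1 g1 g2 l2 l3; apply: (le_trans l3); apply: ler_wpM2r => //; apply: (le_trans l2); rewrite mulrC; exact: ler_wpM2r.
Qed.

End Pairs.

Lemma cuntz0 (R : realType) (D : cstarAlgType R) (c : D) : c ≾ 0 -> c = 0.
Proof.
move=> /cuntzP h; apply: nrm_le0; apply/ler_addgt0Pr => r r0; rewrite add0r.
by have [v] := h r r0; rewrite cmulr0 cmul0r subr0 => /ltW.
Qed.

Section PurelyInfinite.
Context {R : realType} {X : metricType R} {cX : compact [set: X]} {A : cstarAlgType R} {S : stabilization A}.
Local Notation D := (stab S).
Local Notation SX := (ctsStab cX S).
Hypothesis PI : forall a c : D, cpos a -> cpos c -> c <> 0 -> a ≾ c.

(** The triples are treated one by one; shrinking an element further preserves the separations
    already obtained ([sep_hered]). *)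
Lemma separation (I : eqType) (act : pred I) (tr : seq (I * I * D)) (eta : R) (c : I -> D) : 0 < eta ->
  (forall i, act i -> cpos (c i) /\ c i <> 0) -> exists c', (forall i, act i -> [/\ cpos (c' i), c' i <> 0 & hered (c' i) (c i)]) /\
  forall i j z, (i, j, z) \in tr -> act i -> act j -> i != j -> sep eta z (c' i) (c' j).
Proof.
move=> eta0; elim: tr c => [|[[i j] z] tr ih] c hc.
  by exists c; split=> [i /hc[h1 h2]|//]; split=> //; left.
have [/and3P[ai aj ij]|nact] := boolP [&& act i, act j & i != j]; last first.
  have [c' [h1 h2]] := ih c hc; exists c'; split=> // k l w; rewrite inE => /orP[/eqP[-> -> _]|]; last exact: h2.
  by move=> ak al kl; move: nact; rewrite ak al kl.
have [pi ni] := hc i ai; have [pj nj] := hc j aj.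
have [ci [cj [[pi' ni'] [pj' nj'] hi hj hs]]] := pair_separation PI z pi ni pj nj eta0.
pose c1 k := if k == i then ci else if k == j then cj else c k.
have h1 k : act k -> [/\ cpos (c1 k), c1 k <> 0 & hered (c1 k) (c k)].
  rewrite /c1; have [->|ki] := eqVneq k i; first by [].
  by have [->|kj] := eqVneq k j; [|move=> /hc[? ?]; split=> //; left].
have [c' [h2 h3]] := ih c1 (fun k ak => let: And3 a b _ := h1 k ak in conj a b).
exists c'; split=> [k ak|k l w].
  by have [? ? u] := h2 k ak; split=> //; have [_ _ u'] := h1 k ak; exact: hered_trans u u'.
rewrite inE => /orP[/eqP[-> -> ->]|]; last exact: h3.
move=> _ _ _; have [_ _ u] := h2 i ai; have [_ _ u'] := h2 j aj.
by apply: sep_hered u u' _; rewrite /c1 eqxx (eq_sym j) (negbTE ij) eqxx.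
Qed.

(** The witness at a centre is a multiple of some [c' i] in a small hereditary subalgebra. A cross
    term of the glued witness contains [ll x] in the middle, so the [c' i] are separated across the
    values of [ll] on a finite net; continuity of [ll] covers the other points. *)
Lemma pi_comparison (F G : stab SX) : cpos F -> cpos G -> ple (cl F) (cl G) -> F ≾ G.
Proof.
move=> pF pG FG; apply: cuntz_lim => e e0.
pose ff := cts_ev (F : cts_alg cX D); pose gg := cts_ev (G : cts_alg cX D).
have pf x : cpos (ff x) := ev_cpos x pF; have pg x : cpos (gg x) := ev_cpos x pG.
(* The diagonal terms contribute [4 * r] and the cross terms [2 * r]. *)
have [r r0 re] : exists2 r : R, 0 < r & 6 * r < e by exists (e / 7); lra.
have [d d0 hd] := @ple_unif _ _ cX _ _ F G 1 1 r pF pG FG r0.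
pose L := fc (kap d) G; pose ll := cts_ev (L : cts_alg cX D).
have ck := @cont_kap R d; have k0 := @kap0 R d; have sG := cpos_sa pG.
have llE x : ll x = fc (kap d) (gg x) by exact: ev_fc.
have LG : L ≾ G by apply: fc_cuntz => // s _; have /andP[] := @kap01 R d s.
pose N := nrm F + r + 1; have N0 : 0 < N by rewrite /N; have := nrm_ge0 F; lra.
have NN : 0 < N ^+ 2 by rewrite exprn_gt0.
have [d1 d10 h1] := ev_unif (F : cts_alg cX D) r0.
have [d2 d20 h2] := ev_unif (L : cts_alg cX D) (divr_gt0 r0 NN).
have dm0 : 0 < Num.min d1 d2 by rewrite lt_min d10.
have [n [p [h [ch hh0 hh1 hp]]]] := pou cX dm0.
pose C := N ^+ 2 * (n * n).+1%:R; have C0 : 0 < C by rewrite mulr_gt0.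
pose w := r / C; have w0 : 0 < w by rewrite divr_gt0.
have [d3 d30 h3] := ev_unif (L : cts_alg cX D) w0.
have [m [q hq]] := finite_net cX d30.
(* At a centre where the cutdown of [ff] is 0 the witness is 0; there [gg] may vanish, so no
   separation is asked for. *)
pose act i := cut r (ff (p i)) != 0.
have hc i : act i -> cpos (cut d (gg (p i))) /\ cut d (gg (p i)) <> 0.
  move=> ai; split; first exact: cpos_cut (ltW d0) _.
  move=> c0; move/eqP: ai; apply; apply: cuntz0; rewrite -c0.
  by apply/cl_le; [exact: cpos_cut (ltW r0) _|exact: cpos_cut (ltW d0) _|exact: hd].
pose tr := [seq (ij, ll (q l)) | ij <- enum {: 'I_n * 'I_n}, l <- enum 'I_m].
have [c' [h4 h5]] := separation tr w0 hc.
have /choice[y hy] i : exists y : D, [/\ nrm (cut r (ff (p i)) - y ** star y) <= r,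
    act i -> exists v, y = v ** c' i & ~~ act i -> y = 0].
  have [ai|ai] := boolP (act i); last first.
    by exists 0; split=> //; move: ai; rewrite negbK => /eqP ->; rewrite cmul0r subr0 nrm0 ltW.
  have [pc nc _] := h4 i ai; have sc := cpos_sa pc.
  have ncc : c' i ** c' i <> 0.
    by move=> z0; apply: nc; apply/eqP; rewrite -nrm_eq0 -sqrf_eq0 -nrm_cstar sc z0 nrm0.
  have /cuntzP/(_ _ r0)[v hv] := PI (cpos_cut (ltW r0) (pf (p i))) (cpos_sq sc) ncc.
  by exists (v ** c' i); split=> // [|_]; [move/ltW: hv; rewrite starM sc !cmulA|exists v].
have yN i : nrm (y i) <= N.
  have [yb _ _] := hy i; have := nrm_le_dist (y i ** star (y i)) (cut r (ff (p i))); rewrite nrm_distC nrm_cstar2.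
  have := cle_nrm (cpos_cut (ltW r0) (pf (p i))) (_ : _ =<= ff (p i)); have fc0 := cut_le (lexx 0) (ltW r0) (pf (p i)).
  rewrite (cut0 (pf (p i))) in fc0 => /(_ fc0); have := nrm_ev (F : cts_alg cX D) (p i); rewrite -/(ff _) /N.
  have := nrm_ge0 (y i); move: yb; move: (nrm (y i)) (nrm F) (nrm (ff _)) (nrm _) (nrm _) => *; nra.
have yL i : y i ** ll (p i) = y i.
  have [_ ya yn] := hy i; have [ai|ai] := boolP (act i); last by rewrite yn// cmul0r.
  have [v ->] := ya ai; rewrite -cmulA; congr (_ ** _).
  have cL : cut d (gg (p i)) ** ll (p i) = cut d (gg (p i)).
    rewrite llE; apply: fc_absorb => //; [exact: cont_cut|exact: cut_00 (ltW d0)|].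
    move=> s _; have [sd|sd] := leP (s - d) 0; first by rewrite mul0r.
    by rewrite kap1 ?mulr1//; lra.
  by have [_ _ [->//|[x ->]]] := h4 i ai; rewrite -[LHS]cmulA cL.
have cs i : continuous (fun x => Num.sqrt (h i x)).
  by move=> x; apply: (continuous_comp (ch i x)); exact: sqrt_continuous.
pose Z : cts_alg cX D := \sum_i fmul (cs i) (fcst (y i)).
have ZE x : cts_ev Z x = \sum_i (Num.sqrt (h i x))%:C *: y i by rewrite /Z ev_sum.
exists ((Z : stab SX) ** L ** star (Z : stab SX)); last exact: cuntz_trans (cuntz_conj _ _) LG.
apply: le_lt_trans re; apply: nrm_cts_le => [|x]; first by rewrite mulr_ge0// ltW.
change (nrm (ff x - cts_ev Z x ** ll x ** star (cts_ev Z x)) <= 6 * r).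
pose T i j := (Num.sqrt (h i x) * Num.sqrt (h j x))%:C *: (y i ** ll x ** star (y j)).
have -> : cts_ev Z x ** ll x ** star (cts_ev Z x) = \sum_i \sum_j T i j.
  rewrite ZE star_sum !cmul_suml; apply: eq_bigr => i _; rewrite cmul_sumr; apply: eq_bigr => j _.
  by rewrite starZr cscaleAr !cscaleAl scalerA /T rmorphM mulrC.
have -> : \sum_i \sum_j T i j = \sum_i (h i x)%:C *: (y i ** ll x ** star (y i)) + \sum_i \sum_(j | j != i) T i j.
  by rewrite -big_split; apply: eq_bigr => i _; rewrite (bigD1 i)//= {1}/T -expr2 sqr_sqrtr.
have diag : nrm (\sum_i (h i x)%:C *: (y i ** ll x ** star (y i)) - ff x) <= 4 * r.
  apply: convex_dist => // i hi; have := hp i x hi; rewrite lt_min => /andP[/h1 u1 /h2 u2].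
  have [u3 _ _] := hy i; have u4 := cut_dist (ltW r0) (pf (p i)).
  have -> : y i ** ll x ** star (y i) - ff x = - (y i ** (ll (p i) - ll x) ** star (y i)) - (cut r (ff (p i)) - y i ** star (y i))
      - (ff (p i) - cut r (ff (p i))) + (ff (p i) - ff x).
    by rewrite cmulBr yL cmulBl; zmod.
  rewrite (le_trans (nrmD _ _))// (le_trans (lerD (nrmB _ _) (lexx _)))//.
  rewrite (le_trans (lerD (lerD (nrmB _ _) (lexx _)) (lexx _)))// nrmN.
  have u5 : nrm (y i ** (ll (p i) - ll x) ** star (y i)) <= r.
    have := nrmM (y i ** (ll (p i) - ll x)) (star (y i)); have := nrmM (y i) (ll (p i) - ll x); rewrite nrm_star.
    have {}u2 : nrm (ll (p i) - ll x) < r / N ^+ 2 by [].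
    move: u2; rewrite ltr_pdivlMr//; have := yN i; have := nrm_ge0 (y i); have := nrm_ge0 (ll (p i) - ll x).
    move=> l1 l2 l3 l4 l5 l6; apply: (le_trans l6); apply: (le_trans (ler_wpM2r l2 l5)); rewrite mulrAC.
    by apply: (le_trans (ler_wpM2r l1 (ler_pM l2 l2 l3 l3))); rewrite mulrC -expr2 ltW.
  by move: u1 u3 u4 u5; rewrite -/(ff (p i)) -/(ff x); move: (nrm _) (nrm _) (nrm _) (nrm _) => *; lra.
have off i j : j != i -> nrm (T i j) <= 2 * r / (n * n).+1%:R.
  move=> ji; have hle k : 0 <= Num.sqrt (h k x) <= 1.
    rewrite sqrtr_ge0 -sqrtr1 ler_sqrt// -(hh1 x) (bigD1 k)//= lerDl; exact: sumr_ge0.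
  have [/andP[i0 i1] /andP[j0 j1]] := (hle i, hle j).
  rewrite /T nrmZr ger0_norm ?mulr_ge0//; apply: (@le_trans _ _ (1 * nrm (y i ** ll x ** star (y j)))).
    by apply: ler_wpM2r; [exact: nrm_ge0|exact: mulr_ile1].
  rewrite mul1r; have B0 : 0 <= 2 * r / (n * n).+1%:R by rewrite divr_ge0// mulr_ge0// ltW.
  have [ai|ai] := boolP (act i); last by have [_ _ ->] := hy i; rewrite // !cmul0r nrm0.
  have [aj|aj] := boolP (act j); last by have [_ _ ->] := hy j; rewrite // star0 cmulr0 nrm0.
  have [l /h3 hl] := hq x.
  have -> : y i ** ll x ** star (y j) = y i ** ll (q l) ** star (y j) - y i ** (ll (q l) - ll x) ** star (y j).
    by rewrite cmulBr cmulBl; zmod.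
  have s1 : nrm (y i ** ll (q l) ** star (y j)) <= w * nrm (y i) * nrm (y j).
    have [_ /(_ ai)[v yi] _] := hy i; have [_ /(_ aj)[u yj] _] := hy j.
    have [pj _ _] := h4 j aj; have sj := cpos_sa pj.
    have hs : sep w (ll (q l)) (c' i) (c' j).
      apply: h5 => //; last by rewrite eq_sym.
      by apply: allpairs_f; rewrite mem_enum.
    have := hs v (star u); rewrite -yi -{1 2}sj -starM -yj nrm_star//.
  have s2 : nrm (y i ** (ll (q l) - ll x) ** star (y j)) <= w * nrm (y i) * nrm (y j).
    have := nrmM (y i ** (ll (q l) - ll x)) (star (y j)); have := nrmM (y i) (ll (q l) - ll x); rewrite nrm_star.
    have {hl} : nrm (ll (q l) - ll x) < w by []; have := nrm_ge0 (y i); have := nrm_ge0 (y j).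
    move=> l1 l2 l3 l4 l5; apply: (le_trans l5); apply: ler_wpM2r => //; apply: (le_trans l4); rewrite mulrC.
    by apply: ler_wpM2r => //; exact: ltW.
  have s3 : w * nrm (y i) * nrm (y j) <= r / (n * n).+1%:R.
    have -> : r / (n * n).+1%:R = w * (N * N).
      rewrite /w /C; set k := (X in N ^+ 2 * X); have kp : 0 < k by [].
      by change (r / k = r / (N ^+ 2 * k) * (N * N)); clearbody k; field; rewrite !gt_eqF.
    rewrite -mulrA ler_pM2l//; apply: ler_pM; rewrite ?nrm_ge0//; exact: yN.
  rewrite (le_trans (nrmB _ _))// (_ : 2 * r / _ = r / (n * n).+1%:R + r / (n * n).+1%:R); last by field.
  by apply: lerD; [exact: le_trans s1 s3|exact: le_trans s2 s3].
have offs : nrm (\sum_i \sum_(j | j != i) T i j) <= 2 * r.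
  pose t := 2 * r / (n * n).+1%:R; have t0 : 0 <= t by rewrite divr_ge0// mulr_ge0// ltW.
  apply: (@le_trans _ _ (\sum_(i < n) \sum_(j < n) t)).
    apply: (le_trans (nrm_sum _ _ _)); apply: ler_sum => i _; apply: (le_trans (nrm_sum _ _ _)).
    rewrite [leRHS](bigID (fun j => j != i))/=; apply: ler_wpDr; first exact: sumr_ge0.
    by apply: ler_sum => j; exact: off.
  have -> : \sum_(i < n) \sum_(j < n) t = (n * n)%:R * t by rewrite !sumr_const !card_ord -mulrnA (mulr_natl _ (n * n)).
  by rewrite /t mulrA ler_pdivrMr// mulrC ler_wpM2l ?mulr_ge0 ?(ltW r0)// ler_nat.
rewrite opprD addrA (le_trans (nrmB _ _))// nrm_distC; move: diag offs; move: (nrm _) (nrm _) => *; lra.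
Qed.

Lemma pi_pure : almost_unperforated S -> almost_unperforated SX /\ almost_divisible SX.
Proof.
move=> AU; have cmp (x y : CuM SX) : ple x y -> x ⊑ y.
  have [F pF ->] := cl_surj x; have [G pG ->] := cl_surj y => h.
  by apply/cl_le => //; exact: pi_comparison.
split=> [x y k /ple_le h|].
  by apply: cmp => p; have := h p; rewrite !cu_mulE !evMn; exact: AU.
(* The class serves as its own divisor: at a point where [F] is nonzero its class is the largest
   one, so all multiples are below it. *)
apply: AD_of_cut => F e n pF e0; exists (cl F); split; last first.
  apply: (cule_trans (cl_cut (ltW e0) pF)); exact: (@culeMnl _ _ _ 1 n.+1).
apply: cmp => p; rewrite evMn ev_cl//.
have pf := ev_cpos p pF; have [z|nz] := pselect (cts_ev (F : cts_alg cX D) p = 0).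
  by rewrite z cl0 mul0rn; exact: cule_refl.
have [a pa ->] := cl_surj (cl (cts_ev (F : cts_alg cX D) p) *+ n : CuM S).
by apply/cl_le => //; exact: PI.
Qed.

End PurelyInfinite.

(** * Quotient algebras *)

Section IdealApproximation.
Context {R : realType} {A : cstarAlgType R} {I : set A} (hI : closed_ideal I).
Implicit Types (a b c h w x y : A).

Lemma ideal_fc (f : R -> R) h : star h = h -> continuous f -> f 0 = 0 -> I h -> I (fc f h).
Proof.
move=> hh cf f0 Ih; apply/(closed_nrm _).1 => [|r r0]; first exact: ideal_closed hI.
have [q [q0 _ hq]] := fc_approx hh cf f0 (divr_gt0 r0 (ltr0n R 2)) (lexx _).
exists (hp q h); last by rewrite nrm_distC; apply: le_lt_trans hq _; lra.
have [p ->] : exists p, q = 'X * p.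
  have : root q 0 by apply/rootP.
  by move=> /factor_theorem[p ->]; exists p; rewrite subr0 mulrC.
elim/poly_ind: p => [|p c ih]; first by rewrite mulr0 hp0; exact: ideal0.
have -> : 'X * (p * 'X + c%:P) = ('X * p) * 'X + c *: 'X by rewrite mulrDr mulrA -[c *: 'X]mul_polyC [_%:P * _]mulrC.
rewrite hpD hpM ?hornerM ?hornerX ?mul0r// hpZ hpX; apply: idealD => //; last exact: idealZ.
exact: Defs.idealMr.
Qed.

(** [k] is the approximate unit function [au m] at [star b ** b], which lies in [I] by [ideal_fc].
    The last clause says that [1 - k] is contractive, as [qn_cstar] requires. *)
Lemma approx_unit b (r : R) : 0 < r -> I (star b ** b) -> exists k, [/\ I k, star k = k, nrm (b - b ** k) < r &
  forall w, nrm (w - w ** k) <= nrm w].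
Proof.
move=> r0 Ib; pose E := star b ** b; have pE : cpos E := cpos_ss b; have EE := cpos_sa pE.
pose m := r ^+ 2 / 2; have m0 : 0 < m by rewrite divr_gt0// exprn_gt0.
have ca := cont_au m0; have a0 := au0 m; have am := fun s => au_itv s m0.
have amb (s : R) : 0 <= s -> s * (1 - au m s) ^+ 2 <= m.
  move=> s0; rewrite auE max_l//; have sm : 0 < s + m by rewrite ltr_wpDl.
  have -> : 1 - s / (s + m) = m / (s + m) by field; rewrite gt_eqF.
  rewrite expr_div_n mulrA ler_pdivrMr ?exprn_gt0//; nra.
move: (au m) ca a0 am amb => f cf f0 f01 fm.
pose k := fc f E; have kk : star k = k by exact: star_fc.
exists k; split=> //; first exact: ideal_fc.
  have : nrm (b - b ** k) ^+ 2 <= m.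
    rewrite -nrm_cstar starB starM kk.
    have -> : (star b - k ** star b) ** (b - b ** k) = fc (fun s => s * (1 - f s) ^+ 2) E.
      have -> : (fun s => s * (1 - f s) ^+ 2) = (fun s => (s - s * f s - f s * s) + f s * s * f s) by apply/funext => s; ring.
      transitivity (E - E ** k - k ** E + k ** E ** k); first by rewrite /E !cmulBr !cmulBl !cmulA; zmod.
      by rewrite fcD ?fcB ?fcM ?(fc_id EE) ?f0 ?mulr0 ?mul0r ?subr0 ?addr0//; cts.
    apply: fc_le_pos; [exact/cpos_psd|by cts|by rewrite mul0r|].
    by move=> s /andP[s0 _]; rewrite ger0_norm ?fm// mulr_ge0 ?sqr_ge0.
  by have := nrm_ge0 (b - b ** k); rewrite /m; move: (nrm _) => *; nra.
move=> w; apply: le_of_sq; first exact: nrm_ge0.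
rewrite -!nrm_cstar2 starB starM kk; apply: cle_nrm.
  have -> : (w - w ** k) ** (star w - k ** star w) = (w - w ** k) ** star (w - w ** k) by rewrite starB starM kk.
  exact: cpos_ss'.
have -> : (w - w ** k) ** (star w - k ** star w) = w ** star w - w ** fc (fun s => 2 * f s - f s * f s) E ** star w.
  have -> : (fun s => 2 * f s - f s * f s) = (fun s => f s + f s - f s * f s) by apply/funext => s; ring.
  rewrite fcB ?fcD ?fcM ?f0 ?mul0r ?addr0//; try by cts.
  by rewrite -/k !cmulBr !cmulBl !cmulDr !cmulDl !cmulA; zmod.
rewrite /cle subKr; apply: cpos_conj'; apply: cpos_fc => //; [by cts|by rewrite f0; ring|].
by move=> s _; have /andP[] := f01 s; move: (f s) => *; nra.
Qed.

(** [star a] is the limit of [star a ** k] with [k] in [I]. *)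
Lemma ideal_star a : I a -> I (star a).
Proof.
move=> Ia; apply/(closed_nrm _).1 => [|r r0]; first exact: ideal_closed hI.
have [|k [Ik _ hk _]] := approx_unit (b := star a) r0; first by rewrite starK; exact: Defs.idealMr.
by exists (star a ** k) => //; exact: Defs.idealMl.
Qed.

Definition qn x : R := inf [set nrm (x - b) | b in I].

Lemma qn_has_inf x : has_inf [set nrm (x - b) | b in I].
Proof.
split; first by exists (nrm (x - 0)), 0 => //; exact: ideal0.
by exists 0 => _ [b _ <-]; exact: nrm_ge0.
Qed.

Lemma qn_le x b : I b -> qn x <= nrm (x - b).
Proof. by move=> Ib; apply: ge_inf; [exact: (qn_has_inf x).2|exists b]. Qed.

Lemma qn_glb x (r : R) : (forall b, I b -> r <= nrm (x - b)) -> r <= qn x.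
Proof. by move=> h; apply: lb_le_inf; [exact: (qn_has_inf x).1|move=> _ [b Ib <-]; exact: h]. Qed.

Lemma qn_lt x (r : R) : 0 < r -> exists2 b, I b & nrm (x - b) < qn x + r.
Proof. by move=> r0; have [_ [b Ib <-] h] := inf_adherent r0 (qn_has_inf x); exists b. Qed.

Lemma qn_ge0 x : 0 <= qn x.
Proof. by apply: qn_glb => b _; exact: nrm_ge0. Qed.

Lemma qn_eq x y : I (x - y) -> qn x = qn y.
Proof.
have le u v : I (u - v) -> qn u <= qn v.
  move=> Iuv; apply: qn_glb => b Ib; have -> : v - b = u - (u - v + b) by zmod.
  by apply: qn_le; exact: idealD.
move=> h; apply/eqP; rewrite eq_le !le//.
have -> : y - x = 0 - (x - y) by zmod.
exact: idealB (ideal0 hI) h.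
Qed.

Lemma qnD x y : qn (x + y) <= qn x + qn y.
Proof.
apply/ler_addgt0Pr => r r0; have r2 : 0 < r / 2 by rewrite divr_gt0.
have [b Ib hb] := qn_lt x r2; have [c Ic hc] := qn_lt y r2.
apply: (le_trans (qn_le _ (idealD hI Ib Ic))).
have -> : x + y - (b + c) = (x - b) + (y - c) by zmod.
by apply: (le_trans (nrmD _ _)); move: hb hc; move: (nrm _) (nrm _) => *; lra.
Qed.

Lemma qnZ (z : R[i]) x : qn (z *: x) = complex.Re `|z| * qn x.
Proof.
have z0 (w : R[i]) : 0 <= complex.Re `|w| by rewrite -lecR RRe_real ?normr_real ?normr_ge0.
have le (w : R[i]) y : qn (w *: y) <= complex.Re `|w| * qn y.
  apply/ler_addgt0Pr => r r0; have w1 : 0 < complex.Re `|w| + 1 by rewrite ltr_wpDl.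
  have [b Ib] := qn_lt y (divr_gt0 r0 w1).
  have -> : qn y + r / (complex.Re `|w| + 1) = (qn y * (complex.Re `|w| + 1) + r) / (complex.Re `|w| + 1) by field; rewrite gt_eqF.
  rewrite ltr_pdivlMr// => hb.
  apply: (le_trans (qn_le _ (idealZ w hI Ib))); rewrite -scalerBr nrmZ; have := qn_le y Ib.
  by move: hb (z0 w); move: (nrm _) (qn y) (complex.Re _) => *; nra.
apply/eqP; rewrite eq_le; apply/andP; split; first exact: le.
have [->|zn] := eqVneq z 0; first by rewrite normr0 mul0r qn_ge0.
have := le z^-1 (z *: x); rewrite scalerA mulVf// scale1r => h.
have zr : 0 < complex.Re `|z| by rewrite -ltcR RRe_real ?normr_real ?normr_gt0.
have E : complex.Re `|z^-1| = (complex.Re `|z|)^-1.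
  have zE : (complex.Re `|z|)%:C = `|z| by exact: RRe_real (normr_real z).
  apply: (@complexI R); rewrite (RRe_real (normr_real _)) normfV -{1}zE; exact: esym (fmorphV (real_complex R) _).
by move: h; rewrite E mulrC ler_pdivlMr// mulrC.
Qed.

Lemma qn_eq0 x : qn x = 0 -> I x.
Proof.
move=> x0; apply/(closed_nrm _).1 => [|r r0]; first exact: ideal_closed hI.
by have [b Ib] := qn_lt x r0; rewrite x0 add0r; exists b.
Qed.

Lemma qnM x y : qn (x ** y) <= qn x * qn y.
Proof.
have key (r : R) : 0 < r -> qn (x ** y) <= (qn x + r) * (qn y + r).
  move=> r0; have [b Ib hb] := qn_lt x r0; have [c Ic hc] := qn_lt y r0.
  apply: (@le_trans _ _ (nrm ((x - b) ** (y - c)))).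
    have -> : (x - b) ** (y - c) = x ** y - (b ** (y - c) + x ** c) by rewrite !cmulBr !cmulBl; zmod.
    by apply: qn_le; apply: idealD => //; [exact: Defs.idealMr|exact: Defs.idealMl].
  by apply: (le_trans (nrmM _ _)); apply: ler_pM; rewrite ?nrm_ge0// ltW.
apply/ler_addgt0Pr => e e0; have x0 := qn_ge0 x; have y0 := qn_ge0 y.
pose C := qn x + qn y + 1; have C0 : 0 < C by rewrite /C; lra.
pose r := Num.min 1 (e / C); have r0 : 0 < r by rewrite /r lt_min ltr01 divr_gt0.
have r1 : r <= 1 by rewrite /r ge_min lexx.
have rC : r * C <= e by rewrite -ler_pdivlMr// /r ge_min lexx orbT.
apply: (le_trans (key r r0)); move: rC; rewrite /C; nra.
Qed.

Lemma qn_star x : qn (star x) = qn x.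
Proof.
have le y : qn (star y) <= qn y.
  apply: qn_glb => b Ib; rewrite -nrm_star starB; exact: qn_le (ideal_star Ib).
by apply/eqP; rewrite eq_le le/= -{1}(starK x) le.
Qed.

(** For [c] in [I] nearly attaining the quotient norm of [y = star x ** x], let [k] nearly absorb
    [c]. Then [x - x ** k] represents the coset of [x], and the square of its norm is that of
    [(1 - k) y (1 - k)], at most [nrm (y - c)] up to the error of absorption. *)
Lemma qn_cstar x : qn (star x ** x) = qn x ^+ 2.
Proof.
apply/eqP; rewrite eq_le; apply/andP; split; first by rewrite (le_trans (qnM _ _))// qn_star expr2.
apply/ler_addgt0Pr => r r0; have r2 : 0 < r / 2 by rewrite divr_gt0.
set y := star x ** x; have [c Ic hc] := qn_lt y r2.
have [|k [Ik kk hk hw]] := approx_unit (b := c) r2; first exact: Defs.idealMl.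
have hw' w : nrm (w - k ** w) <= nrm w by rewrite -nrm_star starB starM kk -[leRHS]nrm_star hw.
have xk : qn x <= nrm (x - x ** k) by apply: qn_le; exact: Defs.idealMl.
apply: (@le_trans _ _ (nrm (x - x ** k) ^+ 2)); first by rewrite lerXn2r ?nnegrE ?qn_ge0 ?nrm_ge0.
rewrite -nrm_cstar starB starM kk.
pose z := y - c; have -> : (star x - k ** star x) ** (x - x ** k) =
    ((z - k ** z) - (z - k ** z) ** k) + ((c - c ** k) - k ** (c - c ** k)).
  by rewrite /z /y !(cmulBr, cmulBl) !cmulA; zmod.
apply: (le_trans (nrmD _ _)); have := hw (z - k ** z); have := hw' z; have := hw' (c - c ** k).
by move: hc hk; rewrite -/z; move: (nrm _) (nrm _) (nrm _) (nrm _) => *; lra.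
Qed.

End IdealApproximation.

Arguments qn {R A} I x.

Section Quotient.
Context {R : realType} {A : cstarAlgType R} {I : set A} (hI : closed_ideal I).

Definition rep (x : A) : A := xget 0 [set y | I (x - y)].

Lemma rep_mod x : I (x - rep x).
Proof.
have h : [set y | I (x - y)] x by rewrite /= subrr; exact: ideal0.
exact: (xgetPex 0 (ex_intro _ x h)).
Qed.

Lemma rep_eq x y : I (x - y) -> rep x = rep y.
Proof.
move=> h; rewrite /rep; congr xget; apply/seteqP; split=> z /= hz.
  by have := idealB hI hz h; congr I; zmod.
by have := idealD hI hz h; congr I; zmod.
Qed.

Lemma repK x : rep (rep x) = rep x.
Proof. by apply/esym/rep_eq; exact: rep_mod. Qed.

(** The quotient algebra is carried by canonical representatives of the cosets. *)
Record coset_rep := CosetRep { qrep : A; qrepP : rep qrep == qrep }.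

HB.instance Definition _ := [isSub of coset_rep for qrep].
HB.instance Definition _ := [Choice of coset_rep by <:].

End Quotient.

Arguments rep {R A} I x.

Arguments coset_rep {R A} I.

Definition quot (R : realType) (A : cstarAlgType R) (I : set A) (hI : closed_ideal I) : Type := coset_rep I.

Section QuotientAlgebra.
Context {R : realType} {A : cstarAlgType R} {I : set A} {hI : closed_ideal I}.
Local Notation Q := (quot hI).
Implicit Types (p q : Q) (x y : A).

HB.instance Definition _ := Choice.copy Q (coset_rep I).

Definition quo x : Q := CosetRep (introT eqP (repK hI x)).

Definition lift q : A := qrep q.

Lemma quo_eq x y : quo x = quo y <-> I (x - y).
Proof.
split=> [h|h]; last by apply: val_inj; exact: rep_eq.
have /= e : rep I x = rep I y := congr1 lift h.
have := idealB hI (rep_mod hI x) (rep_mod hI y); rewrite e; congr I; zmod.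
Qed.

Lemma liftK q : quo (lift q) = q.
Proof. by apply: val_inj; exact: eqP (qrepP q). Qed.

Lemma lift_quo x : I (lift (quo x) - x).
Proof. by apply/quo_eq; rewrite liftK. Qed.

Lemma quo_ind (P : Q -> Prop) : (forall x, P (quo x)) -> forall q, P q.
Proof. by move=> h q; rewrite -(liftK q). Qed.

Definition qadd p q : Q := quo (lift p + lift q).

Definition qopp p : Q := quo (- lift p).

Definition qscale (z : R[i]) p : Q := quo (z *: lift p).

Definition qmul p q : Q := quo (lift p ** lift q).

Definition qstar p : Q := quo (star (lift p)).

Lemma qaddE x y : qadd (quo x) (quo y) = quo (x + y).
Proof. by apply/quo_eq; have := idealD hI (lift_quo x) (lift_quo y); congr I; zmod. Qed.

Lemma qoppE x : qopp (quo x) = quo (- x).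
Proof. by apply/quo_eq; have := idealB hI (ideal0 hI) (lift_quo x); congr I; zmod. Qed.

Lemma qscaleE (z : R[i]) x : qscale z (quo x) = quo (z *: x).
Proof. by apply/quo_eq; rewrite -scalerBr; apply: idealZ => //; exact: lift_quo. Qed.

Lemma qmulE x y : qmul (quo x) (quo y) = quo (x ** y).
Proof.
apply/quo_eq; rewrite cmulBB; apply: idealD => //; [apply: Defs.idealMr => //|apply: Defs.idealMl => //]; exact: lift_quo.
Qed.

Lemma qstarE x : qstar (quo x) = quo (star x).
Proof. by apply/quo_eq; rewrite -starB; apply: ideal_star => //; exact: lift_quo. Qed.

Let addA : associative qadd.
Proof. by elim/quo_ind=> x; elim/quo_ind=> y; elim/quo_ind=> z; rewrite !qaddE addrA. Qed.
Let addC : commutative qadd.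
Proof. by elim/quo_ind=> x; elim/quo_ind=> y; rewrite !qaddE addrC. Qed.
Let add0 : left_id (quo 0) qadd.
Proof. by elim/quo_ind=> x; rewrite qaddE add0r. Qed.
Let addN : left_inverse (quo 0) qopp qadd.
Proof. by elim/quo_ind=> x; rewrite qoppE qaddE addNr. Qed.

HB.instance Definition _ := GRing.isZmodule.Build Q addA addC add0 addN.

Lemma quoD x y : quo (x + y) = quo x + quo y. Proof. by rewrite -[RHS]/(qadd _ _) qaddE. Qed.

Let scaleA (z w : R[i]) q : qscale z (qscale w q) = qscale (z * w) q.
Proof. by elim/quo_ind: q => x; rewrite !qscaleE scalerA. Qed.
Let scale1 : left_id 1 qscale.
Proof. by elim/quo_ind=> x; rewrite qscaleE scale1r. Qed.
Let scaleDr : right_distributive qscale +%R.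
Proof. by move=> z; elim/quo_ind=> x; elim/quo_ind=> y; rewrite -quoD !qscaleE scalerDr quoD. Qed.
Let scaleDl q : {morph qscale^~ q : z w / z + w}.
Proof. by move=> z w; elim/quo_ind: q => x; rewrite !qscaleE scalerDl quoD. Qed.

HB.instance Definition _ := GRing.Zmodule_isLmodule.Build R[i] Q scaleA scale1 scaleDr scaleDl.

Lemma quoZ (z : R[i]) x : quo (z *: x) = z *: quo x. Proof. by rewrite -[RHS]/(qscale _ _) qscaleE. Qed.

Definition qnorm q : R[i] := (qn I (lift q))%:C.

Lemma qnormE x : qnorm (quo x) = (qn I x)%:C.
Proof. by congr _%:C; apply: qn_eq => //; exact: lift_quo. Qed.

Let normD p q : qnorm (p + q) <= qnorm p + qnorm q.
Proof. by elim/quo_ind: p => x; elim/quo_ind: q => y; rewrite -quoD !qnormE -rmorphD lecR qnD. Qed.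
Let normZ (z : R[i]) q : qnorm (z *: q) = `|z| * qnorm q.
Proof. 
elim/quo_ind: q => x; rewrite -quoZ !qnormE qnZ// -[in RHS](RRe_real (normr_real z)).
exact: (rmorphM (real_complex R)).
Qed.

Let norm_eq0 q : qnorm q = 0 -> q = 0.
Proof.
elim/quo_ind: q => x; rewrite qnormE => /complexI /(qn_eq0 hI) h.
by rewrite -[RHS]/(quo 0); apply/quo_eq; rewrite subr0.
Qed.

HB.instance Definition _ := Lmodule_isNormed.Build R[i] Q normD normZ norm_eq0.

Lemma nrm_quo x : nrm (quo x) = qn I x.
Proof. by rewrite /nrm -[`|_|]/(qnorm _) qnormE. Qed.

Lemma quo_lift q (r : R) : 0 < r -> exists2 x, quo x = q & nrm x < nrm q + r.
Proof.
move=> r0; elim/quo_ind: q => y; have [b Ib hb] := qn_lt hI y r0.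
exists (y - b); last by rewrite nrm_quo.
by apply/quo_eq; have := idealB hI (ideal0 hI) Ib; congr I; zmod.
Qed.

Lemma quoB x y : quo (x - y) = quo x - quo y.
Proof. by rewrite -scaleN1r quoD quoZ scaleN1r. Qed.

(** Approximations converging geometrically in the quotient lift to a Cauchy sequence in [A]. *)
Lemma quot_cvg (F : set_system Q) : ProperFilter F -> cauchy F -> cvg F.
Proof.
move=> FF cF; pose w n : R := 2^-1 ^+ n; have w0 n : 0 < w n by rewrite exprn_gt0.
have wS n : w n = 2 * w n.+1 by rewrite /w exprS mulrA divff ?mul1r// pnatr_eq0.
have small (r : R) : 0 < r -> exists n, 6 * w n < r.
  move=> r0; exists (Num.bound (6 / r)); have := archi_boundP (ltW (divr_gt0 (ltr0n R 6) r0)).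
  set N := Num.bound _ => h; have : (N%:R : R) < 2 ^+ N by rewrite -natrX ltr_nat ltn_expl.
  move=> h2; rewrite /w exprVn ltr_pdivrMr ?exprn_gt0//; move: (lt_trans h h2); rewrite ltr_pdivrMr//.
  by rewrite mulrC.
have /choice[q hq] n : exists q : Q, F [set p | nrm (q - p) < w n].
  have wC : (0 : R[i]) < (w n)%:C by rewrite ltcR.
  have /cauchyP/(_ _ wC)[q hq] := cF; exists q; move: hq; apply: filterS => p.
  by rewrite -ball_normE /= nrm_lt.
have qq n : nrm (q n.+1 - q n) < 2 * w n.
  have [p [/= h1 h2]] := @filter_ex _ _ FF _ (filterI (hq n) (hq n.+1)).
  apply: (le_lt_trans (nrm_dist3 _ p _)); rewrite (nrm_distC p); have := w0 n.+1; move: h1 h2.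
  by rewrite (wS n); move: (nrm _) (nrm _) => *; lra.
have /choice[L hL] (pn : Q * nat) : exists x, quo x = pn.1 /\ nrm x < nrm pn.1 + w pn.2.
  by have [x h1 h2] := quo_lift pn.1 (w0 pn.2); exists x.
pose a := fix a n := if n is n'.+1 then a n' + L (q n'.+1 - q n', n') else L (q 0%N, 0%N).
have qa n : quo (a n) = q n.
  by elim: n => [|n ih] /=; [exact: (hL (_, _)).1 | rewrite quoD ih (hL (_, _)).1 addrC subrK].
have aS n k : nrm (a (n + k)%N - a n) <= 6 * (w n - w (n + k)%N).
  elim: k => [|k ih]; first by rewrite addn0 !subrr nrm0 mulr0.
  rewrite addnS (le_trans (nrm_dist3 _ (a (n + k)%N) _))//.
  have -> : a (n + k).+1 - a (n + k)%N = L (q (n + k).+1 - q (n + k)%N, (n + k)%N) by rewrite /= addrAC subrr add0r.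
  have := (hL (q (n + k).+1 - q (n + k)%N, (n + k)%N)).2 => /=; have := qq (n + k)%N.
  by move: ih (wS (n + k)%N); move: (nrm _) (nrm _) (nrm _) => *; lra.
have [l hl] : exists l : A, a @ \oo --> l.
  apply: nrm_cauchy_cvg => r r0; have [N hN] := small (r / 2) (divr_gt0 r0 (ltr0n R 2)).
  exists N => m n Nm Nn; apply: (le_lt_trans (nrm_dist3 _ (a N) _)); rewrite (nrm_distC _ (a n)).
  have := aS N (m - N)%N; have := aS N (n - N)%N; rewrite !subnKC//; have := w0 n; have := w0 m.
  by move: hN; move: (nrm _) (nrm _) => *; lra.
apply/cvg_ex; exists (quo l); apply/nrm_cvgP => r r0.
have [N1 hN1] := small (r / 2) (divr_gt0 r0 (ltr0n R 2)).
have /nrm_cvg_seqP/(_ _ (divr_gt0 r0 (ltr0n R 2)))[N2 hN2] := hl.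
pose n := maxn N1 N2; have := hq n; apply: filterS => p /= hp.
apply: (le_lt_trans (nrm_dist3 _ (q n) _)); rewrite -qa -quoB nrm_quo.
have h1 := qn_le hI (l - a n) (ideal0 hI); rewrite subr0 in h1.
have h2 := hN2 n (leq_maxr _ _); have h3 : w n <= w N1.
  by rewrite /w ler_wiXn2l ?leq_maxl// ?invr_ge0// invf_le1// ler1n.
by move: hp h1 h2 hN1 (w0 N1); rewrite -qa; move: (nrm _) (qn _ _) (nrm _) => *; lra.
Qed.

HB.instance Definition _ := Uniform_isComplete.Build Q quot_cvg.

Let mulA : associative qmul.
Proof. by elim/quo_ind=> x; elim/quo_ind=> y; elim/quo_ind=> z; rewrite !qmulE cmulA. Qed.
Let mulDl : left_distributive qmul +%R.
Proof. by elim/quo_ind=> x; elim/quo_ind=> y; elim/quo_ind=> z; rewrite -quoD !qmulE cmulDl quoD. Qed.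
Let mulDr : right_distributive qmul +%R.
Proof. by elim/quo_ind=> x; elim/quo_ind=> y; elim/quo_ind=> z; rewrite -quoD !qmulE cmulDr quoD. Qed.
Let scaleAl (z : R[i]) p q : qmul (z *: p) q = z *: qmul p q.
Proof. by elim/quo_ind: p => x; elim/quo_ind: q => y; rewrite -quoZ !qmulE cscaleAl quoZ. Qed.
Let scaleAr (z : R[i]) p q : qmul p (z *: q) = z *: qmul p q.
Proof. by elim/quo_ind: p => x; elim/quo_ind: q => y; rewrite -quoZ !qmulE cscaleAr quoZ. Qed.
Let stK : involutive qstar.
Proof. by elim/quo_ind=> x; rewrite !qstarE starK. Qed.
Let stD : {morph qstar : p q / p + q}.
Proof. by elim/quo_ind=> x; elim/quo_ind=> y; rewrite -quoD !qstarE starD quoD. Qed.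
Let stZ (z : R[i]) q : qstar (z *: q) = Num.conj z *: qstar q.
Proof. by elim/quo_ind: q => x; rewrite -quoZ !qstarE starZ quoZ. Qed.
Let stM p q : qstar (qmul p q) = qmul (qstar q) (qstar p).
Proof. by elim/quo_ind: p => x; elim/quo_ind: q => y; rewrite !(qmulE, qstarE) starM. Qed.
Let norm_mul p q : `|qmul p q| <= `|p| * `|q|.
Proof. by elim/quo_ind: p => x; elim/quo_ind: q => y; rewrite qmulE -!nrmE -rmorphM lecR !nrm_quo qnM. Qed.
Let norm_st_mul q : `|qmul (qstar q) q| = `|q| ^+ 2.
Proof. by elim/quo_ind: q => x; rewrite !(qmulE, qstarE) -!nrmE -rmorphXn !nrm_quo qn_cstar. Qed.

HB.instance Definition _ := isCStarAlgebra.Build R Q mulA mulDl mulDr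
  scaleAl scaleAr stK stD stZ stM norm_mul norm_st_mul.

Lemma quo_map : @quotient_map R A I Q quo.
Proof.
split=> [|q|x].
- split=> [z x y|x y|x]; [by rewrite quoD quoZ| |].
    by rewrite -[RHS]/(qmul _ _) qmulE.
  by rewrite -[RHS]/(qstar _) qstarE.
- by exists (lift q); exact: liftK.
- by rewrite -[0]/(quo 0) quo_eq subr0.
Qed.

End QuotientAlgebra.

(** * Stably finite quotients *)

Section MatrixStar.
Context {R : realType} {Q : cstarAlgType R} {n : nat}.
Implicit Types (p q v : 'M[unitization Q]_n).

Lemma mxstarM p q : mxstar (p *m q) = mxstar q *m mxstar p.
Proof.
apply/matrixP => i j; rewrite !mxE; have u0 : ustar (0 : unitization Q) = 0 by rewrite /ustar /= star0 conjC0.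
rewrite (big_morph ustar (@ustarD _ _) u0); apply: eq_bigr => k _; rewrite !mxE.
exact: ustarM.
Qed.

Lemma mxstarK p : mxstar (mxstar p) = p.
Proof. by apply/matrixP => i j; rewrite !mxE ustarK. Qed.

(** Otherwise the unit matrix would be equivalent, through [v], to the proper subprojection
    [v *m mxstar v]. *)
Lemma isometry_unitary v : stably_finite Q -> mxstar v *m v = 1%:M -> v *m mxstar v = 1%:M.
Proof.
move=> sf vv; apply: contrapT => nv; apply: (sf n 1%:M); split.
  split; last by rewrite mul1mx.
  by rewrite -vv mxstarM mxstarK.
exists (v *m mxstar v), v; split=> //; last by rewrite mul1mx.
split; first by rewrite mxstarM mxstarK.
by rewrite mulmxA -(mulmxA v) vv mulmx1.
Qed.

End MatrixStar.

Lemma fc_conj_expand (R : realType) (D : cstarAlgType R) (h : D) (f : R -> R) : star h = h -> continuous f -> f 0 = 0 ->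
  fc (fun s => f s + f s + f s * f s + s + f s * s + s * f s + f s * s * f s) h =
  fc f h + fc f h + fc f h ** fc f h + h + fc f h ** h + h ** fc f h + fc f h ** h ** fc f h.
Proof. by move=> sh cf f0; rewrite !fcD ?fcM ?(fc_id sh) ?f0 ?mul0r ?mulr0 ?addr0//; cts. Qed.

Section FiniteQuotients.
Context {R : realType} {B : cstarAlgType R} {S : stabilization B}.
Local Notation D := (stab S).
Hypothesis FQ : forall (I : set B) (Q : cstarAlgType R) (pi : B -> Q), closed_ideal I -> quotient_map I pi -> stably_finite Q.
Variables (J : set D) (hJ : closed_ideal J).
Implicit Types (a d h x y : D).

(** Modulo [J] a corner becomes a matrix algebra over the quotient of [B] by [pull J]. The
    hypothesis makes [1 + M b] an isometry over the unitization of that quotient; it is unitary by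
    stable finiteness, and this is the conclusion read back in [J]. *)
Lemma corner_isometry n e (b : 'M[B]_n) : onb n e -> J (star (cor e b) + cor e b + star (cor e b) ** cor e b) ->
  J (cor e b + star (cor e b) + cor e b ** star (cor e b)).
Proof.
move=> he; have hI := pull_closed hJ; pose Q := quot hI; pose pi : B -> Q := quo.
have hpi : quotient_map (pull J) pi by exact: quo_map.
have hh := quotient_hom hpi; have sf : stably_finite Q := FQ hI hpi.
pose M (c : 'M[B]_n) : 'M[unitization Q]_n := map_mx (fun x : B => uinj (pi x)) c.
have MD c c' : M (c + c') = M c + M c'.
  by apply/matrixP => i j; rewrite !mxE (homD hh) uinjD.
have MM c c' : M (cmx c c') = M c *m M c'.
  apply/matrixP => i j; rewrite !mxE (big_morph pi (homD hh) (hom0 hh)).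
  rewrite (big_morph (@uinj R Q) (@uinjD _ _) (erefl : uinj 0 = 0)).
  by apply: eq_bigr => k _; rewrite !mxE (star_homM hh) uinjM.
pose bs := (map_mx star b)^T.
have Ms : mxstar (M b) = M bs by apply/matrixP => i j; rewrite !mxE (star_hom_star hh) ustar_inj.
have M0 c : M c = 0 <-> forall i j, pull J (c i j).
  split=> [/matrixP h i j|h].
    by apply/(quotient_ker hpi); apply: uinj_inj; have := h i j; rewrite !mxE.
  by apply/matrixP => i j; rewrite !mxE ((quotient_ker hpi _).2 (h i j)).
have s1 : mxstar (1%:M : 'M[unitization Q]_n) = 1%:M.
  apply/matrixP => i j; rewrite !mxE eq_sym; case: eqP => _; rewrite /ustar /= star0 ?conjC0//.
  by rewrite conjC1.
pose U := 1%:M + M b; have sU : mxstar U = 1%:M + M bs.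
  by rewrite -Ms -s1; apply/matrixP => i j; rewrite !mxE ustarD.
rewrite cor_star -!corM// -!corD => h1.
have UU : mxstar U *m U = 1%:M.
  rewrite sU /U mulmxDl !mulmxDr !mul1mx mulmx1 -MM.
  have := (M0 (bs + b + cmx bs b)).2 (fun i j => pull_cor i j hJ he h1); rewrite !MD => e1.
  by transitivity (1%:M + (M bs + M b + M (cmx bs b))); [zmod | rewrite e1 addr0].
have := isometry_unitary sf UU; rewrite sU /U mulmxDl !mulmxDr !mul1mx mulmx1 -MM => h2.
apply: cor_pull => //; apply/M0; rewrite !MD.
have -> : M b + M bs + M (cmx b bs) = (1%:M + M bs + (M b + M (cmx b bs))) - 1%:M by zmod.
by rewrite h2 subrr.
Qed.

Local Notation pi := (@quo R D J hJ).

(** [1 + d] is nearly an isometry modulo [J]. Replacing [d] by [d'] in a corner and multiplying by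
    the inverse square root [1 + u] of [1 + h] gives [1 + d2], an exact isometry modulo [J], hence
    unitary there by [corner_isometry]. The factor 6 is 3 for the norm of [1 + star d2] times 2 for
    that of [1 + u]. *)
Lemma almost_isometry d : nrm (pi (star d + d + star d ** d)) <= 1 / 4 ->
  forall y, nrm (pi y) <= 6 * nrm (pi (y + y ** d)).
Proof.
move=> hd y; have hh := quotient_hom (quo_map (hI := hJ)).
apply/ler_addgt0Pr => r r0; have d0 := nrm_ge0 d; have y0 := nrm_ge0 y.
(* The tolerance for [d']: the second bound keeps [h] within 1/4 of the given element, and the third
   absorbs the error [nrm y * t] at the end. *)
pose t := Num.min 1 (Num.min ((2 * nrm d + 3)^-1 / 4) (r / (6 * nrm y + 1))).
have t0 : 0 < t by rewrite /t !lt_min ltr01 !divr_gt0 ?invr_gt0//; lra.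
have t1 : t <= 1 by rewrite /t ge_min lexx.
have t2 : t * (2 * nrm d + 3) <= 1 / 4.
  rewrite -ler_pdivlMr; last lra.
  by rewrite /t ge_min; apply/orP; right; rewrite ge_min; apply/orP; left; rewrite mulrC mul1r.
have t3 : t * (6 * nrm y + 1) <= r.
  rewrite -ler_pdivlMr; last lra.
  by rewrite /t !ge_min lexx !orbT.
have [ys hys] := corner_dense d t0; have [n [e [he pe]]] := gram_schmidt ys; have [b hb] := hys n e he pe.
pose d' := cor e b; rewrite -/d' in hb.
pose h := star d' + d' + star d' ** d'.
have sh : star h = h by rewrite /h !starD starM starK; zmod.
have ph : nrm (pi h) <= 1 / 2.
  have -> : h = (star d + d + star d ** d) - (star (d - d') + (d - d') + star d ** (d - d') + star (d - d') ** d').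
    by rewrite /h !(starB, cmulBr, cmulBl); zmod.
  rewrite (homB hh) (le_trans (nrmB _ _))//; set z := _ + star (d - d') ** d'.
  have : nrm z <= 1 / 4.
    have := nrmM (star d) (d - d'); have := nrmM (star (d - d')) d'; have := nrm_le_dist d' d; rewrite !nrm_star (nrm_distC d').
    have := nrmD (star (d - d') + (d - d') + star d ** (d - d')) (star (d - d') ** d').
    have := nrmD (star (d - d') + (d - d')) (star d ** (d - d')); have := nrmD (star (d - d')) (d - d'); rewrite -/z nrm_star.
    have := nrm_ge0 (d - d'); have := nrm_ge0 d'; move: hb.
    move: (nrm (d - d')) (nrm d') (nrm z) => p q u l1 l2 l3 l4 l5 l6 l7 l8 l9.
    apply: le_trans t2; apply: (le_trans l6); apply: (le_trans (lerD l5 (lexx _))).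
    apply: (le_trans (lerD (lerD l4 (lexx _)) (lexx _))); apply: (le_trans (lerD (lerD (lexx _) l9) l8)).
    by nra.
  have := hom_nrm hh z; move: hd; move: (nrm _) (nrm _) (nrm _) => *; lra.
(* The lower bound 1/2 makes [rho] continuous on the whole line; modulo [J], where [h] has norm at
   most 1/2, it changes nothing. *)
pose m (s : R) := Num.max (1 + s) (1 / 2); have m0 s : 0 < m s by rewrite /m lt_max; apply/orP; right; lra.
pose rho (s : R) := (Num.sqrt (m s))^-1 - 1.
have q0 s : 0 < Num.sqrt (m s) by rewrite sqrtr_gt0.
have cm : continuous m by rewrite /m; cts.
have cr : continuous rho by rewrite /rho; cts => s; rewrite gt_eqF.
have r00 : rho 0 = 0 by rewrite /rho /m addr0 max_l ?sqrtr1 ?invr1 ?subrr//; lra.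
pose F (s : R) := rho s + rho s + rho s * rho s + s + rho s * s + s * rho s + rho s * s * rho s.
have cF : continuous F by rewrite /F; cts.
have F00 : F 0 = 0 by rewrite /F r00; ring.
have F0 (s : R) : `|s| <= 1 / 2 -> F s = 0.
  move=> s2; have ms : m s = 1 + s by rewrite /m max_l//; move: s2; rewrite ler_norml => /andP[*]; lra.
  have := sqr_sqrtr (ltW (m0 s)); rewrite {2}ms => hs; have -> : F s = (1 + rho s) ^+ 2 * (1 + s) - 1 by rewrite /F; ring.
  rewrite -hs /rho; have := q0 s; move: (Num.sqrt _) => u u0; field; rewrite gt_eqF//.
have rb (s : R) : `|rho s| <= 1.
  have : 1 / 2 <= Num.sqrt (m s).
    apply: le_of_sq; first exact: ltW.
    rewrite sqr_sqrtr ?(ltW (m0 s))//; have : 1 / 2 <= m s by rewrite /m le_max lexx orbT.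
    by rewrite expr2; lra.
  have := q0 s; rewrite /rho; move: (Num.sqrt _) => u u0 u1; rewrite ler_norml.
  have : u^-1 <= 2 by rewrite -[u^-1]mul1r ler_pdivrMr//; lra.
  move=> u2; apply/andP; split; last by rewrite lerBlDr (_ : 1 + 1 = 2).
  by rewrite -subr_ge0 opprK addrNK invr_ge0 ltW.
clearbody rho; pose bs := (map_mx star b)^T.
have hE : h = cor e (bs + b + cmx bs b) by rewrite /h cor_star -!corM// -!corD.
have [c hc] : exists c : 'M[B]_n, fc rho h = cor e c by rewrite hE; apply: cor_fc => //; rewrite -hE.
pose u := fc rho h; have uu : star u = u by exact: star_fc.
pose d2 := d' + u + d' ** u.
have d2E : d2 = cor e (b + c + cmx b c) by rewrite /d2 /u hc -corM// -!corD.
have iso : star d2 + d2 + star d2 ** d2 = fc F h.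
  rewrite [fc F h](fc_conj_expand sh cr r00) -/u.
  rewrite /h /d2 !(starD, starM) uu !(cmulDl, cmulDr) !cmulA; zmod.
have Jiso : J (star d2 + d2 + star d2 ** d2).
  apply/(quotient_ker (quo_map (hI := hJ))); rewrite iso (hom_fc hh)//; apply: nrm_le0.
  apply: fc_le => //; first exact: hom_sa.
  by move=> s hs; rewrite F0 ?normr0//; exact: le_trans hs ph.
have Jun : J (d2 + star d2 + d2 ** star d2) by move: Jiso; rewrite d2E; exact: corner_isometry.
have d2D : d2 = d' + u + d' ** u by [].
clearbody d2; pose D2 := pi d2; pose Y := pi (y + y ** d2).
have nD2 : nrm D2 <= 2.
  have : star D2 ** D2 = - (star D2 + D2).
    apply/eqP; rewrite -addr_eq0 addrC; apply/eqP.
    have h0 := (quotient_ker (quo_map (hI := hJ)) _).2 Jiso; rewrite !(homD hh) (star_homM hh) (star_hom_star hh) in h0.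
    exact: h0.
  move/(congr1 nrm); rewrite nrm_cstar nrmN => E; have := nrmD (star D2) D2; rewrite -E nrm_star.
  by have := nrm_ge0 D2; move: (nrm D2) => *; nra.
have yY : pi y = Y + Y ** star D2.
  rewrite -(star_hom_star hh) -(star_homM hh) -(homD hh); apply/(quo_eq (hI := hJ)).
  have := idealB hJ (ideal0 hJ) (Defs.idealMl hJ y Jun); congr J.
  by rewrite !(cmulDl, cmulDr) !cmulA; zmod.
have n1 : nrm (pi y) <= 3 * nrm Y.
  rewrite yY (le_trans (nrmD _ _))//; have := nrmM Y (star D2); rewrite nrm_star; have := nrm_ge0 Y.
  by move: nD2; move: (nrm D2) (nrm Y) (nrm _) => *; nra.
have pu : nrm (pi u) <= 1.
  by rewrite /u (hom_fc hh)//; apply: fc_le => //; exact: hom_sa.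
have n2 : nrm Y <= 2 * nrm (pi (y + y ** d')).
  have -> : Y = pi (y + y ** d') + pi (y + y ** d') ** pi u.
    by rewrite -(star_homM hh) -(homD hh) /Y d2D; congr pi; rewrite !(cmulDl, cmulDr) !cmulA; zmod.
  rewrite (le_trans (nrmD _ _))//; have := nrmM (pi (y + y ** d')) (pi u); have := nrm_ge0 (pi (y + y ** d')).
  by move: pu; move: (nrm (pi u)) (nrm (pi (y + y ** d'))) (nrm _) => ? ? ? v1 v2 v3; clear -v1 v2 v3 FQ hJ; nra.
have n3 : nrm (pi (y + y ** d')) <= nrm (pi (y + y ** d)) + nrm y * t.
  have -> : y + y ** d' = (y + y ** d) - y ** (d - d') by rewrite cmulBr; zmod.
  rewrite (homB hh) (le_trans (nrmB _ _))// lerD2l (le_trans (hom_nrm hh _))// (le_trans (nrmM _ _))//.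
  by rewrite ler_wpM2l// ltW.
move: n1 n2 n3 t3; move: (nrm (pi y)) (nrm Y) (nrm (pi (y + y ** d'))) (nrm (pi _)) => ? ? ? ? v1 v2 v3 v4; clear -v1 v2 v3 v4 t0 FQ hJ; nra.
Qed.

Lemma ideal_cuntz a h : J h -> a ≾ h -> J a.
Proof.
move=> Jh /cuntzP ah; apply/(closed_nrm _).1 => [|r r0]; first exact: ideal_closed hJ.
by have [v hv] := ah r r0; exists (v ** h ** star v) => //; apply: Defs.idealMr => //; exact: Defs.idealMl.
Qed.

(** Modulo [J] the hypothesis gives [y] with [y ** star y] close to [P + P'], built from two
    orthogonal copies of [a], and with right support in the cutdown of the first copy. Then [1 + d],
    which is [(1 - Ps) + star y ** P ** H], is nearly an isometry, whereas [P' ** y] times [1 + d]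
    is nearly 0. By [almost_isometry] [P' ** y] itself is small, so the cube of [P'] lies in [J]. *)
Lemma infinite_in_ideal a (c : D) (e : R) : cpos a -> cpos c -> 0 < e -> J c -> dsum a a ≾ dsum (cut e a) c -> J (cut (e / 2) a).
Proof.
move=> pa pc e0 Jc dd; have sa := cpos_sa pa; have hh := quotient_hom (quo_map (hI := hJ)).
have ck := @cont_kap R e; have k0 := @kap0 R e; have k01 := @kap01 R e; have k1 := fun s => @kap1 R e s e0.
have kn (s : R) : s <= 0 -> kap e s = 0.
  move=> s0; rewrite kapE max_r// ge_min; apply/orP; left; apply: mulr_le0_ge0 => //.
  by rewrite divr_ge0// ltW.
move: (kap e) ck k0 k01 k1 kn => k ck k0 k01 k1 kn.
(* The squares of [phi] and [1 - psi] add up to 1. This makes [1 + d] isometric up to the error,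
   since [y ** Ps = y] removes the mixed terms. *)
pose phi (s : R) := k (s - e / 2); pose psi (s : R) := 1 - Num.sqrt (1 - phi s ^+ 2).
have cph : continuous phi.
  have c1 : continuous (fun s : R => s - e / 2) by cts.
  by move=> s; apply: (continuous_comp (c1 s)); exact: ck.
have phb (s : R) : `|phi s| <= 1 by rewrite /phi; have /andP[? ?] := k01 (s - e / 2); rewrite ger0_norm.
have cps : continuous psi by rewrite /psi; cts.
have ph0 : phi 0 = 0 by rewrite /phi kn//; lra.
have ps0 : psi 0 = 0 by rewrite /psi ph0 expr0n subr0 sqrtr1 subrr.
have phk s : phi s * k s = phi s.
  by rewrite /phi; have [h|h] := leP (s - e / 2) 0; [rewrite kn ?mul0r | rewrite (k1 s) ?mulr1//; lra].
have psE s : 1 - phi s * phi s = (1 - psi s) * (1 - psi s).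
  rewrite /psi subKr -[RHS]expr2 sqr_sqrtr ?expr2//.
  by have /andP[] := k01 (s - e / 2); rewrite -/(phi s); nra.
have ps1 s : e <= s -> psi s = 1 by move=> h; rewrite /psi /phi k1 ?expr1n ?subrr ?sqrtr0 ?subr0//; lra.
have cutk s : Num.max (s - e / 2) 0 * k s = Num.max (s - e / 2) 0.
  by have [h|h] := leP (s - e / 2) 0; [rewrite mul0r | rewrite (k1 s) ?mulr1//; lra].
clearbody phi psi.
pose g := fc k a; pose H := dl (fc phi a); pose Ps := dl (fc psi a); pose P := dl g; pose P' := dr g.
have sP : star P = P by rewrite -(star_hom_star dl_hom) star_fc.
have sP' : star P' = P' by rewrite -(star_hom_star dr_hom) star_fc.
have sH : star H = H by rewrite -(star_hom_star dl_hom) star_fc.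
have sPs : star Ps = Ps by rewrite -(star_hom_star dl_hom) star_fc.
have ng : nrm g <= 1.
  by apply: fc_le => // s _; have /andP[? ?] := k01 s; rewrite ger0_norm.
have nP : nrm P <= 1 := le_trans (hom_nrm dl_hom g) ng.
have nP' : nrm P' <= 1 := le_trans (hom_nrm dr_hom g) ng.
have nH : nrm H <= 1.
  apply: (le_trans (hom_nrm dl_hom _)); apply: fc_le => // s _; exact: phb.
have HP : H ** P = H.
  by rewrite -(star_homM dl_hom) -fcM//; congr dl; congr fc; apply/funext => s; rewrite phk.
have PH : P ** H = H by rewrite -sP -sH -starM HP.
have HH : H ** H = Ps + Ps - Ps ** Ps.
  rewrite -!(star_homM dl_hom) -(homD dl_hom) -(homB dl_hom) -!fcM// -fcD// -fcB ?ps0 ?addr0 ?mul0r//; try by cts.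
  by congr dl; congr fc; apply/funext => s; have := psE s; move: (phi s) (psi s) => p q E; lra.
have PP' : P ** P' = 0 by exact: dldr.
have P'P : P' ** P = 0 by rewrite -sP -sP' -starM PP' star0.
have pg : cpos g by apply: cpos_fc => // s _; have /andP[] := k01 s.
have ga : g ≾ a by apply: fc_cuntz => // s _; have /andP[] := k01 s.
have pe : cpos (cut e a) := cpos_cut (ltW e0) pa.
have gg : dsum g g ≾ dsum (cut e a) c by apply: cuntz_trans dd; exact: dsum_mono.
pose s := sqc (cut e a); have ss : star s = s by apply: star_sqc; exact: cpos_sa.
have sK : s ** s = cut e a by apply: sqcK; exact/cpos_psd.
have sps : s ** fc psi a = s.
  have sE : s = fc (fun r => Num.sqrt (Num.max (r - e) 0)) a by exact: sqc_cut_fc (ltW e0) pa.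
  rewrite sE; apply: fc_absorb => //; [by cts|by rewrite max_r ?sqrtr0//; lra|].
  move=> r _; have [h|h] := leP (r - e) 0; first by rewrite sqrtr0 mul0r.
  by rewrite ps1 ?mulr1//; lra.
have key (t : R) : 0 < t <= 1 / 4 -> nrm (pi (P' ** P' ** P')) <= t + 36 * t.
  move=> /andP[t0 t4]; have /cuntzP/(_ _ t0)[v hv] := gg.
  pose y := v ** dl s; have yPs : y ** Ps = y by rewrite /y /Ps -cmulA -(star_homM dl_hom) sps.
  have hy : nrm (pi (P + P' - y ** star y)) <= t.
    have -> : pi (P + P' - y ** star y) = pi (dsum g g - v ** dsum (cut e a) c ** star v).
      apply/(quo_eq (hI := hJ)); have Jr : J (dr c) by apply: (ideal_cuntz Jc); exact: (dr_cuntz pc).1.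
      have := Defs.idealMr hJ (star v) (Defs.idealMl hJ v Jr); congr J.
      rewrite !dsumE /y starM -(star_hom_star dl_hom) ss -/P -/P' cmulDr cmulDl -sK (star_homM dl_hom) !cmulA; zmod.
    by apply: (le_trans (hom_nrm hh _)); exact: ltW.
  clearbody y.
  pose d := star (P ** y) ** H - Ps.
  have small u w : nrm u <= 1 -> nrm w <= 1 -> nrm (pi (u ** (P + P' - y ** star y) ** w)) <= t.
    move=> nu nw; rewrite !(star_homM hh); set z := pi (_ - _) in hy *.
    have := nrmM (pi u ** z) (pi w); have := nrmM (pi u) z; have := hom_nrm hh u; have := hom_nrm hh w.
    have := nrm_ge0 (pi w); have := nrm_ge0 (pi u); have := nrm_ge0 z.
    move: (nrm (pi u)) (nrm (pi w)) (nrm z) hy => p q r l0 l1 l2 l3 l4 l5 l6 l7; apply: (le_trans l7).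
    have l8 : nrm (pi u ** z) <= r by apply: (le_trans l6); nra.
    by apply: (le_trans (ler_wpM2r l3 l8)); nra.
  have nHP : nrm (H ** P) <= 1 by rewrite HP.
  have iso : nrm (pi (star d + d + star d ** d)) <= 1 / 4.
    have -> : star d + d + star d ** d = - (H ** (P + P' - y ** star y) ** H).
      rewrite /d starB !(starM, starK) sH sP sPs.
      transitivity (H ** P ** y ** star y ** P ** H - H ** H).
        rewrite HH HP -(cmulA _ P H) PH !cmulBl !cmulBr !cmulA.
        have e1 : H ** y ** Ps = H ** y by rewrite -cmulA yPs.
        have e2 : Ps ** star y = star y by rewrite -[RHS](congr1 star yPs) starM sPs.
        by rewrite HP e1 e2 -(cmulA _ P H) PH; zmod.
      have HP' : H ** P' = 0 by rewrite -HP -cmulA PP' cmulr0.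
      by rewrite HP -(cmulA _ P H) PH cmulBr cmulDr HP HP' addr0 cmulBl !cmulA; zmod.
    by rewrite (homN hh) nrmN; apply: (le_trans (small _ _ nH nH)).
  have := almost_isometry iso (P' ** y).
  have -> : P' ** y + P' ** y ** d = - (P' ** (P + P' - y ** star y) ** H).
    rewrite /d cmulBr -(cmulA _ y Ps) yPs starM sP -(cmulA _ P H) PH.
    have P'H : P' ** H = 0 by rewrite -PH cmulA P'P cmul0r.
    by rewrite cmulBr cmulDr P'P cmulBl cmulDl cmul0r -(cmulA P' P' H) P'H cmulr0 !cmulA; zmod.
  rewrite (homN hh) nrmN => h1; have h2 := small P' H nP' nH.
  have E : P' ** P' ** P' = P' ** (P + P' - y ** star y) ** P' + P' ** y ** star (P' ** y).
    by rewrite starM sP' cmulBr cmulDr P'P add0r cmulBl !cmulA; zmod.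
  rewrite E (homD hh) (le_trans (nrmD _ _))//; apply: lerD; first exact: small.
  rewrite (star_homM hh (P' ** y)) (star_hom_star hh) nrm_cstar2.
  by move: h1 h2 (nrm_ge0 (pi (P' ** y))); move: (nrm _) (nrm _) => *; nra.
have z0 : pi (P' ** P' ** P') = 0.
  apply: nrm_le0; apply/ler_addgt0Pr => r r0; rewrite add0r.
  pose t := Num.min (1 / 4) (r / 37); have t0 : 0 < t by rewrite /t lt_min; apply/andP; split; lra.
  apply: (le_trans (key t _)); first by rewrite t0 /t ge_min lexx.
  have : t <= r / 37 by rewrite /t ge_min lexx orbT.
  lra.
have Jg : J (g ** g ** g).
  have /(quotient_ker (quo_map (hI := hJ))) := z0; rewrite -!(star_homM dr_hom) => h.
  by apply: (ideal_cuntz h); apply: (dr_cuntz _).2; apply: cpos_sac => //; exact: cpos_sa.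
have cg : cut (e / 2) a ** g = cut (e / 2) a.
  have e2 : 0 <= e / 2 by rewrite divr_ge0// ltW.
  by apply: fc_absorb => //; [exact: cont_cut|exact: cut_00].
by have := Defs.idealMl hJ (cut (e / 2) a) Jg; rewrite !cmulA !cg.
Qed.

End FiniteQuotients.

(** [infinite_in_ideal], for the ideal generated by a representative of [z], puts a cutdown of [x]
    into that ideal, and [gen_ideal_cut] bounds a further cutdown by copies of [z]. *)
Lemma finite_cancellative (R : realType) (B : cstarAlgType R) (S : stabilization B) :
  (forall (I : set B) (Q : cstarAlgType R) (pi : B -> Q), closed_ideal I -> quotient_map I pi -> stably_finite Q) ->
  cancellative S.
Proof.
move=> FQ x' x z; have [a pa ->] := cl_surj x; have [c pc ->] := cl_surj z => /(wb_rep pa)[e e0 xe] le.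
have pe := cpos_cut (ltW e0) pa; have e2 : 0 < e / 2 by rewrite divr_gt0.
have dd : dsum a a ≾ dsum (cut e a) c.
  apply/cl_le; [exact: cpos_dsum|exact: cpos_dsum|].
  rewrite -!cl_add//; rewrite mulr2n in le; apply: (cule_trans le); apply: culeD xe (cule_refl _).
have gc : gen_ideal c c.
  by apply: (ideal_sandwich (gen_ideal_closed c)) => u w r r0; exists [:: (u, w)]; rewrite big_seq1 subrr nrm0.
have ja := infinite_in_ideal FQ (gen_ideal_closed c) pa pc e0 gc dd.
have [K hK] := gen_ideal_cut (cpos_cut (ltW e2) pa) pc ja e2.
exists K; apply: (cule_trans xe); move: hK; rewrite cut_cut ?(ltW e2)//; last exact: cpos_sa.
by rewrite -splitr.
Qed.

Theorem theorem1 (R : realType) (X : metricType R) (cX : compact [set: X])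
    (A : cstarAlgType R) (pureA : pure_cstar A)
    (hA : simple_cstar A \/
          (forall (I : set A) (Q : cstarAlgType R) (pi : A -> Q),
             closed_ideal I -> quotient_map I pi -> stably_finite Q)) :
  pure_cstar (cts_alg cX A).
Proof.
have [S [AU AD]] := pureA; exists (ctsStab cX S).
case: hA => [sA|FQ]; last exact: cts_pure AU AD (finite_cancellative FQ).
by case: (simple_dichotomy AU sA) => [CA|PI]; [exact: cts_pure | exact: pi_pure].
Qed.
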